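(* Let $(Z,d,\nu)$ be a complete doubling metric measure space, let $p\ge 1$ and $0<\theta<1$, and let the uniformized hyperbolic filling $X_\rho$ of $Z$ and its completion $\bar X_\rho=X_\rho\cup Z$ be equipped with the measure $\mu_\beta$ for $\beta=p(1-\theta)$. Then there are bounded linear operators $$T:\tilde D^{1,p}(X_\rho)\to\tilde B^\theta_p(Z),\qquad P:\tilde B^\theta_p(Z)\to\tilde D^{1,p}(\bar X_\rho)$$ (the trace operator and the Poisson extension operator defined in the context) such that for each $f\in\tilde B^\theta_p(Z)$ we have $T(Pf)=f$ $\nu$-a.e., i.e. $T\circ P$ is the identity on $\tilde B^\theta_p(Z)$ (up to $\nu$-a.e. equality). Furthermore $T$ restricts to a bounded linear operator $T:\tilde N^{1,p}(X_\rho)\to\check B^\theta_p(Z)$, and there is a truncation $P_0$ of $P$ (defined in the context) that defines a bounded linear operator $P_0:\check B^\theta_p(Z)\to\tilde N^{1,p}(\bar X_\rho)$ with $T\circ P_0$ being the identity on $\check B^\theta_p(Z)$.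
   Context: **Metric measure spaces.** A metric measure space is a metric space with a Borel regular measure giving every ball positive finite measure. Balls are open and carry a specified center and radius. $(Z,d,\nu)$ is doubling: $\nu(B_Z(z,2r))\le C_\nu\,\nu(B_Z(z,r))$ for all $z,r$. **Hyperbolic filling.** Fix $\alpha>1$ and $\tau>\max\{3,\alpha/(\alpha-1)\}$. For each $n\in\mathbb Z$ choose a maximal $\alpha^{-n}$-separated set $S_n\subset Z$ (distinct points at distance $\ge\alpha^{-n}$). Put $V_n=\{(z,n):z\in S_n\}$, $V=\bigcup_n V_n$, $\pi(z,n)=z$, $h(z,n)=n$, and $B(v)=B_Z(\pi(v),\tau\alpha^{-h(v)})$. Distinct vertices $v,w$ are joined by an edge ($v\sim w$) iff $|h(v)-h(w)|\le 1$ and $B(v)\cap B(w)\ne\emptyset$. $X$ is the resulting (connected) metric graph with unit-length edges; $h$ is extended linearly to edges. **Uniformization.** $\rho(x)=\alpha^{-h(x)}$, $d_\rho(x,y)=\inf_\gamma\int_\gamma\rho\,ds$ over curves in $X$ from $x$ to $y$; $X_\rho=(X,d_\rho)$, $\bar X_\rho$ its completion, $\partial X_\rho=\bar X_\rho\setminus X_\rho$. There is a canonical biLipschitz identification (constant depending on $\alpha,\tau$) of $Z$ with $\partial X_\rho$: $z\in Z$ corresponds to $\lim_{n\to\infty}v_n$ in $\bar X_\rho$ for any $v_n\in V_n$ with $d(\pi(v_n),z)<\alpha^{-n}$. After this construction the metric of $Z$ is replaced by the biLipschitz equivalent metric induced by $d_\rho$, so that $Z=\partial X_\rho$ isometrically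 ($S_n$, $B(v)$ and the functions $\psi_v$ below are those coming from the original metric). **Measures.** Let $\mathcal L$ be Lebesgue measure on the unit edges of $X$, $\mu(A)=\sum_{v\in V}\sum_{w\sim v}(\nu(B(v))+\nu(B(w)))\,\mathcal L(A\cap vw)$ where $vw$ is the edge from $v$ to $w$, and $d\mu_\beta=\alpha^{-\beta h}\,d\mu$ on $X_\rho$, extended by $\mu_\beta(\partial X_\rho)=0$. **Newtonian and Dirichlet spaces.** For a metric measure space $(Y,d,\mu)$, a Borel $g:Y\to[0,\infty]$ is an upper gradient of $u:Y\to[-\infty,\infty]$ if $|u(x)-u(y)|\le\int_\gamma g\,ds$ for every nonconstant compact rectifiable curve $\gamma$ joining points $x,y$ (with $\int_\gamma g\,ds=\infty$ required if $u(x)$ or $u(y)$ is infinite). $\|u\|_{D^{1,p}(Y)}=\inf_g\|g\|_{L^p(Y)}$ over upper gradients $g$ of $u$; $\|u\|_{N^{1,p}(Y)}=\|u\|_{L^p(Y)}+\|u\|_{D^{1,p}(Y)}$. $\tilde D^{1,p}(Y)$, $\tilde N^{1,p}(Y)$ are the spaces of (pointwise defined) measurable functions with finite seminorm. **Besov spaces.** $L^p_{\rm loc}(Z)$: functions in $L^p(B)$ for every ball $B$. $\|u\|_{B^\theta_p(Z)}^p=\int_Z\int_Z\frac{|u(x)-u(y)|^p}{d(x,y)^{p\theta}}\frac{d\nu(x)\,d\nu(y)}{\nu(B(x,d(x,y)))}$; $\tilde B^\theta_p(Z)=\{u\in L^p_{\rm loc}(Z):\|u\|_{B^\theta_p(Z)}<\infty\}$;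 $\check B^\theta_p(Z)=L^p(Z)\cap\tilde B^\theta_p(Z)$ with norm $\|u\|_{L^p(Z)}+\|u\|_{B^\theta_p(Z)}$. Boundedness of operators is with respect to these (semi)norms. **Operators.** For each $n$ fix a Lipschitz partition of unity $\{\psi_v\}_{v\in V_n}$ on $Z$: $\psi_v:Z\to[0,1]$, $\sum_{v\in V_n}\psi_v=1$, $\operatorname{supp}\psi_v\subset B_Z(\pi(v),2\alpha^{-n})$, $\psi_v$ is $C\alpha^{n}$-Lipschitz with $C=C(C_\nu)$. Set $T_nu=\sum_{v\in V_n}u(v)\psi_v$ and let $Tu$ be the limit of $T_nu$ as $n\to\infty$ in $L^p(B)$ for every ball $B\subset Z$. For $f\in L^1_{\rm loc}(Z)$ let $Pf(v)=\frac1{\nu(B(v))}\int_{B(v)}f\,d\nu$ for $v\in V$, extended to each edge by linear interpolation with respect to $d_\rho$-arclength, and $Pf(z)=\limsup_{r\to0^+}\frac{1}{\mu_\beta(X_\rho\cap B_\rho(z,r))}\int_{X_\rho\cap B_\rho(z,r)}Pf\,d\mu_\beta$ for $z\in Z$, where $B_\rho(z,r)$ is the $d_\rho$-ball in $\bar X_\rho$. The truncation is $P_0f=\xi_0Pf$, where $\xi_0:\bar X_\rho\to[0,1]$ equals $1$ on $Z$ and on $\{h\ge 1\}$, equals $0$ on $\{h\le 0\}$, and is linearly interpolated (with respect to $d_\rho$) on edges joining height $0$ to height $1$. $T$ is applied to $Pf$, $P_0f$ via their restrictions to $X_\rho$. *)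

(* Defs.v *)
From HB Require Import structures.
From mathcomp Require Import all_boot all_order all_algebra.
From mathcomp Require Import all_classical all_reals all_analysis.
From mathcomp Require Import measurable_realfun.

Set Implicit Arguments.
Unset Strict Implicit.
Unset Printing Implicit Defensive.

Import Order.TTheory GRing.Theory Num.Theory.
Import numFieldNormedType.Exports.

Local Open Scope classical_set_scope.
Local Open Scope ring_scope.
Local Open Scope ereal_scope.

(* The library's measurable types are pointed, hence so are the metric spaces. *)
#[short(type="pmetricType")]
HB.structure Definition PointedMetric (K : numDomainType) :=
  {M of Pointed M & Metric K M}.

#[short(type="completeMetricType")]
HB.structure Definition CompleteMetric (K : numDomainType) :=
  {M of Complete M & Metric K M}.

(* A Borel regular measure is determined by its restriction to the Borel sets,
   so it is represented by a measure on the Borel sigma-algebra. *)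
Notation borel M := (g_sigma_algebraType (@open M)).

Section metric_measure_spaces.
Context {R : realType} {M : pmetricType R}.

Definition metric_measure (nu : {measure set (borel M) -> \bar R}) :=
  forall (x : M) (r : R), (0 < r)%R -> 0 < nu (ball x r) < +oo.

Definition doubling (nu : {measure set (borel M) -> \bar R}) :=
  exists C : R, forall (x : M) (r : R), (0 < r)%R ->
    nu (ball x (2 * r)) <= C%:E * nu (ball x r).

(* Measurability on D with respect to the completion of mu. *)
Definition mu_measurable (mu : {measure set (borel M) -> \bar R})
    (D : set M) d (U : measurableType d) (u : M -> U) :=
  exists2 u' : borel M -> U, measurable_fun (D : set (borel M)) u' &
    u = u' %[ae mu in D].

Definition norm_on (mu : {measure set (borel M) -> \bar R}) (D : set M)
    (p : R) (u : M -> \bar R) : \bar R :=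
  (\int[mu]_(x in D) `|u x| `^ p) `^ p^-1.

End metric_measure_spaces.

(* Curves in a set T with an extended real valued distance dist; a compact curve
   is the restriction to [a, b] of a function from R to T. *)
Section curves.
Context {R : realType} {T : Type} (dist : T -> T -> \bar R).
Implicit Types (a b : R) (gam : R -> T) (Y : set T).

Definition curve_length a b gam : \bar R :=
  ereal_sup [set \sum_(0 <= i < size s)
      dist (gam (nth b (a :: s) i)) (gam (nth b (a :: s) i.+1))
    | s in itv_partition a b].

Definition curve_continuous a b gam :=
  forall t, t \in `[a, b] -> forall e : R, (0 < e)%R ->
    \forall s \near t, s \in `[a, b] -> dist (gam t) (gam s) < e%:E.

Definition rectifiable_curve Y a b gam :=
  [/\ (a <= b)%R, gam @` `[a, b] `<=` Y, curve_continuous a b gam &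
      curve_length a b gam < +oo].

Definition nonconstant_curve a b gam :=
  exists s t, [/\ s \in `[a, b], t \in `[a, b] & gam s <> gam t].

(* The arc length parametrization of gam, defined on [0, length of gam]. *)
Definition arc_param a b gam (l : R) : T :=
  gam (inf [set s | s \in `[a, b] /\ l%:E <= curve_length a s gam]).

Definition line_integral a b gam (g : T -> \bar R) : \bar R :=
  \int[lebesgue_measure]_(l in `[0%R, fine (curve_length a b gam)])
    g (arc_param a b gam l).

End curves.

(* Upper gradients, Dirichlet and Newtonian seminorms of a subset Y of M with
   the restricted metric and measure; values of functions off Y are ignored. *)
Section newtonian.
Context {R : realType} {M : pmetricType R}.
Variables (mu : {measure set (borel M) -> \bar R}) (Y : set M) (p : R).
Implicit Types (u g : M -> \bar R).

Let dist (x y : M) : \bar R := (mdist x y)%:E.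

Definition upper_gradient u g :=
  [/\ forall x, Y x -> 0 <= g x,
      measurable_fun (Y : set (borel M)) (g : borel M -> \bar R) &
      forall (a b : R) (gam : R -> M),
        rectifiable_curve dist Y a b gam -> nonconstant_curve a b gam ->
        let finite_ends :=
          (u (gam a) \is a fin_num) && (u (gam b) \is a fin_num) in
        (finite_ends ->
          `|u (gam a) - u (gam b)| <= line_integral dist a b gam g) /\
        (~~ finite_ends -> line_integral dist a b gam g = +oo)].

Definition dirichlet_norm u : \bar R :=
  ereal_inf [set norm_on mu Y p g | g in upper_gradient u].

Definition newton_norm u : \bar R := norm_on mu Y p u + dirichlet_norm u.

Definition dirichlet_space : set (M -> \bar R) :=
  [set u | mu_measurable mu Y u /\ dirichlet_norm u < +oo].

Definition newton_space : set (M -> \bar R) :=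
  [set u | mu_measurable mu Y u /\ newton_norm u < +oo].

End newtonian.

(* The distance delta need not be the one of the metric structure of Z. *)
Section besov.
Context {R : realType} {Z : pmetricType R}.
Variables (nu : {measure set (borel Z) -> \bar R}) (delta : Z -> Z -> R).
Variables (p theta : R).
Implicit Types u : Z -> R.

Definition dball (x : Z) (r : R) : set Z := [set y | (delta x y < r)%R].

Definition Lp_loc : set (Z -> R) :=
  [set u | mu_measurable nu setT u /\
    forall x r, norm_on nu (dball x r) p (EFin \o u) < +oo].

(* The integrand vanishes for x = y. *)
Definition besov_norm u : \bar R :=
  (\int[nu]_y \int[nu]_x
     (((`|u x - u y| `^ p) / (delta x y `^ (p * theta)))%R%:E
        / nu (dball x (delta x y)))) `^ p^-1.

Definition besov_space : set (Z -> R) :=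
  [set u | Lp_loc u /\ besov_norm u < +oo].

Definition besov_check_norm u : \bar R :=
  norm_on nu setT p (EFin \o u) + besov_norm u.

Definition besov_check_space : set (Z -> R) :=
  [set u | besov_space u /\ norm_on nu setT p (EFin \o u) < +oo].

End besov.

Section filling.
Context {R : realType} {Z : pmetricType R}.
Variables (alpha tau : R) (S : int -> set Z).

Definition eps_separated (e : R) (A : set Z) :=
  forall x y, A x -> A y -> x != y -> (e <= mdist x y)%R.

Definition maximal_separated (e : R) (A : set Z) :=
  eps_separated e A /\ forall A', eps_separated e A' -> A `<=` A' -> A' = A.

Local Notation V := (Z * int)%type.

Definition vertices : set V := [set v | S v.2 v.1].

Definition vball (v : V) : set Z := ball v.1 (tau * alpha ^ (- v.2)).

Definition adj (v w : V) :=
  [/\ vertices v, vertices w, v != w, (`|v.2 - w.2| <= 1)%R &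
      vball v `&` vball w !=set0].

(* Points of the graph X are given by their barycentric coordinates: the point
   at distance t from v on the unit edge vw is the function (1 - t) v + t w. *)
Definition edge_pt (v w : V) (t : R) : V -> R :=
  fun x => ((1 - t) * (x == v)%:R + t * (x == w)%:R)%R.

Definition vertex_pt (v : V) : V -> R := edge_pt v v 0.

Definition fillingX : set (V -> R) :=
  [set x | (exists2 v, vertices v & x = vertex_pt v) \/
    exists v w t, [/\ adj v w, t \in `[0%R, 1%R] & x = edge_pt v w t]].

(* Chains of segments, each contained in one edge, with their total length. *)
Inductive polyline : (V -> R) -> (V -> R) -> R -> Prop :=
| polyline_nil x : fillingX x -> polyline x x 0
| polyline_cons v w s t y l :
    adj v w -> s \in `[0%R, 1%R] -> t \in `[0%R, 1%R] ->
    polyline (edge_pt v w t) y l ->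
    polyline (edge_pt v w s) y (`|s - t| + l)%R.

Definition graph_dist (x y : V -> R) : \bar R :=
  ereal_inf [set l%:E | l in polyline x y].

Definition height (x : V -> R) : R :=
  (\sum_(v \in [set: V]) x v * (v.2)%:~R)%R.

Definition rho (x : V -> R) : R := alpha `^ (- height x).

Definition dist_rho (x y : V -> R) : \bar R :=
  ereal_inf [set L | exists a b gam,
    [/\ rectifiable_curve graph_dist fillingX a b gam, gam a = x, gam b = y &
        L = line_integral graph_dist a b gam (EFin \o rho)]].

(* The fraction of the dist_rho-length of the edge vw that lies between v and
   the point edge_pt v w t. *)
Definition arc_fraction (v w : V) (t : R) : R :=
  (fine (curve_length dist_rho 0 t (edge_pt v w)) /
   fine (curve_length dist_rho 0 1 (edge_pt v w)))%R.

(* psi n z stands for the function psi_v attached to the vertex v = (z, n). *)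
Definition partition_of_unity (C : R) (psi : int -> Z -> Z -> R) :=
  forall n : int,
  [/\ forall z x, S n z -> (0 <= psi n z x <= 1)%R,
      forall x, \esum_(z in S n) (psi n z x)%:E = 1,
      forall z, S n z ->
        closure [set x | psi n z x != 0%R] `<=` ball z (2 * alpha ^ (- n)) &
      forall z x y, S n z ->
        (`|psi n z x - psi n z y| <= C * alpha ^ n * mdist x y)%R].

Section uniformization.
Context {Xbar : completeMetricType R} (iota : (V -> R) -> Xbar).

Definition is_completion :=
  (forall x y, fillingX x -> fillingX y ->
    (mdist (iota x) (iota y))%:E = dist_rho x y) /\
  dense (iota @` fillingX).

Definition Xrho : set Xbar := iota @` fillingX.

(* The identification phi of Z with the boundary of X_rho. *)
Definition boundary_map (phi : Z -> Xbar) :=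
  forall (z : Z) (v : nat -> Z),
    (forall n : nat, S n%:Z (v n) /\ (mdist (v n) z < alpha ^ (- n%:Z))%R) ->
    iota (vertex_pt (v n, n%:Z)) @[n --> \oo] --> phi z.

Definition induced_dist (phi : Z -> Xbar) (x y : Z) : R :=
  mdist (phi x) (phi y).

Definition heightbar (y : Xbar) : R :=
  height ('pinv_(fun=> cst 0%R) fillingX iota y).

Section measures.
Variable nu : {measure set (borel Z) -> \bar R}.

(* Every edge is counted twice, once for each orientation. *)
Definition is_mu (mu : {measure set (borel Xbar) -> \bar R}) :=
  forall A : set (borel Xbar), measurable A ->
    mu A = \esum_(v in vertices) \esum_(w in adj v)
      ((nu (vball v) + nu (vball w)) *
       lebesgue_measure
         [set t : R | t \in `[0%R, 1%R] /\ A (iota (edge_pt v w t))]).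

Definition is_mu_beta (beta : R)
    (mu mu_beta : {measure set (borel Xbar) -> \bar R}) :=
  forall A : set (borel Xbar), measurable A ->
    mu_beta A =
      \int[mu]_(y in A `&` Xrho) (alpha `^ (- beta * heightbar y))%:E.

Definition vaverage (f : Z -> R) (v : V) : R :=
  ((\int[nu]_(x in vball v) f x) / fine (nu (vball v)))%R.

Definition poisson_extension (mu_beta : {measure set (borel Xbar) -> \bar R})
    (f : Z -> R) (F : Xbar -> \bar R) :=
  [/\ forall v, vertices v -> F (iota (vertex_pt v)) = (vaverage f v)%:E,
      forall v w t, adj v w -> t \in `[0%R, 1%R] ->
        F (iota (edge_pt v w t)) =
          ((1 - arc_fraction v w t) * vaverage f v
             + arc_fraction v w t * vaverage f w)%R%:E &
      forall y, ~ Xrho y ->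
        F y = limf_esup
          (fun r : R => (mu_beta (Xrho `&` ball y r))^-1 *
             \int[mu_beta]_(x in Xrho `&` ball y r) F x)
          (0%R : R)^'+].

(* The sum is locally finite; u is finite at vertices when its Dirichlet
   seminorm on X_rho is finite. *)
Definition trace_approx (psi : int -> Z -> Z -> R) (u : Xbar -> \bar R)
    (n : nat) (x : Z) : R :=
  (\sum_(z \in S n%:Z)
     fine (u (iota (vertex_pt (z, n%:Z)))) * psi n%:Z z x)%R.

Definition is_trace (delta : Z -> Z -> R) (p : R) (psi : int -> Z -> Z -> R)
    (u : Xbar -> \bar R) (f : Z -> R) :=
  forall z r,
    norm_on nu (dball delta z r) p
      (fun x => (trace_approx psi u n x - f x)%R%:E) @[n --> \oo] --> 0.

End measures.

Definition is_cutoff (xi : Xbar -> R) :=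
  [/\ forall y, ~ Xrho y -> xi y = 1%R,
      forall x, fillingX x -> (1 <= height x)%R -> xi (iota x) = 1%R,
      forall x, fillingX x -> (height x <= 0)%R -> xi (iota x) = 0%R &
      forall v w t, adj v w -> v.2 = 0%R -> w.2 = 1%R -> t \in `[0%R, 1%R] ->
        xi (iota (edge_pt v w t)) = arc_fraction v w t].

End uniformization.
End filling.

Definition lincomb {R : realType} {T : Type} (a b : R) (u v : T -> \bar R) :
    T -> \bar R :=
  fun x => a%:E * u x + b%:E * v x.

Section operators.
Context {R : realType}.

Definition bounded_operator {A B : Type} (D : set A) (normA : A -> \bar R)
    (E : set B) (normB : B -> \bar R) (F : A -> B) :=
  exists C : R, forall u, D u -> E (F u) /\ normB (F u) <= C%:E * normA u.

Context {Z X : pmetricType R}.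

(* Functions with finite Dirichlet seminorm on X_rho are real valued there, so
   extended real arithmetic in lincomb is harmless. *)
Definition linear_ae (nu : {measure set (borel Z) -> \bar R})
    (D : set (X -> \bar R)) (T : (X -> \bar R) -> (Z -> R)) :=
  forall (a b : R) u v, D u -> D v ->
    T (lincomb a b u v) = (fun x => a * T u x + b * T v x)%R %[ae nu].

(* An operator whose values are defined pointwise by an upper limit is linear
   only up to the Newtonian equivalence ||u - v|| = 0. *)
Definition linear_newton (mu : {measure set (borel X) -> \bar R}) (p : R)
    (D : set (Z -> R)) (P : (Z -> R) -> (X -> \bar R)) :=
  forall (a b : R) f g, D f -> D g ->
    newton_norm mu setT p
      (fun y => P (fun z => a * f z + b * g z)%R y
                  - lincomb a b (P f) (P g) y) = 0.

End operators.

(* Main.v *)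
(** Trace.  The difference of the values of [u] at the ends of an edge is at most
    the integral of an upper gradient over that edge, so the discrete energy
    [sum_(v ~ w) |u v - u w|^p nu(B v) alpha^(p theta h(v))] is controlled by the
    Dirichlet seminorm.  Since [|T_(n+1) u - T_n u|^p] is controlled by the edge
    differences at level [n], the tails of this energy bound [|Tu - T_n u|^p], which
    gives convergence a.e. and in [L^p]; comparing [Tu x] and [Tu y] through a vertex
    of scale [d(x, y)] gives the Besov bound.

    Extension.  Let [osc v] be the [L^p] mean oscillation of [f] over a dilate of
    [B v], and [a v] a multiple of [osc v * alpha^(h v)].  The function
    [G = (sum_v a(v)^p 1_(ball around v))^(1/p)], set to [+oo] on the boundary, is an
    upper gradient of [Pf]: the ends of a curve are joined by two vertical chains of
    vertices meeting at the scale of their distance, the curve crosses annuli close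
    to each vertex of the chains, and there [G >= a v].  If the integral of [G] is
    finite along a curve ending at the boundary point [z], then
    [sum_n a(v_n) alpha^(-n)] converges along the chain to [z], which forces the
    averages defining [Pf z] to converge to the limit of [f_(B v_n)].  Summation over
    the vertices bounds [int G^p] by the Besov energy.  For the linearity of [P],
    [eps * (G_f + G_g)] is an upper gradient of [P(a f + b g) - a P f - b P g] for
    every [eps > 0]. *)

From HB Require Import structures.
Require Import Defs.
From mathcomp Require Import all_boot all_order all_algebra.
From mathcomp Require Import all_classical all_reals all_analysis.
From mathcomp Require Import measurable_realfun.
From mathcomp Require Import ring lra zify.

Set Implicit Arguments.
Unset Strict Implicit.
Unset Printing Implicit Defensive.

Import Order.TTheory GRing.Theory Num.Theory.
Import numFieldNormedType.Exports.

Local Open Scope classical_set_scope.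
Local Open Scope ring_scope.
Local Open Scope ereal_scope.

(** * Integrals and sums of nonnegative functions *)

(** The exponent [beta = p (1 - theta)] balances the two energies: an edge at [v] has length about
    [alpha^(-h(v))] and [mu_beta]-mass about [alpha^(-beta h(v)) nu(B v)], so the [p]-th power of a
    difference quotient times the mass is [|u v - u w|^p nu(B v) alpha^(p theta h(v))]. Positivity
    of [beta] bounds the mass of all descendants of a vertex by a multiple of its own; positivity of
    [theta] drives the geometric series of the trace.

    Upper gradients are tested on all rectifiable curves of the completion, which may touch the
    boundary very often and need not follow edges in any order. The estimate for [Pf] therefore
    looks only at the two ends of a curve and at the concentric balls around them that it must
    cross.

    Besov functions are measurable only for the completed measure and their energy is an iterated
    integral. Integrals of nonnegative functions are therefore handled as suprema over simple
    functions. Monotonicity, superadditivity and scaling survive in this generality, and the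
    estimates are arranged so as to need only these. *)

Section lower_integral.
Context d (T : measurableType d) (R : realType) (mu : {measure set T -> \bar R}).
Implicit Types (D N : set T) (f g : T -> \bar R).

Import HBNNSimple.

(* No measurability is required below: the integral of a nonnegative function is
   the supremum of the integrals of the simple functions below it. *)
Lemma ge0_le_integral_lower D f g : (forall x, D x -> 0 <= f x <= g x) ->
  \int[mu]_(x in D) f x <= \int[mu]_(x in D) g x.
Proof.
move=> fg; rewrite ge0_integralE; last by move=> x /fg /andP[].
rewrite ge0_integralE; last by move=> x /fg /andP[f0 /(le_trans f0)].
apply: ge_ereal_sup => _ [h hf <-].
apply: ereal_sup_ubound; exists h => // x.
apply: (le_trans (hf x)); rewrite !patchE; case: ifPn => // /set_mem /fg.
by case/andP.
Qed.

(** A simple function below [f] plus one below [g] is a simple function below [f + g].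
    Superadditivity is the half of additivity that needs no measurability, and the half that lower
    bounds for line integrals require. *)
Lemma ge0_integralD_lower D f g : (forall x, D x -> 0 <= f x) ->
  (forall x, D x -> 0 <= g x) ->
  \int[mu]_(x in D) f x + \int[mu]_(x in D) g x <=
  \int[mu]_(x in D) (f x + g x).
Proof.
move=> f0 g0.
have fg0 x : D x -> 0 <= f x + g x by move=> Dx; rewrite adde_ge0 ?f0 ?g0.
rewrite (ge0_integralE _ f0) (ge0_integralE _ g0) (ge0_integralE _ fg0).
set B1 := ereal_sup _; set B2 := ereal_sup _; set B := ereal_sup _.
have le1 (h k : {nnsfun T >-> R}) : (forall x, (h x)%:E <= (f \_ D) x) ->
  (forall x, (k x)%:E <= (g \_ D) x) -> sintegral mu h + sintegral mu k <= B.
  move=> hf kg; rewrite -sintegralD; apply: ereal_sup_ubound.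
  exists (h \+ k)%R => // x; rewrite /= EFinD.
  have := leeD (hf x) (kg x); rewrite !patchE; case: ifPn => //.
  by rewrite addr0.
pose z : {nnsfun T >-> R} := nnsfun0.
have zero F : (forall x, D x -> 0 <= F x) ->
    forall x, (z x)%:E <= (F \_ D) x.
  by move=> F0 x; rewrite erestrict_ge0.
have sint0 : sintegral mu z = 0.
  exact: sintegral0.
have B2B : B2 <= B.
  apply: ge_ereal_sup => _ [k kg <-].
  by rewrite -[leLHS]add0e -{1}sint0 le1//; exact: zero.
have [->|Bfin] := eqVneq B +oo; first by rewrite leey.
have B20 : 0 <= B2.
  by apply: ereal_sup_ubound; exists z => //; exact: zero.
have fB : B \is a fin_num.
  by rewrite ge0_fin_numE ?ltey// (le_trans B20).
have fB2 : B2 \is a fin_num.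
  by rewrite ge0_fin_numE// (le_lt_trans B2B)// ltey.
rewrite -leeBrDr//; apply: ge_ereal_sup => _ [h hf <-].
have h0 : 0 <= sintegral mu h by exact: sintegral_ge0.
have hB : sintegral mu h <= B.
  by rewrite -[leLHS]adde0 -{1}sint0 le1//; exact: zero.
have fh : sintegral mu h \is a fin_num.
  by rewrite ge0_fin_numE// (le_lt_trans hB)// ltey.
rewrite leeBrDr// addeC -leeBrDr//; apply: ge_ereal_sup => _ [k kg <-].
by rewrite leeBrDr// addeC le1.
Qed.

(** A simple function below [f] is measurable, so deleting the null set [N] does not change its
    integral, and what remains lies below [f] on [D] minus [N]. *)
Lemma ge0_negligible_integral_lower D N f : measurable N -> mu N = 0 ->
  (forall x, D x -> 0 <= f x) ->
  \int[mu]_(x in D) f x = \int[mu]_(x in D `\` N) f x.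
Proof.
move=> mN N0 f0; apply/eqP; rewrite eq_le; apply/andP; split; last first.
  rewrite integral_mkcond [leRHS]integral_mkcond.
  apply: ge0_le_integral_lower => x _; rewrite !patchE.
  have [/set_mem [Dx Nx]|_] := boolP (x \in D `\` N).
    by rewrite mem_set// f0//= lexx.
  by case: ifPn => /=; rewrite ?lexx// => /set_mem/f0 ->.
rewrite ge0_integralE//; apply: ge_ereal_sup => _ [h hf <-].
rewrite -integralT_nnsfun (ge0_negligible_integral mN)//; last 2 first.
- exact/measurable_EFinP.
- by move=> x _; rewrite lee_fin.
rewrite integral_mkcond [leRHS]integral_mkcond.
apply: ge0_le_integral_lower => x _; rewrite !patchE.
have [/set_mem [_ Nx]|_] := boolP (x \in setT `\` N).
  rewrite lee_fin fun_ge0/=.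
  have [/set_mem [Dx _]|/negP DN] := boolP (x \in D `\` N).
    by have := hf x; rewrite patchE mem_set.
  have := hf x; rewrite patchE; case: ifPn => //.
  by move/set_mem => Dx; exfalso; apply: DN; exact/mem_set.
rewrite lexx/=; case: ifPn => // /set_mem [Dx Nx].
exact: f0.
Qed.

Lemma ge0_ae_eq_integral_lower D f g : (forall x, D x -> 0 <= f x) ->
  (forall x, D x -> 0 <= g x) -> {ae mu, forall x, D x -> f x = g x} ->
  \int[mu]_(x in D) f x = \int[mu]_(x in D) g x.
Proof.
move=> f0 g0 [N [mN N0 sN]].
rewrite (ge0_negligible_integral_lower mN N0 f0).
rewrite (ge0_negligible_integral_lower mN N0 g0).
apply: eq_integral => x /set_mem [Dx Nx]; apply: contrapT => fg.
by apply: Nx; apply: sN => /= /(_ Dx).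
Qed.

(** Allows a function that is measurable only for the completed measure to be exchanged, under the
    integral sign, for a Borel representative. *)
Lemma ae_eq_integral_lower D f g : {ae mu, forall x, D x -> f x = g x} ->
  \int[mu]_(x in D) f x = \int[mu]_(x in D) g x.
Proof.
move=> fg; rewrite integralE [RHS]integralE.
by congr (_ - _); apply: ge0_ae_eq_integral_lower => //;
  apply: filterS fg => x /[apply]; rewrite ?funeposE ?funenegE => ->.
Qed.

End lower_integral.

Section esums.
Context {R : realType} {I : choiceType}.
Implicit Types (A : set I) (a : I -> \bar R).

(** The inequality [H] for a positive factor, used for [k] and then for [k^-1], gives both
    halves. *)
Lemma esumZl A a (k : R) : (0 <= k)%R -> (forall i, A i -> 0 <= a i) ->
  \esum_(i in A) (k%:E * a i) = k%:E * \esum_(i in A) a i.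
Proof.
rewrite le_eqVlt => /predU1P[<- _|k0 a0].
  by rewrite mul0e esum1// => i _; rewrite mul0e.
move: a a0.
have H (c : R) b : (0 < c)%R -> (forall i, A i -> 0 <= b i) ->
    \esum_(i in A) (c%:E * b i) <= c%:E * \esum_(i in A) b i.
  move=> c0 b0; apply: ge_ereal_sup => _ [X [fX XA] <-].
  rewrite fsbig_finite//= big_seq -ge0_sume_distrr; last first.
    by move=> i; rewrite in_fset_set// => /set_mem /XA /b0.
  rewrite -big_seq -fsbig_finite// lee_pmul2l ?fin_numE// ?lte_fin//.
  by apply: esum_ge; exists X.
move=> a a0; apply/eqP; rewrite eq_le H//=.
rewrite -lee_pdivlMl// (le_trans _ (H _ _ _ _)) ?invr_gt0//; last first.
  by move=> i Ai; rewrite mule_ge0 ?lee_fin ?(ltW k0)// a0.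
apply: le_esum => i Ai.
by rewrite muleA -EFinM mulVf ?mul1e// gt_eqF.
Qed.

Lemma le_esum_sub A B a b : A `<=` B -> (forall i, B i -> 0 <= b i) ->
  (forall i, A i -> a i <= b i) ->
  \esum_(i in A) a i <= \esum_(i in B) b i.
Proof.
move=> AB b0 ab; apply: (@le_trans _ _ (\esum_(i in A) b i)).
  exact: le_esum.
apply: ge_ereal_sup => _ [X [fX XA] <-]; apply: esum_ge.
by exists X => //; split => //; apply: subset_trans AB.
Qed.

Lemma esum_ge_term A a i : A i -> (forall j, A j -> 0 <= a j) ->
  a i <= \esum_(j in A) a j.
Proof.
move=> Ai a0; rewrite -[leLHS](@esum_set1 _ _ i); last exact: a0.
by apply: le_esum_sub => // j ->.
Qed.

(** Values in [option I] let finite, infinite and empty [A] be enumerated alike. The enumeration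
    carries measurability and monotone convergence from series over to [\esum]. *)
Lemma countable_esum_nneseries A : countable A ->
  exists e : nat -> option I,
    (forall i, A i -> exists k, e k = Some i) /\
    (forall a, (forall i, A i -> 0 <= a i) -> \esum_(i in A) a i =
      \sum_(0 <= k <oo) (if e k is Some i then a i else 0)) /\
    (forall k i, e k = Some i -> A i).
Proof.
move=> /countable_injP [f finj].
pose e k := if pselect (exists2 i, A i & f i = k) is left H
  then Some (projT1 (cid2 H)) else None.
have ef i : A i -> e (f i) = Some i.
  move=> Ai; rewrite /e; case: pselect => [H|[]]; last by exists i.
  case: cid2 => j Aj /= fji; congr Some; apply: finj => //; exact/mem_set.
exists e; split; last split.
- by move=> i Ai; exists (f i); exact: ef.
- move=> a a0.
  rewrite (@nneseries_esumT _ (fun k => if e k is Some i then a i else 0)); last first.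
    move=> k; rewrite /e; case: pselect => // H; case: cid2 => /= i Ai _; exact: a0.
  rewrite [RHS](esumID (f @` A)); last first.
    move=> k _; rewrite /e; case: pselect => // H; case: cid2 => /= i Ai _; exact: a0.
  rewrite [X in _ = _ + X]esum1 ?adde0; last first.
    by move=> k [_ nk]; rewrite /e; case: pselect.
  rewrite setTI esum_image; last first.
    by move=> x y xA yA; apply: finj.
  by apply: eq_esum => i Ai; rewrite ef.
- move=> k i; rewrite /e; case: pselect => // H [<-].
  by case: cid2.
Qed.

End esums.

Lemma esum_swap {R : realType} {I J : choiceType} (A : set I) (B : set J)
    (a : I -> J -> \bar R) : (forall i j, A i -> B j -> 0 <= a i j) ->
  \esum_(i in A) \esum_(j in B) a i j = \esum_(j in B) \esum_(i in A) a i j.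
Proof.
move=> a0; rewrite esum_esum// esum_esum; last by move=> *; exact: a0.
rewrite (@reindex_esum _ _ _ (B `*`` fun=> A) _ (fun p => (p.2, p.1)))//.
split.
- by move=> [j i] [/= Bj Ai].
- by move=> [j i] [j' i'] _ _ /= [-> ->].
- by move=> [i j] [/= Ai Bj]; exists (j, i).
Qed.

Section integral_esum.
Context d (T : measurableType d) (R : realType) (mu : {measure set T -> \bar R}).
Context {I : choiceType} (A : set I) (D : set T) (f : I -> T -> \bar R).
Hypotheses (cA : countable A) (mD : measurable D).
Hypothesis mf : forall i, A i -> measurable_fun D (f i).
Hypothesis f0 : forall i x, A i -> D x -> 0 <= f i x.

Lemma measurable_fun_esum : measurable_fun D (fun x => \esum_(i in A) f i x).
Proof.
have [e [eS [eE eA]]] := @countable_esum_nneseries R I A cA.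
apply: (eq_measurable_fun (fun x => \sum_(0 <= k <oo)
   (if e k is Some i then f i x else 0))).
  by move=> x /set_mem Dx; rewrite eE// => i Ai; exact: f0.
apply: (@ge0_emeasurable_sum _ _ _ D
  (fun k x => if e k is Some i then f i x else 0) xpredT) => k.
  by move=> x Dx _; case ek: (e k) => [i|] //; apply: f0 => //; apply: eA ek.
by move=> _; case ek: (e k) => [i|] //; apply: mf; apply: eA ek.
Qed.

Lemma integral_esum : \int[mu]_(x in D) (\esum_(i in A) f i x) =
  \esum_(i in A) \int[mu]_(x in D) f i x.
Proof.
have [e [eS [eE eA]]] := @countable_esum_nneseries R I A cA.
under eq_integral => x /set_mem Dx.
  rewrite eE; last by move=> i Ai; exact: f0.
  over.
rewrite integral_nneseries//; last 2 first.
- by move=> k; case ek: (e k) => [i|] //; apply: mf; apply: eA ek.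
- by move=> k x Dx; case ek: (e k) => [i|] //; apply: f0 => //; apply: eA ek.
rewrite eE; last by move=> i Ai; apply: integral_ge0 => x Dx; exact: f0.
apply: eq_eseriesr => k _; case: (e k) => // ; exact: integral0.
Qed.

End integral_esum.

Section powers.
Context {R : realType}.
Implicit Types (p q s t a b : R).

(** For [t > s] the factor [(t / s)^(p - 1)] is at least 1, so the second summand alone dominates
    [t]; otherwise the first does. *)
Lemma young_powR p s t : (1 <= p)%R -> (0 < s)%R -> (0 <= t)%R ->
  (t <= s + s `^ (1 - p) * t `^ p)%R.
Proof.
move=> p1 s0 t0; have [ts|st] := leP t s.
  by rewrite (le_trans ts)// lerDl mulr_ge0// powR_ge0.
rewrite (@le_trans _ _ (s `^ (1 - p) * t `^ p)%R)//; last by rewrite lerDr ltW.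
have tp : (0 < t)%R by rewrite (lt_trans s0).
rewrite -(opprB p 1) powRN mulrC ler_pdivlMr ?powR_gt0//.
rewrite -(@mulr_powRB1 _ t p)//; last by rewrite (lt_le_trans ltr01).
rewrite ler_wpM2l// ge0_ler_powR ?subr_ge0// ?nnegrE ltW//.
Qed.

Lemma young_poweR p s (t : \bar R) : (1 <= p)%R -> (0 < s)%R -> 0 <= t ->
  t <= s%:E + (s `^ (1 - p))%:E * t `^ p.
Proof.
move=> p1 s0; case: t => [t| |] //.
- by rewrite !lee_fin; exact: young_powR.
- move=> _; rewrite poweRyr ?gt_eqF ?(lt_le_trans _ p1)//.
  by rewrite gt0_muley ?lte_fin ?powR_gt0// addey// leey.
Qed.

Lemma powRD_le p a b : (0 <= p)%R -> (0 <= a)%R -> (0 <= b)%R ->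
  ((a + b) `^ p <= 2 `^ p * (a `^ p + b `^ p))%R.
Proof.
move=> p0 a0 b0; wlog ab : a b a0 b0 / (a <= b)%R.
  move=> H; have [/H|/ltW/H] := leP a b; first exact.
  by rewrite [(b + a)%R]addrC [(b `^ p + _)%R]addrC; exact.
rewrite (@le_trans _ _ ((2 * b) `^ p)%R)//.
  rewrite ge0_ler_powR ?nnegrE ?addr_ge0 ?mulr_ge0//.
  by rewrite mulr_natl mulr2n lerD2r.
by rewrite powRM// ler_wpM2l ?powR_ge0// lerDr powR_ge0.
Qed.

Lemma sum_geometric_le q n : (0 < q < 1)%R ->
  (\sum_(0 <= i < n) q ^+ i <= (1 - q)^-1)%R.
Proof.
move=> /andP[q0 q1].
have := @geometric_le_lim R n 1 q ler01 q0; rewrite ger0_norm ?(ltW q0)// mul1r.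
move=> /(_ q1); rewrite /series/=; apply: le_trans.
by apply: ler_sum => i _; rewrite mul1r.
Qed.

End powers.

Section mean_power.
Context d (T : measurableType d) (R : realType) (mu : {measure set T -> \bar R}).
Context (D : set T) (p : R).
Hypotheses (mD : measurable D) (D0 : 0 < mu D < +oo) (p1 : (1 <= p)%R).

(* A form of Hoelder's inequality, from [t <= s + s^(1-p) t^p]. *)
Lemma mean_poweR (h : T -> \bar R) : measurable_fun D h ->
  (forall x, D x -> 0 <= h x) ->
  (\int[mu]_(x in D) h x) `^ p <=
  (2 `^ p * fine (mu D) `^ (p - 1))%:E * \int[mu]_(x in D) (h x `^ p).
Proof.
move=> mh h0.
have p0 : (0 < p)%R by rewrite (lt_le_trans ltr01).
case/andP: D0 => D1 D2.
have m0 : (0 < fine (mu D))%R by rewrite fine_gt0// D1.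
have fD : mu D \is a fin_num by rewrite ge0_fin_numE// ltW.
set m := fine (mu D) in m0 *.
have mhp : measurable_fun D (fun x => h x `^ p).
  by apply: (measurableT_comp (measurable_poweR p)).
set I := \int[mu]_(x in D) h x; set J := \int[mu]_(x in D) _.
have J0 : 0 <= J by apply: integral_ge0 => x _; exact: poweR_ge0.
have I0 : 0 <= I by apply: integral_ge0.
have [->|Jfin] := eqVneq J +oo.
  by rewrite gt0_muley ?leey// lte_fin mulr_gt0 ?powR_gt0.
have fJ : J \is a fin_num by rewrite ge0_fin_numE// ltey.
have key s : (0 < s)%R -> I <= (s * m + s `^ (1 - p) * fine J)%:E.
  move=> s0; rewrite EFinD !EFinM /m !fineK//.
  rewrite -(integral_cst mu mD s%:E) /J -ge0_integralZl//; last 2 first.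
  - by move=> x _; exact: poweR_ge0.
  - by rewrite lee_fin powR_ge0.
  rewrite -ge0_integralD//; last 3 first.
  - by move=> x _; rewrite /cst lee_fin ltW.
  - by move=> x _; rewrite mule_ge0 ?poweR_ge0// lee_fin powR_ge0.
  - exact: measurable_funeM.
  apply: ge0_le_integral_lower => x Dx.
  by rewrite h0//= young_poweR// h0.
have fI : I \is a fin_num.
  by rewrite ge0_fin_numE// (le_lt_trans (key 1%R ltr01))// ltry.
rewrite -(fineK fI) -(fineK fJ) poweR_EFin -EFinM lee_fin.
have i0 : (0 <= fine I)%R by rewrite fine_ge0.
have j0 : (0 <= fine J)%R by rewrite fine_ge0.
have key' s : (0 < s)%R -> (fine I <= s * m + s `^ (1 - p) * fine J)%R.
  by move=> s0; rewrite -lee_fin fineK// key.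
move: key'; move: (fine I) (fine J) i0 j0 => i j i0 j0 key'.
have [j00|jp] := eqVneq j 0%R.
  rewrite j00 mulr0.
  suff -> : i = 0%R by rewrite powR0// gt_eqF.
  apply/eqP; rewrite eq_le i0 andbT; apply/ler_addgt0Pr => e e0; rewrite add0r.
  have := key' (e / m)%R; rewrite j00 mulr0 addr0 divfK ?gt_eqF//; apply.
  by rewrite divr_gt0.
have jgt0 : (0 < j)%R by rewrite lt_neqAle eq_sym jp.
(* The choice [s^p = j / m] makes the two terms of the bound equal, both being [s m]. *)
pose s := ((j / m) `^ p^-1)%R.
have s0 : (0 < s)%R by rewrite powR_gt0// divr_gt0.
have sp : (s `^ p = j / m)%R.
  by rewrite -powRrM mulVf ?gt_eqF// powRr1// ltW// divr_gt0.
have : (i <= 2 * (s * m))%R.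
  rewrite (le_trans (key' _ s0))// powRB; last by rewrite (gt_eqF s0) implybT.
  rewrite powRr1 ?(ltW s0)// sp invf_div [in X in (_ + X <= _)%R]mulrAC mulrA.
  have -> : (s * j * (m / j) = s * m)%R by field; rewrite gt_eqF.
  by rewrite -mulrA mulr_natl mulr2n lexx.
move=> /(ge0_ler_powR (ltW p0)) H; rewrite (le_trans (H _ _))// ?nnegrE//.
  by rewrite !mulr_ge0// ltW.
rewrite powRM// ?mulr_ge0 ?(ltW s0) ?(ltW m0)// powRM ?(ltW s0) ?(ltW m0)// sp.
rewrite -[leRHS]mulrA ler_wpM2l ?powR_ge0//.
rewrite -(@mulr_powRB1 _ m p)// ?(ltW m0)//.
by rewrite mulrA divfK ?gt_eqF// mulrC.
Qed.

End mean_power.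

Section lebesgue_domination.
Context {R : realType}.

(** Lebesgue measure is an infimum over covers by half-open intervals, so a bound on these passes to
    all measurable sets by countable subadditivity of [m]. *)
Lemma le_lebesgue_measure (m : {measure set (measurableTypeR R) -> \bar R}) (K : R) :
  (0 < K)%R -> (forall s t, (s <= t)%R -> m `]s, t]%classic <= (K * (t - s))%:E) ->
  forall A : set (measurableTypeR R), measurable A ->
  m A <= K%:E * lebesgue_measure A.
Proof.
move=> K0 mK A mA; rewrite -lee_pdivrMl//.
rewrite /lebesgue_measure /lebesgue_stieltjes_measure /measure_extension /mu_ext.
apply: le_ereal_inf_tmp => _ [F [mF AF] <-].
rewrite lee_pdivrMl// -nneseriesZl; last first.
  by move=> k _; exact: wlength_ge0.
have mF' k : measurable (F k : set (measurableTypeR R)).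
  exact: sub_sigma_algebra.
apply: (@le_trans _ _ (\sum_(0 <= k <oo) m (F k))).
  by apply: measure_sigma_subadditive.
apply: lee_nneseries => // k _; have [[s t] _ <-]/= := mF k.
have [st|ts] := leP s t.
  by rewrite wlength_itv_bnd// -EFinM mK.
by rewrite set_itv_ge ?bnd_simp -?leNgt ?(ltW ts)// measure0 wlength0 mule0.
Qed.

End lebesgue_domination.

(** The supremum of the [s] with [P a s] is itself such a point and, by the local hypothesis, cannot
    lie below [b]. It turns estimates valid on short pieces of a curve into estimates on the whole
    curve. *)
Lemma real_induction {R : realType} (P : R -> R -> Prop) (a b : R) : (a <= b)%R ->
  (forall s t u, (a <= s)%R -> (s <= t)%R -> (t <= u)%R -> (u <= b)%R ->
    P s t -> P t u -> P s u) ->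
  (forall t, (a <= t <= b)%R -> exists2 e : R, (0 < e)%R &
    forall s, (a <= s <= b)%R -> (`|s - t| < e)%R ->
      ((s <= t)%R -> P s t) /\ ((t <= s)%R -> P t s)) ->
  P a b.
Proof.
move=> ab Ptrans Ploc.
pose A := [set s | (a <= s <= b)%R /\ P a s].
have Aa : A a.
  split; first by rewrite lexx.
  have [|e e0 H] := Ploc a; first by rewrite lexx.
  by case: (H a); rewrite ?subrr ?normr0 ?lexx// => + _; exact.
have supA : has_sup A.
  by split; [exists a|exists b => x [/andP[]]].
set c := sup A.
have ac : (a <= c)%R by apply: ub_le_sup => //; case: supA.
have cb : (c <= b)%R by apply: ge_sup; [exists a|move=> x [/andP[]]].
have [|e e0 H] := Ploc c; first by rewrite ac.
have [s [/andP[as_ sb] Ps] cs] := sup_adherent e0 supA.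
have sc : (s <= c)%R by apply: ub_le_sup; [case: supA|split => //; rewrite as_].
have Pac : P a c.
  apply: (Ptrans a s c) => //.
  case: (H s); rewrite ?as_ ?sb//; last by move=> + _; exact.
  by rewrite distrC ger0_norm ?subr_ge0// ltrBlDr addrC -ltrBlDr.
pose u := Order.min b (c + e / 2)%R.
have cu : (c <= u)%R by rewrite le_min cb lerDl divr_ge0// ltW.
have ub : (u <= b)%R by rewrite ge_min lexx.
have Pu : P a u.
  apply: (Ptrans a c u) => //.
  case: (H u); rewrite ?ub ?(le_trans ac)//; last by move=> _; exact.
  rewrite ger0_norm ?subr_ge0// ltrBlDr (@le_lt_trans _ _ (c + e / 2)%R)//.
    by rewrite ge_min lexx orbT.
  by rewrite addrC ltrD2r ltr_pdivrMr// ltr_pMr// ltr1n.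
have uc : (u <= c)%R.
  by apply: ub_le_sup; [case: supA|split => //; rewrite ub (le_trans ac)].
suff -> : b = u by [].
move: uc; rewrite /u /Order.min; case: ltP => // _.
by rewrite gerDl leNgt divr_gt0.
Qed.

Lemma open_mball {R : realType} (T : metricType R) (x : T) (r : R) : open (ball x r).
Proof.
rewrite openE => y; rewrite ballEmdist/= => xy.
apply/nbhs_ballP; exists (r - mdist x y)%R; first by rewrite /= subr_gt0.
move=> z; rewrite !ballEmdist/= ltrBrDl.
exact/le_lt_trans/metric_triangle.
Qed.

(** * Curves and line integrals *)

Lemma ereal_supD_le {R : realType} (A B : set \bar R) (C : \bar R) :
  (exists2 x, A x & 0 <= x) -> (exists2 x, B x & 0 <= x) ->
  (forall x y, A x -> B y -> x + y <= C) -> ereal_sup A + ereal_sup B <= C.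
Proof.
move=> [x0 Ax0 x00] [y0 By0 y00] H.
have [->|Cfin] := eqVneq C +oo; first by rewrite leey.
have BC : ereal_sup B <= C.
  apply: ge_ereal_sup => y By; apply: le_trans (H _ _ Ax0 By).
  by rewrite leeDr.
have AC : ereal_sup A <= C.
  apply: ge_ereal_sup => x Ax; apply: le_trans (H _ _ Ax By0).
  by rewrite leeDl.
have B0 : 0 <= ereal_sup B by apply: (le_trans y00); exact: ereal_sup_ubound.
have fB : ereal_sup B \is a fin_num.
  by rewrite ge0_fin_numE// (le_lt_trans BC)// ltey.
rewrite -leeBrDr//; apply: ge_ereal_sup => x Ax; rewrite leeBrDr//.
case: x Ax => [r| |] Ax; last 2 first.
- have := H _ _ Ax By0; rewrite addye ?leye_eq ?(negbTE Cfin)//.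
  by rewrite gt_eqF// (lt_le_trans _ y00).
- by rewrite addNye leNye.
rewrite addeC -leeBrDr//; apply: ge_ereal_sup => y By.
by rewrite leeBrDr// addeC H.
Qed.

Section curve_length_theory.
Context {R : realType} {T : Type} (dist : T -> T -> \bar R).
Hypothesis dist_ge0 : forall x y, 0 <= dist x y.
Hypothesis dist_tri : forall x y z, dist x z <= dist x y + dist y z.
Hypothesis dist_sym : forall x y, dist x y = dist y x.
Implicit Types (a b : R) (gam : R -> T).

Fixpoint path_length gam a (s : seq R) : \bar R :=
  if s is x :: s' then dist (gam a) (gam x) + path_length gam x s' else 0.

Lemma path_lengthE gam a b s :
  \sum_(0 <= i < size s) dist (gam (nth b (a :: s) i))
    (gam (nth b (a :: s) i.+1)) = path_length gam a s.
Proof.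
elim: s a => [|x s ih] a /=; first by rewrite big_nil.
by rewrite big_nat_recl//= -ih.
Qed.

Lemma path_length_ge0 gam a s : 0 <= path_length gam a s.
Proof. by elim: s a => //= x s ih a; rewrite adde_ge0. Qed.

Lemma path_length_cat gam a s t :
  path_length gam a (s ++ t) = path_length gam a s + path_length gam (last a s) t.
Proof. by elim: s a => [|x s ih] a /=; rewrite ?add0e// ih addeA. Qed.

Lemma curve_lengthE a b gam : curve_length dist a b gam =
  ereal_sup [set path_length gam a s | s in itv_partition a b].
Proof.
rewrite /curve_length; congr ereal_sup; apply: eq_imagel => s _.
exact: path_lengthE.
Qed.

Lemma path_length_le_curve a b gam s : itv_partition a b s ->
  path_length gam a s <= curve_length dist a b gam.
Proof. by move=> abs; rewrite curve_lengthE; apply: ereal_sup_ubound; exists s. Qed.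

Lemma itv_partition_ex a b : (a <= b)%R -> exists s, itv_partition a b s.
Proof.
rewrite le_eqVlt => /predU1P[->|ab]; first by exists [::]; split => /=.
by exists [:: b]; exact: itv_partition1.
Qed.

Lemma curve_length_ge0 a b gam : (a <= b)%R -> 0 <= curve_length dist a b gam.
Proof.
move=> /itv_partition_ex[s abs].
exact: le_trans (path_length_ge0 gam a s) (path_length_le_curve gam abs).
Qed.

Lemma curve_lengthxx a gam : curve_length dist a a gam = 0.
Proof.
rewrite curve_lengthE (_ : [set _ | _ in _] = [set 0]) ?ereal_sup1//.
apply/seteqP; split => [x [s /itv_partitionxx -> <-]//|x ->].
by exists [::].
Qed.

Lemma dist_le_curve_length a b gam : (a < b)%R ->
  dist (gam a) (gam b) <= curve_length dist a b gam.
Proof.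
move=> ab; have := path_length_le_curve gam (itv_partition1 ab).
by rewrite /= adde0.
Qed.

Lemma curve_lengthD_ge a b c gam : (a <= b)%R -> (b <= c)%R ->
  curve_length dist a b gam + curve_length dist b c gam <=
  curve_length dist a c gam.
Proof.
move=> ab bc; rewrite 2!curve_lengthE; apply: ereal_supD_le.
- have [s abs] := itv_partition_ex ab.
  by exists (path_length gam a s); [exists s|exact: path_length_ge0].
- have [s bcs] := itv_partition_ex bc.
  by exists (path_length gam b s); [exists s|exact: path_length_ge0].
- move=> _ _ [s abs <-] [t bct <-].
  have <- : last a s = b by case: abs => _ /eqP.
  rewrite -path_length_cat; apply: path_length_le_curve.
  exact: itv_partition_cat abs bct.
Qed.

Lemma curve_length_le a b c gam : (a <= b)%R -> (b <= c)%R ->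
  curve_length dist a b gam <= curve_length dist a c gam.
Proof.
move=> ab bc; apply: le_trans (curve_lengthD_ge gam ab bc).
by rewrite leeDl// curve_length_ge0.
Qed.

Lemma curve_length_dist_le a b c gam : (a <= b)%R -> (b < c)%R ->
  curve_length dist a b gam + dist (gam b) (gam c) <=
  curve_length dist a c gam.
Proof.
move=> ab bc; apply: le_trans (curve_lengthD_ge gam ab (ltW bc)).
by rewrite leeD2l// dist_le_curve_length.
Qed.

(** Inserting [b] into a partition of [[a, c]] can only increase the sum, by the triangle
    inequality; the enlarged partition is then cut at [b]. *)
Lemma path_length_split a b c gam s : (a < b)%R -> (b < c)%R ->
  itv_partition a c s -> exists s1 s2, [/\ itv_partition a b s1,
    itv_partition b c s2 &
    path_length gam a s <= path_length gam a s1 + path_length gam b s2].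
Proof.
elim: s a => [|x s ih] a ab bc.
  by move=> /itv_partition_nil ac; move: ab; rewrite ltNge ltW// ac.
move=> acs; have ax : (a < x)%R by case: acs => /= /andP[].
have xcs := itv_partition_cons acs.
have [xb|bx|xb] := ltgtP x b.
- have [s1 [s2 [xbs1 bcs2 H]]] := ih _ xb bc xcs.
  exists (x :: s1), s2; split => //.
    by case: xbs1 => p1 l1; split => //=; rewrite ax.
  by rewrite /= -addeA leeD2l.
- exists [:: b], (x :: s); split => //.
  + exact: itv_partition1.
  + by case: xcs => p1 l1; split => //=; rewrite bx.
  + by rewrite /= adde0 addeA leeD2r.
- subst x; exists [:: b], s; split => //; first exact: itv_partition1.
  by rewrite /= adde0.
Qed.

Lemma curve_lengthD a b c gam : (a <= b)%R -> (b <= c)%R ->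
  curve_length dist a c gam =
  curve_length dist a b gam + curve_length dist b c gam.
Proof.
move=> ab bc; apply/eqP; rewrite eq_le curve_lengthD_ge// andbT.
move: ab; rewrite [X in is_true X]le_eqVlt => /orP[/eqP ->|ab].
  by rewrite curve_lengthxx add0e.
move: bc; rewrite [X in is_true X]le_eqVlt => /orP[/eqP ->|bc].
  by rewrite curve_lengthxx adde0.
rewrite [leLHS]curve_lengthE; apply: ge_ereal_sup => _ [s acs <-].
have [s1 [s2 [abs1 bcs2 H]]] := path_length_split gam ab bc acs.
by apply: (le_trans H); apply: leeD; exact: path_length_le_curve.
Qed.

Lemma curve_length_lip a b gam (K : R) : (a <= b)%R ->
  (forall s t, (a <= s)%R -> (s <= t)%R -> (t <= b)%R ->
    dist (gam s) (gam t) <= (K * (t - s))%:E) ->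
  curve_length dist a b gam <= (K * (b - a))%:E.
Proof.
move=> ab H; rewrite curve_lengthE; apply: ge_ereal_sup => _ [s abs <-].
elim: s a ab H abs => [|x s ih] a ab H abs.
  by rewrite /= lee_fin (itv_partition_nil abs) subrr mulr0.
have ax : (a < x)%R by case: abs => /= /andP[].
have xbs := itv_partition_cons abs.
have xb := itv_partition_le xbs.
rewrite /=; apply: (@le_trans _ _ ((K * (x - a))%:E + (K * (b - x))%:E)); last first.
  by rewrite -EFinD lee_fin -mulrDr addrC addrA subrK.
apply: leeD; first by apply: H => //; exact: ltW.
by apply: ih => // s' t' xs; apply: H; apply: (le_trans (ltW ax)).
Qed.

Lemma path_length_rcons gam a s x : path_length gam a (rcons s x) =
  path_length gam a s + dist (gam (last a s)) (gam x).
Proof. by rewrite -cats1 path_length_cat /= adde0. Qed.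

Lemma curve_length_rev_le a b c gam : curve_length dist a b gam <=
  curve_length dist (c - b) (c - a) (fun s => gam (c - s)%R).
Proof.
rewrite [leLHS]curve_lengthE; apply: ge_ereal_sup => _ [s abs <-].
have : exists s', itv_partition (c - b)%R (c - a)%R s' /\
    path_length gam a s = path_length (fun s => gam (c - s)%R) (c - b)%R s'.
  elim: s a abs => [|x s ih] a abs.
    by exists [::]; rewrite (itv_partition_nil abs); split => //; split => /=.
  have ax : (a < x)%R by case: abs => /= /andP[].
  have xbs := itv_partition_cons abs.
  have [s' [bxs' E]] := ih _ xbs.
  have lx : last (c - b)%R s' = (c - x)%R by case: bxs' => _ /eqP.
  exists (rcons s' (c - a)%R); split.
    case: bxs' => p1 _; split; last by rewrite last_rcons.
    by rewrite rcons_path p1 /= lx ltrD2l ltrN2.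
  by rewrite path_length_rcons lx !subKr /= E addeC dist_sym.
by move=> [s' [? ->]]; exact: path_length_le_curve.
Qed.

Lemma curve_length_rev a b c gam :
  curve_length dist (c - b) (c - a) (fun s => gam (c - s)%R) =
  curve_length dist a b gam.
Proof.
apply/eqP; rewrite eq_le curve_length_rev_le andbT.
apply: (le_trans (curve_length_rev_le _ _ c _)).
rewrite !subKr le_eqVlt; apply/orP; left; apply/eqP.
by congr curve_length; apply/funext => s; rewrite subKr.
Qed.

Section line_integrals.
Variables (a b : R) (gam : R -> T) (g : T -> \bar R).
Hypotheses (ab : (a <= b)%R) (gam_fin : curve_length dist a b gam < +oo).
Hypothesis g0 : forall s, (a <= s <= b)%R -> 0 <= g (gam s).

Let L s := fine (curve_length dist a s gam).

Lemma curve_length_fin s : (a <= s <= b)%R -> curve_length dist a s gam = (L s)%:E.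
Proof.
move=> /andP[as_ sb]; rewrite /L fineK// ge0_fin_numE ?curve_length_ge0//.
exact: le_lt_trans (curve_length_le gam as_ sb) gam_fin.
Qed.

Lemma L_homo s t : (a <= s)%R -> (s <= t)%R -> (t <= b)%R -> (L s <= L t)%R.
Proof.
move=> as_ st tb; rewrite -lee_fin -!curve_length_fin ?as_ ?(le_trans st)//.
  exact: curve_length_le.
by rewrite tb (le_trans as_).
Qed.

(** Generalized inverse of the length function [L]; by definition [arc_param dist a b gam l] is
    [gam (time_of l)]. *)
Definition time_of (l : R) : R :=
  inf [set s | s \in `[a, b] /\ l%:E <= curve_length dist a s gam].

Lemma time_of_itv l s t : (a <= s)%R -> (s <= t)%R -> (t <= b)%R ->
  (L s < l)%R -> (l <= L t)%R -> (s <= time_of l <= t)%R.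
Proof.
move=> as_ st tb sl lt; have at_ : (a <= t)%R by apply: le_trans st.
have It : [set s | s \in `[a, b] /\ l%:E <= curve_length dist a s gam] t.
  split; first by rewrite in_itv/= at_.
  by rewrite curve_length_fin ?at_// lee_fin.
apply/andP; split; last first.
  by apply: ge_inf => //; exists a => x [] /=; rewrite in_itv/= => /andP[].
apply: lb_le_inf; first by exists t.
move=> x [] /=; rewrite in_itv/= => /andP[ax xb].
rewrite curve_length_fin ?ax// lee_fin => lx.
rewrite leNgt; apply/negP => xs.
have := L_homo ax (ltW xs) (le_trans st tb).
by rewrite leNgt (lt_le_trans sl).
Qed.

(** The part of the line integral between the times [s] and [t], in the arc length of the whole
    curve. Half-open intervals make consecutive pieces disjoint, so that superadditivity holds
    without measurability of [g] along the curve. *)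
Definition sub_integral s t : \bar R :=
  \int[lebesgue_measure]_(l in `]L s, L t]) g (arc_param dist a b gam l).

Lemma arc_param_ge0 s t l : (a <= s)%R -> (s <= t)%R -> (t <= b)%R ->
  (l \in `]L s, L t])%R -> 0 <= g (arc_param dist a b gam l).
Proof.
move=> as_ st tb; rewrite in_itv/= => /andP[sl lt].
have /andP[h1 h2] := time_of_itv as_ st tb sl lt.
by apply: g0; rewrite (le_trans as_ h1) (le_trans h2).
Qed.

Lemma sub_integral_ge0 s t : (a <= s)%R -> (s <= t)%R -> (t <= b)%R ->
  0 <= sub_integral s t.
Proof.
by move=> as_ st tb; apply: integral_ge0 => l /= /(arc_param_ge0 as_ st tb).
Qed.

Lemma sub_integralD s t u : (a <= s)%R -> (s <= t)%R -> (t <= u)%R -> (u <= b)%R ->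
  sub_integral s t + sub_integral t u <= sub_integral s u.
Proof.
move=> as_ st tu ub.
have at_ := le_trans as_ st; have tb := le_trans tu ub.
have su := le_trans st tu.
rewrite /sub_integral [X in X + _]integral_mkcond [X in _ + X]integral_mkcond.
rewrite [leRHS]integral_mkcond.
apply: le_trans (ge0_integralD_lower _ _ _) _ => [x _|x _|].
- apply: erestrict_ge0 => l; exact: (arc_param_ge0 as_ st tb).
- apply: erestrict_ge0 => l; exact: (arc_param_ge0 at_ tu ub).
apply: ge0_le_integral_lower => l _; rewrite !patchE !mem_setE.
have Lst := L_homo as_ st tb; have Ltu := L_homo at_ tu ub.
case: ifPn => h1; case: ifPn => h2.
- by exfalso; move: h1 h2; rewrite !in_itv/= => /andP[_ h] /andP[]; rewrite ltNge h.
- have h3 : (l \in `]L s, L u])%R.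
    by move: h1; rewrite !in_itv/= => /andP[-> /le_trans ->].
  by rewrite h3 adde0 lexx andbT (arc_param_ge0 as_ su ub).
- have h3 : (l \in `]L s, L u])%R.
    by move: h2; rewrite !in_itv/= => /andP[/(le_lt_trans Lst) -> ->].
  by rewrite h3 add0e lexx andbT (arc_param_ge0 as_ su ub).
- rewrite adde0 lexx/=; case: ifPn => // h3.
  exact: (arc_param_ge0 as_ su ub).
Qed.

Lemma time_of_le l : (l <= L b)%R -> (a <= time_of l <= b)%R.
Proof.
move=> lb; have Ib : [set s | s \in `[a, b] /\ l%:E <= curve_length dist a s gam] b.
  split; first by rewrite in_itv/= ab lexx.
  by rewrite curve_length_fin ?ab ?lexx// lee_fin.
apply/andP; split; last first.
  by apply: ge_inf => //; exists a => x [] /=; rewrite in_itv/= => /andP[].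
by apply: lb_le_inf; [exists b|move=> x [] /=; rewrite in_itv/= => /andP[]].
Qed.

Lemma sub_integral_le s t : (a <= s)%R -> (s <= t)%R -> (t <= b)%R ->
  sub_integral s t <= line_integral dist a b gam g.
Proof.
move=> as_ st tb.
have sb := le_trans st tb; have at_ := le_trans as_ st.
rewrite /sub_integral /line_integral integral_mkcond [leRHS]integral_mkcond.
apply: ge0_le_integral_lower => l _; rewrite !patchE !mem_setE.
case: ifPn => h1.
  have h2 : (l \in `[0, fine (curve_length dist a b gam)])%R.
    move: h1; rewrite !in_itv/= => /andP[h1 h2]; apply/andP; split.
      by apply: le_trans (ltW h1); rewrite fine_ge0// curve_length_ge0.
    by rewrite (le_trans h2)// L_homo.
  by rewrite h2 lexx andbT (arc_param_ge0 as_ st tb).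
rewrite lexx/=; case: ifPn => //; rewrite in_itv/= => /andP[_ h2].
by apply: g0; exact: time_of_le.
Qed.

(** The interval of arc lengths from [L s] to [L t] is at least as long as the distance between the
    two points, and the integrand is at least [c] on it. *)
Lemma sub_integral_ge s t (c : R) : (a <= s)%R -> (s <= t)%R -> (t <= b)%R ->
  dist (gam s) (gam s) = 0 -> (0 <= c)%R ->
  (forall r, (s <= r <= t)%R -> c%:E <= g (gam r)) ->
  c%:E * dist (gam s) (gam t) <= sub_integral s t.
Proof.
move=> as_; rewrite [X in is_true X]le_eqVlt => /orP[/eqP est|st] tb dist_xx c0 H.
  subst t.
  by rewrite dist_xx mule0 sub_integral_ge0// (le_trans as_).
have sb := le_trans (ltW st) tb; have at_ := le_trans as_ (ltW st).
have Lst := L_homo as_ (ltW st) tb.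
apply: (@le_trans _ _ (c%:E * (L t - L s)%:E)).
  rewrite lee_wpmul2l ?lee_fin// EFinB leeBrDl ?fin_numE//.
  rewrite -!curve_length_fin ?as_ ?at_//.
  exact: curve_length_dist_le.
rewrite /sub_integral.
have -> : (L t - L s)%:E = lebesgue_measure `]L s, L t]%classic.
  rewrite lebesgue_measure_itv/= lte_fin; case: ltP => //.
  by move=> ts; have -> : L t = L s; [apply/eqP; rewrite eq_le ts Lst|rewrite subrr].
rewrite -(integral_cst lebesgue_measure _ c%:E)//.
apply: ge0_le_integral_lower => l /=; rewrite in_itv/= => /andP[h1 h2].
rewrite lee_fin c0/=; apply: H.
exact: (time_of_itv as_ (ltW st) tb h1 h2).
Qed.

End line_integrals.

End curve_length_theory.

(** * Crossing of concentric balls by a curve *)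

Section hitting_times.
Context {R : realType}.
Variables (a b : R) (phi : R -> R).
Hypothesis phi_cont : forall t, (a <= t <= b)%R -> forall e : R, (0 < e)%R ->
  exists2 d : R, (0 < d)%R & forall s, (a <= s <= b)%R -> (`|s - t| < d)%R ->
    (`|phi s - phi t| < e)%R.

Lemma first_hit s0 r : (a <= s0 <= b)%R -> (phi a <= r <= phi s0)%R ->
  exists t, [/\ (a <= t <= s0)%R, phi t = r &
    forall s, (a <= s <= t)%R -> (phi s <= r)%R].
Proof.
move=> /andP[as0 s0b] /andP[pa ps0].
pose A := [set s | (a <= s <= s0)%R /\ (r <= phi s)%R].
have As0 : A s0 by split => //; rewrite as0 lexx.
have infA : has_inf A by split; [exists s0|exists a => x [/andP[]]].
set t := inf A.
have at_ : (a <= t)%R by apply: lb_le_inf; [exists s0|move=> x [/andP[]]].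
have ts0 : (t <= s0)%R by apply: ge_inf => //; case: infA.
have tb := le_trans ts0 s0b.
have below s : (a <= s)%R -> (s < t)%R -> (phi s < r)%R.
  move=> as_ st; rewrite ltNge; apply/negP => rs.
  have : (t <= s)%R.
    apply: ge_inf; first by case: infA.
    by split => //; rewrite as_ (le_trans (ltW st)).
  by rewrite leNgt st.
have rt : (r <= phi t)%R.
  rewrite leNgt; apply/negP => tr.
  have e0 : (0 < r - phi t)%R by rewrite subr_gt0.
  have [|d d0 H] := phi_cont (t := t) _ e0; first by rewrite at_.
  have [s [/andP[as_ ss0] rs] std] := inf_adherent d0 infA.
  have ts : (t <= s)%R by apply: ge_inf; [case: infA|split => //; rewrite as_].
  have := H s; rewrite as_ (le_trans ss0 s0b) ger0_norm ?subr_ge0//.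
  rewrite ltrBlDl => /(_ isT std); rewrite ltr_norml => /andP[_].
  by rewrite ltrD2r ltNge rs.
have tr : (phi t <= r)%R.
  rewrite leNgt; apply/negP => rlt.
  have e0 : (0 < phi t - r)%R by rewrite subr_gt0.
  have [|d d0 H] := phi_cont (t := t) _ e0; first by rewrite at_.
  move: (at_); rewrite le_eqVlt => /orP[/eqP ta|lat].
    by move: rlt; rewrite -ta ltNge pa.
  pose s := Order.max a (t - d / 2)%R.
  have as_ : (a <= s)%R by rewrite le_max lexx.
  have st : (s < t)%R by rewrite gt_max lat/= ltrBlDr ltrDl divr_gt0.
  have := H s; rewrite as_ (le_trans (ltW st) tb).
  rewrite distrC ger0_norm ?subr_ge0 ?(ltW st)// => /(_ isT).
  have -> : (t - s < d)%R.
    rewrite ltrBlDr -ltrBlDl (@lt_le_trans _ _ (t - d / 2)%R)//.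
      by rewrite ltrD2l ltrN2 ltr_pdivrMr// ltr_pMr// ltr1n.
    by rewrite le_max lexx orbT.
  move=> /(_ isT); rewrite distrC ltr_norml => /andP[_].
  by rewrite ltrD2l ltrN2 ltNge ltW// below.
exists t; split; first by rewrite at_.
  by apply/eqP; rewrite eq_le tr rt.
move=> s /andP[as_]; rewrite le_eqVlt => /orP[/eqP -> //|st].
by rewrite ltW// below.
Qed.

Variables (h : R -> \bar R) (J : R -> R -> \bar R).
Hypothesis J_ge0 : forall s t, (a <= s)%R -> (s <= t)%R -> (t <= b)%R -> 0 <= J s t.
Hypothesis JD : forall s t u, (a <= s)%R -> (s <= t)%R -> (t <= u)%R ->
  (u <= b)%R -> J s t + J t u <= J s u.
Hypothesis J_ge : forall s t (c : R), (a <= s)%R -> (s <= t)%R -> (t <= b)%R ->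
  (0 <= c)%R -> (forall r, (s <= r <= t)%R -> c%:E <= h r) ->
  (c * `|phi s - phi t|)%:E <= J s t.

(** Here [phi] is the distance to the starting point and the [r j] are decreasing radii. Between the
    first hitting times [t1] of [r 1] and [t0] of [r 0] the curve crosses the outermost annulus
    inside the ball of radius [r 0], which contributes [c 0 (r 0 - r 1)]. The curve up to [t1] takes
    care of the inner annuli by induction. *)
Lemma chain_integral n (c r : nat -> R) s0 : (a <= s0 <= b)%R ->
  (phi a <= 0)%R -> (r 0%N <= phi s0)%R ->
  (forall j, (0 <= r j)%R) -> (forall j, (r j.+1 <= r j)%R) ->
  (forall j, (0 <= c j)%R) ->
  (forall j s, (j < n)%N -> (a <= s <= s0)%R -> (phi s <= r j)%R -> (c j)%:E <= h s) ->
  (\sum_(0 <= j < n) c j * (r j - r j.+1))%:E <= J a s0.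
Proof.
elim: n c r s0 => [|n ih] c r s0 /andP[as0 s0b] pa r0s0 r0 rdecr c0 H.
  by rewrite big_nil J_ge0.
have [||t0 [/andP[at0 t0s0] pt0 bt0]] := first_hit (s0 := s0) (r := r 0%N).
- by rewrite as0.
- by rewrite r0s0 (le_trans pa).
have t0b := le_trans t0s0 s0b.
have [||t1 [/andP[at1 t1t0] pt1 bt1]] := first_hit (s0 := t0) (r := r 1%N).
- by rewrite at0.
- by rewrite pt0 rdecr (le_trans pa).
apply: (@le_trans _ _ (J a t0)); last first.
  by apply: le_trans (JD _ at0 t0s0 s0b) => //; rewrite leeDl// J_ge0.
rewrite big_nat_recl// addrC.
apply: le_trans (JD (lexx a) at1 t1t0 t0b); rewrite EFinD; apply: leeD.
  apply: (ih (fun j => c j.+1) (fun j => r j.+1)) => //.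
  - by rewrite at1 (le_trans t1t0).
  - by rewrite pt1.
  - move=> j s jn /andP[as_ st1]; apply: H => //.
    by rewrite as_ (le_trans st1)// (le_trans t1t0).
have -> : (r 0%N - r 1%N)%R = `|phi t1 - phi t0|%R.
  by rewrite pt1 pt0 distrC ger0_norm// subr_ge0.
apply: J_ge => // s /andP[t1s st0]; apply: H => //.
  by rewrite (le_trans at1)// (le_trans st0).
by apply: bt0; rewrite (le_trans at1).
Qed.

End hitting_times.

Lemma chain_integral_rev {R : realType} (a b : R) (phi : R -> R) (h : R -> \bar R)
    (J : R -> R -> \bar R) :
  (forall t, (a <= t <= b)%R -> forall e : R, (0 < e)%R ->
    exists2 d : R, (0 < d)%R & forall s, (a <= s <= b)%R -> (`|s - t| < d)%R ->
    (`|phi s - phi t| < e)%R) ->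
  (forall s t, (a <= s)%R -> (s <= t)%R -> (t <= b)%R -> 0 <= J s t) ->
  (forall s t u, (a <= s)%R -> (s <= t)%R -> (t <= u)%R ->
    (u <= b)%R -> J s t + J t u <= J s u) ->
  (forall s t (c : R), (a <= s)%R -> (s <= t)%R -> (t <= b)%R ->
    (0 <= c)%R -> (forall r, (s <= r <= t)%R -> c%:E <= h r) ->
    (c * `|phi s - phi t|)%:E <= J s t) ->
  forall n (c r : nat -> R) s0, (a <= s0 <= b)%R ->
  (phi b <= 0)%R -> (r 0%N <= phi s0)%R ->
  (forall j, (0 <= r j)%R) -> (forall j, (r j.+1 <= r j)%R) ->
  (forall j, (0 <= c j)%R) ->
  (forall j s, (j < n)%N -> (s0 <= s <= b)%R -> (phi s <= r j)%R -> (c j)%:E <= h s) ->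
  (\sum_(0 <= j < n) c j * (r j - r j.+1))%:E <= J s0 b.
Proof.
move=> pc J0 JD Jge n c r s0 /andP[as0 s0b] pb rs0 r0 rd c0 H.
have := @chain_integral R (- b) (- a) (fun s => phi (- s))%R _ (fun s => h (- s)%R)
  (fun s t => J (- t) (- s))%R _ _ _ n c r (- s0)%R.
rewrite !opprK; apply => //.
- move=> t /andP[bt ta] e e0.
  have [|d d0 Hd] := pc (- t)%R _ e e0; first by rewrite lerNr ta lerNl.
  exists d => // s /andP[bs sa] std; apply: Hd; first by rewrite lerNr sa lerNl.
  by rewrite -opprD normrN.
- by move=> s t bs st ta; apply: J0; rewrite ?lerN2// 1?lerNr// lerNl.
- move=> s t u bs st tu ua; rewrite addeC; apply: JD; rewrite ?lerN2// 1?lerNr//.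
  by rewrite lerNl.
- move=> s t k bs st ta k0 Hk; rewrite distrC; apply: Jge; rewrite ?lerN2// 1?lerNr//.
    by rewrite lerNl.
  move=> q /andP[tq qs]; have := Hk (- q)%R; rewrite opprK; apply.
  by rewrite lerNr qs lerNl.
- by rewrite lerN2 s0b lerN2.
- move=> j s jn /andP[bs ss0]; apply: H => //.
  by rewrite lerNr ss0 lerNl.
Qed.

Section edge_integral.
Context {R : realType} {T : Type} (dist : T -> T -> \bar R).
Hypothesis dist_ge0 : forall x y, 0 <= dist x y.
Hypothesis dist_tri : forall x y z, dist x z <= dist x y + dist y z.

(** The inverse of the length function pushes Lebesgue measure forward to a measure that is at most
    [K] times Lebesgue measure, because the length function is [K]-Lipschitz. *)
Lemma line_integral_lip (gam : R -> T) (g : T -> \bar R) (K : R) : (0 < K)%R ->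
  (forall s t, (0 <= s)%R -> (s <= t)%R -> (t <= 1)%R ->
    dist (gam s) (gam t) <= (K * (t - s))%:E) ->
  (forall s, (0 <= s <= 1)%R -> 0 <= g (gam s)) ->
  measurable_fun (`[0%R, 1%R]%classic : set (measurableTypeR R)) (g \o gam) ->
  line_integral dist 0 1 gam g <=
  K%:E * \int[lebesgue_measure]_(t in `[0%R, 1%R]) g (gam t).
Proof.
move=> K0 Hlip g0 mg.
have fin : curve_length dist 0 1 gam < +oo.
  by apply: le_lt_trans (curve_length_lip ler01 Hlip) _; rewrite ltry.
pose L s := fine (curve_length dist 0 s gam).
have LE s : (0 <= s <= 1)%R -> curve_length dist 0 s gam = (L s)%:E.
  exact: curve_length_fin.
have L0 : L 0%R = 0%R by rewrite /L curve_lengthxx.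
have Llip s t : (0 <= s)%R -> (s <= t)%R -> (t <= 1)%R ->
    (0 <= L t - L s <= K * (t - s))%R.
  move=> s0 st t1; have t0 := le_trans s0 st; have s1 := le_trans st t1.
  rewrite subr_ge0 (L_homo dist_ge0 fin)//=.
  rewrite -lee_fin EFinB -!LE ?s0 ?t0//.
  rewrite (curve_lengthD dist_ge0 dist_tri gam s0 st) LE ?s0//.
  rewrite addeAC subee// add0e.
  apply: curve_length_lip => // u v su uv vt.
  by apply: Hlip => //; [apply: (le_trans s0)|apply: (le_trans vt)].
pose cl (s : R) : R := (Order.max 0 (Order.min s 1))%R.
have cl01 s : (0 <= cl s <= 1)%R.
  by rewrite le_max lexx ge_max ler01/= ge_min lexx orbT.
have clE s : (0 <= s <= 1)%R -> cl s = s.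
  by move=> /andP[s0 s1]; rewrite /cl (min_idPl s1) (max_idPr s0).
have cl_mono s t : (s <= t)%R -> (0 <= cl t - cl s <= t - s)%R.
  move=> st; rewrite /cl /Order.max /Order.min.
  case: (ltP s 1%R) => ?; case: (ltP t 1%R) => ?; do 2?case: ifPn => ?; lra.
(* The length function [L], continued with slope [K] outside [[0, 1]]. It is then unbounded in both
   directions, so its generalized inverse [sg] is defined on the whole line; [sg] is monotone, hence
   Borel. *)
pose M s := (L (cl s) + K * (s - cl s))%R.
have M_lip s t : (s <= t)%R -> (0 <= M t - M s <= K * (t - s))%R.
  move=> st; have /andP[c1 c2] := cl_mono _ _ st.
  have /andP[s0 s1] := cl01 s; have /andP[t0 t1] := cl01 t.
  have cst : (cl s <= cl t)%R by rewrite -subr_ge0.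
  have /andP[l1 l2] := Llip _ _ s0 cst t1.
  have -> : (M t - M s = (L (cl t) - L (cl s)) + K * ((t - s) - (cl t - cl s)))%R.
    by rewrite /M; ring.
  apply/andP; split; first by rewrite addr_ge0// mulr_ge0 ?(ltW K0)// subr_ge0.
  by rewrite [X in (_ + X)%R]mulrBr addrC -lerBrDl opprB addrCA subrr addr0.
have ME s : (0 <= s <= 1)%R -> M s = L s.
  by move=> s01; rewrite /M clE// subrr mulr0 addr0.
have L1 : (0 <= L 1%R)%R.
  by rewrite -lee_fin -LE ?lexx ?ler01// curve_length_ge0.
have Mneg s : (s <= 0)%R -> M s = (K * s)%R.
  move=> s0; have -> : M s = (L (cl s) + K * (s - cl s))%R by [].
  have -> : cl s = 0%R by rewrite /cl; apply/max_idPl; rewrite ge_min s0.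
  by rewrite L0 add0r subr0.
have Mbig s : (1 <= s)%R -> M s = (L 1 + K * (s - 1))%R.
  move=> s1; have -> : M s = (L (cl s) + K * (s - cl s))%R by [].
  by have -> : cl s = 1%R by rewrite /cl (min_idPr s1) (max_idPr ler01).
pose A l := [set s | (l <= M s)%R].
have A_ne l : A l !=set0.
  exists (1 + `|l| / K)%R; rewrite /A/= Mbig ?lerDl ?divr_ge0// ?(ltW K0)//.
  rewrite addrAC subrr add0r mulrC divfK ?gt_eqF// (le_trans (ler_norm l))//.
  by rewrite lerDr.
have A_lb l : has_lbound (A l).
  exists (Order.min 0 (l / K))%R => s; rewrite /A/= => ls.
  rewrite ge_min; have [//|s0] := leP 0%R s.
  by rewrite ler_pdivrMr// mulrC -Mneg// ltW.
pose sg l := inf (A l).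
have sg_homo l l' : (l <= l')%R -> (sg l <= sg l')%R.
  move=> ll; apply: lb_le_inf => // x Ax; apply: ge_inf => //.
  exact: le_trans ll Ax.
have msg : measurable_fun setT (sg : measurableTypeR R -> measurableTypeR R).
  exact: nondecreasing_measurable.
have sg_gt s l : (s < sg l)%R -> (M s < l)%R.
  move=> sl; rewrite ltNge; apply/negP => lM.
  by have : (sg l <= s)%R; [exact: ge_inf|rewrite leNgt sl].
have sg_le t l : (sg l <= t)%R -> (l <= M t)%R.
  move=> lt_; apply/ler_addgt0Pr => e e0.
  have e1 : (0 < e / K)%R by rewrite divr_gt0.
  have [x Ax xl] := inf_adherent e1 (conj (A_ne l) (A_lb l)).
  have [xt|tx] := leP x t.
    have /andP[+ _] := M_lip _ _ xt; rewrite subr_ge0 => MM.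
    by rewrite (le_trans Ax)// (le_trans MM)// lerDl ltW.
  have /andP[_ MM] := M_lip _ _ (ltW tx).
  rewrite (le_trans Ax)// -lerBlDl (le_trans MM)// mulrC -ler_pdivlMr//.
  by rewrite lerBlDl ltW// (lt_le_trans xl)// lerD2r.
pose sgm : {mfun measurableTypeR R >-> measurableTypeR R} :=
  HB.pack (sg : measurableTypeR R -> measurableTypeR R)
    (isMeasurableFun.Build _ _ _ _ (sg : measurableTypeR R -> measurableTypeR R) msg).
(* It suffices to test half-open intervals: the preimage of []s, t]] under [sg] lies in []M s, M
   t]], whose length is at most [K (t - s)]. *)
have dom : forall B : set (measurableTypeR R), measurable B ->
    pushforward lebesgue_measure sgm B <= K%:E * lebesgue_measure B.
  apply: le_lebesgue_measure => // s t st.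
  apply: (@le_trans _ _ (lebesgue_measure `]M s, M t]%classic)).
    have sub : sg @^-1` `]s, t] `<=` `]M s, M t]%classic.
      by move=> l /=; rewrite !in_itv/= => /andP[/sg_gt -> /sg_le ->].
    have m1 : measurable (sg @^-1` `]s, t] : set (measurableTypeR R)).
      by rewrite -[X in measurable X]setTI; apply: (msg measurableT).
    have m2 : measurable (`]M s, M t]%classic : set (measurableTypeR R)) by [].
    exact: (le_measure lebesgue_measure (mem_set m1) (mem_set m2) sub).
  have /andP[Mst1 Mst2] := M_lip _ _ st.
  rewrite lebesgue_measure_itv/= lte_fin; case: ltP => [_|_].
    by rewrite -EFinB lee_fin.
  by rewrite lee_fin mulr_ge0 ?(ltW K0)// subr_ge0.
pose f := (g \o gam) \_ `[0%R, 1%R].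
have f0 t : 0 <= f t.
  by apply: erestrict_ge0 => u /=; rewrite in_itv/=; exact: g0.
have mf : measurable_fun setT (f : measurableTypeR R -> \bar R).
  exact/(measurable_restrictT _ _).1.
have timeE l : (0 < l)%R -> (l <= L 1)%R -> time_of dist 0 1 gam l = sg l.
  move=> l0 l1.
  have Al1 : A l 1%R by rewrite /A/= ME ?lexx ?ler01.
  have T1 : [set s | s \in `[0%R, 1%R] /\ l%:E <= curve_length dist 0 s gam] 1%R.
    by split; [rewrite in_itv/= lexx ler01|rewrite LE ?lexx ?ler01// lee_fin].
  apply/eqP; rewrite eq_le; apply/andP; split; last first.
    apply: lb_le_inf; first by exists 1%R.
    move=> s [] /=; rewrite in_itv/= => s01; rewrite LE// lee_fin => ls.
    by apply: ge_inf => //; rewrite /A/= ME.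
  apply: lb_le_inf; first by exists 1%R.
  have lbT : has_lbound [set s | s \in `[0%R, 1%R] /\ l%:E <= curve_length dist 0 s gam].
    by exists 0%R => s [] /=; rewrite in_itv/= => /andP[].
  move=> s; rewrite /A/= => ls; have [s1|s1] := leP 1%R s.
    by apply: le_trans s1; exact: ge_inf.
  have s0 : (0 <= s)%R.
    rewrite leNgt; apply/negP => sn; move: ls; rewrite Mneg ?(ltW sn)// leNgt.
    by rewrite (lt_trans _ l0)// pmulr_rlt0.
  have s01 : (0 <= s <= 1)%R by rewrite s0 ltW.
  by apply: ge_inf => //; split; rewrite ?in_itv//= LE// lee_fin -ME.
apply: (@le_trans _ _ (\int[lebesgue_measure]_l f (sg l))).
  rewrite /line_integral.
  rewrite (@ge0_negligible_integral_lower _ _ _ _ _ ([set 0%R] : set (measurableTypeR R)))//=.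
  - rewrite integral_mkcond; apply: ge0_le_integral_lower => l _; rewrite patchE.
    case: ifPn => [/set_mem [/=]|_]; last by rewrite lexx f0.
    rewrite in_itv/= => /andP[l0 l1] /eqP l00.
    have lp : (0 < l)%R by rewrite lt_neqAle eq_sym l00.
    rewrite /arc_param -/(time_of dist 0 1 gam l) timeE//.
    have /andP[sg0 sg1] : (0 <= sg l <= 1)%R.
      by rewrite -timeE//; exact: (time_of_le dist_ge0 ler01 fin).
    rewrite /f patchE mem_set/= ?in_itv/= ?sg0 ?sg1// lexx andbT.
    by rewrite g0// sg0.
  - by rewrite lebesgue_measure_set1.
  - move=> l; rewrite in_itv/= => /andP[l0 l1]; apply: g0.
    exact: (time_of_le dist_ge0 ler01 fin).
have -> : \int[lebesgue_measure]_l f (sg l) =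
    \int[pushforward lebesgue_measure sgm]_t f t.
  by rewrite ge0_integral_pushforward// => t _.
have K0' : (0 <= K)%R by exact: ltW.
apply: (@le_trans _ _ (\int[mscale (NngNum K0') lebesgue_measure]_t f t)).
  apply: ge0_le_measure_integral => //.
rewrite ge0_integral_mscale//=.
by rewrite [X in _ <= _ * X]integral_mkcond.
Qed.

End edge_integral.

(** * Geometry of the hyperbolic filling and its uniformization *)

Section filling_geometry.
Context {R : realType} {Z : completeMetricType R}.
Variables (alpha tau : R) (S : int -> set Z).
Hypothesis alpha1 : (1 < alpha)%R.
Hypothesis tau3 : (3 < tau)%R.
Hypothesis hS : forall n : int, maximal_separated (alpha ^ (- n))%R (S n).

Local Open Scope ring_scope.
Local Notation V := (Z * int)%type.
Local Notation e n := (alpha ^ (- (n : int))).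
Implicit Types (v w u : V) (z : Z) (m n : int).
Local Notation vertices := (vertices S).
Local Notation adj := (adj alpha tau S).
Local Notation X := (fillingX alpha tau S).
Local Notation polyline := (polyline alpha tau S).
Local Notation graph_dist := (graph_dist alpha tau S).
Local Notation dist_rho := (dist_rho alpha tau S).
Local Notation rho := (rho alpha).

Lemma alpha_gt0 : 0 < alpha. Proof. exact: lt_trans alpha1. Qed.
Hint Resolve alpha_gt0 : core.

Lemma scale_gt0 n : 0 < e n. Proof. by rewrite exprz_gt0. Qed.
Hint Resolve scale_gt0 : core.

Lemma scale_ge0 n : 0 <= e n. Proof. exact: ltW. Qed.

Lemma scaleD m n : e (m + n) = e m * e n.
Proof. by rewrite opprD expfzDr// gt_eqF. Qed.

Lemma scaleS n : e (n + 1) = e n / alpha.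
Proof. by rewrite scaleD exprN1. Qed.

Lemma scale_pred n : e (n - 1) = alpha * e n.
Proof. by rewrite -[in RHS](subrK 1 n) scaleS mulrCA divff ?mulr1// gt_eqF. Qed.

Lemma scale_le m n : (e n <= e m) = (m <= n).
Proof. by rewrite ler_eXz2l// lerN2. Qed.

Lemma scale_lt m n : (e n < e m) = (m < n).
Proof. by rewrite ltr_eXz2l// ltrN2. Qed.

Lemma scale_powR n : e n = alpha `^ (- n%:~R).
Proof. by rewrite -mulrNz powR_intmul// ltW. Qed.

(** Otherwise [z] could be added to the maximal separated set [S n]. *)
Lemma exists_near n z : exists s, S n s /\ mdist s z < e n.
Proof.
have [sepS maxS] := hS n; apply: contrapT => noS.
have far s : S n s -> e n <= mdist s z.
  by move=> Ss; rewrite leNgt; apply/negP => sz; apply: noS; exists s.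
have SzS : S n `|` [set z] = S n.
  apply: maxS; last by move=> s Ss; left.
  move=> x y [Sx|->] [Sy|->] xy; first exact: sepS.
  - exact: far.
  - by rewrite metric_sym; exact: far.
  - by rewrite eqxx in xy.
have Sz : S n z by rewrite -SzS; right.
by have := far _ Sz; rewrite mdistxx leNgt scale_gt0.
Qed.

Definition near_pt n z : Z := projT1 (cid (exists_near n z)).

Lemma near_ptS n z : S n (near_pt n z).
Proof. by rewrite /near_pt; case: cid => s []. Qed.

Lemma near_pt_dist n z : mdist (near_pt n z) z < e n.
Proof. by rewrite /near_pt; case: cid => s []. Qed.

Lemma near_pt_id n z : S n z -> near_pt n z = z.
Proof.
move=> Sz; apply/eqP; apply/negPn/negP => zz.
have := (hS n).1 _ _ (near_ptS n z) Sz zz.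
by rewrite leNgt near_pt_dist.
Qed.

Definition near_vtx z n : V := (near_pt n z, n).

Lemma near_vtxV z n : vertices (near_vtx z n).
Proof. exact: near_ptS. Qed.

Lemma adj_sym v w : adj v w -> adj w v.
Proof.
move=> [v1 w1 vw h B]; split => //.
- by rewrite eq_sym.
- by rewrite distrC.
- by case: B => z [Bv Bw]; exists z.
Qed.

Lemma adj_neq v w : adj v w -> v != w. Proof. by case. Qed.

Lemma adj_level v w : adj v w -> (v.2 - 1 <= w.2)%R /\ (w.2 <= v.2 + 1)%R.
Proof. by case=> _ _ _ + _; rewrite ler_norml => /andP[h1 h2]; split; lra. Qed.

Lemma adj_scale v w : adj v w -> e w.2 <= alpha * e v.2.
Proof. by move=> /adj_level[h _]; rewrite -scale_pred scale_le. Qed.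

Lemma tau_gt0 : 0 < tau. Proof. by apply: lt_trans tau3. Qed.

Lemma adj_dist v w : adj v w -> mdist v.1 w.1 < tau * (1 + alpha) * e v.2.
Proof.
move=> vw; case: (vw) => _ _ _ _ [z []]; rewrite /vball !ballEmdist/= => vz wz.
rewrite (le_lt_trans (metric_triangle _ z _))// (metric_sym z).
rewrite -mulrA mulrDl mul1r mulrDr (lt_le_trans (ltrD vz wz))// lerD2l.
by rewrite ler_pM2l ?tau_gt0// adj_scale.
Qed.

Lemma adjP v w z : vertices v -> vertices w -> `|v.2 - w.2| <= 1 -> v != w ->
  mdist v.1 z < tau * e v.2 -> mdist w.1 z < tau * e w.2 -> adj v w.
Proof.
move=> vv vw h n vz wz; split => //; exists z.
by rewrite /vball !ballEmdist.
Qed.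

(** The threshold 3 for [tau] comes from here: the net point of [z'] is within [e n + 2 e n] of [z],
    so both vertex balls contain [z]. *)
Lemma near_vtx_same z z' n : mdist z z' < 2 * e n ->
  near_vtx z n = near_vtx z' n \/ adj (near_vtx z n) (near_vtx z' n).
Proof.
move=> zz'; have [->|n0] := eqVneq (near_vtx z n) (near_vtx z' n); first by left.
right; apply: (adjP (z := z)) => //; rewrite /= ?subrr ?normr0//.
- exact: near_vtxV.
- exact: near_vtxV.
- by rewrite (lt_trans (near_pt_dist _ _))// ltr_pMl// (lt_trans _ tau3)// ltr1n.
- rewrite (le_lt_trans (metric_triangle _ z' _))//.
  rewrite (@lt_trans _ _ (e n + 2 * e n))//.
    by rewrite ltrD// ?near_pt_dist// metric_sym.
  by rewrite -{1}[e n]mul1r -mulrDl ltr_pM2r//; apply: le_lt_trans tau3; lra.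
Qed.

Lemma near_vtx_succ z n : adj (near_vtx z n) (near_vtx z (n + 1)).
Proof.
apply: (adjP (z := z)) => /=.
- exact: near_vtxV.
- exact: near_vtxV.
- by rewrite opprD addrA subrr add0r normrN normr1.
- by apply/eqP => -[_] /eqP; rewrite -subr_eq0 opprD addrA subrr add0r oppr_eq0.
- by rewrite (lt_trans (near_pt_dist _ _))// ltr_pMl// (lt_trans _ tau3)// ltr1n.
- by rewrite (lt_trans (near_pt_dist _ _))// ltr_pMl// (lt_trans _ tau3)// ltr1n.
Qed.

Lemma exists_adj v : vertices v -> exists w, adj v w.
Proof.
move=> Vv; exists (near_vtx v.1 (v.2 + 1)).
have := near_vtx_succ v.1 v.2; rewrite {1}/near_vtx near_pt_id//.
Qed.

Lemma edge_ptl v w (t : R) : v != w -> edge_pt v w t v = 1 - t.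
Proof. by move=> vw; rewrite /edge_pt eqxx (negbTE vw) mulr1 mulr0 addr0. Qed.

Lemma edge_ptr v w (t : R) : v != w -> edge_pt v w t w = t.
Proof. by move=> vw; rewrite /edge_pt eqxx eq_sym (negbTE vw) mulr1 mulr0 add0r. Qed.

Lemma edge_ptn v w (t : R) u : u != v -> u != w -> edge_pt v w t u = 0.
Proof. by move=> /negbTE uv /negbTE uw; rewrite /edge_pt uv uw !mulr0 addr0. Qed.

Lemma edge_ptC v w (t : R) : edge_pt w v t = edge_pt v w (1 - t) :> (V -> R).
Proof. by apply/funext => x; rewrite /edge_pt subKr addrC. Qed.

Lemma edge_pt0 v w : edge_pt v w 0 = vertex_pt v :> (V -> R).
Proof. by apply/funext => x; rewrite /vertex_pt /edge_pt !mul0r !addr0. Qed.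

Lemma edge_pt1 v w : edge_pt v w 1 = vertex_pt w :> (V -> R).
Proof. by rewrite edge_ptC subrr edge_pt0. Qed.

(** The extension of a vertex function that is affine on every unit edge, read off from barycentric
    coordinates; [height] is the case where [f] is the level. *)
Definition interpol (f : V -> R) (x : V -> R) : R :=
  \sum_(v \in [set: V]) x v * f v.

Lemma interpol_edge f v w t : v != w ->
  interpol f (edge_pt v w t) = (1 - t) * f v + t * f w.
Proof.
move=> vw; rewrite /interpol (@fsbigE _ _ _ _ _ [:: v; w])//=; last 2 first.
- by rewrite inE vw.
- move=> u _; rewrite !inE negb_or => /andP[uv uw].
  by rewrite edge_ptn// mul0r.
by rewrite !big_cons big_nil !in_setT edge_ptl// edge_ptr// addr0.
Qed.

Lemma interpol_vertex f v : interpol f (vertex_pt v) = f v.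
Proof.
rewrite /interpol (@fsbigE _ _ _ _ _ [:: v])//=; last first.
  move=> u _; rewrite inE => uv; rewrite /vertex_pt /edge_pt (negbTE uv).
  by rewrite !mulr0 addr0 mul0r.
rewrite big_cons big_nil in_setT /vertex_pt /edge_pt eqxx.
by rewrite /= subr0 mul0r !addr0 !mul1r.
Qed.

Lemma height_edge v w (t : R) : v != w ->
  height (edge_pt v w t) = (1 - t) * v.2%:~R + t * w.2%:~R.
Proof. exact: (interpol_edge (fun v => v.2%:~R)). Qed.

Lemma height_vertex v : height (vertex_pt v) = v.2%:~R :> R.
Proof. exact: (interpol_vertex (fun v => v.2%:~R)). Qed.

Lemma adj_levelR v w : adj v w -> (`|v.2%:~R - w.2%:~R| <= 1 :> R).
Proof. by case=> _ _ _ h _; rewrite -intrB -intr_norm -[1]/(1%:~R) ler_int. Qed.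

Lemma height_edge_lip v w (s t : R) : adj v w ->
  `|height (edge_pt v w s) - height (edge_pt v w t)| <= `|s - t|.
Proof.
move=> vw; rewrite !height_edge ?(adj_neq vw)//.
have -> : (1 - s) * v.2%:~R + s * w.2%:~R - ((1 - t) * v.2%:~R + t * w.2%:~R) =
  (t - s) * (v.2%:~R - w.2%:~R) :> R by ring.
by rewrite normrM distrC ler_piMr// adj_levelR.
Qed.

Lemma height_edge_bound v w (t : R) : adj v w -> t \in `[0, 1] ->
  v.2%:~R - 1 <= height (edge_pt v w t) <= v.2%:~R + 1.
Proof.
move=> vw; rewrite in_itv/= => /andP[t0 t1].
have := @height_edge_lip v w 0 t vw.
rewrite edge_pt0 height_vertex sub0r normrN (ger0_norm t0) => h.
have := le_trans h t1; rewrite ler_norml => /andP[h1 h2].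
by apply/andP; split; lra.
Qed.

Lemma fillingX_edge v w (t : R) : adj v w -> t \in `[0, 1] -> X (edge_pt v w t).
Proof. by move=> vw t01; right; exists v, w, t. Qed.

Lemma fillingX_vertex v : vertices v -> X (vertex_pt v).
Proof. by left; exists v. Qed.

Lemma fillingXE x : X x ->
  exists v w t, [/\ adj v w, t \in `[0, 1] & x = edge_pt v w t].
Proof.
case=> // -[v Vv ->]; have [w vw] := exists_adj Vv.
by exists v, w, 0; split => //; rewrite ?edge_pt0// in_itv/= lexx ler01.
Qed.

(** With [v] the nearer end of the edge, the coordinate of [x] at [v] is at least [1/2], the lower
    bound on which the estimates near the boundary rest. *)
Lemma fillingXE2 x : X x ->
  exists v w t, [/\ adj v w, t \in `[0, 2^-1] & x = edge_pt v w t].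
Proof.
move=> /fillingXE[v [w [t [vw + ->]]]]; rewrite in_itv/= => /andP[t0 t1].
have [th|ht] := leP t 2^-1.
  by exists v, w, t; split => //; rewrite in_itv/= t0.
exists w, v, (1 - t); split; [exact: adj_sym| |by rewrite (edge_ptC v w) subKr].
by rewrite in_itv/=; apply/andP; split; lra.
Qed.

Lemma polyline_ge0 x y l : polyline x y l -> 0 <= l.
Proof. by elim=> // *; rewrite addr_ge0. Qed.

Lemma polyline_trans (x y z : V -> R) (l m : R) : polyline x y l -> polyline y z m ->
  polyline x z (l + m).
Proof.
move=> xy; elim: xy z m => [{}x _|v w s t {}y {}l vw s01 t01 _ ih] z m yz.
  by rewrite add0r.
by rewrite -addrA; apply: polyline_cons => //; exact: ih.
Qed.

Lemma polyline_edge v w (s t : R) : adj v w -> s \in `[0, 1] -> t \in `[0, 1] ->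
  polyline (edge_pt v w s) (edge_pt v w t) `|s - t|.
Proof.
move=> vw s01 t01; rewrite -[`|_|]addr0; apply: polyline_cons => //.
by apply: polyline_nil; exact: fillingX_edge.
Qed.

Lemma polyline_sym x y l : polyline x y l -> polyline y x l.
Proof.
elim=> [{}x Xx|v w s t {}y {}l vw s01 t01 _ ih]; first exact: polyline_nil.
by rewrite addrC; apply: (polyline_trans ih); rewrite distrC; exact: polyline_edge.
Qed.

Lemma polyline_height x y l : polyline x y l -> `|height x - height y| <= l.
Proof.
elim=> [{}x _|v w s t {}y {}l vw s01 t01 _ ih]; first by rewrite subrr normr0.
rewrite -(subrK (height (edge_pt v w t)) (height (edge_pt v w s))) -addrA.
by rewrite (le_trans (ler_normD _ _))// lerD// height_edge_lip.
Qed.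

Lemma graph_dist_ge0 x y : (0 <= graph_dist x y)%E.
Proof.
by apply: le_ereal_inf_tmp => _ [l xy <-]; rewrite lee_fin (polyline_ge0 xy).
Qed.

Lemma graph_dist_le x y l : polyline x y l -> (graph_dist x y <= l%:E)%E.
Proof. by move=> xy; apply: ereal_inf_lbound; exists l. Qed.

Lemma graph_dist_xx x : X x -> graph_dist x x = 0%E.
Proof.
move=> Xx; apply/eqP; rewrite eq_le graph_dist_ge0 andbT.
by apply: graph_dist_le; exact: polyline_nil.
Qed.

Lemma graph_dist_sym x y : graph_dist x y = graph_dist y x.
Proof.
by congr ereal_inf; apply/seteqP; split => _ [l xy <-]; exists l => //;
  exact: polyline_sym.
Qed.

Lemma graph_dist_height x y : (`|height x - height y|%:E <= graph_dist x y)%E.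
Proof.
by apply: le_ereal_inf_tmp => _ [l xy <-]; rewrite lee_fin polyline_height.
Qed.

Lemma graph_dist_ltP x y r : (graph_dist x y < r%:E)%E ->
  exists2 l, polyline x y l & l < r.
Proof.
move=> /ereal_inf_lt [_ [l xy <-]]; rewrite lte_fin => lr.
by exists l.
Qed.

(** * Lower bounds for the uniformized distance by test functions *)

Section test_function.
Variables (F : (V -> R) -> R) (K : R).
Hypothesis K0 : 0 < K.
Hypothesis F_lip : forall v w s t, adj v w -> s \in `[0, 1] -> t \in `[0, 1] ->
  `|F (edge_pt v w s) - F (edge_pt v w t)| <= K * e v.2 * `|s - t|.

(** Along a polyline of length [l] the height drops by at most [l], so it stays above [c], and an
    edge met there starts at a vertex of scale at most [alpha^(1 - c)]. *)
Lemma polyline_test x y l c : polyline x y l -> c <= height x - l ->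
  `|F x - F y| <= K * alpha `^ (1 - c) * l.
Proof.
elim=> [{}x _ _|v w s t {}y {}l vw s01 t01 yl ih hc].
  by rewrite subrr normr0 mulr0.
rewrite -(subrK (F (edge_pt v w t)) (F (edge_pt v w s))) -addrA.
have l0 := polyline_ge0 yl.
rewrite (le_trans (ler_normD _ _))// mulrDr lerD//.
  rewrite (le_trans (F_lip vw s01 t01))// ler_wpM2r// ler_pM2l//.
  rewrite scale_powR ler_powR ?(ltW alpha1)//.
  have /andP[_ h2] := height_edge_bound vw s01.
  have := normr_ge0 (s - t); lra.
apply: ih; have := @height_edge_lip v w s t vw; rewrite ler_norml => /andP[h1 h2].
by lra.
Qed.

(** Polylines of length at most 1 stay above the height [height x - 1], so [alpha^2 rho x] bounds
    the scales of their edges. Longer polylines cannot improve the infimum. *)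
Lemma graph_dist_test x y : (graph_dist x y < 1)%E ->
  ((`|F x - F y|)%:E <= (K * alpha ^+ 2 * rho x)%:E * graph_dist x y)%E.
Proof.
move=> xy1.
have C0 : 0 < K * alpha ^+ 2 * rho x by rewrite !mulr_gt0 ?exprn_gt0 ?powR_gt0.
have H l : polyline x y l -> l <= 1 -> `|F x - F y| <= K * alpha ^+ 2 * rho x * l.
  move=> xy l1; have := @polyline_test x y l (height x - 1) xy.
  rewrite lerD2l lerN2 => /(_ l1); rewrite opprB addrA powRD; last first.
    by rewrite (gt_eqF alpha_gt0) implybT.
  by rewrite -[1 + 1]/(2%:R) powR_mulrn ?(ltW alpha_gt0)// mulrA.
rewrite -lee_pdivrMl//; apply: le_ereal_inf_tmp => _ [l xy <-].
rewrite -EFinM lee_fin ler_pdivrMl//.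
have [l1|/ltW l1] := leP l 1; first exact: H.
have [m xym m1] := graph_dist_ltP xy1.
by rewrite (le_trans (H _ xym (ltW m1)))// ler_pM2l// (le_trans (ltW m1)).
Qed.


(** The estimate is additive along a curve, so by [real_induction] it is enough to prove it on short
    pieces. There [rho] is at least [rho (gam t) / alpha], and the local estimate in the graph
    metric loses only this extra factor [alpha]. *)
Lemma dist_rho_test x y : X x -> X y ->
  ((`|F x - F y|)%:E <= (K * alpha ^+ 3)%:E * dist_rho x y)%E.
Proof.
move=> Xx Xy; have C0 : 0 < K * alpha ^+ 3 by rewrite mulr_gt0 ?exprn_gt0.
rewrite -lee_pdivrMl//.
apply: le_ereal_inf_tmp => _ [a [b [gam [[ab gX gcont glen] ga gb ->]]]].
rewrite lee_pdivrMl//.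
have gXt t : a <= t <= b -> X (gam t).
  by move=> t01; apply: gX; exists t.
have rho0 t : (0 <= (EFin \o rho) (gam t))%E by rewrite lee_fin powR_ge0.
pose I := sub_integral graph_dist a b gam (EFin \o rho).
have ID := sub_integralD graph_dist_ge0 glen (fun t _ => rho0 t).
have I0 := sub_integral_ge0 graph_dist_ge0 glen (fun t _ => rho0 t).
have Ige := sub_integral_ge graph_dist_ge0 glen (fun t _ => rho0 t).
suff : ((`|F (gam a) - F (gam b)|)%:E <= (K * alpha ^+ 3)%:E * I a b)%E.
  rewrite ga gb => /le_trans; apply; rewrite lee_pmul2l ?lte_fin//.
  exact: (sub_integral_le graph_dist_ge0 ab glen (fun t _ => rho0 t)).
pose P (s t : R) : Prop := ((`|F (gam s) - F (gam t)|)%:E <= (K * alpha ^+ 3)%:E * I s t)%E.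
rewrite -/(P a b); apply: (real_induction ab).
- rewrite /P.
  move=> s t u as_ st tu ub h1 h2.
  apply: (@le_trans _ _ ((K * alpha ^+ 3)%:E * (I s t + I t u))%E); last first.
    by rewrite lee_pmul2l ?lte_fin//; exact: ID.
  rewrite ge0_muleDr; [|apply: I0 => //|apply: I0 => //]; last 2 first.
  + by rewrite (le_trans tu).
  + by rewrite (le_trans as_).
  apply: le_trans (leeD h1 h2); rewrite -EFinD lee_fin.
  by rewrite -{1}(subrK (F (gam t)) (F (gam s))) -addrA ler_normD.
- rewrite /P.
  move=> t tab; have half : (0 : R) < 2^-1 by rewrite invr_gt0.
  have tI : t \in `[a, b] by rewrite in_itv.
  have /nbhs_ballP [d d0 dH] := gcont t tI _ half.
  have near r : a <= r <= b -> `|r - t| < d ->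
      (graph_dist (gam t) (gam r) < 2^-1%:E)%E.
    by move=> rab rt; apply: dH; rewrite ?in_itv//= /ball/= distrC.
  (* A lower bound for [rho] near [gam t]: within graph distance [1/2] the height changes by less
     than 1. *)
  pose c := rho (gam t) / alpha.
  have c0 : 0 <= c by rewrite divr_ge0 ?powR_ge0 ?(ltW alpha_gt0).
  have cE : K * alpha ^+ 3 * c = K * alpha ^+ 2 * rho (gam t).
    by rewrite /c exprS; field; rewrite gt_eqF.
  have crho r : a <= r <= b -> `|r - t| < d -> (c%:E <= (EFin \o rho) (gam r))%E.
    move=> rab rt; have := near r rab rt => h.
    have := le_lt_trans (graph_dist_height _ _) h.
    rewrite lte_fin ltr_norml => /andP[h1 h2].
    rewrite lee_fin /c /rho -{2}(powRr1 (ltW alpha_gt0)) -powRB; last first.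
      by rewrite (gt_eqF alpha_gt0) implybT.
    by rewrite ler_powR ?(ltW alpha1)//; lra.
  have upper r : a <= r <= b -> `|r - t| < d ->
      ((`|F (gam t) - F (gam r)|)%:E <=
       (K * alpha ^+ 3)%:E * (c%:E * graph_dist (gam t) (gam r)))%E.
    move=> rab rt; rewrite muleA -EFinM cE; apply: graph_dist_test.
    by apply: lt_trans (near r rab rt) _; rewrite lte_fin; lra.
  exists d => // s sab std; case/andP: (tab) => at_ tb; case/andP: (sab) => as_ sb.
  have pos : (0 < (K * alpha ^+ 3)%:E)%E by rewrite lte_fin.
  split=> [st|ts].
  + rewrite distrC (le_trans (upper s sab std))// lee_pmul2l// graph_dist_sym.
    apply: Ige => //; first exact/graph_dist_xx/gXt.
    move=> r /andP[sr rt]; apply: crho; first by rewrite (le_trans as_) ?(le_trans rt).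
    rewrite (le_lt_trans _ std)// !(distrC _ t) !ger0_norm ?subr_ge0//.
    by rewrite lerD2l lerN2.
  + rewrite (le_trans (upper s sab std))// lee_pmul2l//.
    apply: Ige => //; first exact/graph_dist_xx/gXt.
    move=> r /andP[tr rs]; apply: crho; first by rewrite (le_trans at_) ?(le_trans rs).
    by rewrite (le_lt_trans _ std)// !ger0_norm ?subr_ge0// lerD2r.
Qed.

End test_function.


Lemma dist_rho_edge v w (s t : R) : adj v w -> 0 <= s -> s <= t -> t <= 1 ->
  (dist_rho (edge_pt v w s) (edge_pt v w t) <= (alpha * e v.2 * (t - s))%:E)%E.
Proof.
move=> vw s0 st t1.
pose gam := edge_pt v w : R -> V -> R.
have in01 r : s <= r <= t -> r \in `[0, 1].
  by move=> /andP[sr rt]; rewrite in_itv/= (le_trans s0 sr) (le_trans rt).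
have glip r q : s <= r -> r <= q -> q <= t ->
    (graph_dist (gam r) (gam q) <= (1 * (q - r))%:E)%E.
  move=> sr rq qt; rewrite mul1r -[X in (_ <= X%:E)%E]ger0_norm ?subr_ge0// distrC.
  apply: graph_dist_le; apply: polyline_edge => //; apply: in01.
    by rewrite sr (le_trans rq).
  by rewrite qt (le_trans sr).
have glen := curve_length_lip st glip.
have glen' : (curve_length graph_dist s t gam < +oo)%E.
  by rewrite (le_lt_trans glen)// ltry.
apply: (@le_trans _ _ (line_integral graph_dist s t gam (EFin \o rho))).
  apply: ereal_inf_lbound; exists s, t, gam; split => //; split => //.
    by move=> _ [r /= + <-]; rewrite in_itv/= => /in01; exact: fillingX_edge.
  move=> r rst d d0; exists d => //= q /= rq; rewrite in_itv/= => qst.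
  have rst' : s <= r <= t by move: rst; rewrite in_itv.
  apply: (@le_lt_trans _ _ (`|r - q|)%:E); last by rewrite lte_fin.
  by apply: graph_dist_le; apply: polyline_edge => //; exact: in01.
pose c := alpha * e v.2.
have c0 : 0 <= c by rewrite mulr_ge0// ltW.
have h : (line_integral graph_dist s t gam (EFin \o rho) <=
    \int[lebesgue_measure]_(l in `[0%R, fine (curve_length graph_dist s t gam)])
    (cst c%:E) l)%E.
  apply: ge0_le_integral_lower => l /=; rewrite in_itv/= => /andP[l0 l1].
  have lst := time_of_le graph_dist_ge0 st glen' l1.
  rewrite lee_fin powR_ge0/= lee_fin /c -scale_pred scale_powR /rho.
  rewrite ler_powR ?(ltW alpha1)// lerN2 intrB.
  by have /andP[] := height_edge_bound vw (in01 _ lst).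
apply: (le_trans h).
have len0 : 0 <= fine (curve_length graph_dist s t gam).
  by rewrite fine_ge0// curve_length_ge0//; exact: graph_dist_ge0.
rewrite integral_cst//= lebesgue_measure_itv/= lte_fin.
have lenle : fine (curve_length graph_dist s t gam) <= t - s.
  rewrite -lee_fin fineK; first by rewrite -[t - s]mul1r.
  by rewrite ge0_fin_numE// curve_length_ge0//; exact: graph_dist_ge0.
case: ltP => _; last by rewrite mule0 lee_fin mulr_ge0 ?subr_ge0.
by rewrite -EFinB subr0 -EFinM lee_fin ler_wpM2l.
Qed.

Lemma exists_scale (r : R) : 0 < r -> exists n : int, e (n + 1) <= r < e n.
Proof.
move=> r0; pose L := ln alpha; have L0 : 0 < L by rewrite ln_gt0.
pose x := - ln r / L.
exists (Num.ceil x - 1); rewrite subrK !scale_powR.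
have -> : r = alpha `^ (- x).
  rewrite /x -mulNr opprK /powR gt_eqF// -/L divfK ?gt_eqF// lnK//.
have /andP[h1 h2] := ceil_itv x.
apply/andP; split; first by rewrite ler_powR ?(ltW alpha1)// lerN2.
by rewrite /powR (gt_eqF alpha_gt0) ltr_expR ltr_pM2r// ltrN2.
Qed.

End filling_geometry.

(** * Metric estimates in the uniformized filling *)

Section uniformization_geometry.
Context {R : realType} {Z : completeMetricType R}.
Variables (alpha tau : R) (S : int -> set Z).
Hypothesis alpha1 : (1 < alpha)%R.
Hypothesis tau3 : (3 < tau)%R.
Hypothesis hS : forall n : int, maximal_separated (alpha ^ (- n))%R (S n).
Context {Xbar : completeMetricType R} (iota : (Z * int -> R) -> Xbar).
Hypothesis hiota : is_completion alpha tau S iota.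

Local Open Scope ring_scope.
Local Notation V := (Z * int)%type.
Local Notation e n := (alpha ^ (- (n : int))).
Implicit Types (v w u : V) (z : Z) (m n : int).
Local Notation vertices := (vertices S).
Local Notation adj := (adj alpha tau S).
Local Notation X := (fillingX alpha tau S).
Local Notation vtx := (near_vtx alpha1 hS).
Local Notation d x y := (mdist (iota x) (iota y)).

Let alpha0 : 0 < alpha := alpha_gt0 alpha1.
Hint Resolve alpha0 : core.
Let e0 n : 0 < e n := scale_gt0 alpha1 n.
Hint Resolve e0 : core.

Lemma iota_test (F : (V -> R) -> R) (K : R) : 0 < K ->
  (forall v w s t, adj v w -> s \in `[0, 1] -> t \in `[0, 1] ->
    `|F (edge_pt v w s) - F (edge_pt v w t)| <= K * e v.2 * `|s - t|) ->
  forall x y, X x -> X y -> `|F x - F y| <= K * alpha ^+ 3 * d x y.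
Proof.
move=> K0 HF x y Xx Xy; have := dist_rho_test alpha1 K0 HF Xx Xy.
by rewrite -hiota.1.
Qed.

Lemma iota_edge v w (s t : R) : adj v w -> s \in `[0, 1] -> t \in `[0, 1] ->
  d (edge_pt v w s) (edge_pt v w t) <= alpha * e v.2 * `|s - t|.
Proof.
move=> vw; wlog st : s t / s <= t.
  move=> H s01 t01; have [/H|/ltW/H] := leP s t; first exact.
  by rewrite metric_sym distrC; exact.
move=> s01 t01; rewrite distrC ger0_norm ?subr_ge0// -lee_fin.
rewrite hiota.1; [|exact: fillingX_edge|exact: fillingX_edge].
move: s01 t01; rewrite !in_itv/= => /andP[s0 _] /andP[_ t1].
exact: dist_rho_edge.
Qed.

Lemma iota_edge_vertex v w (t : R) : adj v w -> t \in `[0, 1] ->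
  d (edge_pt v w t) (vertex_pt v) <= alpha * e v.2.
Proof.
move=> vw t01; rewrite -(edge_pt0 v w).
have z01 : (0 : R) \in `[0, 1] by rewrite in_itv/= lexx ler01.
rewrite (le_trans (iota_edge vw t01 z01))// subr0 ler_piMr//.
  by rewrite mulr_ge0// ltW.
by move: t01; rewrite in_itv/= => /andP[t0 t1]; rewrite ger0_norm.
Qed.

Lemma iota_adj v w : adj v w -> d (vertex_pt v) (vertex_pt w) <= alpha * e v.2.
Proof.
move=> vw; rewrite metric_sym -(edge_pt1 v w); apply: iota_edge_vertex => //.
by rewrite in_itv/= lexx ler01.
Qed.

(** The test function is the barycentric coordinate at [u], which varies only on the edges at [u];
    neighbouring scales differ by a factor [alpha] at most. This yields the injectivity of [iota]
    and, later, the description of the boundary. *)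
Lemma iota_coord u x y : X x -> X y ->
  `|x u - y u| <= alpha ^+ 4 / e u.2 * d x y.
Proof.
move=> Xx Xy; have K0 : 0 < alpha / e u.2 by rewrite divr_gt0.
have -> : alpha ^+ 4 / e u.2 = alpha / e u.2 * alpha ^+ 3.
  by rewrite [RHS]mulrAC [in LHS]exprS.
apply: (iota_test (F := fun x => x u) K0) => // v w s t vw s01 t01.
have vw' := adj_neq vw.
have st0 : 0 <= `|s - t| by [].
have [->|uv] := eqVneq u v.
  rewrite !edge_ptl// divfK ?gt_eqF//.
  have -> : 1 - s - (1 - t) = t - s by ring.
  by rewrite distrC ler_peMl// ltW.
have [->|uw] := eqVneq u w.
  rewrite !edge_ptr// ler_peMl//.
  rewrite mulrAC ler_pdivlMr// mul1r.
  exact: (adj_scale alpha1 vw).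
by rewrite !edge_ptn// subrr normr0 !mulr_ge0// ?invr_ge0 ltW.
Qed.

Lemma iota_interpol (f : V -> R) (K : R) : 0 < K ->
  (forall v w, adj v w -> `|f v - f w| <= K * e v.2) ->
  forall x y, X x -> X y ->
    `|interpol f x - interpol f y| <= K * alpha ^+ 3 * d x y.
Proof.
move=> K0 Hf; apply: iota_test => // v w s t vw s01 t01.
have vw' := adj_neq vw; rewrite !interpol_edge//.
have -> : (1 - s) * f v + s * f w - ((1 - t) * f v + t * f w) =
  (t - s) * (f v - f w) by ring.
by rewrite normrM mulrC (distrC t) ler_wpM2r// Hf.
Qed.

(** Interpolated scale: comparable to [e v.2] on each edge at [v], and Lipschitz, so that it bounds
    the distance to boundary points from below. *)
Definition depth : (V -> R) -> R := interpol (fun v => e v.2).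

Lemma depth_lip x y : X x -> X y -> `|depth x - depth y| <= alpha ^+ 4 * d x y.
Proof.
move=> Xx Xy; rewrite [alpha ^+ 4]exprS; apply: iota_interpol => // v w vw.
rewrite ler_norml; apply/andP; split.
  rewrite lerNl opprB (@le_trans _ _ (e w.2))//; first by rewrite gerBl ltW.
  exact: (adj_scale alpha1 vw).
rewrite (@le_trans _ _ (e v.2))//; first by rewrite gerBl ltW.
by rewrite ler_peMl// ltW.
Qed.

Lemma depth_edge v w (t : R) : adj v w -> t \in `[0, 1] ->
  e v.2 / alpha <= depth (edge_pt v w t) <= alpha * e v.2.
Proof.
move=> vw; rewrite in_itv/= => /andP[t0 t1].
have h1 := adj_scale alpha1 vw; have h2 := adj_scale alpha1 (adj_sym vw).
rewrite /depth interpol_edge ?(adj_neq vw)//.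
have h3 : e v.2 / alpha <= e w.2 by rewrite ler_pdivrMr// mulrC.
have h4 : e v.2 / alpha <= e v.2 by rewrite ler_pdivrMr// ler_peMr// ltW.
have h5 : e v.2 <= alpha * e v.2 by rewrite ler_peMl// ltW.
by apply/andP; split; nra.
Qed.

Lemma depth_vertex v : depth (vertex_pt v) = e v.2.
Proof. exact: interpol_vertex. Qed.

(** Adjacent vertices have projections at distance [O(e v.2)], which makes the distance of the
    projection to a fixed [z] an admissible test function. *)
Lemma iota_proj z x y : X x -> X y ->
  `|interpol (fun v => mdist v.1 z) x - interpol (fun v => mdist v.1 z) y|
  <= tau * (1 + alpha) * alpha ^+ 3 * d x y.
Proof.
have t0 := tau_gt0 tau3.
apply: iota_interpol; first by rewrite mulr_gt0// addr_gt0.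
move=> v w vw; rewrite (@le_trans _ _ (mdist v.1 w.1))//; last first.
  by apply: ltW; exact: (adj_dist alpha1 tau3 vw).
rewrite ler_norml; apply/andP; split.
  by rewrite lerNl opprB lerBlDr (metric_sym v.1 w.1) metric_triangle.
by rewrite lerBlDr metric_triangle.
Qed.

Lemma iota_inj x y : X x -> X y -> iota x = iota y -> x = y.
Proof.
move=> Xx Xy xy; apply/funext => u; apply/eqP; rewrite -subr_eq0 -normr_le0.
by have := iota_coord u Xx Xy; rewrite xy mdistxx mulr0.
Qed.

(** The sum of [alpha * alpha^(-k)] over [k >= 0]: the length bound for an infinite vertical chain
    that starts at level 0. *)
Definition chainC : R := alpha ^+ 2 / (alpha - 1).

Lemma chainC_gt0 : 0 < chainC.
Proof. by rewrite divr_gt0 ?exprn_gt0// subr_gt0. Qed.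

(** The right side is telescoping: [chainC (e n - e (n + 1))] is exactly the bound [alpha e n] for
    one vertical edge, so the induction loses nothing. *)
Lemma iota_chain z n (k : nat) :
  d (vertex_pt (vtx z n)) (vertex_pt (vtx z (n + k%:Z))) <=
  chainC * (e n - e (n + k%:Z)).
Proof.
elim: k => [|k ih]; first by rewrite addr0 mdistxx subrr mulr0.
rewrite (le_trans (metric_triangle _ (iota (vertex_pt (vtx z (n + k%:Z)))) _))//.
have := iota_adj (near_vtx_succ alpha1 tau3 hS z (n + k%:Z)).
rewrite -addrA -PoszD addn1 => h.
rewrite (le_trans (lerD ih h))// -subr_ge0 le_eqVlt; apply/orP; left.
rewrite /= -addn1 PoszD addrA scaleS// /chainC eq_sym.
rewrite -subr_eq0; apply/eqP; field.
by rewrite !gt_eqF// subr_gt0.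
Qed.

Lemma iota_chain_le z n m : n <= m ->
  d (vertex_pt (vtx z n)) (vertex_pt (vtx z m)) <= chainC * e n.
Proof.
move=> nm; have -> : m = n + (absz (m - n))%:Z.
  by rewrite gez0_abs ?subr_ge0// addrCA subrr addr0.
rewrite (le_trans (iota_chain _ _ _))// ler_pM2l ?chainC_gt0//.
by rewrite gerBl ltW.
Qed.

End uniformization_geometry.

(** * The boundary of the uniformization and its identification with the base space *)

Section boundary_geometry.
Context {R : realType} {Z : completeMetricType R}.
Variables (alpha tau : R) (S : int -> set Z).
Hypothesis alpha1 : (1 < alpha)%R.
Hypothesis tau3 : (3 < tau)%R.
Hypothesis hS : forall n : int, maximal_separated (alpha ^ (- n))%R (S n).
Context {Xbar : completeMetricType R} (iota : (Z * int -> R) -> Xbar).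
Hypothesis hiota : is_completion alpha tau S iota.
Variable phi : Z -> Xbar.
Hypothesis hphi : boundary_map alpha S iota phi.

Local Open Scope ring_scope.
Local Notation V := (Z * int)%type.
Local Notation e n := (alpha ^ (- (n : int))).
Implicit Types (v w u : V) (z : Z) (m n : int).
Local Notation vertices := (vertices S).
Local Notation adj := (adj alpha tau S).
Local Notation X := (fillingX alpha tau S).
Local Notation Xrho := (Xrho alpha tau S iota).
Local Notation vtx := (near_vtx alpha1 hS).
Local Notation d x y := (mdist (iota x) (iota y)).
Local Notation chainC := (chainC alpha).

Let alpha0 : 0 < alpha := alpha_gt0 alpha1.
Hint Resolve alpha0 : core.
Let e0 n : 0 < e n := scale_gt0 alpha1 n.
Hint Resolve e0 : core.
Let tau0 : 0 < tau := tau_gt0 tau3.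
Hint Resolve tau0 : core.

Lemma exists_scale_nat (r : R) (N : nat) : 0 < r ->
  exists2 n : nat, (N <= n)%N & e n%:Z < r.
Proof.
move=> r0; have [n /andP[h1 _]] := exists_scale alpha1 (divr_gt0 r0 alpha0).
pose m := maxn N (absz (n + 1)).
exists m; first by rewrite leq_maxl.
apply: (@le_lt_trans _ _ (e (n + 1))).
  rewrite scale_le// (le_trans (ler_norm _))// -abszE lez_nat.
  by rewrite leq_maxr.
by rewrite (le_lt_trans h1)// ltr_pdivrMr// ltr_pMr.
Qed.

Lemma near_vtx_cvg z : iota (vertex_pt (vtx z n%:Z)) @[n --> \oo] --> phi z.
Proof.
have := @hphi z (fun n : nat => near_pt alpha1 hS n%:Z z); apply => n.
by split; [exact: near_ptS|exact: near_pt_dist].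
Qed.

Lemma phi_approx z (r : R) N : 0 < r -> exists2 n : nat, (N <= n)%N &
  mdist (iota (vertex_pt (vtx z n%:Z))) (phi z) < r.
Proof.
move=> r0; have := @near_vtx_cvg z.
move=> /metricType_numDomainType.cvgrPdist_lt/(_ _ r0) [M _ HM].
exists (maxn N M); first exact: leq_maxl.
by rewrite metric_sym; apply: HM => /=; exact: leq_maxr.
Qed.

Lemma vtx_phi z n : mdist (iota (vertex_pt (vtx z n))) (phi z) <= chainC * e n.
Proof.
apply/ler_addgt0Pr => r r0.
have [m nm h] := phi_approx z (absz n) r0.
rewrite (le_trans (metric_triangle _ (iota (vertex_pt (vtx z m%:Z))) _))//.
rewrite lerD ?(ltW h)//; apply: (iota_chain_le alpha1 tau3 hS hiota).
by rewrite (le_trans (ler_norm _))// -abszE lez_nat.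
Qed.

(** The McShane extension of [F], evaluated at the single point [y]. *)
Lemma lipschitz_ext (F : (V -> R) -> R) (L : R) : 0 <= L ->
  (forall x y, X x -> X y -> `|F x - F y| <= L * d x y) ->
  forall y : Xbar, exists a, forall x, X x -> `|F x - a| <= L * mdist (iota x) y.
Proof.
move=> L0 HF y; pose A := [set F x + L * mdist (iota x) y | x in X].
have lbA x : X x -> lbound A (F x - L * mdist (iota x) y).
  move=> Xx _ [x' Xx' <-]; have := HF _ _ Xx Xx'.
  rewrite ler_norml => /andP[_ h].
  have := metric_triangle (iota x) y (iota x') => tri.
  have := ler_wpM2l L0 tri; rewrite mulrDr (metric_sym y) => h2; lra.
have [x0 Xx0] : X !=set0.
  by exists (vertex_pt (vtx point 0)); apply: fillingX_vertex; exact: near_vtxV.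
exists (inf A) => x Xx; rewrite ler_norml; apply/andP; split.
  rewrite lerBrDl -lerBrDr opprK; apply: ge_inf; last by exists x.
  by exists (F x - L * mdist (iota x) y); exact: lbA.
rewrite lerBlDl -lerBlDr; apply: lb_le_inf; last exact: lbA.
by exists (F x + L * mdist (iota x) y); exists x.
Qed.

Lemma iota_dense (y : Xbar) (r : R) : 0 < r -> exists2 x, X x & mdist (iota x) y < r.
Proof.
move=> r0; have [y' [yx [x Xx xy]]] :=
  hiota.2 (ball y r) (ex_intro _ y (ballxx y r0)) (@open_mball _ _ y r).
by exists x => //; move: yx; rewrite -xy ballEmdist/= metric_sym.
Qed.

Lemma mdist_eq0_le (x y : Xbar) : (forall r, 0 < r -> mdist x y <= r) -> x = y.
Proof.
move=> H; apply: mdist_positivity; apply/eqP; rewrite eq_le mdist_ge0 andbT.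
by apply/ler_addgt0Pr => r r0; rewrite add0r H.
Qed.

Lemma X_coord_edge x v w : X x -> v != w -> 0 < x v -> 0 < x w ->
  adj v w /\ exists t, t \in `[0, 1] /\ x = edge_pt v w t.
Proof.
move=> /fillingXE -/(_ alpha1 tau3 hS) [v' [w' [t [vw' t01 ->]]]] vw xv xw.
have n' := adj_neq vw'.
have vin : v = v' \/ v = w'.
  have [|a] := eqVneq v v'; first by left.
  have [|b] := eqVneq v w'; first by right.
  by move: xv; rewrite edge_ptn// ltxx.
have win : w = v' \/ w = w'.
  have [|a] := eqVneq w v'; first by left.
  have [|b] := eqVneq w w'; first by right.
  by move: xw; rewrite edge_ptn// ltxx.
case: vin => ?; case: win => ?; subst v w; rewrite ?eqxx// in vw *.
- by split => //; exists t.
- split; first exact: adj_sym.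
  exists (1 - t); rewrite (edge_ptC v' w') subKr; split => //.
  by move: t01; rewrite !in_itv/= => /andP[t0 t1]; apply/andP; split; lra.
Qed.

(** Every coordinate extends continuously to [y]; the claim is that all extended values vanish off
    [Xrho]. If the value [a] at [v] is positive, points near [y] lie on edges through [v]. For
    [a = 1] they converge to [v] itself; for [a < 1] they eventually lie on one single edge, at
    parameters tending to [1 - a]. In both cases [y] is in [Xrho]. No local finiteness of the graph
    is involved. *)
Lemma iota_limit_coord (y : Xbar) : ~ Xrho y ->
  forall x v, X x -> `|x v| <= alpha ^+ 4 / e v.2 * mdist (iota x) y.
Proof.
move=> nXy x v Xx.
have C0 u : 0 < alpha ^+ 4 / e u.2 by rewrite divr_gt0 ?exprn_gt0.
have ext u := lipschitz_ext (ltW (C0 u))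
  (fun x y Xx Xy => iota_coord alpha1 hiota u Xx Xy) y.
have [a Ha] := ext v.
suff a0 : a = 0 by have := Ha _ Xx; rewrite a0 subr0.
apply: contrapT => /eqP an0; apply: nXy.
have coord0 x' u : X x' -> 0 <= x' u <= 1.
  move=> /fillingXE -/(_ alpha1 tau3 hS) [v' [w' [t [vw' + ->]]]].
  rewrite in_itv/= => /andP[t0 t1]; have n' := adj_neq vw'.
  have [->|uv] := eqVneq u v'; first by rewrite edge_ptl//; apply/andP; split; lra.
  have [->|uw] := eqVneq u w'; first by rewrite edge_ptr// t0.
  by rewrite edge_ptn// lexx ler01.
have aux (b : R) (c : R) u : 0 < c ->
    (forall x, X x -> `|x u - b| <= alpha ^+ 4 / e u.2 * mdist (iota x) y) ->
    exists2 r, 0 < r & forall x, X x -> mdist (iota x) y < r -> `|x u - b| < c.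
  move=> c0 Hb; exists (c / (alpha ^+ 4 / e u.2)); first by rewrite divr_gt0.
  move=> x' Xx' h; rewrite (le_lt_trans (Hb _ Xx'))// mulrC -ltr_pdivlMr//.
have a_ge0 : 0 <= a.
  rewrite leNgt; apply/negP => an; have [|r r0 Hr] := @aux a (- a) v _ Ha.
    by rewrite oppr_gt0.
  have [x' Xx' xy'] := iota_dense y r0.
  have := Hr _ Xx' xy'; rewrite ltr_norml => /andP[_].
  by have /andP[h _] := coord0 x' v Xx'; lra.
have a_gt0 : 0 < a by rewrite lt_neqAle eq_sym an0.
have a_le1 : a <= 1.
  rewrite leNgt; apply/negP => an; have [|r r0 Hr] := @aux a (a - 1) v _ Ha.
    by rewrite subr_gt0.
  have [x' Xx' xy'] := iota_dense y r0.
  have := Hr _ Xx' xy'; rewrite ltr_norml => /andP[+ _].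
  by have /andP[_ h] := coord0 x' v Xx'; lra.
have zero01 : (0 : R) \in `[0, 1] by rewrite in_itv/= lexx ler01.
have Vv : vertices v.
  have [r r0 Hr] := @aux a a v a_gt0 Ha.
  have [x' Xx' xy'] := iota_dense y r0.
  have := Hr _ Xx' xy'; rewrite ltr_norml => /andP[+ _].
  move: Xx' => /fillingXE -/(_ alpha1 tau3 hS) [v' [w' [t [vw' _ ->]]]].
  have [->|uv] := eqVneq v v'; first by case: vw'.
  have [->|uw] := eqVneq v w'; first by case: vw'.
  by rewrite edge_ptn//; lra.
have [a1|a1] := eqVneq a 1.
  exists (vertex_pt v); first exact: fillingX_vertex.
  apply: mdist_eq0_le => r r0.
  pose c := Num.min 1 (r / 2 / (alpha * e v.2)).
  have ae0 : 0 < alpha * e v.2 by rewrite mulr_gt0.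
  have c0 : 0 < c by rewrite lt_min ltr01 !divr_gt0.
  have [q q0 Hq] := @aux a c v c0 Ha.
  pose q' := Num.min q (r / 2).
  have q'0 : 0 < q' by rewrite lt_min q0 divr_gt0.
  have [x' Xx' xy'] := iota_dense y q'0.
  have xq : mdist (iota x') y < q by rewrite (lt_le_trans xy')// ge_min lexx.
  have xr : mdist (iota x') y < r / 2 by rewrite (lt_le_trans xy')// ge_min lexx orbT.
  have := Hq _ Xx' xq; rewrite a1 distrC.
  move: (Xx') => /fillingXE -/(_ alpha1 tau3 hS) [v' [w' [t [vw' t01 xE]]]] xc.
  have : exists w s, [/\ adj v w, s \in `[0, 1] & x' = edge_pt v w s].
    have xv0 : x' v != 0.
      apply/eqP => xv0; move: xc; rewrite xv0 subr0 normr1 => h.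
      by have := lt_le_trans h (_ : c <= 1); rewrite ge_min lexx ltxx => /(_ isT).
    have [vv|uv] := eqVneq v v'; first by exists w', t; rewrite vv.
    have [vv|uw] := eqVneq v w'.
      exists v', (1 - t); rewrite vv; split => //; first exact: adj_sym.
        by move: t01; rewrite !in_itv/= => /andP[t0 t1]; apply/andP; split; lra.
      by rewrite (edge_ptC v' w') subKr.
    by move: xv0; rewrite xE edge_ptn// eqxx.
  move=> [w [s [vw s01 xE']]].
  move: xc; rewrite xE' edge_ptl ?(adj_neq vw)// subKr => xc.
  rewrite (le_trans (metric_triangle _ (iota x') _))//.
  rewrite [r]splitr lerD ?(ltW xr)// metric_sym xE' -(edge_pt0 v w).
  rewrite (le_trans (iota_edge alpha1 hiota vw s01 zero01))// subr0 mulrC.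
  rewrite -ler_pdivlMr// ltW// (lt_le_trans xc)//.
  by rewrite ge_min lexx orbT.
have a_lt1 : a < 1 by rewrite lt_neqAle a1.
(* a nearby point determines the edge through [v] on which [y] lies *)
have [r1 r10 Hr1] := @aux a (Num.min a (1 - a) / 2) v
  ltac:(by rewrite divr_gt0// lt_min a_gt0 subr_gt0) Ha.
(* Since [e v.2 <= alpha e w.2], the constant [alpha^5 / e v.2] dominates the Lipschitz constant of
   the coordinate at any neighbour [w]. Within [r2] that coordinate moves by at most [(1 - a) / 4],
   hence stays positive up to [y]. *)
pose r2 := Num.min r1 ((1 - a) / 4 / (alpha ^+ 5 / e v.2)).
have r20 : 0 < r2 by rewrite lt_min r10 !divr_gt0 ?subr_gt0 ?exprn_gt0.
have [x1 Xx1 xy1] := iota_dense y r20.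
have : exists w s, [/\ adj v w, s \in `[0, 1] & x1 = edge_pt v w s].
  have x1v : 0 < x1 v.
    have := Hr1 _ Xx1 (lt_le_trans xy1 _); rewrite ge_min lexx => /(_ isT).
    rewrite ltr_norml => /andP[+ _].
    have : Num.min a (1 - a) <= a by rewrite ge_min lexx.
    by move: (Num.min _ _) => c; lra.
  move: (Xx1) => /fillingXE -/(_ alpha1 tau3 hS) [v' [w' [t [vw' t01 xE]]]].
  have [vv|uv] := eqVneq v v'; first by exists w', t; rewrite vv.
  have [vv|uw] := eqVneq v w'.
    exists v', (1 - t); rewrite vv; split => //; first exact: adj_sym.
      by move: t01; rewrite !in_itv/= => /andP[t0 t1]; apply/andP; split; lra.
    by rewrite (edge_ptC v' w') subKr.
  by move: x1v; rewrite xE edge_ptn// ltxx.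
move=> [w [s [vw s01 x1E]]].
have vw' := adj_neq vw.
have [b Hb] := ext w.
have b_gt : 0 < b.
  have h1 := Hr1 _ Xx1 (lt_le_trans xy1 _); move: h1.
  rewrite ge_min lexx => /(_ isT); rewrite x1E edge_ptl// ltr_norml => /andP[_].
  have : Num.min a (1 - a) <= 1 - a by rewrite ge_min lexx orbT.
  move: (Num.min _ _) => c c1 h1.
  have := Hb _ Xx1; rewrite {1}x1E edge_ptr// ler_norml => /andP[_ h2].
  have h3 : alpha ^+ 4 / e w.2 * mdist (iota x1) y <= (1 - a) / 4.
    have xy1' : mdist (iota x1) y <= (1 - a) / 4 / (alpha ^+ 5 / e v.2).
      by rewrite (le_trans (ltW xy1))// ge_min lexx orbT.
    rewrite ler_pdivlMr in xy1'; last by rewrite divr_gt0 ?exprn_gt0.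
    rewrite (le_trans _ xy1')// mulrC ler_wpM2l ?mdist_ge0//.
    rewrite ler_pdivrMr// mulrAC ler_pdivlMr//.
    have -> : alpha ^+ 5 * e w.2 = alpha ^+ 4 * (alpha * e w.2).
      by rewrite mulrA -exprSr.
    by rewrite ler_pM2l ?exprn_gt0// (adj_scale alpha1 (adj_sym vw)).
  by lra.
have [r3 r30 Hr3] := @aux a a v a_gt0 Ha.
have [r4 r40 Hr4] := @aux b b w b_gt Hb.
have sa01 : 1 - a \in `[0, 1] by rewrite in_itv/=; apply/andP; split; lra.
exists (edge_pt v w (1 - a)); first exact: fillingX_edge.
apply: mdist_eq0_le => r r0.
have ae0 : 0 < alpha * e v.2 by rewrite mulr_gt0.
have [r5 r50 Hr5] := @aux a (r / 2 / (alpha * e v.2)) v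
  ltac:(by rewrite !divr_gt0) Ha.
pose q := Num.min (Num.min r3 r4) (Num.min r5 (r / 2)).
have q0 : 0 < q by rewrite !lt_min r30 r40 r50 divr_gt0.
have [x' Xx' xy'] := iota_dense y q0.
move: xy'; rewrite !lt_min => /andP[/andP[h3 h4] /andP[h5 h6]].
have xv : 0 < x' v by have := Hr3 _ Xx' h3; rewrite ltr_norml => /andP[+ _]; lra.
have xw : 0 < x' w by have := Hr4 _ Xx' h4; rewrite ltr_norml => /andP[+ _]; lra.
have [_ [s' [s'01 xE]]] := X_coord_edge Xx' vw' xv xw.
have := Hr5 _ Xx' h5; rewrite {1}xE edge_ptl// => h7.
rewrite (le_trans (metric_triangle _ (iota x') _))//.
rewrite [r]splitr lerD ?(ltW h6)// metric_sym xE.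
rewrite (le_trans (iota_edge alpha1 hiota vw s'01 sa01))// mulrC.
rewrite -ler_pdivlMr// ltW// (le_lt_trans _ h7)//.
by rewrite distrC le_eqVlt; apply/orP; left; apply/eqP; congr `|_|; ring.
Qed.

(** The coordinate at [v] is at least [1/2] on this half of the edge and vanishes at [y]. *)
Lemma edge_depth_boundary (y : Xbar) v w (t : R) : ~ Xrho y -> adj v w ->
  t \in `[0, 2^-1] -> e v.2 <= 2 * alpha ^+ 4 * mdist (iota (edge_pt v w t)) y.
Proof.
move=> nXy vw; rewrite in_itv/= => /andP[t0 t1].
have Xe : X (edge_pt v w t).
  by apply: fillingX_edge => //; rewrite in_itv/= t0; lra.
have := iota_limit_coord nXy v Xe; rewrite edge_ptl ?(adj_neq vw)//.
rewrite ger0_norm; last by lra.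
rewrite mulrAC ler_pdivlMr// => h; rewrite -mulrA -ler_pdivrMl//.
by rewrite (le_trans _ h)// ler_pM2r//; lra.
Qed.

(** A point of [Xrho] has coordinate at least [1/2] at its nearer vertex [v], whereas the vertices
    of the chain over [z] soon lie at levels beyond that of [v] and have coordinate 0 there. *)
Lemma phi_notin z : ~ Xrho (phi z).
Proof.
move=> [x /fillingXE2 -/(_ alpha1 tau3 hS) [v [w [t [vw + ->]]]] xz].
rewrite in_itv/= => /andP[t0 t1].
have Xe : X (edge_pt v w t).
  by apply: fillingX_edge => //; rewrite in_itv/= t0; lra.
have r0 : 0 < e v.2 / (2 * alpha ^+ 4) by rewrite divr_gt0// mulr_gt0 ?exprn_gt0.
have [n nv h] := phi_approx z (absz (v.2 + 1)) r0.
have Xn : X (vertex_pt (vtx z n%:Z)).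
  by apply: fillingX_vertex; exact: near_vtxV.
have := iota_coord alpha1 hiota v Xe Xn.
rewrite edge_ptl ?(adj_neq vw)// xz metric_sym.
have -> : vertex_pt (vtx z n%:Z) v = 0.
  have vn : v != vtx z n%:Z.
    apply/eqP => vE; have v2 : v.2 = n%:Z by rewrite vE.
    by move: nv; rewrite v2 -PoszD absz_nat addn1 ltnn.
  by rewrite /vertex_pt edge_ptn.
rewrite subr0 ger0_norm; last by lra.
rewrite leNgt => /negP; apply.
rewrite mulrC; rewrite ltr_pdivlMr ?mulr_gt0 ?exprn_gt0// in h.
rewrite mulrA ltr_pdivrMr// (lt_le_trans _ (_ : 2^-1 * e v.2 <= _))//; last first.
  by rewrite ler_pM2r//; lra.
by move: h; move: (mdist _ _) (alpha ^+ 4) => a b; lra.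
Qed.

(** A Lipschitz function that converges along the chain over [z] extends to [phi z] with the limit
    as its value. *)
Lemma limit_test (F : (V -> R) -> R) (L b : R) z : 0 <= L ->
  (forall x y, X x -> X y -> `|F x - F y| <= L * d x y) ->
  (forall r, 0 < r -> exists N : nat, forall n : nat, (N <= n)%N ->
    `|F (vertex_pt (vtx z n%:Z)) - b| <= r) ->
  forall x, X x -> `|F x - b| <= L * mdist (iota x) (phi z).
Proof.
move=> L0 HF Hb x Xx; apply/ler_addgt0Pr => r r0.
have r20 : 0 < r / 2 / (L + 1) by rewrite !divr_gt0// ltr_wpDl.
have [N HN] := Hb (r / 2) ltac:(by rewrite divr_gt0).
have [n Nn h] := phi_approx z N r20.
set y := vertex_pt (vtx z n%:Z) in h.
have Xy : X y by apply: fillingX_vertex; exact: near_vtxV.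
rewrite -(subrK (F y) (F x)) -addrA (le_trans (ler_normD _ _))//.
rewrite [in leRHS](splitr r) addrA lerD ?HN//.
rewrite (le_trans (HF _ _ Xx Xy))//.
have := ler_wpM2l L0 (metric_triangle (iota x) (phi z) (iota y)).
move=> /le_trans; apply; rewrite mulrDr lerD2l metric_sym.
rewrite ltr_pdivlMr ?ltr_wpDl// in h; rewrite (le_trans _ (ltW h))// mulrC.
by rewrite ler_wpM2l ?mdist_ge0// lerDl.
Qed.

Lemma scale_eventually (r : R) : 0 < r -> exists N : nat, forall n : nat, (N <= n)%N ->
  e n%:Z <= r.
Proof.
move=> r0; have [N _ h] := exists_scale_nat 0 r0; exists N => n Nn.
by rewrite (le_trans _ (ltW h))// scale_le// lez_nat.
Qed.

Lemma depth_phi x z : X x -> depth alpha x <= alpha ^+ 4 * mdist (iota x) (phi z).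
Proof.
move=> Xx.
have := @limit_test (depth alpha) (alpha ^+ 4) 0 z _ _ _ x Xx.
rewrite subr0 => h; apply: (le_trans (ler_norm _)); apply: h.
- by rewrite exprn_ge0// ltW.
- exact: depth_lip.
- move=> r r0; have [N HN] := scale_eventually r0; exists N => n Nn.
  by rewrite subr0 depth_vertex ger0_norm ?HN// ltW.
Qed.

Definition projC : R := tau * (1 + alpha) * alpha ^+ 3.

Lemma projC_gt0 : 0 < projC.
Proof. by rewrite !mulr_gt0 ?exprn_gt0 ?addr_gt0. Qed.

Lemma proj_phi x z z' : X x ->
  `|interpol (fun v => mdist v.1 z') x - mdist z z'| <= projC * mdist (iota x) (phi z).
Proof.
move=> Xx; apply: limit_test => //; first exact/ltW/projC_gt0.
- by move=> x1 x2; exact: iota_proj.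
- move=> r r0; have [N HN] := scale_eventually r0; exists N => n Nn.
  rewrite interpol_vertex (le_trans _ (HN _ Nn))// ltW//.
  have := near_pt_dist alpha1 hS n%:Z z; apply: le_lt_trans.
  rewrite ler_norml; apply/andP; split.
    by rewrite lerNl opprB lerBlDr (metric_sym _ z) metric_triangle.
  by rewrite lerBlDr metric_triangle.
Qed.

Lemma mdist_phi_ge z z' : mdist z z' <= projC * mdist (phi z) (phi z').
Proof.
apply/ler_addgt0Pr => r r0.
have c0 : 0 < r / 2 / projC by rewrite !divr_gt0// projC_gt0.
have r20 : 0 < r / 2 by rewrite divr_gt0.
have [N HN] := scale_eventually r20.
have [n Nn h] := phi_approx z' N c0.
have Xn : X (vertex_pt (vtx z' n%:Z)).
  by apply: fillingX_vertex; exact: near_vtxV.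
have := proj_phi z z' Xn; rewrite interpol_vertex => h1.
have h2 := near_pt_dist alpha1 hS n%:Z z'.
have h3 := HN n Nn.
have := ler_norm (mdist z z' - mdist (vtx z' n%:Z).1 z'); rewrite distrC => h4.
have := ler_wpM2l (ltW projC_gt0) (metric_triangle (iota (vertex_pt (vtx z' n%:Z))) (phi z') (phi z)).
rewrite mulrDr (metric_sym (phi z')) => h5.
rewrite ltr_pdivlMr ?projC_gt0// mulrC in h.
have : (vtx z' n%:Z).1 = near_pt alpha1 hS n%:Z z' by [].
move: h h1 h2 h3 h4 h5; move: (mdist (iota _) _) => q1.
move: (projC * q1) => q2.
lra.
Qed.

(** At the scale of [mdist z z'] the chains over [z] and [z'] pass through equal or adjacent
    vertices; the path follows one chain up to this level, crosses over, and descends along the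
    other. *)
Lemma mdist_phi_le z z' : mdist (phi z) (phi z') <=
  (2 * chainC + alpha) * alpha * mdist z z'.
Proof.
have [->|zz] := eqVneq z z'; first by rewrite !mdistxx mulr0.
have zz0 : 0 < mdist z z' by rewrite mdist_gt0.
have [n /andP[h1 h2]] := exists_scale alpha1 zz0.
have h3 : e n <= alpha * mdist z z'.
  by rewrite -(ler_pM2l (_ : 0 < alpha^-1)) ?invr_gt0// mulKf ?gt_eqF// mulrC -scaleS.
have h : d (vertex_pt (vtx z n)) (vertex_pt (vtx z' n)) <= alpha * e n.
  have [->|/(iota_adj alpha1 hiota)//] : vtx z n = vtx z' n \/ adj (vtx z n) (vtx z' n).
    by apply: near_vtx_same => //; rewrite (lt_le_trans h2)// ler_peMl ?ler1n// ltW.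
  by rewrite mdistxx mulr_ge0// ltW.
rewrite (le_trans (metric_triangle _ (iota (vertex_pt (vtx z n))) _))//.
have h4 := metric_triangle (iota (vertex_pt (vtx z n))) (iota (vertex_pt (vtx z' n))) (phi z').
have h5 := vtx_phi z n; rewrite metric_sym in h5.
have h6 := vtx_phi z' n.
apply: (@le_trans _ _ ((2 * chainC + alpha) * e n)).
  rewrite mulrDl -mulrA mulr_natl mulr2n -addrA [X in _ <= _ + X]addrC lerD//.
  by rewrite (le_trans h4)// lerD.
rewrite -mulrA ler_pM2l// addr_gt0// mulr_gt0//; exact: chainC_gt0.
Qed.

(** Points of the graph tending to [y] lie near vertices [v k] of scale tending to 0, whose
    projections form a Cauchy sequence. Completeness of [Z] provides the limit [z], and [v k] is
    joined to the chain over [z] at a level of comparable scale. *)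
Lemma boundary_phi (y : Xbar) : ~ Xrho y -> exists z, y = phi z.
Proof.
move=> nXy; pose c := 1 + 2 * alpha ^+ 5.
have c0 : 0 < c by rewrite addr_gt0// mulr_gt0 ?exprn_gt0.
have ex (k : nat) : exists v, [/\ vertices v, e v.2 <= 2 * alpha ^+ 4 * e k%:Z &
    mdist (iota (vertex_pt v)) y <= c * e k%:Z].
  have [x + xy] := iota_dense y (e0 k%:Z).
  move=> /fillingXE2 -/(_ alpha1 tau3 hS) [v [w [t [vw t01 xE]]]].
  rewrite xE in xy; have h := edge_depth_boundary nXy vw t01.
  have h1 : e v.2 <= 2 * alpha ^+ 4 * e k%:Z.
    by rewrite (le_trans h)// ler_pM2l ?(ltW xy)// mulr_gt0 ?exprn_gt0.
  exists v; split => //; first by case: vw.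
  have t01' : t \in `[0, 1].
    by move: t01; rewrite !in_itv/= => /andP[-> ?]; lra.
  have h2 := iota_edge_vertex alpha1 hiota vw t01'; rewrite metric_sym in h2.
  apply: (le_trans (metric_triangle _ (iota (edge_pt v w t)) _)).
  apply: (le_trans (lerD h2 (ltW xy))).
  rewrite mulrDl mul1r addrC lerD2l.
  have -> : 2 * alpha ^+ 5 * e k%:Z = alpha * (2 * alpha ^+ 4 * e k%:Z).
    by rewrite [alpha ^+ 5]exprS; ring.
  by rewrite ler_pM2l.
have [v hv] := choice ex.
pose ze k := (v k).1.
have vE k : v k = vtx (ze k) (v k).2.
  have [Vv _ _] := hv k; rewrite /near_vtx near_pt_id//.
  by rewrite /ze; case: (v k).
have Xv k : X (vertex_pt (v k)).
  by apply: fillingX_vertex; case: (hv k).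
have zz k l : mdist (ze k) (ze l) <= projC * (c * (e k%:Z + e l%:Z)).
  have := iota_proj alpha1 tau3 hiota (ze l) (Xv k) (Xv l).
  rewrite !interpol_vertex mdistxx subr0 ger0_norm ?mdist_ge0// => h.
  rewrite (le_trans h)// ler_pM2l ?projC_gt0//.
  rewrite (le_trans (metric_triangle _ y _))// mulrDr lerD//.
    by case: (hv k).
  by rewrite metric_sym; case: (hv l).
have zz2 k l : (k <= l)%N -> mdist (ze k) (ze l) <= projC * c * 2 * e k%:Z.
  move=> kl; rewrite (le_trans (zz k l))//.
  have -> : projC * c * 2 * e k%:Z = projC * (c * (e k%:Z + e k%:Z)) by ring.
  by rewrite ler_pM2l ?projC_gt0// ler_pM2l// lerD2l scale_le// lez_nat.
have pc0 : 0 < projC * c by apply: mulr_gt0 => //; exact: projC_gt0.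
have K0 : 0 < projC * c * 2 by apply: mulr_gt0.
have cau : cauchy (ze @ \oo).
  apply: cauchy_exP => r r0.
  have [N _ HN] := exists_scale_nat 0 (divr_gt0 r0 K0).
  exists (ze N); exists N => // l /= Nl; rewrite ballEmdist/=.
  by rewrite (le_lt_trans (zz2 _ _ Nl))// mulrC -ltr_pdivlMr.
pose z := lim (ze @ \oo).
have zez : ze @ \oo --> z by exact: (@cauchy_cvg _ (ze @ \oo) _ cau).
have zd k : mdist (ze k) z <= projC * c * 2 * e k%:Z.
  apply/ler_addgt0Pr => r r0.
  have /metricType_numDomainType.cvgrPdist_lt/(_ _ r0) [M _ HM] := zez.
  have h := HM (maxn k M) (leq_maxr _ _).
  rewrite (le_trans (metric_triangle _ (ze (maxn k M)) _))// lerD//.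
    by apply: zz2; exact: leq_maxl.
  by rewrite metric_sym ltW.
(* The constant [B] fixes a level [m] of scale just above [B e k]. This places [m] no higher than
   the level of [v k] and [ze k] within [2 e m] of [z], so that the two chains can be connected at
   level [m]. *)
exists z; pose B := 2 * alpha ^+ 4 + projC * c.
have B0 : 0 < B by rewrite addr_gt0// mulr_gt0 ?exprn_gt0.
pose M := c + (2 * chainC + alpha) * alpha * B.
have C0 : 0 < 2 * chainC + alpha by rewrite addr_gt0// mulr_gt0// chainC_gt0.
have M0 : 0 < M by rewrite addr_gt0// !mulr_gt0.
apply: mdist_eq0_le => r r0.
have [k _ hk] := exists_scale_nat 0 (divr_gt0 r0 M0).
have [Vv hv1 hv2] := hv k.
have [m /andP[m1 m2]] := exists_scale alpha1 (mulr_gt0 B0 (e0 k%:Z)).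
have em : e m <= alpha * B * e k%:Z.
  rewrite -(ler_pM2l (_ : 0 < alpha^-1)) ?invr_gt0// -mulrA mulKf ?gt_eqF//.
  by rewrite mulrC -scaleS.
have mv : m <= (v k).2.
  rewrite -(scale_le alpha1) (le_trans hv1)// ltW// (le_lt_trans _ m2)//.
  by rewrite ler_pM2r// lerDl ltW.
have zm : mdist (ze k) z < 2 * e m.
  rewrite (le_lt_trans (zd k))// mulrAC mulrC ltr_pM2l// (le_lt_trans _ m2)//.
  by rewrite ler_pM2r// lerDr mulr_ge0 ?exprn_ge0// ltW.
have h1 : d (vertex_pt (v k)) (vertex_pt (vtx (ze k) m)) <= chainC * e m.
  have hc := iota_chain_le alpha1 tau3 hS hiota (ze k) mv.
  by rewrite metric_sym; move: hc; rewrite -vE.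
have h2 : d (vertex_pt (vtx (ze k) m)) (vertex_pt (vtx z m)) <= alpha * e m.
  have [->|/(iota_adj alpha1 hiota)//] : vtx (ze k) m = vtx z m \/
      adj (vtx (ze k) m) (vtx z m) by exact: near_vtx_same.
  by rewrite mdistxx mulr_ge0// ltW.
have h3 := vtx_phi z m.
have t1 := metric_triangle y (iota (vertex_pt (v k))) (phi z).
have t2 := metric_triangle (iota (vertex_pt (v k))) (iota (vertex_pt (vtx (ze k) m))) (phi z).
have t3 := metric_triangle (iota (vertex_pt (vtx (ze k) m))) (iota (vertex_pt (vtx z m))) (phi z).
rewrite metric_sym in hv2.
apply: (@le_trans _ _ (M * e k%:Z)); last by rewrite mulrC -ler_pdivlMr// ltW.
apply: (@le_trans _ _ (c * e k%:Z + (2 * chainC + alpha) * e m)).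
  have -> : (2 * chainC + alpha) * e m = chainC * e m + (alpha * e m + chainC * e m).
    by ring.
  rewrite (le_trans t1)// lerD// (le_trans t2)// lerD// (le_trans t3)// lerD//.
have -> : M * e k%:Z = c * e k%:Z + (2 * chainC + alpha) * (alpha * B * e k%:Z).
  by rewrite /M; ring.
by rewrite lerD2l ler_pM2l.
Qed.

End boundary_geometry.

(** * Doubling measures *)

Lemma measurable_mball {R : realType} (T : pmetricType R) (x : T) (r : R) :
  measurable (ball x r : set (borel T)).
Proof. by apply: sub_sigma_algebra; exact: open_mball. Qed.

Section doubling_spaces.
Context {R : realType} {Z : completeMetricType R}.
Variable nu : {measure set (borel Z) -> \bar R}.
Hypotheses (hnu : metric_measure nu) (hdoubling : doubling nu).

Local Open Scope ring_scope.

Definition vol (x : Z) (r : R) : R := fine (nu (ball x r)).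

Lemma vol_fin x r : 0 < r -> nu (ball x r) = (vol x r)%:E.
Proof.
move=> r0; have /andP[h1 h2] := hnu x r0.
by rewrite /vol fineK// ge0_fin_numE// ltW.
Qed.

Lemma vol_gt0 x r : 0 < r -> 0 < vol x r.
Proof. by move=> r0; rewrite -lte_fin -vol_fin//; have /andP[] := hnu x r0. Qed.

Lemma vol_ge0 x r : 0 <= vol x r.
Proof. exact: fine_ge0. Qed.

Lemma vol_le x y r s : 0 < r -> 0 < s -> ball x r `<=` ball y s -> vol x r <= vol y s.
Proof.
move=> r0 s0 xy; rewrite -lee_fin -!vol_fin//.
by apply: le_measure => //; rewrite inE; exact: measurable_mball.
Qed.

Lemma ball_sub (x y : Z) r s : mdist x y + r <= s -> ball x r `<=` ball y s.
Proof.
move=> h z; rewrite !ballEmdist/= => xz.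
rewrite (le_lt_trans (metric_triangle _ x _))// (lt_le_trans _ h)//.
by rewrite metric_sym ltrD2l.
Qed.

Lemma doubling_const : exists2 C : R, 1 <= C & forall x r, 0 < r ->
  vol x (2 * r) <= C * vol x r.
Proof.
have [C HC] := hdoubling; exists (Num.max 1 C); first by rewrite le_max lexx.
move=> x r r0; have := HC x r r0; rewrite !vol_fin ?mulr_gt0// -EFinM lee_fin.
move=> /le_trans; apply; rewrite ler_pM2r ?vol_gt0//.
by rewrite le_max lexx orbT.
Qed.

Lemma doubling_factor (k : R) : exists2 C : R, 0 < C & forall x r, 0 < r ->
  vol x (k * r) <= C * vol x r.
Proof.
have [C C1 HC] := doubling_const.
have C0 : 0 < C by apply: lt_le_trans C1.
have pow n x r : 0 < r -> vol x (2 ^+ n * r) <= C ^+ n * vol x r.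
  move=> r0; elim: n => [|n ih]; first by rewrite !mul1r.
  rewrite !exprS -!mulrA (le_trans (HC _ _ _)) ?mulr_gt0 ?exprn_gt0//.
  by rewrite ler_pM2l.
pose n := Num.bound k; exists (C ^+ n); first by rewrite exprn_gt0.
move=> x r r0; have [k0|k0] := leP k 0.
  rewrite (_ : vol x _ = 0) ?mulr_ge0 ?exprn_ge0 ?(ltW C0) ?vol_ge0//.
  rewrite /vol (_ : ball _ _ = set0) ?measure0//; apply/seteqP; split => // z.
  rewrite ballEmdist/= ltNge (le_trans _ (mdist_ge0 _ _))//.
  by rewrite mulr_le0_ge0// ltW.
apply: le_trans (pow n x r r0); apply: vol_le; rewrite ?mulr_gt0 ?exprn_gt0//.
apply: ball_sub; rewrite mdistxx add0r ler_pM2r// ltW//.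
rewrite (lt_trans (archi_boundP (ltW k0)))//.
by rewrite -natrX ltr_nat ltn_expl.
Qed.

Lemma vol_compare (a b : R) : 0 < a + b -> 0 < b -> exists2 C : R, 0 < C &
  forall x y r, 0 < r -> mdist x y <= a * r -> vol x (b * r) <= C * vol y r.
Proof.
move=> ab b0; have [C C0 HC] := doubling_factor (a + b); exists C => // x y r r0 xy.
apply: le_trans (HC y r r0); apply: vol_le; rewrite ?mulr_gt0//.
by apply: ball_sub; rewrite mulrDl lerD2r.
Qed.

Section packing.
Variables (alpha : R) (S : int -> set Z).
Hypothesis alpha1 : 1 < alpha.
Hypothesis hS : forall n : int, maximal_separated (alpha ^ (- n)) (S n).
Local Notation e n := (alpha ^ (- (n : int))).
Let alpha0 : 0 < alpha := alpha_gt0 alpha1.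
Hint Resolve alpha0 : core.
Let e0 n : 0 < e n := scale_gt0 alpha1 n.
Hint Resolve e0 : core.

(** The balls of radius [e n / 2] around net points are disjoint, lie in one ball of comparable
    radius around [x], and have comparable volume by doubling. *)
Lemma packing (k : R) : 0 < k -> exists2 C : R, 0 < C & forall n x,
  (\esum_(z in S n `&` ball x (k * e n)) 1 <= C%:E)%E.
Proof.
move=> k0.
have [||C C0 HC] := @vol_compare (2 * k) (2 * (k + 1)).
- by rewrite addr_gt0 ?mulr_gt0 ?addr_gt0.
- by rewrite mulr_gt0 ?addr_gt0.
exists C => // n x; apply: ge_ereal_sup => _ [F [finF FS] <-].
have h0 : 0 < e n / 2 by rewrite divr_gt0.
pose V := vol x ((k + 1) * e n).
have V0 : 0 < V by rewrite vol_gt0// mulr_gt0// addr_gt0.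
have disj : trivIset F (fun z => ball z (e n / 2)).
  move=> z w Fz Fw [p []]; rewrite !ballEmdist/= => zp wp.
  apply/eqP; apply/negPn/negP => zw.
  have [Sz _] := FS _ Fz; have [Sw _] := FS _ Fw.
  have := (hS n).1 _ _ Sz Sw zw; rewrite leNgt => /negP; apply.
  rewrite (le_lt_trans (metric_triangle _ p _))// [e n]splitr.
  by rewrite ltrD// metric_sym.
have mea z : measurable (ball z (e n / 2) : set (borel Z)) by exact: measurable_mball.
have : (\sum_(z \in F) nu (ball z (e n / 2)) <= V%:E)%E.
  have <- : nu (\bigcup_(z in F) ball z (e n / 2)) =
      (\sum_(z \in F) nu (ball z (e n / 2)))%E.
    by apply: measure_fin_bigcup => // z _; exact: mea.
  rewrite /V -vol_fin; last by rewrite mulr_gt0// addr_gt0.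
  apply: le_measure; rewrite ?inE.
  - by apply: fin_bigcup_measurable => // z _; exact: mea.
  - exact: measurable_mball.
  move=> y [z /FS[_ xz]]; apply: ball_sub.
  move: xz; rewrite ballEmdist/= metric_sym => xz.
  have := e0 n; rewrite mulrDl mul1r => ?; lra.
have low : (\sum_(z \in F) (V / C)%:E <= \sum_(z \in F) nu (ball z (e n / 2)))%E.
  apply: lee_fsum => // z /FS[_ xz]; rewrite vol_fin// lee_fin ler_pdivrMr//.
  rewrite mulrC /V.
  have -> : (k + 1) * e n = 2 * (k + 1) * (e n / 2) by field.
  apply: HC => //; have -> : 2 * k * (e n / 2) = k * e n by field.
  by move: xz; rewrite ballEmdist/= => /ltW.
move=> /(le_trans low).
have -> : (\sum_(z \in F) (V / C)%:E = (V / C)%:E * \sum_(z \in F) (1 : R)%:E)%E.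
  by rewrite ge0_mule_fsumr//; apply: eq_fsbigr => z _; rewrite mule1.
rewrite -lee_pdivlMl ?divr_gt0// => /le_trans; apply.
by rewrite -EFinM lee_fin invf_div divfK// gt_eqF.
Qed.

Lemma packing_finite (k : R) n x : finite_set (S n `&` ball x (k * e n)).
Proof.
have [k0|k0] := leP k 0.
  rewrite (_ : _ `&` _ = set0)//; apply/seteqP; split => // z [_].
  rewrite ballEmdist/= ltNge (le_trans _ (mdist_ge0 _ _))//.
  by rewrite mulr_le0_ge0// ltW.
have [C C0 /(_ n x) HC] := packing k0.
apply: contrapT => inf.
have [B BA cB] := infinite_set_fset (Num.bound C) inf.
have : ((Num.bound C)%:R%:E <= C%:E :> \bar R)%E.
  apply: le_trans HC; apply: esum_ge; exists [set` finmap.enum_fset B].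
    by split => //; exact: finite_seq.
  rewrite -fsbig_seq ?finmap.fset_uniq// big_const_seq count_predT.
  have iterE k' : iter k' (fun x : \bar R => 1 + x)%E 0%E = k'%:R%:E.
    by elim: k' => //= k' ->; rewrite -EFinD -natr1 addrC.
  by rewrite iterE lee_fin ler_nat.
by rewrite lee_fin leNgt archi_boundP// ltW.
Qed.

Lemma net_countable n : countable (S n).
Proof.
have -> : S n = \bigcup_(k in [set: nat]) (S n `&` ball point (k%:R * e n)).
  apply/seteqP; split => [z Sz|z [k _ []]//].
  exists (Num.bound (mdist point z / e n)) => //; split => //.
  rewrite ballEmdist/= -ltr_pdivrMr//.
  by rewrite archi_boundP// divr_ge0 ?mdist_ge0 ?(ltW (e0 _)).
apply: bigcup_countable => // k _; apply: finite_set_countable.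
exact: packing_finite.
Qed.

Lemma vertices_countable : countable (vertices S).
Proof.
have -> : vertices S = \bigcup_(n in [set: int]) ((fun z => (z, n)) @` S n).
  apply/seteqP; split => [[z n] Sz|_ [n _ [z Sz <-]]//].
  by exists n => //; exists z.
apply: bigcup_countable => // n _; exact: card_le_trans (card_image_le _ _) (net_countable n).
Qed.

End packing.

End doubling_spaces.

(** * Geometric sums over integer levels *)

Section int_series.
Context {R : realType}.
Local Open Scope ring_scope.

Lemma esum_int_ge (k : int) (f : int -> \bar R) : (forall n, 0 <= f n)%E ->
  (\esum_(n in [set n : int | (k <= n)%R]) f n =
   \sum_(0 <= i <oo) f (k + i%:Z)%R)%E.
Proof.
move=> f0; rewrite nneseries_esumT//.
rewrite (@reindex_esum _ _ _ [set: nat] _ (fun i : nat => k + i%:Z)%R)//.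
split.
- by move=> i _ /=; rewrite lerDl.
- by move=> i j _ _ /addrI [].
- move=> n /= kn; exists (absz (n - k)) => //.
  by rewrite gez0_abs ?subr_ge0// addrCA subrr addr0.
Qed.

Lemma esum_int_le (k : int) (f : int -> \bar R) : (forall n, 0 <= f n)%E ->
  (\esum_(n in [set n : int | (n <= k)%R]) f n =
   \sum_(0 <= i <oo) f (k - i%:Z)%R)%E.
Proof.
move=> f0; rewrite nneseries_esumT//.
rewrite (@reindex_esum _ _ _ [set: nat] _ (fun i : nat => k - i%:Z)%R)//.
split.
- by move=> i _ /=; rewrite gerBl.
- by move=> i j _ _ /addrI /oppr_inj [].
- move=> n /= kn; exists (absz (k - n)) => //.
  by rewrite gez0_abs ?subr_ge0// opprB addrC subrK.
Qed.

Lemma nneseries_geometric_le (c q : R) : 0 <= c -> 0 < q < 1 ->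
  (\sum_(0 <= i <oo) (c * q ^+ i)%:E <= (c * (1 - q)^-1)%:E)%E.
Proof.
move=> c0 q01; have /andP[q0 q1] := q01.
apply: lime_le.
  by apply: is_cvg_nneseries => n _ _; rewrite lee_fin mulr_ge0// exprn_ge0// ltW.
apply: nearW => n; rewrite sumEFin lee_fin -mulr_sumr ler_wpM2l//.
exact: sum_geometric_le.
Qed.

Variable alpha : R.
Hypothesis alpha1 : 1 < alpha.
Local Notation e n := (alpha ^ (- (n : int))).

Lemma powR_scaleD (s : R) (k : int) (i : nat) :
  e (k + i%:Z) `^ s = e k `^ s * (alpha `^ (- s)) ^+ i.
Proof.
have a0 := alpha_gt0 alpha1.
rewrite (scaleD alpha1) powRM ?scale_ge0//; congr (_ * _).
rewrite -(powR_mulrn i (powR_ge0 alpha (- s))) (scale_powR alpha1 i%:Z).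
rewrite -(powRrM alpha (- (i%:Z)%:~R) s) -(powRrM alpha (- s) i%:R).
by congr (_ `^ _); rewrite !mulNr mulrC.
Qed.

Lemma geometric_scale_ge (s : R) : 0 < s -> exists2 C : R, 0 < C & forall k : int,
  (\esum_(n in [set n : int | (k <= n)%R]) (e n `^ s)%:E <= (C * e k `^ s)%:E)%E.
Proof.
move=> s0; have a0 := alpha_gt0 alpha1.
pose q := alpha `^ (- s).
have q0 : 0 < q by rewrite powR_gt0.
have q1 : q < 1.
  by rewrite /q powRN invf_lt1 ?powR_gt0// -(powRr0 alpha) /powR gt_eqF// ltr_expR ltr_pM2r ?ln_gt0.
exists (1 - q)^-1; first by rewrite invr_gt0 subr_gt0.
move=> k; rewrite esum_int_ge; last by move=> n; rewrite lee_fin powR_ge0.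
under eq_eseriesr do rewrite powR_scaleD.
rewrite mulrC; apply: nneseries_geometric_le; first exact: powR_ge0.
by rewrite q0.
Qed.

Lemma geometric_scale_le (s : R) : 0 < s -> exists2 C : R, 0 < C & forall k : int,
  (\esum_(n in [set n : int | (n <= k)%R]) (e n `^ (- s))%:E
   <= (C * e k `^ (- s))%:E)%E.
Proof.
move=> s0; have a0 := alpha_gt0 alpha1.
pose q := alpha `^ (- s).
have q0 : 0 < q by rewrite powR_gt0.
have q1 : q < 1.
  by rewrite /q powRN invf_lt1 ?powR_gt0// -(powRr0 alpha) /powR gt_eqF// ltr_expR ltr_pM2r ?ln_gt0.
exists (1 - q)^-1; first by rewrite invr_gt0 subr_gt0.
move=> k; rewrite esum_int_le; last by move=> n; rewrite lee_fin powR_ge0.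
have E (i : nat) : e (k - i%:Z) `^ (- s) = e k `^ (- s) * q ^+ i.
  rewrite -[in RHS](subrK i%:Z k) powR_scaleD -mulrA -exprMn opprK.
  by rewrite -powRD ?subrr ?powRr0 ?expr1n ?mulr1// (gt_eqF a0) implybT.
under eq_eseriesr do rewrite E.
rewrite mulrC; apply: nneseries_geometric_le; first exact: powR_ge0.
by rewrite q0.
Qed.

End int_series.

(** * Sums over vertices of integrals over their balls *)

Section level_sums.
Context {R : realType} {Z : completeMetricType R}.
Variable nu : {measure set (borel Z) -> \bar R}.
Hypotheses (hnu : metric_measure nu) (hdoubling : doubling nu).
Variables (alpha : R) (S : int -> set Z).
Hypothesis alpha1 : (1 < alpha)%R.
Hypothesis hS : forall n : int, maximal_separated (alpha ^ (- n))%R (S n).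
Local Notation V := (Z * int)%type.
Local Notation e n := (alpha ^ (- (n : int)))%R.
Local Notation vertices := (vertices S).
Let alpha0 : (0 < alpha)%R := alpha_gt0 alpha1.
Hint Resolve alpha0 : core.
Let e0 n : (0 < e n)%R := scale_gt0 alpha1 n.
Hint Resolve e0 : core.

Lemma esum_vertices (D : set V) (f : V -> \bar R) : (forall v, 0 <= f v) ->
  D `<=` vertices ->
  \esum_(v in D) f v =
  \esum_(n in [set: int]) \esum_(z in [set z | D (z, n)]) f (z, n).
Proof.
move=> f0 DV; rewrite esum_esum//.
rewrite (@reindex_esum _ _ _ ([set: int] `*`` (fun n => [set z | D (z, n)])) _
  (fun p => (p.2, p.1)))//.
split.
- by move=> [n z] [_ /=].
- by move=> [n z] [n' z'] _ _ /= [-> ->].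
- by move=> [z n] Dzn; exists (n, z).
Qed.

(** After exchanging sum and integral, the integrand is [h x] times the number of balls containing
    [x], which [packing] bounds. *)
Lemma level_overlap (k : R) : (0 < k)%R -> exists2 C : R, (0 < C)%R &
  forall (n : int) (D : set Z) (A : set (borel Z)) (h : borel Z -> \bar R),
  D `<=` S n -> measurable A -> measurable_fun setT h -> (forall x, 0 <= h x) ->
  (forall z, D z -> ball z (k * e n)%R `<=` A) ->
  \esum_(z in D) \int[nu]_(x in ball z (k * e n)%R) h x
  <= C%:E * \int[nu]_(x in A) h x.
Proof.
move=> k0; have [C C0 HC] := packing hnu hdoubling alpha1 hS k0.
exists C => // n D A h DS mA mh h0 DA.
have cD : countable D by apply: sub_countable (net_countable hnu hdoubling alpha1 hS n); exact: subset_card_le.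
have mb (z : Z) : measurable (ball z (k * e n)%R : set (borel Z)).
  exact: measurable_mball.
under eq_esum => z Dz.
  rewrite -[X in \int[_]_(_ in X) _](setIidl (DA z Dz)) setIC integral_mkcondr.
  over.
rewrite -integral_esum//; last 2 first.
- move=> z Dz; apply/measurable_restrict => //.
  by apply: measurable_funS mh => //; exact: measurableI.
- by move=> z x Dz Ax; apply: erestrict_ge0.
rewrite -ge0_integralZl//; last 2 first.
- exact: measurable_funS mh.
- by rewrite lee_fin ltW.
apply: ge0_le_integral_lower => x Ax; apply/andP; split.
  by apply: esum_ge0 => z _; apply: erestrict_ge0.
have -> : \esum_(z in D) (h \_ (ball z (k * e n)%R)) x =
    \esum_(z in D `&` ball x (k * e n)%R) h x.
  rewrite esum_mkcondr; apply: eq_esum => z Dz; rewrite patchE.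
  congr (if _ then _ else _); apply/idP/idP => /set_mem h1; apply/mem_set.
    exact: ball_sym.
  exact: ball_sym.
have [hx|hx] := eqVneq (h x) +oo.
  have [->|ne] := eqVneq (D `&` ball x (k * e n)%R) set0.
    by rewrite esum_set0 mule_ge0// lee_fin ltW.
  by rewrite hx gt0_muley ?leey// lte_fin.
have fh : h x \is a fin_num by rewrite ge0_fin_numE// ltey.
rewrite -(fineK fh); apply: (@le_trans _ _ (\esum_(z in D `&` ball x (k * e n)%R)
   ((fine (h x))%:E * 1))).
  by apply: le_esum => z _; rewrite mule1.
rewrite esumZl ?fine_ge0// muleC lee_wpmul2r ?lee_fin ?fine_ge0//.
apply: le_trans (HC n x); apply: le_esum_sub => // z [Dz xz].
by split => //; exact: DS.
Qed.

(** Each level contributes at most a multiple of the integral over [A], by bounded overlap; the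
    weights [e n^s] with [s > 0] make the sum over the levels from [j] on a convergent geometric
    series. *)
Lemma descendant_sum (k s : R) : (0 < k)%R -> (0 < s)%R -> exists2 C : R, (0 < C)%R &
  forall (j : int) (D : set V) (A : set (borel Z)) (h : borel Z -> \bar R),
  D `<=` vertices -> measurable A -> measurable_fun setT h -> (forall x, 0 <= h x) ->
  (forall v, D v -> (j <= v.2)%R /\ ball v.1 (k * e v.2)%R `<=` A) ->
  \esum_(v in D) ((e v.2 `^ s)%:E * \int[nu]_(x in ball v.1 (k * e v.2)%R) h x)
  <= (C * e j `^ s)%:E * \int[nu]_(x in A) h x.
Proof.
move=> k0 s0; have [C1 C10 HC1] := level_overlap k0.
have [C2 C20 HC2] := geometric_scale_ge alpha1 s0.
exists (C2 * C1)%R; first by rewrite mulr_gt0.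
move=> j D A h DV mA mh h0 HD.
have I0 (B : set (borel Z)) : 0 <= \int[nu]_(x in B) h x by exact: integral_ge0.
rewrite esum_vertices//; last by move=> v; rewrite mule_ge0// lee_fin powR_ge0.
apply: (@le_trans _ _ (\esum_(n in [set n : int | (j <= n)%R])
   ((e n `^ s)%:E * (C1%:E * \int[nu]_(x in A) h x)))).
  rewrite [leRHS]esum_mkcond; apply: le_esum => n _.
  case: ifPn => [|/negP nj]; last first.
    rewrite esum1// => z /= /HD [/= jn _]; exfalso; apply: nj.
    exact/mem_set.
  move=> _; rewrite (esumZl (a := fun z => \int[nu]_(x in ball z (k * e n)%R) h x)
    (powR_ge0 (e n) s)); last by move=> *; exact: I0.
  rewrite lee_wpmul2l ?lee_fin ?powR_ge0//=.
  apply: HC1 => // [z /DV//|z /HD[]//].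
have [Ioo|Ifin] := eqVneq (\int[nu]_(x in A) h x) +oo.
  by rewrite Ioo [leRHS]gt0_muley ?leey// lte_fin !mulr_gt0 ?powR_gt0.
have fI : \int[nu]_(x in A) h x \is a fin_num by rewrite ge0_fin_numE ?ltey.
have fI0 : (0 <= fine (\int[nu]_(x in A) h x))%R by rewrite fine_ge0.
rewrite -(fineK fI).
have -> : \esum_(n in [set n : int | (j <= n)%R])
   ((e n `^ s)%:E * (C1%:E * (fine (\int[nu]_(x in A) h x))%:E)) =
  (C1 * fine (\int[nu]_(x in A) h x))%:E * \esum_(n in [set n : int | (j <= n)%R]) (e n `^ s)%:E.
  rewrite -esumZl ?mulr_ge0// ?ltW//; last by move=> n _; rewrite lee_fin powR_ge0.
  by apply: eq_esum => n _; rewrite -!EFinM; congr (_%:E); ring.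
apply: le_trans (lee_wpmul2l _ (HC2 j)) _; first by rewrite lee_fin mulr_ge0// ltW.
by rewrite -!EFinM lee_fin le_eqVlt; apply/orP; left; apply/eqP; ring.
Qed.

End level_sums.

(** * The weighted measure on the filling *)

Section edge_measure.
Context {R : realType} {Z : completeMetricType R}.
Variable nu : {measure set (borel Z) -> \bar R}.
Hypotheses (hnu : metric_measure nu) (hdoubling : doubling nu).
Variables (alpha tau : R) (S : int -> set Z).
Hypothesis alpha1 : (1 < alpha)%R.
Hypothesis tau3 : (3 < tau)%R.
Hypothesis hS : forall n : int, maximal_separated (alpha ^ (- n))%R (S n).
Context {Xbar : completeMetricType R} (iota : (Z * int -> R) -> Xbar).
Hypothesis hiota : is_completion alpha tau S iota.

Local Open Scope ring_scope.
Local Notation V := (Z * int)%type.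
Local Notation e n := (alpha ^ (- (n : int))).
Implicit Types (v w u : V) (z : Z) (m n : int).
Local Notation vertices := (vertices S).
Local Notation adj := (adj alpha tau S).
Local Notation X := (fillingX alpha tau S).
Local Notation Xrho := (Xrho alpha tau S iota).
Local Notation vtx := (near_vtx alpha1 hS).
Local Notation d x y := (mdist (iota x) (iota y)).
Local Notation vball := (vball alpha tau).

Let alpha0 : 0 < alpha := alpha_gt0 alpha1.
Hint Resolve alpha0 : core.
Let e0 n : 0 < e n := scale_gt0 alpha1 n.
Hint Resolve e0 : core.
Let tau0 : 0 < tau := tau_gt0 tau3.
Hint Resolve tau0 : core.

Definition edge_path v w (t : R) : Xbar := iota (edge_pt v w t).

Definition edge_set v w : set (borel Xbar) := edge_path v w @` `[0, 1].

(** Oriented edges: every edge occurs twice, as in the sum that defines [mu]. *)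
Definition edges : set (V * V) := vertices `*`` adj.

Lemma edgesE v w : edges (v, w) <-> adj v w.
Proof. by split => [[]//|vw]; split => //; case: vw. Qed.

Lemma edges_countable : countable edges.
Proof.
have cV := vertices_countable hnu hdoubling alpha1 hS.
apply: countableXR => // v _.
by apply: sub_countable cV; apply: subset_card_le => w [].
Qed.

(** Makes an edge path a continuous map on the whole line, so that closedness and Borel
    measurability follow from results for total functions. *)
Let clamp (t : R) : R := Num.min 1 (Num.max 0 t).

Let clamp01 t : clamp t \in `[0, 1].
Proof.
rewrite in_itv/= /clamp le_min ler01 le_max lexx/=.
by rewrite ge_min lexx.
Qed.

Let clampE t : t \in `[0, 1] -> clamp t = t.
Proof.
by rewrite in_itv/= => /andP[t0 t1]; rewrite /clamp (max_idPr t0) (min_idPr t1).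
Qed.

Let clamp_lip s t : `|clamp s - clamp t| <= `|s - t|.
Proof.
rewrite /clamp /Num.min /Num.max.
have h1 := ler_norm (s - t); have h2 := ler_norm (t - s); rewrite distrC in h2.
move: h1 h2; move: (`|s - t|) => N h1 h2; rewrite ler_norml.
by case: (ltP 0 s) => s1; case: (ltP 0 t) => t1; rewrite ?ltr10;
  try (case: (ltP 1 s) => s2); try (case: (ltP 1 t) => t2);
  apply/andP; split; lra.
Qed.

Let edge_path_clamp_continuous v w : adj v w ->
  continuous (edge_path v w \o clamp : R -> Xbar).
Proof.
move=> vw s; apply/metricType_numDomainType.cvgrPdist_lt => r r0.
have K0 : 0 < alpha * e v.2 by rewrite mulr_gt0.
apply/nbhs_ballP; exists (r / (alpha * e v.2)) => /=; first by rewrite divr_gt0.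
move=> t; rewrite /ball/= => st.
rewrite /edge_path (le_lt_trans (iota_edge alpha1 hiota vw (clamp01 _) (clamp01 _)))//.
by rewrite (le_lt_trans (ler_wpM2l (ltW K0) (clamp_lip _ _)))// mulrC -ltr_pdivlMr.
Qed.

Let edge_setE v w : edge_set v w = (edge_path v w \o clamp) @` `[0, 1].
Proof.
by apply/seteqP; split => _ [t t01 <-]; exists t => //=; rewrite clampE.
Qed.

Let edge_path_clamp_measurable v w : adj v w -> measurable_fun
  [set: measurableTypeR R] (edge_path v w \o clamp : measurableTypeR R -> borel Xbar).
Proof.
move=> vw; apply: (@measurability _ _ (measurableTypeR R) (borel Xbar) setT _ (@open Xbar)) => //.
move=> _ [U oU <-]; rewrite setTI; apply: (@open_measurable R).
by have /continuousP := edge_path_clamp_continuous vw; exact.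
Qed.

Lemma edge_set_measurable v w : adj v w -> measurable (edge_set v w).
Proof.
move=> vw; rewrite -[X in measurable X]setCK; apply: measurableC.
apply: sub_sigma_algebra; apply: closed_openC.
rewrite edge_setE; apply: compact_closed; first exact: metric_hausdorff.
apply: continuous_compact; last exact: segment_compact.
by apply: continuous_subspaceT; exact: edge_path_clamp_continuous.
Qed.

Lemma edge_path_measurable v w : adj v w -> measurable_fun
  (`[0, 1]%classic : set (measurableTypeR R))
  (edge_path v w : measurableTypeR R -> borel Xbar).
Proof.
move=> vw; apply: (@eq_measurable_fun _ _ (measurableTypeR R) (borel Xbar) _ (edge_path v w \o clamp)).
  by move=> t /set_mem t01 /=; rewrite clampE.
by apply: measurable_funTS; exact: edge_path_clamp_measurable.
Qed.

Lemma edge_set_sub v w : adj v w -> edge_set v w `<=` Xrho.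
Proof. by move=> vw _ [t t01 <-]; exists (edge_pt v w t) => //; exact: fillingX_edge. Qed.

Lemma Xrho_edges : Xrho = \bigcup_(vw in edges) edge_set vw.1 vw.2.
Proof.
apply/seteqP; split => [_ [x /(fillingXE alpha1 tau3 hS)[v [w [t [vw t01 ->]]]] <-]|y].
  by exists (v, w); [exact/edgesE|exists t].
by move=> [[v w] [/= _ vw]]; exact: edge_set_sub.
Qed.

Lemma bigcup_edges_measurable (A : V * V -> set (borel Xbar)) :
  (forall vw, edges vw -> measurable (A vw)) -> measurable (\bigcup_(vw in edges) A vw).
Proof.
move=> mA; have [e [eS [_ eA]]] := @countable_esum_nneseries R _ _ edges_countable.
have -> : \bigcup_(vw in edges) A vw =
    \bigcup_k (if e k is Some vw then A vw else set0).
  apply/seteqP; split => [y [vw Evw Ay]|y [k _]].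
    by have [k ek] := eS _ Evw; exists k => //; rewrite ek.
  by case ek: (e k) => [vw|] // Ay; exists vw => //; exact: eA ek.
apply: bigcupT_measurable => k; case ek: (e k) => [vw|] //.
by apply: mA; exact: eA ek.
Qed.

Lemma Xrho_measurable : measurable (Xrho : set (borel Xbar)).
Proof.
rewrite Xrho_edges; apply: bigcup_edges_measurable => -[v w] [_ vw].
exact: edge_set_measurable.
Qed.

(** A common point has the same barycentric coordinates on both edges, hence a single [depth], which
    is comparable to the scale of either edge. *)
Lemma edge_set_meet v w v' w' : adj v w -> adj v' w' ->
  edge_set v w `&` edge_set v' w' !=set0 ->
  [/\ e v'.2 <= alpha ^+ 2 * e v.2, e v.2 <= alpha ^+ 2 * e v'.2 &
      d (vertex_pt v) (vertex_pt v') <= alpha * e v.2 + alpha * e v'.2].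
Proof.
move=> vw vw' [y [[t t01 <-] [s s01 ]]].
move=> /(iota_inj alpha1 hiota (fillingX_edge vw' s01) (fillingX_edge vw t01)) st.
have /andP[h1 h2] := depth_edge alpha1 vw t01.
have /andP[h3 h4] := depth_edge alpha1 vw' s01.
rewrite st in h3 h4.
have d1 := iota_edge_vertex alpha1 hiota vw t01.
have d2 := iota_edge_vertex alpha1 hiota vw' s01.
rewrite st in d2; split.
- by have := le_trans h3 h2; rewrite ler_pdivrMr// mulrAC -expr2.
- by have := le_trans h1 h4; rewrite ler_pdivrMr// mulrAC -expr2.
- rewrite (le_trans (metric_triangle _ (iota (edge_pt v w t)) _))//.
  by rewrite lerD// metric_sym.
Qed.

Lemma vertex_proj v w : vertices v -> vertices w ->
  mdist v.1 w.1 <= tau * (1 + alpha) * alpha ^+ 3 * d (vertex_pt v) (vertex_pt w).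
Proof.
move=> Vv Vw; have := iota_proj alpha1 tau3 hiota w.1 (fillingX_vertex alpha tau Vv) (fillingX_vertex alpha tau Vw).
by rewrite !interpol_vertex mdistxx subr0 => /(le_trans (ler_norm _)).
Qed.

(** Each level contains boundedly many vertices of [D], by [packing], and the levels that occur have
    scale comparable to [r]. *)
Lemma near_count (k c : R) : 0 < k -> 0 < c -> exists2 C : R, 0 < C &
  forall z (r : R) (D : set V), 0 < r -> D `<=` vertices ->
  (forall w, D w -> [/\ e w.2 <= c * r, r <= c * e w.2 & mdist z w.1 < k * r]) ->
  (\esum_(w in D) 1 <= C%:E)%E.
Proof.
move=> k0 c0; have kc0 : 0 < k * c by rewrite mulr_gt0.
have [C1 C10 HC1] := packing hnu hdoubling alpha1 hS kc0.
have [C2 C20 HC2] := geometric_scale_ge alpha1 ltr01.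
exists (C1 * c * C2 * (alpha * c)); first by rewrite !mulr_gt0.
move=> z r D r0 DV HD.
have [j /andP[j1 j2]] := exists_scale alpha1 (mulr_gt0 c0 r0).
rewrite (esum_vertices (S := S))//.
(* A level that occurs satisfies [c e n / r >= 1]. Inserting this factor replaces the count of
   levels by a geometric series. *)
apply: (@le_trans _ _ (\esum_(n in [set n : int | (j <= n)%R]) ((C1 * c / r)%:E * (e n `^ 1)%:E))%E).
  rewrite [leRHS]esum_mkcond; apply: le_esum => n _.
  have [[z1 Dz1]|nD] := pselect (exists z1, D (z1, n)); last first.
    rewrite esum1; last by move=> z1 /= Dz1; exfalso; apply: nD; exists z1.
    case: ifPn => // _; rewrite -EFinM lee_fin; apply: mulr_ge0.
      by rewrite divr_ge0 ?mulr_ge0 ?(ltW C10) ?(ltW c0) ?(ltW r0).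
    exact: powR_ge0.
  have [/= h1 h2 _] := HD _ Dz1.
  rewrite ifT; last first.
    by apply/mem_set => /=; rewrite ltW// -(scale_lt alpha1) (le_lt_trans h1).
  rewrite -EFinM powRr1 ?(scale_ge0 alpha1)//.
  apply: (@le_trans _ _ C1%:E); last first.
    have -> : C1 * c / r * e n = C1 * (c * e n / r) by ring.
    by rewrite lee_fin ler_pMr// ler_pdivlMr// mul1r.
  apply: le_trans (HC1 n z); apply: le_esum_sub => // z2 /= Dz2.
  split; first exact: (DV _ Dz2).
  have [/= _ _ h3] := HD _ Dz2.
  rewrite ballEmdist/= (lt_le_trans h3)// -mulrA ler_pM2l//.
rewrite esumZl; last 2 first.
- by rewrite divr_ge0 ?mulr_ge0 ?(ltW C10) ?(ltW c0) ?(ltW r0).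
- by move=> n _; rewrite lee_fin powR_ge0.
apply: (@le_trans _ _ ((C1 * c / r)%:E * (C2 * e j `^ 1)%:E)%E).
  apply: lee_wpmul2l => //.
  by rewrite lee_fin divr_ge0 ?mulr_ge0 ?(ltW C10) ?(ltW c0) ?(ltW r0).
rewrite -EFinM lee_fin powRr1 ?(scale_ge0 alpha1)//.
have ej : e j <= alpha * (c * r).
  by move: j1; rewrite (scaleS alpha1) ler_pdivrMr// mulrC.
have -> : C1 * c * C2 * (alpha * c) = C1 * c / r * C2 * (alpha * (c * r)).
  by field; rewrite gt_eqF.
rewrite [leLHS]mulrA; apply: ler_wpM2l => //.
by rewrite mulr_ge0 ?divr_ge0 ?mulr_ge0 ?(ltW C10) ?(ltW c0) ?(ltW r0) ?(ltW C20).
Qed.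

Lemma degree_bound : exists2 C : R, 0 < C & forall v, (\esum_(w in adj v) 1 <= C%:E)%E.
Proof.
have k0 : 0 < tau * (1 + alpha) by rewrite mulr_gt0// addr_gt0.
have [C C0 HC] := near_count k0 alpha0; exists C => // v.
apply: (HC v.1 (e v.2)) => // w vw; first by case: vw.
split; [exact: (adj_scale alpha1 vw)|exact: (adj_scale alpha1 (adj_sym vw))|].
exact: (adj_dist alpha1 tau3 vw).
Qed.

Lemma esum_edges (a : V -> V -> \bar R) : (forall v w, adj v w -> 0 <= a v w)%E ->
  (\esum_(vw in edges) a vw.1 vw.2 = \esum_(v in vertices) \esum_(w in adj v) a v w)%E.
Proof. by move=> a0; rewrite esum_esum// => v w _; exact: a0. Qed.

(** The first vertex of an edge that meets [vw] has scale and position comparable to those of [v],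
    so [near_count] bounds the number of such vertices, and [degree_bound] the number of edges at
    each. *)
Lemma edge_overlap : exists2 C : R, 0 < C & forall v w, adj v w ->
  (\esum_(vw in edges `&` [set vw | edge_set v w `&` edge_set vw.1 vw.2 !=set0]) 1
   <= C%:E)%E.
Proof.
have [C1 C10 HC1] := degree_bound.
pose k := tau * (1 + alpha) * alpha ^+ 3 * (2 * alpha ^+ 3).
have k0 : 0 < k by rewrite /k; apply: mulr_gt0; rewrite !mulr_gt0 ?exprn_gt0// addr_gt0.
have [||C2 C20 HC2] := @near_count (k + 1) (alpha ^+ 2); rewrite ?addr_gt0 ?exprn_gt0//.
exists (C1 * C2); first by rewrite mulr_gt0.
move=> v w vw; have Vv : vertices v by case: vw.
pose D := [set v' | exists2 w', adj v' w' & edge_set v w `&` edge_set v' w' !=set0].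
apply: (@le_trans _ _ (\esum_(p in D `*`` adj) 1)%E).
  apply: le_esum_sub => // -[v' w'] [[_ /= vw'] ne]; split => //=.
  by exists w'.
have -> : (\esum_(p in D `*`` adj) 1 = \esum_(v' in D) \esum_(w' in adj v') (1 : \bar R))%E.
  by rewrite esum_esum.
apply: (@le_trans _ _ (\esum_(v' in D) (C1%:E * 1))%E).
  by apply: le_esum => v' _; rewrite mule1 HC1.
rewrite esumZl ?(ltW C10)// EFinM lee_pmul2l ?lte_fin//.
apply: (HC2 v.1 (e v.2)) => //; first by move=> v' [w' [Vv' _]].
move=> v' [w' vw' /(edge_set_meet vw vw')[h1 h2 h3]]; split => //.
have Vv' : vertices v' by case: vw'.
rewrite (le_lt_trans (vertex_proj Vv Vv'))//.
apply: (@le_lt_trans _ _ (k * e v.2)); last by rewrite ltr_pM2r// ltrDl.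
have -> : k * e v.2 = tau * (1 + alpha) * alpha ^+ 3 * (2 * alpha ^+ 3 * e v.2).
  by rewrite /k; ring.
apply: ler_wpM2l.
  by rewrite !mulr_ge0 ?exprn_ge0 ?addr_ge0// ltW.
rewrite (le_trans h3)//.
have -> : 2 * alpha ^+ 3 * e v.2 = alpha * (alpha ^+ 2 * e v.2) + alpha * (alpha ^+ 2 * e v.2).
  by ring.
rewrite lerD// ler_pM2l//; first by rewrite ler_peMl ?exprn_ege1// ltW.
Qed.


Section vertex_volume.

Definition vvol v : R := vol nu v.1 (e v.2).

Lemma vvol_gt0 v : 0 < vvol v. Proof. exact: vol_gt0. Qed.

Lemma vvol_compare (a b : R) : 0 < a + b -> 0 < b -> exists2 C : R, 0 < C &
  forall v w, mdist v.1 w.1 <= a * e w.2 -> e v.2 <= b * e w.2 -> vvol v <= C * vvol w.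
Proof.
move=> ab b0; have [C C0 HC] := vol_compare hnu hdoubling ab b0; exists C => // v w h1 h2.
apply: le_trans (HC v.1 w.1 (e w.2) _ h1) => //.
by apply: vol_le => //; [rewrite mulr_gt0|apply: ball_sub; rewrite mdistxx add0r].
Qed.

Lemma vvol_adj : exists2 C : R, 0 < C & forall v w, adj v w -> vvol w <= C * vvol v.
Proof.
have [|C C0 HC] := @vvol_compare (tau * (1 + alpha)) alpha _ alpha0.
  by rewrite !addr_gt0 ?mulr_gt0// addr_gt0.
exists C => // v w vw; apply: HC; last exact: (adj_scale alpha1 vw).
by rewrite metric_sym ltW// (adj_dist alpha1 tau3 vw).
Qed.

Lemma nu_vball v : nu (vball v) = (vol nu v.1 (tau * e v.2))%:E.
Proof. by rewrite /vball vol_fin// mulr_gt0. Qed.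

Lemma vball_vvol : exists2 C : R, 0 < C & forall v,
  ((vvol v)%:E <= nu (vball v) <= (C * vvol v)%:E)%E.
Proof.
have [C C0 HC] := doubling_factor hnu hdoubling tau; exists C => // v.
rewrite nu_vball !lee_fin HC// andbT; apply: vol_le => //; first by rewrite mulr_gt0.
by apply: ball_sub; rewrite mdistxx add0r ler_peMl// ltW// (lt_trans _ tau3)// ltr1n.
Qed.

End vertex_volume.

Section weighted_measure.
Variables (mu mu_beta : {measure set (borel Xbar) -> \bar R}) (beta : R).
Hypothesis beta0 : 0 < beta.
Hypothesis hmu : is_mu alpha tau S iota nu mu.
Hypothesis hmu_beta : is_mu_beta alpha tau S iota beta mu mu_beta.
Local Notation heightbar := (heightbar alpha tau S iota).

(** The discrete counterpart of the [mu_beta]-mass of an edge at [v]; comparability is proved in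
    [mu_beta_edge_ge] and [mu_beta_edge_set]. *)
Definition vmass v : R := e v.2 `^ beta * vvol v.

Lemma vmass_gt0 v : 0 < vmass v.
Proof. by rewrite /vmass; apply: mulr_gt0; [rewrite powR_gt0|exact: vvol_gt0]. Qed.

Lemma heightbarE x : X x -> heightbar (iota x) = height x.
Proof.
move=> Xx; rewrite /heightbar pinvKV//; last exact/mem_set.
by move=> y z /set_mem Xy /set_mem Xz; exact: (iota_inj alpha1 hiota).
Qed.

Lemma weight_edge v w t : adj v w -> t \in `[0, 1] ->
  alpha `^ (- beta) * e v.2 `^ beta <= alpha `^ (- beta * heightbar (edge_path v w t))
  <= alpha `^ beta * e v.2 `^ beta.
Proof.
move=> vw t01; rewrite heightbarE; last exact: fillingX_edge.
have /andP[h1 h2] := height_edge_bound vw t01.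
rewrite (scale_powR alpha1) -powRrM -!powRD ?(gt_eqF alpha0) ?implybT//.
have b0 := ltW beta0.
have h3 := ler_wpM2l b0 h1; have h4 := ler_wpM2l b0 h2.
by apply/andP; split; apply: ler_powR; rewrite ?(ltW alpha1)//; lra.
Qed.

Lemma mu_beta_boundary : mu_beta (~` Xrho) = 0%E.
Proof.
rewrite hmu_beta; last by apply: measurableC; exact: Xrho_measurable.
by rewrite setICl integral_set0.
Qed.

Lemma mu_betaI A : measurable A -> mu_beta A = mu_beta (A `&` Xrho).
Proof.
move=> mA; have mX := Xrho_measurable.
by rewrite !hmu_beta -?setIA ?setIid//; exact: measurableI.
Qed.

Lemma mu_edge_ge v w (A : set (borel Xbar)) : adj v w -> measurable A ->
  ((vvol v)%:E * lebesgue_measure [set t : R | t \in `[0%R, 1%R] /\ A (edge_path v w t)]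
  <= mu A)%E.
Proof.
move=> vw mA; rewrite hmu//.
have [C C0 HC] := vball_vvol.
have t0 v' w' : (0 <= (nu (vball v') + nu (vball w')) *
   lebesgue_measure [set t : R | t \in `[0%R, 1%R] /\ A (edge_path v' w' t)])%E.
  by rewrite mule_ge0// ?measure_ge0// adde_ge0.
apply: le_trans (esum_ge_term (i := v) _ _); last 2 first.
- by case: vw.
- by move=> v' _; apply: esum_ge0.
apply: le_trans (esum_ge_term (i := w) _ _) => //.
rewrite lee_wpmul2r ?measure_ge0//.
by have /andP[h _] := HC v; rewrite (le_trans h)// leeDl.
Qed.

Lemma mu_beta_edge_ge : exists2 c : R, 0 < c & forall v w (A : set (borel Xbar)),
  adj v w -> measurable A ->
  ((c * vmass v)%:E * lebesgue_measure [set t : R | t \in `[0%R, 1%R] /\ A (edge_path v w t)]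
  <= mu_beta A)%E.
Proof.
exists (alpha `^ (- beta)); first by rewrite powR_gt0.
move=> v w A vw mA.
have mE := edge_set_measurable vw.
have mAE : measurable (A `&` edge_set v w) by exact: measurableI.
apply: (@le_trans _ _ (mu_beta (A `&` edge_set v w))); last first.
  by apply: le_measure; rewrite ?inE//; apply: subIsetl.
rewrite hmu_beta//.
apply: (@le_trans _ _ (\int[mu]_(y in A `&` edge_set v w `&` Xrho)
    (alpha `^ (- beta) * e v.2 `^ beta)%:E)%E); last first.
  apply: ge0_le_integral_lower => y [[_ [t t01 <-]] _].
  have /andP[h1 h2] := weight_edge vw t01.
  by rewrite !lee_fin h1 mulr_ge0 ?powR_ge0.
rewrite integral_cst//; last by apply: measurableI => //; exact: Xrho_measurable.
rewrite (setIidl (A := A `&` edge_set v w)); last first.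
  by move=> y [_]; exact: edge_set_sub.
rewrite /vmass mulrA EFinM -muleA lee_pmul2l ?lte_fin ?mulr_gt0 ?powR_gt0//.
apply: le_trans (mu_edge_ge vw mAE); apply: lee_wpmul2l.
  by rewrite lee_fin ltW// vvol_gt0.
rewrite le_eqVlt; apply/orP; left; apply/eqP; congr (lebesgue_measure _).
apply/seteqP; split => t [t01 h]; split => //; last by case: h.
by split => //; exists t.
Qed.

(** For one edge, [c vmass v] times the push-forward of Lebesgue measure under the edge path is at
    most [mu_beta], by [mu_beta_edge_ge]. Summation over the edges costs only their bounded
    overlap. *)
Lemma edge_integral_le : exists2 C : R, 0 < C & forall g : borel Xbar -> \bar R,
  measurable_fun (Xrho : set (borel Xbar)) g -> (forall y, Xrho y -> 0 <= g y)%E ->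
  (\esum_(v in vertices) \esum_(w in adj v)
     ((vmass v)%:E * \int[lebesgue_measure]_(t in `[0%R, 1%R]) g (edge_path v w t))
   <= C%:E * \int[mu_beta]_(y in Xrho) g y)%E.
Proof.
have [c c0 Hc] := mu_beta_edge_ge.
have [C C0 HC] := edge_overlap.
exists (c^-1 * C); first by rewrite mulr_gt0// invr_gt0.
move=> g mg g0; have mX := Xrho_measurable.
have one v w : adj v w ->
    ((vmass v)%:E * \int[lebesgue_measure]_(t in `[0%R, 1%R]) g (edge_path v w t)
     <= (c^-1)%:E * \int[mu_beta]_(y in Xrho) (g \_ (edge_set v w)) y)%E.
  move=> vw; have mE := edge_set_measurable vw.
  have EX := edge_set_sub vw.
  have mgE : measurable_fun (edge_set v w) g by apply: measurable_funS mg.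
  pose f := g \_ (edge_set v w).
  have f0 y : (0 <= f y)%E by apply: erestrict_ge0 => z /EX; exact: g0.
  have mf : measurable_fun setT f by exact/(measurable_restrictT _ _).1.
  pose gm : measurableTypeR R -> borel Xbar := edge_path v w \o clamp.
  have mgm : measurable_fun setT gm by exact: edge_path_clamp_measurable.
  have cm0 : 0 <= c * vmass v by rewrite mulr_ge0 ?(ltW c0) ?(ltW (vmass_gt0 v)).
  rewrite lee_pdivlMl// muleA -EFinM.
  (* Lebesgue measure restricted to [[0, 1]], in the form of a measure on the whole line that can be
     pushed forward. *)
  pose U := uniform_prob (@ltr01 R).
  have UE (h : measurableTypeR R -> \bar R) : measurable_fun setT h -> (forall x, 0 <= h x)%E ->
      (\int[U]_x h x = \int[lebesgue_measure]_(x in `[0%R, 1%R]) h x)%E.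
    by move=> mh h0; rewrite integral_uniform// subr0 invr1 mul1e.
  apply: (@le_trans _ _ (\int[mscale (NngNum cm0) (pushforward U gm)]_y f y)%E); last first.
    rewrite [leRHS]integral_mkcond.
    have -> : ((g \_ (edge_set v w)) \_ Xrho) = f.
      by rewrite -patch_setI setIidr.
    apply: ge0_le_measure_integral => // A mA.
    rewrite /= /mscale/= /pushforward.
    apply: le_trans (Hc _ _ _ vw mA).
    rewrite lee_wpmul2l ?lee_fin//.
    have mgA : measurable (gm @^-1` A) by rewrite -[_ @^-1` _]setTI; exact: mgm.
    rewrite -[leLHS]mul1e.
    have -> : (1 * U (gm @^-1` A) = \int[U]_x (\1_(gm @^-1` A) x)%:E)%E.
      by rewrite integral_indic// setIT mul1e.
    rewrite UE; last 2 first.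
    + by apply/measurable_EFinP; exact: measurable_indic.
    + by move=> x; rewrite lee_fin.
    rewrite integral_indic//.
    rewrite le_eqVlt; apply/orP; left; apply/eqP; congr (lebesgue_measure _).
    apply/seteqP; split => t /= [h1 h2].
      by split => //; move: h1; rewrite /gm/= clampE.
    by split => //; rewrite /gm/= clampE.
  rewrite ge0_integral_mscale//= lee_wpmul2l ?lee_fin//.
  rewrite ge0_integral_pushforward// UE; last 2 first.
  - exact: measurableT_comp.
  - by move=> x; exact: f0.
  apply: ge0_le_integral_lower => t /= t01.
  have Et : edge_set v w (edge_path v w t) by exists t.
  rewrite g0 /=; last exact: EX.
  by rewrite /f/gm/= clampE// patchE mem_set.
apply: (@le_trans _ _ (\esum_(vw in edges)
    ((c^-1)%:E * \int[mu_beta]_(y in Xrho) (g \_ (edge_set vw.1 vw.2)) y))%E).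
  rewrite -(@esum_edges (fun v w => (vmass v)%:E *
      \int[lebesgue_measure]_(t in `[0%R, 1%R]) g (edge_path v w t))%E).
    by apply: le_esum => -[v w] [_ vw]; exact: one.
  move=> v w vw; rewrite mule_ge0 ?lee_fin ?(ltW (vmass_gt0 v))//.
  by apply: integral_ge0 => t t01; apply: g0; apply: (edge_set_sub vw); exists t.
have gE0 v w y : Xrho y -> (0 <= (g \_ (edge_set v w)) y)%E.
  by move=> Xy; rewrite patchE; case: ifPn => // _; exact: g0.
have mgE v w : adj v w -> measurable_fun (Xrho : set (borel Xbar)) (g \_ (edge_set v w)).
  move=> vw; have mE := edge_set_measurable vw.
  apply/(measurable_restrict _ _ _).1 => //; apply: measurable_funS mg => //.
rewrite esumZl ?invr_ge0 ?(ltW c0)//; last first.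
  by move=> vw _; apply: integral_ge0 => y; exact: gE0.
rewrite EFinM -muleA lee_pmul2l ?lte_fin ?invr_gt0//.
rewrite -integral_esum//; last 3 first.
- exact: edges_countable.
- by move=> -[v w] [_ vw]; exact: mgE.
- by move=> vw y _; exact: gE0.
rewrite -ge0_integralZl//; last by rewrite lee_fin ltW.
apply: ge0_le_integral_lower => y Xy; apply/andP; split.
  by apply: esum_ge0 => vw _; exact: gE0.
move: (Xy); rewrite Xrho_edges => -[[v w] [_ vw] /= yE].
have -> : (\esum_(vw in edges) (g \_ (edge_set vw.1 vw.2)) y =
    \esum_(vw in edges `&` [set vw | edge_set vw.1 vw.2 y]) g y)%E.
  rewrite [RHS]esum_mkcondr; apply: eq_esum => vw' _; rewrite patchE.
  congr (if _ then _ else _); apply/idP/idP => /set_mem h; exact/mem_set.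
have [gy|gy] := eqVneq (g y) +oo%E.
  by rewrite gy [leRHS]gt0_muley ?leey// lte_fin.
have fg : g y \is a fin_num by rewrite ge0_fin_numE ?ltey ?g0.
rewrite -(fineK fg); apply: (@le_trans _ _ (\esum_(vw in edges `&` [set vw | edge_set vw.1 vw.2 y])
   ((fine (g y))%:E * 1))%E).
  by apply: le_esum => z _; rewrite mule1.
have fg0 : 0 <= fine (g y) by rewrite fine_ge0// g0.
rewrite esumZl// muleC lee_wpmul2r ?lee_fin//.
apply: le_trans (HC v w vw); apply: le_esum_sub => // vw' [h1 h2].
by split => //; exists y.
Qed.

(** Only edges meeting [vw] contribute to the sum that defines [mu]; there are boundedly many and
    their volumes are comparable to [vvol v]. The weight varies by a bounded factor along the
    edge. *)
Lemma mu_beta_edge_set : exists2 C : R, 0 < C & forall v w, adj v w ->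
  (mu_beta (edge_set v w) <= (C * vmass v)%:E)%E.
Proof.
have [C1 C10 HC1] := edge_overlap.
have [C2 C20 HC2] := vball_vvol.
have [C3 C30 HC3] := vvol_adj.
pose k := tau * (1 + alpha) * alpha ^+ 3 * (alpha + alpha ^+ 3) * alpha ^+ 2.
have k0 : 0 < k by rewrite /k !(mulr_gt0, addr_gt0, exprn_gt0).
have [||C4 C40 HC4] := @vvol_compare k (alpha ^+ 2); rewrite ?addr_gt0 ?exprn_gt0//.
pose K := C2 * (C4 + C3 * C4).
have K0 : 0 < K by rewrite !(mulr_gt0, addr_gt0).
exists (alpha `^ beta * K * C1); first exact: mulr_gt0 (mulr_gt0 (powR_gt0 _ alpha0) K0) C10.
move=> v w vw; have mE := edge_set_measurable vw; have Vv : vertices v by case: vw.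
have v0 := vvol_gt0 v.
have muE : (mu (edge_set v w) <= (K * C1 * vvol v)%:E)%E.
  rewrite hmu//; pose a v' w' := ((nu (vball v') + nu (vball w')) *
     lebesgue_measure [set t : R | t \in `[0%R, 1%R] /\ edge_set v w (edge_path v' w' t)])%E.
  have a0 v' w' : (0 <= a v' w')%E by rewrite mule_ge0 ?adde_ge0.
  rewrite -(@esum_edges a)//.
  apply: (@le_trans _ _ (\esum_(vw' in edges `&`
      [set vw' | edge_set v w `&` edge_set vw'.1 vw'.2 !=set0]) ((K * vvol v)%:E * 1))%E).
    rewrite [leRHS]esum_mkcondr; apply: le_esum => -[v' w'] /= [/= _ vw'].
    case: ifPn => [/set_mem /= ne|/negP ne].
      have Vv' : vertices v' by case: vw'.
      rewrite /a mule1 -[leRHS]mule1; apply: lee_pmul => //; first exact: adde_ge0.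
        have /andP[_ h1] := HC2 v'; have /andP[_ h2] := HC2 w'.
        apply: (le_trans (leeD h1 h2)); rewrite -EFinD lee_fin -mulrDr /K -mulrA.
        rewrite ler_pM2l// mulrDl -mulrA.
        have h3 : vvol v' <= C4 * vvol v.
          have [h4 h5 h6] := edge_set_meet vw vw' ne.
          apply: HC4 => //; rewrite metric_sym (le_trans (vertex_proj Vv Vv'))//.
          have -> : k * e v.2 = tau * (1 + alpha) * alpha ^+ 3 *
              (alpha * (alpha ^+ 2 * e v.2) + alpha * (alpha ^+ 2 * (alpha ^+ 2 * e v.2))).
            by rewrite /k; ring.
          apply: ler_wpM2l; first by rewrite !mulr_ge0 ?addr_ge0 ?exprn_ge0// ltW.
          rewrite (le_trans h6)// lerD// ler_pM2l//.
            by rewrite ler_peMl ?exprn_ege1// ltW.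
          by rewrite (le_trans h4)// ler_pM2l ?exprn_gt0// ler_peMl ?exprn_ege1// ltW.
        by rewrite lerD// (le_trans (HC3 _ _ vw'))// ler_pM2l.
      rewrite (_ : 1%E = lebesgue_measure (`[0, 1]%classic : set (measurableTypeR R))); last first.
        by rewrite lebesgue_measure_itv/= lte_fin ltr01 oppr0 adde0.
      apply: le_measure; rewrite ?inE//; last by move=> t [].
      exact: (edge_path_measurable vw' (measurable_itv _) mE).
    rewrite (_ : a v' w' = 0%E)// /a.
    rewrite (_ : [set t : R | _] = set0) ?measure0 ?mule0//.
    apply/seteqP; split => // t [t01 h]; apply: ne; apply/mem_set => /=.
    by exists (edge_path v' w' t); split => //; exists t.
  rewrite esumZl ?(ltW (mulr_gt0 K0 v0))//.
  have -> : K * C1 * vvol v = K * vvol v * C1 by ring.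
  by rewrite [in leRHS]EFinM lee_wpmul2l ?HC1// lee_fin (ltW (mulr_gt0 K0 v0)).
have mX := Xrho_measurable.
rewrite hmu_beta//.
apply: (@le_trans _ _ (\int[mu]_(y in edge_set v w `&` Xrho)
    (alpha `^ beta * e v.2 `^ beta)%:E)%E).
  apply: ge0_le_integral_lower => y [[t t01 <-] _].
  by have /andP[_ h2] := weight_edge vw t01; rewrite !lee_fin h2 powR_ge0.
rewrite (setIidl (A := edge_set v w)); last exact: edge_set_sub.
rewrite integral_cst//.
apply: le_trans (lee_wpmul2l _ muE) _; first by rewrite lee_fin mulr_ge0 ?powR_ge0.
rewrite -EFinM lee_fin le_eqVlt; apply/orP; left; apply/eqP.
by rewrite /vmass; ring.
Qed.

Definition star_set (B : set Xbar) : set V :=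
  [set v | exists2 w, adj v w & edge_set v w `&` B !=set0].

(** The integrand is dominated by [a v + a w] on each edge met by [B]. Edges have mass at most a
    multiple of [vmass v], reversing the orientation exchanges the two terms, and the degree bound
    reduces the sum over edges to one over vertices. *)
Lemma star_integral : exists2 C : R, 0 < C &
  forall (B : set (borel Xbar)) (F : Xbar -> \bar R) (a : V -> R),
  measurable B -> B `<=` Xrho -> (forall v, 0 <= a v) ->
  (forall v w t, adj v w -> t \in `[0, 1] -> B (edge_path v w t) ->
    (0 <= F (edge_path v w t) <= (a v + a w)%:E)%E) ->
  (\int[mu_beta]_(y in B) F y <= C%:E * \esum_(v in star_set B) (a v * vmass v)%:E)%E.
Proof.
have [C1 C10 HC1] := degree_bound.
have [C2 C20 HC2] := mu_beta_edge_set.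
have [C3 C30 HC3] := vvol_adj.
pose C4 := alpha `^ beta * C3; have C40 : 0 < C4 by rewrite mulr_gt0 ?powR_gt0.
have HC4 v w : adj v w -> vmass w <= C4 * vmass v.
  move=> vw; have -> : C4 * vmass v = (alpha * e v.2) `^ beta * (C3 * vvol v).
    by rewrite powRM ?(ltW (e0 _)) ?(ltW alpha0)// /C4 /vmass; ring.
  rewrite /vmass ler_pM ?powR_ge0 ?(ltW (vvol_gt0 _)) ?HC3//.
  by rewrite ge0_ler_powR ?nnegrE ?mulr_ge0 ?(ltW (e0 _)) ?(ltW alpha0) ?(ltW beta0)// (adj_scale alpha1 vw).
exists ((1 + C4) * C2 * C1); first exact: mulr_gt0 (mulr_gt0 (addr_gt0 ltr01 C40) C20) C10.
move=> B F a mB BX a0 Fa.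
pose EB := edges `&` [set vw | edge_set vw.1 vw.2 `&` B !=set0].
have EBc : countable EB by apply: sub_countable edges_countable; apply: subset_card_le => vw [].
have m0 v : 0 <= vmass v by exact/ltW/vmass_gt0.
have t0 v : (0 <= (a v * vmass v)%:E)%E by rewrite lee_fin mulr_ge0.
apply: (@le_trans _ _ (\int[mu_beta]_(y in B) (\esum_(vw in EB)
   ((a vw.1 + a vw.2) * \1_(edge_set vw.1 vw.2) y)%:E))%E).
  apply: ge0_le_integral_lower => y By.
  move: (BX _ By); rewrite Xrho_edges => -[[v w] [_ /= vw] [t t01 yE]].
  have /andP[F0 F1] := Fa v w t vw t01 ltac:(by rewrite yE).
  rewrite -yE F0/= (le_trans F1)//.
  have Et : edge_set v w (edge_path v w t) by exists t.
  apply: le_trans (esum_ge_term (i := (v, w)) _ _).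
  - by rewrite /= indicE mem_set// mulr1.
  - by split; [exact/edgesE|exists (edge_path v w t); split => //; rewrite yE].
  - by move=> vw' _; rewrite lee_fin mulr_ge0 ?addr_ge0// indicE.
rewrite integral_esum//; last 2 first.
- move=> [v w] [[_ vw] _]; apply/measurable_EFinP.
  apply: measurable_funM => //; apply: measurable_indic; exact: edge_set_measurable.
- by move=> vw' y _ _; rewrite lee_fin mulr_ge0 ?addr_ge0// indicE.
apply: (@le_trans _ _ (\esum_(vw in EB) (C2%:E * ((a vw.1 * vmass vw.1)%:E + (C4 * (a vw.2 * vmass vw.2))%:E)))%E).
  apply: le_esum => -[v w] [[_ /= vw] _].
  have mE := edge_set_measurable vw.
  under eq_integral do rewrite EFinM.
  rewrite ge0_integralZl//; last 2 first.
  - by apply/measurable_EFinP; exact: measurable_indic.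
  - by rewrite lee_fin addr_ge0.
  rewrite integral_indic//.
  apply: (@le_trans _ _ ((a v + a w)%:E * (C2 * vmass v)%:E)%E).
    rewrite lee_wpmul2l ?lee_fin ?addr_ge0// (le_trans _ (HC2 _ _ vw))//.
    by apply: le_measure; rewrite ?inE//; exact: measurableI.
  rewrite -EFinD -!EFinM lee_fin mulrCA ler_pM2l// mulrDl lerD2l.
  have -> : C4 * (a w * vmass w) = a w * (C4 * vmass w) by ring.
  exact: ler_wpM2l (HC4 _ _ (adj_sym vw)).
rewrite esumZl ?(ltW C20)//; last first.
  move=> vw _; rewrite adde_ge0// lee_fin.
  exact: mulr_ge0 (ltW C40) (mulr_ge0 (a0 _) (m0 _)).
rewrite esumD//; last first.
  move=> vw _; rewrite lee_fin.
  exact: mulr_ge0 (ltW C40) (mulr_ge0 (a0 _) (m0 _)).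
have -> : (\esum_(vw in EB) (C4 * (a vw.2 * vmass vw.2))%:E =
   C4%:E * \esum_(vw in EB) (a vw.1 * vmass vw.1)%:E)%E.
  rewrite -esumZl ?(ltW C40)//.
  rewrite (@reindex_esum _ _ _ EB EB (fun p => (p.2, p.1)))//.
  have EBsym (p : V * V) : EB p -> EB (p.2, p.1).
    case: p => v w [[_ /= vw] ne]; split => /=.
      by apply/edgesE; exact: adj_sym.
    case: ne => y [[t t01 yE] By]; exists y; split => //; exists (1 - t).
      by move: t01; rewrite /= !in_itv/= => /andP[? ?]; apply/andP; split; lra.
    by rewrite /edge_path (edge_ptC v w) subKr.
  split.
  - by move=> p /EBsym.
  - by move=> [v w] [v' w'] _ _ /= [-> ->].
  - by move=> [v w] /EBsym h; exists (w, v).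
set I := (\esum_(vw in EB) _)%E; set J := (\esum_(v in _) _)%E.
have I0 : (0 <= I)%E by apply: esum_ge0 => vw _; exact: t0.
have IJ : (I <= C1%:E * J)%E.
  apply: (@le_trans _ _ (\esum_(vw in star_set B `*`` adj) (a vw.1 * vmass vw.1)%:E)%E).
    apply: le_esum_sub => //.
    by move=> [v w] [[_ /= vw] ne]; split => //; exists w.
  rewrite -(@esum_esum _ _ _ _ _ (fun v w => (a v * vmass v)%:E)) => [|v w _ _]; last exact: t0.
  rewrite /J -esumZl ?(ltW C10)//.
  apply: le_esum => v _; rewrite (_ : (\esum_(j in adj v) _) = (a v * vmass v)%:E * \esum_(j in adj v) 1)%E.
    by rewrite muleC; apply: lee_wpmul2r.
  rewrite -esumZl ?(mulr_ge0 (a0 v) (m0 v))//.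
  by apply: eq_esum => w _; rewrite mule1.
rewrite -{1}[I]mul1e -ge0_muleDl ?lee_fin ?(ltW C40)// -EFinD muleA -EFinM.
have -> : (1 + C4) * C2 * C1 = C2 * (1 + C4) * C1 by ring.
rewrite (EFinM _ C1) -muleA lee_pmul2l ?lte_fin//.
exact: mulr_gt0 C20 (addr_gt0 ltr01 C40).
Qed.

(** A set whose points have depth and projected distance to [z] at most [c r] meets only edges whose
    vertices have scale [O(r)] and lie within [O(r)] of [z], so [descendant_sum] applies to its
    star. *)
Lemma star_descendants (c k s : R) : 0 < c -> 0 < k -> 0 < s ->
  exists M C : R, [/\ 0 < M, 0 < C & forall (B : set Xbar) z r (h : borel Z -> \bar R),
  0 < r -> measurable_fun setT h -> (forall x, 0 <= h x)%E ->
  (forall x, X x -> B (iota x) -> depth alpha x <= c * r /\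
     interpol (fun v => mdist v.1 z) x <= c * r) ->
  (forall v, star_set B v -> e v.2 <= M * r /\ mdist v.1 z <= M * r) /\
  (\esum_(v in star_set B) ((e v.2 `^ s)%:E * \int[nu]_(x in ball v.1 (k * e v.2)%R) h x)
  <= (C * r `^ s)%:E * \int[nu]_(x in ball z (M * r)) h x)%E].
Proof.
move=> c0 k0 s0; have [C1 C10 HC1] := descendant_sum hnu hdoubling alpha1 hS k0 s0.
pose P := tau * (1 + alpha) * alpha ^+ 3.
have P0 : 0 < P by rewrite /P !(mulr_gt0, addr_gt0, exprn_gt0).
(* [L r] bounds the scales of the star vertices and [M0 r] their distance to [z]; the radius [M r]
   leaves room for the balls of radius [k e v.2] around them. *)
pose L := alpha * c; have L0 : 0 < L by exact: mulr_gt0.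
pose M0 := c + P * (alpha * L); pose M := M0 + k * L + L.
have M00 : 0 < M0 := addr_gt0 c0 (mulr_gt0 P0 (mulr_gt0 alpha0 L0)).
have kL0 : 0 < k * L by exact: mulr_gt0.
have MM : 0 < M := addr_gt0 (addr_gt0 M00 kL0) L0.
exists M, (C1 * (alpha * L) `^ s); split => //.
  by apply: mulr_gt0 => //; rewrite powR_gt0// mulr_gt0.
move=> B z r h r0 mh h0 HB.
have H v : star_set B v -> e v.2 <= L * r /\ mdist v.1 z <= M0 * r.
  move=> [w vw [y [[t t01 <-] By]]].
  have Xt := fillingX_edge vw t01; have [h1 h2] := HB _ Xt By.
  have /andP[h3 _] := depth_edge alpha1 vw t01.
  have ev : e v.2 <= L * r.
    by rewrite /L -mulrA -ler_pdivrMl// mulrC (le_trans h3).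
  have Vv : vertices v by case: vw.
  have := iota_proj alpha1 tau3 hiota z (fillingX_vertex alpha tau Vv) Xt.
  rewrite interpol_vertex => h4; split => //.
  have h5 := le_trans (ler_norm _) h4; rewrite lerBlDr in h5.
  have h6 := iota_edge_vertex alpha1 hiota vw t01; rewrite metric_sym in h6.
  apply: (le_trans h5); rewrite /M0 mulrDl addrC lerD//.
  rewrite -/P -mulrA ler_pM2l// (le_trans h6)// -mulrA ler_pM2l//.
have rM b : b <= M -> b * r <= M * r by move=> bM; rewrite ler_pM2r.
split=> [v /H[h1 h2]|].
  split; first by rewrite (le_trans h1)// rM// /M lerDr addr_ge0// ltW.
  by rewrite (le_trans h2)// rM// /M -addrA lerDl addr_ge0// ltW.
have [j /andP[j1 j2]] := exists_scale alpha1 (mulr_gt0 L0 r0).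
have mB : measurable (ball z (M * r) : set (borel Z)) by exact: measurable_mball.
apply: le_trans (HC1 j (star_set B) _ h _ mB mh h0 _) _.
- by move=> v [w []].
- move=> v /H[h1 h2]; split.
    by rewrite ltW// -(scale_lt alpha1) (le_lt_trans h1).
  apply: ball_sub; rewrite (@le_trans _ _ (M0 * r + k * (L * r)))//.
    exact: lerD h2 (ler_wpM2l (ltW k0) h1).
  by rewrite mulrA -mulrDl rM// /M lerDl ltW.
rewrite lee_wpmul2r ?integral_ge0// lee_fin -mulrA ler_pM2l//.
rewrite -powRM ?(ltW r0)//; last by rewrite mulr_ge0 ?(ltW L0)// ltW.
rewrite ge0_ler_powR ?nnegrE ?(ltW s0) ?(ltW (e0 _)) ?(ltW (mulr_gt0 (mulr_gt0 alpha0 L0) r0))//.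
by move: j1; rewrite (scaleS alpha1) ler_pdivrMr// mulrC mulrA.
Qed.

(** The ball is covered by edges that descend from the vicinity of [v]; [beta > 0] makes the total
    mass of these descendants a convergent series dominated by the mass at [v]. *)
Lemma mu_beta_ball (k : R) : 0 < k -> exists2 C : R, 0 < C & forall v, vertices v ->
  (mu_beta (ball (iota (vertex_pt v)) (k * e v.2)) <= (C * vmass v)%:E)%E.
Proof.
move=> k0; have [C1 C10 HC1] := star_integral.
pose P := tau * (1 + alpha) * alpha ^+ 3.
have P0 : 0 < P by rewrite /P !(mulr_gt0, addr_gt0, exprn_gt0).
pose c := 1 + alpha ^+ 4 * k + P * k.
have c0 : 0 < c by rewrite /c !(mulr_gt0, addr_gt0, exprn_gt0).
have [M [C2 [M0 C20 HC2]]] := star_descendants c0 ltr01 beta0.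
have [C3 C30 HC3] := doubling_factor hnu hdoubling M.
exists (C1 * (C2 * C3)); first by rewrite !mulr_gt0.
move=> v Vv; have mB : measurable (ball (iota (vertex_pt v)) (k * e v.2) : set (borel Xbar)).
  exact: measurable_mball.
have mX := Xrho_measurable; rewrite mu_betaI//.
set B := _ `&` _; have mB' : measurable B by exact: measurableI.
have HB x : X x -> B (iota x) -> depth alpha x <= c * e v.2 /\
     interpol (fun w => mdist w.1 v.1) x <= c * e v.2.
  move=> Xx [xB _]; have Xv := fillingX_vertex alpha tau Vv.
  rewrite ballEmdist/= metric_sym in xB.
  have h1 := depth_lip alpha1 hiota Xx Xv; rewrite depth_vertex in h1.
  have h2 := iota_proj alpha1 tau3 hiota v.1 Xx Xv.
  rewrite interpol_vertex mdistxx subr0 in h2.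
  have h3 := le_trans (le_trans (ler_norm _) h1) (ler_wpM2l (exprn_ge0 4 (ltW alpha0)) (ltW xB)).
  have h4 := le_trans (le_trans (ler_norm _) h2) (ler_wpM2l (ltW P0) (ltW xB)).
  split.
    rewrite lerBlDr in h3; rewrite (le_trans h3)// mulrA -[X in _ + X]mul1r -mulrDl.
    by rewrite ler_pM2r// /c addrC lerDl ltW// mulr_gt0.
  rewrite (le_trans h4)// mulrA ler_pM2r// /c lerDr addr_ge0// mulr_ge0 ?exprn_ge0// ltW//.
rewrite -[mu_beta B]mul1e -integral_cst//.
apply: le_trans (HC1 B _ (fun=> 1) _ _ _ _) _ => //.
- by move=> y [].
- by move=> *; rewrite !lee_fin ler01 lerDl ler01.
rewrite -mulrA EFinM lee_pmul2l ?lte_fin//.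
have [_] := HC2 B v.1 (e v.2) (cst 1%E) (e0 _) (measurable_cst _) (fun=> lee01) HB.
rewrite integral_cst//; last exact: measurable_mball.
rewrite mul1e => h; apply: le_trans (le_trans h _).
  apply: le_esum => w _; rewrite integral_cst//; last exact: measurable_mball.
  by rewrite mul1e !mul1r vol_fin// /vmass.
rewrite vol_fin ?mulr_gt0// -EFinM lee_fin.
rewrite [leRHS](_ : _ = C2 * e v.2 `^ beta * (C3 * vvol v)); last by rewrite /vmass; ring.
by rewrite ler_wpM2l ?HC3// mulr_ge0 ?powR_ge0// ltW.
Qed.

End weighted_measure.

End edge_measure.

(** * Traces *)

Lemma geometric_cauchy {R : realType} (a : nat -> R) (M q : R) : (0 < q < 1)%R ->
  (forall k, `|a k.+1 - a k| <= M * q ^+ k)%R ->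
  exists L : R, forall k, (`|a k - L| <= M * q ^+ k / (1 - q))%R.
Proof.
move=> q01 Ha; have /andP[q0 q1] := q01.
have q1' : (0 < 1 - q)%R by rewrite subr_gt0.
have M0 : (0 <= M)%R by have := le_trans (normr_ge0 _) (Ha 0%N); rewrite expr0 mulr1.
have step k j : (`|a (k + j)%N - a k| <= M * q ^+ k / (1 - q))%R.
  suff H : (`|a (k + j)%N - a k| <= M * q ^+ k * \sum_(i < j) q ^+ i)%R.
    apply: (le_trans H); rewrite ler_wpM2l ?mulr_ge0 ?exprn_ge0 ?(ltW q0)//.
    by rewrite -(big_mkord xpredT (fun i => q ^+ i)%R) sum_geometric_le.
  elim: j => [|j ih]; first by rewrite addn0 subrr normr0 big_ord0 mulr0.
  rewrite big_ord_recr/= mulrDr addnS -(mulrA M (q ^+ k)%R (q ^+ j)%R) -exprD.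
  rewrite -[a _.+1](subrK (a (k + j)%N)) -addrA (le_trans (ler_normD _ _))//.
  by rewrite [leRHS]addrC lerD.
have cv : cauchy (a n @[n --> \oo]).
  apply: cauchy_exP => r r0.
  have [N _ HN] : exists2 N, True & (M * q ^+ N / (1 - q) < r)%R.
    have /cvgrPdist_lt : (fun n => M * q ^+ n / (1 - q))%R @ \oo --> (M * 0 / (1 - q) : R)%R.
      apply: cvgMl; apply: cvgMr.
      by apply: cvg_expr; rewrite ger0_norm// ltW.
    rewrite mulr0 mul0r => /(_ _ r0) [N _ HN]; exists N => //.
    have := HN N (leqnn N); rewrite /= sub0r normrN; apply: le_lt_trans; exact: ler_norm.
  exists (a N); exists N => // k /= Nk; rewrite /ball/= distrC.
  by rewrite -(subnKC Nk) (le_lt_trans (step _ _)).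
have acv : a n @[n --> \oo] --> lim (a n @[n --> \oo]) by exact: cauchy_cvg cv.
exists (lim (a n @[n --> \oo])) => k; apply/ler_addgt0Pr => r r0.
have /cvgrPdist_lt/(_ _ r0) [N _ HN] := acv.
rewrite -(subrK (a (k + N)%N) (a k)) -addrA (le_trans (ler_normD _ _))// lerD//.
  by rewrite distrC.
by rewrite distrC ltW// HN//= leq_addl.
Qed.

Lemma powRN_lt1 {R : realType} (a s : R) : (1 < a)%R -> (0 < s)%R -> (a `^ (- s) < 1)%R.
Proof.
move=> a1 s0; have a0 := lt_trans ltr01 a1.
rewrite powRN invf_lt1 ?powR_gt0// -(powRr0 a) /powR gt_eqF// ltr_expR.
by rewrite ltr_pM2r ?ln_gt0.
Qed.

Lemma esum_finite_support {R : realType} {I : choiceType} (A F : set I) (a : I -> \bar R) :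
  finite_set F -> F `<=` A -> (forall i, A i -> 0 <= a i) ->
  (forall i, A i -> ~ F i -> a i = 0) ->
  \esum_(i in A) a i = \sum_(i \in F) a i.
Proof.
move=> fF FA a0 aF; rewrite (esumID F)// [X in _ + X]esum1 ?adde0; last first.
  by move=> i [Ai /= nF]; exact: aF.
by rewrite (setIidr FA) esum_fset// => i /set_mem /FA /a0.
Qed.

Lemma lipschitz_measurable {R : realType} {M : pmetricType R} (f : M -> R) (K : R) :
  (forall x y, `|f x - f y| <= K * mdist x y)%R ->
  measurable_fun setT (f : borel M -> R).
Proof.
move=> Hf; apply: (measurability _ (RGenOInfty.measurableE R)) => _ [_ [a ->] <-].
rewrite setTI; apply: sub_sigma_algebra; rewrite /=.
pose K' := Num.max K 1%R; have K'0 : (0 < K')%R by rewrite lt_max ltr01 orbT.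
rewrite openE => x /=; rewrite in_itv/= andbT => ax.
rewrite /interior; apply/nbhs_ballP; exists ((f x - a) / K')%R.
  by rewrite /= divr_gt0// subr_gt0.
move=> y; rewrite ballEmdist/= in_itv/= andbT ltr_pdivlMr// => xy.
have h : (`|f x - f y| <= K' * mdist x y)%R.
  by rewrite (le_trans (Hf _ _))// ler_wpM2r ?mdist_ge0// le_max lexx.
have := le_lt_trans (le_trans (ler_norm _) h) (_ : K' * mdist x y < f x - a)%R.
by rewrite mulrC => /(_ xy); lra.
Qed.

(** * Convergence and integrability of the discrete traces *)

Section traces.
Context {R : realType} {Z : completeMetricType R}.
Variable nu : {measure set (borel Z) -> \bar R}.
Hypotheses (hnu : metric_measure nu) (hdoubling : doubling nu).
Variables (p theta : R).
Hypotheses (p1 : (1 <= p)%R) (theta01 : (0 < theta < 1)%R).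
Variables (alpha tau : R) (S : int -> set Z).
Hypothesis alpha1 : (1 < alpha)%R.
Hypothesis tau3 : (3 < tau)%R.
Hypothesis hS : forall n : int, maximal_separated (alpha ^ (- n))%R (S n).
Variables (C0 : R) (psi : int -> Z -> Z -> R).
Hypothesis hpsi : partition_of_unity alpha S C0 psi.

Local Open Scope ring_scope.
Local Notation V := (Z * int)%type.
Local Notation e n := (alpha ^ (- (n : int))).
Implicit Types (v w : V) (z x y : Z) (m n : int) (U : V -> R).
Local Notation vertices := (vertices S).
Local Notation adj := (adj alpha tau S).
Local Notation vtx := (near_vtx alpha1 hS).
Local Notation vvol := (vvol nu alpha).

Let alpha0 : 0 < alpha := alpha_gt0 alpha1.
Hint Resolve alpha0 : core.
Let e0 n : 0 < e n := scale_gt0 alpha1 n.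
Hint Resolve e0 : core.
Let p0 : 0 < p := lt_le_trans ltr01 p1.
Hint Resolve p0 : core.
Let theta0 : 0 < theta. Proof. by case/andP: theta01. Qed.
Hint Resolve theta0 : core.

Definition level_trace U n x : R := \sum_(z \in S n) U (z, n) * psi n z x.

Definition vertex_energy U v : \bar R := (\esum_(w in adj v) (`|U v - U w| `^ p)%:E)%E.

Definition level_energy U n x : \bar R :=
  (\esum_(z in S n) (vertex_energy U (z, n) * (\1_(ball z (2 * e n)) x)%:E))%E.

Lemma vertex_energy_ge0 U v : (0 <= vertex_energy U v)%E.
Proof. by apply: esum_ge0 => w _; rewrite lee_fin powR_ge0. Qed.

Lemma level_energy_ge0 U n x : (0 <= level_energy U n x)%E.
Proof.
by apply: esum_ge0 => z _; rewrite mule_ge0 ?vertex_energy_ge0// lee_fin indicE.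
Qed.

Lemma psi_support n z x : S n z -> psi n z x != 0 -> mdist z x < 2 * e n.
Proof.
move=> Sz px; have [_ _ /(_ _ Sz) h _] := hpsi n.
have := h x; rewrite ballEmdist/=; apply; exact: subset_closure.
Qed.

Lemma level_trace_ball U n x :
  level_trace U n x = \sum_(z \in S n `&` ball x (2 * e n)) U (z, n) * psi n z x.
Proof.
rewrite /level_trace (fsbig_widen (S n `&` ball x (2 * e n)) (S n))//.
move=> z [Sz /= nz]; apply/eqP; rewrite mulf_eq0; apply/orP; right.
apply/negPn/negP => /(psi_support Sz) h; apply: nz; split => //.
by rewrite ballEmdist/= metric_sym.
Qed.

Lemma psi_sum n x : \sum_(z \in S n `&` ball x (2 * e n)) psi n z x = 1.
Proof.
have [ps01 ps1 _ _] := hpsi n.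
have fF := packing_finite hnu hdoubling alpha1 hS 2 n x.
apply/eqP; rewrite -eqe -fsumEFin// -(ps1 x); apply/eqP/esym.
apply: esum_finite_support => //.
- by move=> z Sz; rewrite lee_fin; have /andP[] := ps01 z x Sz.
- move=> z Sz nz; congr (_%:E); apply/eqP/negPn/negP => /(psi_support Sz) h.
  by apply: nz; split => //; rewrite ballEmdist/= metric_sym.
Qed.

(** By the partition of unity, [level_trace U n x] is a convex combination of the values of [U] at
    the vertices of level [n] within [2 e n] of [x]. *)
Lemma level_trace_convex U n x (c M : R) :
  (forall z, S n z -> mdist z x < 2 * e n -> `|U (z, n) - c| <= M) ->
  `|level_trace U n x - c| <= M.
Proof.
move=> H; have fF := packing_finite hnu hdoubling alpha1 hS 2 n x.
have [ps01 _ _ _] := hpsi n.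
have := psi_sum n x; rewrite level_trace_ball !fsbig_finite//= => ps.
rewrite -[X in _ - X]mulr1 -[X in _ - _ * X]ps -[leRHS]mulr1 -[X in _ <= _ * X]ps.
rewrite !mulr_sumr -sumrB.
apply: (le_trans (ler_norm_sum _ _ _)); rewrite big_seq [leRHS]big_seq.
apply: ler_sum => z; rewrite in_fset_set// => /set_mem [Sz xz].
have /andP[s0 _] := ps01 z x Sz.
rewrite -mulrBl normrM (ger0_norm s0) ler_wpM2r// H//.
by move: xz; rewrite ballEmdist/= metric_sym.
Qed.

Lemma vertex_energy_adj U v w : adj v w ->
  ((`|U v - U w| `^ p)%:E <= vertex_energy U v)%E.
Proof.
move=> vw; apply: (esum_ge_term (a := fun w => (`|U v - U w| `^ p)%:E)) => //.
Qed.

Lemma level_energy_near U n z x : S n z -> mdist z x < 2 * e n ->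
  (vertex_energy U (z, n) <= level_energy U n x)%E.
Proof.
move=> Sz zx; apply: le_trans (esum_ge_term (i := z) Sz _).
  by rewrite indicE mem_set ?mule1// ballEmdist.
by move=> *; rewrite mule_ge0 ?vertex_energy_ge0// lee_fin indicE.
Qed.

(** One representative vertex value per point and level. Changing the level, moving the point, or
    passing to the discrete trace then amounts to crossing single edges. *)
Definition anchor U n x : R := U (vtx x n).

Let vtx_near x n : mdist (vtx x n).1 x < 2 * e n.
Proof. by rewrite (lt_trans (near_pt_dist alpha1 hS n x))// ltr_pMl// ltr1n. Qed.

Let energy_vtx U x n : (vertex_energy U (vtx x n) <= level_energy U n x)%E.
Proof. by apply: level_energy_near => //; [exact: near_ptS|exact: vtx_near]. Qed.

Let adj_near x z m n : S m z -> mdist z x < 2 * e m -> `|m - n| <= 1 ->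
  (z, m) = vtx x n \/ adj (vtx x n) (z, m).
Proof.
move=> Sz zx mn; have [->|/eqP ne] := eqVneq (z, m) (vtx x n); first by left.
right; apply: (adjP (z := x)) => //.
- exact: near_vtxV.
- by rewrite distrC.
- by rewrite eq_sym; exact/eqP.
- by rewrite (lt_trans (vtx_near _ _))// ltr_pM2r// (lt_trans _ tau3)// ltr_nat.
- by rewrite (lt_trans zx)// ltr_pM2r// (lt_trans _ tau3)// ltr_nat.
Qed.

Let root_le (a : R) (L : \bar R) : 0 <= a -> ((a `^ p)%:E <= L)%E -> L \is a fin_num ->
  a <= (fine L) `^ p^-1.
Proof.
move=> a0' h fL; rewrite -(fineK fL) lee_fin in h.
rewrite -[leLHS](powRr1 a0') -(mulfV (lt0r_neq0 p0)) powRrM.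
by rewrite ge0_ler_powR ?invr_ge0 ?nnegrE ?powR_ge0// ?(le_trans (powR_ge0 _ _) h)// ltW.
Qed.
Let le_root (a : R) (L : \bar R) : (0 <= L)%E -> 0 <= a ->
  (L \is a fin_num -> a <= (fine L) `^ p^-1) -> ((a `^ p)%:E <= L)%E.
Proof.
move=> L0 a0' h; have [->|nL] := eqVneq L +oo%E; first by rewrite leey.
have fL : L \is a fin_num by rewrite ge0_fin_numE ?ltey.
rewrite -(fineK fL) lee_fin; have fL0 : 0 <= fine L by rewrite fine_ge0.
rewrite -[leRHS](powRr1 fL0) -(mulVf (lt0r_neq0 p0)) powRrM.
by rewrite ge0_ler_powR ?nnegrE ?powR_ge0 ?h// ltW.
Qed.

Lemma anchor_trace U n x :
  ((`|level_trace U n x - anchor U n x| `^ p)%:E <= level_energy U n x)%E.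
Proof.
apply: le_root; rewrite ?level_energy_ge0// => fL.
apply: level_trace_convex => z Sz zx.
have [|->|vw] := @adj_near x z n n Sz zx; first by rewrite subrr normr0.
  by rewrite subrr normr0 powR_ge0.
apply: root_le => //; rewrite distrC.
exact: le_trans (vertex_energy_adj U vw) (energy_vtx U x n).
Qed.

Lemma anchor_succ U n x :
  ((`|anchor U (n + 1) x - anchor U n x| `^ p)%:E <= level_energy U n x)%E.
Proof.
rewrite distrC; apply: le_trans (energy_vtx U x n).
exact/vertex_energy_adj/near_vtx_succ.
Qed.

Lemma anchor_same U n x y : mdist x y < 2 * e n ->
  ((`|anchor U n x - anchor U n y| `^ p)%:E <= level_energy U n x)%E.
Proof.
move=> xy; rewrite /anchor; have [->|vw] := near_vtx_same alpha1 tau3 hS xy.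
  by rewrite subrr normr0 powR0 ?gt_eqF// level_energy_ge0.
exact: le_trans (vertex_energy_adj U vw) (energy_vtx U x n).
Qed.

(** Half of the decay [theta] is put into weights. A finite [tail_energy] makes the differences at
    level [n + i] decay like [qr^i], which replaces Hoelder's inequality for the telescoping series;
    the other half of the decay keeps the integral of the weighted tail under control. *)
Let qr : R := alpha `^ (- (theta / 2)).
Let qr01 : 0 < qr < 1.
Proof. by rewrite powR_gt0//= powRN_lt1// divr_gt0. Qed.
Let qr0 : 0 < qr. Proof. by case/andP: qr01. Qed.

Let wt (i : nat) : R := (qr ^+ i) `^ p.
Let wt_gt0 i : 0 < wt i. Proof. by rewrite powR_gt0// exprn_gt0. Qed.

Definition tail_energy U n x : \bar R :=
  (\esum_(i in [set: nat]) ((wt i)^-1%:E * level_energy U (n + i%:Z)%R x))%E.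

Let tail_term_ge0 U n x i : (0 <= (wt i)^-1%:E * level_energy U (n + i%:Z)%R x)%E.
Proof. by rewrite mule_ge0 ?level_energy_ge0// lee_fin invr_ge0 ltW. Qed.

Lemma tail_energy_ge0 U n x : (0 <= tail_energy U n x)%E.
Proof. by apply: esum_ge0 => i _; exact: tail_term_ge0. Qed.

Let tail_energy_term U n x (i : nat) :
  (level_energy U (n + i%:Z)%R x <= (wt i)%:E * tail_energy U n x)%E.
Proof.
rewrite -lee_pdivrMl//.
exact: (esum_ge_term (a := fun i => ((wt i)^-1%:E * level_energy U (n + i%:Z)%R x)%E)).
Qed.

(** The upper limit is defined at every point and is Borel; it is a limit wherever [tail_energy] is
    finite. *)
Definition limit_trace U x : R :=
  fine (limn_esup (fun n : nat => (level_trace U n%:Z x)%:E)).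

Let tail_root U n x (i : nat) (a : R) : (tail_energy U n x < +oo)%E -> 0 <= a ->
  ((a `^ p)%:E <= level_energy U (n + i%:Z)%R x)%E ->
  a <= (fine (tail_energy U n x)) `^ p^-1 * qr ^+ i.
Proof.
move=> Qoo a0' h; have Q0 := tail_energy_ge0 U n x.
have fQ : tail_energy U n x \is a fin_num by rewrite ge0_fin_numE.
have fQ0 : 0 <= fine (tail_energy U n x) by rewrite fine_ge0.
have := le_trans h (tail_energy_term U n x i).
rewrite -(fineK fQ) -EFinM => /root_le -/(_ a0' isT) /le_trans; apply => /=.
rewrite powRM ?(ltW (wt_gt0 i))//.
rewrite /wt -powRrM mulfV ?gt_eqF// powRr1 ?exprn_ge0 ?(ltW qr0)// mulrC//.
Qed.

(** The anchors have geometrically decaying increments and thus a limit, and the discrete traces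
    differ from them by quantities of the same decay. *)
Lemma limit_trace_cvg U n x : (tail_energy U n x < +oo)%E ->
  level_trace U k%:Z x @[k --> \oo] --> limit_trace U x /\
  `|anchor U n x - limit_trace U x| <= (fine (tail_energy U n x)) `^ p^-1 / (1 - qr).
Proof.
move=> Qoo; set M := _ `^ _; have /andP[_ q1] := qr01.
have M0 : 0 <= M by exact: powR_ge0.
have [|L HL] := @geometric_cauchy R (fun i => anchor U (n + i%:Z) x) M qr qr01.
  move=> i; apply: tail_root => //; rewrite (_ : n + i.+1%:Z = n + i%:Z + 1).
    exact: anchor_succ.
  by rewrite -addn1 PoszD addrA.
have LT i : `|level_trace U (n + i%:Z) x - L| <= M * (1 + (1 - qr)^-1) * qr ^+ i.
  rewrite -(subrK (anchor U (n + i%:Z) x) (level_trace _ _ _)) -addrA.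
  rewrite (le_trans (ler_normD _ _))// mulrDr mulr1 mulrDl lerD//.
    apply: tail_root => //; exact: anchor_trace.
  by rewrite mulrAC HL.
have cv : level_trace U k%:Z x @[k --> \oo] --> L.
  apply/cvgrPdist_lt => r r0; pose K := M * (1 + (1 - qr)^-1).
  have K1 : 0 < K + 1 by rewrite ltr_wpDl// mulr_ge0// addr_ge0// invr_ge0 subr_ge0 ltW.
  have /cvgrPdist_lt/(_ _ (divr_gt0 r0 K1)) [N _ HN] : (fun n : nat => qr ^+ n) @ \oo --> (0 : R).
    by apply: cvg_expr; rewrite ger0_norm// ltW.
  exists (N + absz n)%N => // k /= Nk.
  have kn : k%:Z = n + (absz (k%:Z - n))%:Z.
    rewrite gez0_abs ?subr_ge0; first by rewrite addrCA subrr addr0.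
    by rewrite (le_trans (ler_norm _))// -abszE lez_nat (leq_trans _ Nk)// leq_addl.
  rewrite distrC kn (le_lt_trans (LT _))//.
  have /HN : (N <= absz (k%:Z - n))%N.
    by rewrite -lez_nat abszE (le_trans _ (ler_norm _))// lerBrDr (le_trans _ (_ : (N + absz n)%N%:Z <= k%:Z))// PoszD lerD2l abszE ler_norm.
  rewrite /= sub0r normrN ger0_norm ?exprn_ge0 ?(ltW qr0)//.
  rewrite ltr_pdivlMr// mulrC => /(le_lt_trans _); apply.
  by rewrite ler_wpM2r ?exprn_ge0 ?(ltW qr0)// lerDl.
have -> : limit_trace U x = L.
  have cvE : (level_trace U k%:Z x)%:E @[k --> \oo] --> L%:E.
    by apply: cvg_EFin => //; exact: nearW.
  by rewrite /limit_trace (cvg_limn_einf_sup cvE).2.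
by split => //; have := HL 0%N; rewrite addr0 expr0 mulr1.
Qed.

Lemma limit_trace_anchor : exists2 C : R, 0 < C & forall U n x,
  ((`|limit_trace U x - anchor U n x| `^ p)%:E <= C%:E * tail_energy U n x)%E.
Proof.
have /andP[_ q1] := qr01; have q1' : 0 < 1 - qr by rewrite subr_gt0.
exists (((1 - qr)^-1) `^ p); first by rewrite powR_gt0// invr_gt0.
move=> U n x; have Q0 := tail_energy_ge0 U n x.
have [->|nQ] := eqVneq (tail_energy U n x) +oo%E.
  by rewrite gt0_muley ?leey// lte_fin powR_gt0// invr_gt0.
have Qoo : (tail_energy U n x < +oo)%E by rewrite ltey.
have fQ : tail_energy U n x \is a fin_num by rewrite ge0_fin_numE.
have [_ h] := limit_trace_cvg Qoo.
have fQ0 : 0 <= fine (tail_energy U n x) by rewrite fine_ge0.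
rewrite -(fineK fQ) -EFinM lee_fin distrC.
apply: (@le_trans _ _ ((fine (tail_energy U n x) `^ p^-1 / (1 - qr)) `^ p)).
  by rewrite ge0_ler_powR ?nnegrE ?divr_ge0 ?powR_ge0// ltW.
rewrite powRM ?powR_ge0 ?invr_ge0 ?(ltW q1')//.
by rewrite -powRrM mulVf ?gt_eqF// powRr1// mulrC.
Qed.

Lemma level_energy_measurable U n :
  measurable_fun setT (level_energy U n : borel Z -> \bar R).
Proof.
apply: measurable_fun_esum => //.
- exact: (net_countable hnu hdoubling alpha1 hS).
- move=> z Sz; apply: measurable_funeM; apply/measurable_EFinP.
  by apply: measurable_indic; exact: measurable_mball.
- by move=> z x _ _; rewrite mule_ge0 ?vertex_energy_ge0// lee_fin indicE.
Qed.

Lemma tail_energy_measurable U n :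
  measurable_fun setT (tail_energy U n : borel Z -> \bar R).
Proof.
apply: measurable_fun_esum => //; first exact: countableP.
- by move=> i _; apply: measurable_funeM; exact: level_energy_measurable.
Qed.

Let psi_sum_measurable n (f : Z -> R -> R) :
  (forall z, f z 0 = 0) -> (forall z t, 0 <= f z t) ->
  (forall z, measurable_fun setT (f z)) ->
  measurable_fun setT ((fun x => \sum_(z \in S n `&` ball x (2 * e n)) f z (psi n z x)) : borel Z -> R).
Proof.
move=> f00 f0 mf.
have -> : (fun x => \sum_(z \in S n `&` ball x (2 * e n)) f z (psi n z x)) =
    (fun x => fine (\esum_(z in S n) (f z (psi n z x))%:E)%E).
  apply/funext => x; have fF := packing_finite hnu hdoubling alpha1 hS 2 n x.
  rewrite (esum_finite_support (F := S n `&` ball x (2 * e n)))//.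
  - by rewrite fsumEFin.
  - by move=> z _; rewrite lee_fin.
  - move=> z Sz nz; have [->|/(psi_support Sz) zx] := eqVneq (psi n z x) 0.
      by rewrite f00.
    by exfalso; apply: nz; split => //; rewrite ballEmdist/= metric_sym.
apply: (@measurableT_comp _ _ _ _ _ _ (@fine R)) => //.
apply: measurable_fun_esum => //.
- exact: (net_countable hnu hdoubling alpha1 hS).
- move=> z Sz; apply/measurable_EFinP; apply: (measurableT_comp (mf z)).
  have [_ _ _ lip] := hpsi n; apply: (@lipschitz_measurable R Z) => x y; exact: lip.
- by move=> z x _ _; rewrite lee_fin.
Qed.

Lemma level_trace_measurable U n :
  measurable_fun setT (level_trace U n : borel Z -> R).
Proof.
(* Positive and negative parts are separated because measurability is obtained from countable sums
   of nonnegative functions. *)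
have -> : level_trace U n =
    (fun x => \sum_(z \in S n `&` ball x (2 * e n)) Num.max (U (z, n) * psi n z x) 0 -
       \sum_(z \in S n `&` ball x (2 * e n)) Num.max (- (U (z, n) * psi n z x)) 0).
  apply/funext => x; have fF := packing_finite hnu hdoubling alpha1 hS 2 n x.
  rewrite level_trace_ball !fsbig_finite//= -sumrB; apply: eq_bigr => z _.
  by case: leP => h1; case: leP => h2; lra.
apply: (@measurable_funB _ (borel Z)).
  apply: (@psi_sum_measurable n (fun z t => Num.max (U (z, n) * t) 0)).
  - by move=> z; rewrite mulr0 maxxx.
  - by move=> z t; rewrite le_max lexx orbT.
  - by move=> z; apply: measurable_maxr => //; exact: mulrl_measurable.
apply: (@psi_sum_measurable n (fun z t => Num.max (- (U (z, n) * t)) 0)).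
- by move=> z; rewrite mulr0 oppr0 maxxx.
- by move=> z t; rewrite le_max lexx orbT.
- by move=> z; apply: measurable_maxr => //; apply: measurableT_comp => //; exact: mulrl_measurable.
Qed.

Lemma limit_trace_measurable U : measurable_fun setT (limit_trace U : borel Z -> R).
Proof.
apply: (@measurableT_comp _ _ _ _ _ _ (@fine R)) => //.
apply: (@measurable_fun_limn_esup _ (borel Z)) => n.
by apply/measurable_EFinP; exact: level_trace_measurable.
Qed.

Definition level_sum U n : \bar R := (\esum_(z in S n)
  (vertex_energy U (z, n) * (vvol (z, n) * e n `^ (- (p * theta)))%:E))%E.

Definition energy_sum U : \bar R := (\esum_(v in vertices)
  (vertex_energy U v * (vvol v * e v.2 `^ (- (p * theta)))%:E))%E.

Let energy_term_ge0 U v :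
  (0 <= vertex_energy U v * (vvol v * e v.2 `^ (- (p * theta)))%:E)%E.
Proof.
by rewrite mule_ge0 ?vertex_energy_ge0// lee_fin mulr_ge0 ?powR_ge0// vol_ge0.
Qed.

Lemma level_sum_ge0 U n : (0 <= level_sum U n)%E.
Proof. by apply: esum_ge0 => z _; exact: (energy_term_ge0 U (z, n)). Qed.

Lemma energy_sum_levels U : energy_sum U = (\esum_(n in [set: int]) level_sum U n)%E.
Proof. by rewrite /energy_sum (esum_vertices (S := S)). Qed.

Lemma energy_sum_ge0 U : (0 <= energy_sum U)%E.
Proof. by apply: esum_ge0 => v _; exact: energy_term_ge0. Qed.

Lemma integral_level_energy : exists2 C : R, 0 < C & forall U n,
  (\int[nu]_x level_energy U n x <= (C * e n `^ (p * theta))%:E * level_sum U n)%E.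
Proof.
have [C C1 HC] := doubling_const hnu hdoubling.
have C00 : 0 < C by exact: lt_le_trans C1.
exists C => // U n; rewrite integral_esum//; last 3 first.
- exact: (net_countable hnu hdoubling alpha1 hS).
- move=> z Sz; apply: measurable_funeM; apply/measurable_EFinP.
  by apply: measurable_indic; exact: measurable_mball.
- by move=> z x _ _; rewrite mule_ge0 ?vertex_energy_ge0// lee_fin indicE.
rewrite /level_sum -esumZl; last 2 first.
- by rewrite mulr_ge0 ?powR_ge0// ltW.
- by move=> z _; exact: (energy_term_ge0 U (z, n)).
apply: le_esum => z _.
have mb : measurable (ball z (2 * e n) : set (borel Z)) by exact: measurable_mball.
rewrite ge0_integralZl//; last 2 first.
- by apply/measurable_EFinP; exact: measurable_indic.
- exact: vertex_energy_ge0.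
rewrite integral_indic// setIT muleCA lee_wpmul2l ?vertex_energy_ge0//.
rewrite -EFinM vol_fin ?mulr_gt0// lee_fin.
have -> : C * e n `^ (p * theta) * (vvol (z, n) * e n `^ (- (p * theta))) = C * vvol (z, n).
  rewrite powRN; field; by rewrite gt_eqF// powR_gt0.
exact: HC.
Qed.

Let wtE i : wt i = alpha `^ (- (theta / 2) * i%:R * p).
Proof.
by rewrite /wt -(powR_mulrn i (ltW qr0)) /qr -(powRrM alpha _ i%:R) -(powRrM alpha _ p).
Qed.

(** Shifting the level by [i] multiplies [e n^(p theta)] by [(wt i)^2]; one factor cancels against
    the weight of the tail. *)
Let wt_scale n (i : nat) : (wt i)^-1 * e (n + i%:Z) `^ (p * theta) =
  e n `^ (p * theta) * wt i.
Proof.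
rewrite (powR_scaleD alpha1) mulrCA; congr (_ * _).
rewrite -(powR_mulrn i (powR_ge0 _ _)) -(powRrM alpha _ i%:R) wtE -powRN -powRD.
  by congr (_ `^ _); field.
by rewrite (gt_eqF alpha0) implybT.
Qed.

Let integral_tail : exists2 C : R, 0 < C & forall U n,
  (\int[nu]_x tail_energy U n x <= (C * e n `^ (p * theta))%:E *
    \esum_(i in [set: nat]) ((wt i)%:E * level_sum U (n + i%:Z)%R))%E.
Proof.
have [C C00 HC] := integral_level_energy; exists C => // U n.
rewrite integral_esum//; last 2 first.
- exact: countableP.
- by move=> i _; apply: measurable_funeM; exact: level_energy_measurable.
rewrite -esumZl; last 2 first.
- by rewrite mulr_ge0 ?powR_ge0// ltW.
- by move=> i _; rewrite mule_ge0 ?level_sum_ge0// lee_fin ltW.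
apply: le_esum => i _.
rewrite ge0_integralZl//; last 3 first.
- exact: level_energy_measurable.
- by move=> x _; exact: level_energy_ge0.
- by rewrite lee_fin invr_ge0 ltW.
apply: le_trans (lee_wpmul2l _ (HC U (n + i%:Z))) _.
  by rewrite lee_fin invr_ge0 ltW.
rewrite !muleA -!EFinM lee_wpmul2r ?level_sum_ge0// lee_fin.
by rewrite mulrCA wt_scale mulrA.
Qed.

Lemma integral_tail_energy : exists2 C : R, 0 < C & forall U n,
  (\int[nu]_x tail_energy U n x <= (C * e n `^ (p * theta))%:E * energy_sum U)%E.
Proof.
have [C C00 HC] := integral_tail; exists C => // U n.
apply: (le_trans (HC U n)); apply: lee_wpmul2l.
  by rewrite lee_fin mulr_ge0 ?powR_ge0// ltW.
apply: (@le_trans _ _ (\esum_(i in [set: nat]) level_sum U (n + i%:Z)%R)%E).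
  apply: le_esum => i _; rewrite -[leRHS]mul1e lee_wpmul2r ?level_sum_ge0// lee_fin.
  rewrite wtE -[leRHS](powRr0 alpha) ler_powR ?(ltW alpha1)// !mulNr oppr_le0.
  by rewrite !mulr_ge0// ltW.
rewrite -nneseries_esumT; last by move=> i; exact: level_sum_ge0.
rewrite -(@esum_int_ge R n (level_sum U)); last by move=> m; exact: level_sum_ge0.
by rewrite energy_sum_levels; apply: le_esum_sub => // m _; exact: level_sum_ge0.
Qed.

(** After [integral_tail] the weights [wt i] no longer depend on [n]. Exchanging the sums gives the
    full energy for every [i], by invariance of the integers under translation, and the [wt i] form
    a geometric series. *)
Lemma integral_tail_energy_sum : exists2 C : R, 0 < C & forall U,
  (\esum_(n in [set: int]) ((e n `^ (- (p * theta)))%:E * \int[nu]_x tail_energy U n x)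
   <= C%:E * energy_sum U)%E.
Proof.
have [C C00 HC] := integral_tail.
have w1 : 0 < qr `^ p < 1.
  by rewrite powR_gt0//= /qr -powRrM mulNr powRN_lt1// mulr_gt0// divr_gt0.
have /andP[_ w11] := w1.
exists (C / (1 - qr `^ p)); first by rewrite divr_gt0// subr_gt0.
move=> U.
apply: (@le_trans _ _ (\esum_(n in [set: int]) (C%:E *
    \esum_(i in [set: nat]) ((wt i)%:E * level_sum U (n + i%:Z)%R)))%E).
  apply: le_esum => n _.
  apply: le_trans (lee_wpmul2l _ (HC U n)) _; first by rewrite lee_fin powR_ge0.
  rewrite muleA -EFinM mulrCA -powRD ?(gt_eqF (e0 n)) ?implybT// addNr powRr0 mulr1.
  by [].
have t0 n i : (0 <= (wt i)%:E * level_sum U (n + i%:Z)%R)%E.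
  by rewrite mule_ge0 ?level_sum_ge0// lee_fin ltW.
rewrite esumZl ?(ltW C00)//; last by move=> n _; apply: esum_ge0 => i _.
rewrite EFinM -muleA lee_pmul2l ?lte_fin//.
rewrite esum_swap//.
rewrite (eq_esum (b := fun i => ((wt i)%:E * energy_sum U)%E)); last first.
  move=> i _; rewrite esumZl ?(ltW (wt_gt0 i))//; last by move=> n _; exact: level_sum_ge0.
  congr (_ * _)%E; rewrite energy_sum_levels.
  rewrite [RHS](@reindex_esum _ _ _ [set: int] _ (fun n => n + i%:Z))//.
  split => // [n m _ _ /addIr//|n _]; exists (n - i%:Z) => //.
  by rewrite subrK.
have [->|nE] := eqVneq (energy_sum U) +oo%E.
  by rewrite [leRHS]gt0_muley ?leey// lte_fin invr_gt0 subr_gt0.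
have fE : energy_sum U \is a fin_num by rewrite ge0_fin_numE ?energy_sum_ge0// ltey.
rewrite -(fineK fE); have E0 : 0 <= fine (energy_sum U) by rewrite fine_ge0// energy_sum_ge0.
rewrite (eq_esum (b := fun i => ((fine (energy_sum U))%:E * (wt i)%:E)%E)); last first.
  by move=> i _; rewrite muleC.
rewrite esumZl//; last by move=> i _; rewrite lee_fin ltW.
rewrite muleC lee_wpmul2r ?lee_fin//.
rewrite -nneseries_esumT; last by move=> i; rewrite lee_fin ltW.
rewrite (eq_eseriesr (g := fun i => (1 * (qr `^ p) ^+ i)%:E)).
  by apply: (le_trans (nneseries_geometric_le ler01 w1)); rewrite mul1r.
move=> i _; rewrite mul1r /wt -(powR_mulrn i (ltW qr0)).
rewrite -(powR_mulrn i (powR_ge0 qr p)) -(powRrM qr i%:R p) -(powRrM qr p i%:R).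
by rewrite mulrC.
Qed.

Lemma level_energy_le_tail U n x : (level_energy U n x <= tail_energy U n x)%E.
Proof.
have := tail_energy_term U n x 0.
by rewrite addr0 /wt expr0 powR1 mul1e.
Qed.

Lemma limit_trace_diff : exists2 C : R, 0 < C & forall U n x,
  ((`|level_trace U n x - limit_trace U x| `^ p)%:E <= C%:E * tail_energy U n x)%E.
Proof.
have [C C00 HC] := limit_trace_anchor.
exists (2 `^ p * (1 + C)); first by rewrite mulr_gt0 ?powR_gt0// addr_gt0.
move=> U n x; rewrite EFinM -muleA.
apply: (@le_trans _ _ ((2 `^ p)%:E * ((`|level_trace U n x - anchor U n x| `^ p)%:E +
    (`|limit_trace U x - anchor U n x| `^ p)%:E))%E).
  rewrite -EFinD -EFinM lee_fin (le_trans _ (powRD_le _ _ _)) ?(ltW p0)//.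
  rewrite ge0_ler_powR ?nnegrE ?addr_ge0 ?(ltW p0)//.
  rewrite -(subrK (anchor U n x) (level_trace U n x)) -addrA.
  by rewrite (le_trans (ler_normD _ _))// addrK lerD2l distrC.
rewrite lee_wpmul2l ?lee_fin ?powR_ge0// EFinD ge0_muleDl ?lee_fin ?ler01 ?(ltW C00)//.
by rewrite mul1e leeD// (le_trans (anchor_trace U n x))// level_energy_le_tail.
Qed.

Lemma integral_trace_diff : exists2 C : R, 0 < C & forall U n,
  (\int[nu]_x (`|level_trace U n x - limit_trace U x| `^ p)%:E
   <= (C * e n `^ (p * theta))%:E * energy_sum U)%E.
Proof.
have [C C00 HC] := limit_trace_diff.
have [C' C'0 HC'] := integral_tail_energy.
exists (C * C'); first by rewrite mulr_gt0.
move=> U n; rewrite -mulrA EFinM -muleA.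
apply: le_trans (lee_wpmul2l _ (HC' U n)); last by rewrite lee_fin ltW.
rewrite -ge0_integralZl//; last 3 first.
- exact: tail_energy_measurable.
- by move=> x _; exact: tail_energy_ge0.
- by rewrite lee_fin ltW.
by apply: ge0_le_integral_lower => x _; rewrite HC lee_fin powR_ge0.
Qed.

(** The trace is compared with its anchor at level 0: the difference is controlled by the tail
    energy there, and the anchor itself by the vertex values at level 0, where the scale is 1. *)
Lemma integral_limit_trace : exists2 C : R, 0 < C & forall U,
  (\int[nu]_x (`|limit_trace U x| `^ p)%:E
   <= C%:E * (energy_sum U + \esum_(z in S 0) (vvol (z, 0) * `|U (z, 0)| `^ p)%:E))%E.
Proof.
have [C C00 HC] := limit_trace_anchor.
have [C' C'0 HC'] := integral_tail_energy.
have [C2 C21 HC2] := doubling_const hnu hdoubling.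
have C20 : 0 < C2 by exact: lt_le_trans C21.
pose K := 2 `^ p * (C * C' + C2).
have K0 : 0 < K by rewrite mulr_gt0 ?powR_gt0// addr_gt0// mulr_gt0.
exists K => // U; pose I := (\esum_(z in S 0%R) (vvol (z, 0%R) * `|U (z, 0%R)| `^ p)%:E)%E.
pose A x := (\esum_(z in S 0%R) ((`|U (z, 0%R)| `^ p)%:E * (\1_(ball z (2 * e 0)) x)%:E))%E.
have A0 x : (0 <= A x)%E by apply: esum_ge0 => z _; rewrite -EFinM lee_fin mulr_ge0 ?powR_ge0// indicE.
have mA : measurable_fun setT (A : borel Z -> \bar R).
  apply: measurable_fun_esum => //.
  - exact: (net_countable hnu hdoubling alpha1 hS).
  - move=> z Sz; apply: measurable_funeM; apply/measurable_EFinP.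
    by apply: measurable_indic; exact: measurable_mball.
have IA : (\int[nu]_x A x <= C2%:E * I)%E.
  rewrite integral_esum//; last 2 first.
  - exact: (net_countable hnu hdoubling alpha1 hS).
  - move=> z Sz; apply: measurable_funeM; apply/measurable_EFinP.
    by apply: measurable_indic; exact: measurable_mball.
  rewrite /I -esumZl ?(ltW C20)//; last first.
    by move=> z _; rewrite lee_fin mulr_ge0 ?powR_ge0// vol_ge0.
  apply: le_esum => z _.
  have mb : measurable (ball z (2 * e 0) : set (borel Z)) by exact: measurable_mball.
  rewrite ge0_integralZl//; last by apply/measurable_EFinP; exact: measurable_indic.
  rewrite integral_indic// setIT vol_fin ?mulr_gt0// -!EFinM lee_fin.
  by rewrite mulrA mulrC ler_wpM2r ?powR_ge0// HC2.
have pt x : ((`|limit_trace U x| `^ p)%:E <= (2 `^ p)%:E * (C%:E * tail_energy U 0 x + A x))%E.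
  apply: (@le_trans _ _ ((2 `^ p)%:E * ((`|limit_trace U x - anchor U 0 x| `^ p)%:E +
    (`|anchor U 0 x| `^ p)%:E))%E).
    rewrite -EFinD -EFinM lee_fin (le_trans _ (powRD_le _ _ _)) ?(ltW p0)//.
    rewrite ge0_ler_powR ?nnegrE ?addr_ge0 ?(ltW p0)//.
    by rewrite -{1}(subrK (anchor U 0 x) (limit_trace U x)) ler_normD.
  rewrite lee_wpmul2l ?lee_fin ?powR_ge0// leeD//.
  apply: le_trans (esum_ge_term (i := near_pt alpha1 hS 0 x) _ _).
  - rewrite indicE mem_set ?mule1// ballEmdist/=; exact: vtx_near.
  - exact: near_ptS.
  - by move=> z _; rewrite -EFinM lee_fin mulr_ge0 ?powR_ge0// indicE.
apply: (@le_trans _ _ (\int[nu]_x ((2 `^ p)%:E * (C%:E * tail_energy U 0 x + A x))))%E.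
  by apply: ge0_le_integral_lower => x _; rewrite pt lee_fin powR_ge0.
have mt : measurable_fun setT ((fun x => (C%:E * tail_energy U 0 x)%E) : borel Z -> \bar R).
  by apply: measurable_funeM; exact: tail_energy_measurable.
have t0 x : (0 <= C%:E * tail_energy U 0 x)%E.
  by rewrite mule_ge0 ?tail_energy_ge0// lee_fin ltW.
rewrite ge0_integralZl//; last 2 first.
- exact: emeasurable_funD.
- by move=> x _; rewrite adde_ge0.
rewrite ge0_integralD// ge0_integralZl//; last 3 first.
- exact: tail_energy_measurable.
- by move=> x _; exact: tail_energy_ge0.
- by rewrite lee_fin ltW.
rewrite /K EFinM -muleA lee_wpmul2l ?lee_fin ?powR_ge0//.
have I0 : (0 <= I)%E.
  by apply: esum_ge0 => z _; rewrite lee_fin mulr_ge0 ?powR_ge0// vol_ge0.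
have h1 : (C%:E * \int[nu]_x tail_energy U 0 x <= (C * C')%:E * energy_sum U)%E.
  rewrite EFinM -muleA; apply: lee_wpmul2l; first by rewrite lee_fin ltW.
  by have := HC' U 0; rewrite oppr0 expr0z powR1 mulr1.
apply: le_trans (leeD h1 IA) _.
rewrite ge0_muleDr ?energy_sum_ge0//; apply: leeD.
  by rewrite lee_wpmul2r ?energy_sum_ge0// lee_fin lerDl ltW.
by rewrite lee_wpmul2r// lee_fin lerDr mulr_ge0// ltW.
Qed.

Lemma level_trace_bounded U n z (r : R) : exists2 M : R, 0 <= M &
  forall x, mdist z x < r -> `|level_trace U n x| <= M.
Proof.
have fF := packing_finite hnu hdoubling alpha1 hS ((r + 2 * e n) / e n) n z.
exists (\sum_(i \in S n `&` ball z ((r + 2 * e n) / e n * e n)) `|U (i, n)|).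
  by rewrite fsbig_finite//=; apply: sumr_ge0.
move=> x zx; rewrite -[X in `|X|]subr0; apply: level_trace_convex => i Si ix.
rewrite subr0 fsbig_finite//=.
have iF : i \in finmap.enum_fset (fset_set (S n `&` ball z ((r + 2 * e n) / e n * e n))).
  rewrite in_fset_set//; apply/mem_set; split => //.
  rewrite ballEmdist/= divfK ?gt_eqF// (le_lt_trans (metric_triangle _ x _))//.
  by rewrite ltrD// metric_sym.
by rewrite (big_rem i)//= lerDl sumr_ge0.
Qed.

(** The discrete trace of level 0 is bounded on the ball, since only finitely many vertices matter,
    and its difference to the limit is in [L^p]. *)
Lemma limit_trace_Lp_loc U z (r : R) : 0 < r -> (energy_sum U < +oo)%E ->
  (\int[nu]_(x in ball z r) (`|limit_trace U x| `^ p)%:E < +oo)%E.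
Proof.
move=> r0 Eoo; have [C C00 HC] := integral_trace_diff.
have [M M0 HM] := level_trace_bounded U 0 z r.
have mb : measurable (ball z r : set (borel Z)) by exact: measurable_mball.
pose D x := (`|level_trace U 0 x - limit_trace U x| `^ p)%:E.
have mD : measurable_fun setT (D : borel Z -> \bar R).
  apply/measurable_EFinP; apply: (measurableT_comp (measurable_powR _)).
  apply: measurableT_comp => //; apply: measurable_funB; first exact: level_trace_measurable.
  exact: limit_trace_measurable.
apply: (@le_lt_trans _ _ (\int[nu]_(x in ball z r) ((2 `^ p)%:E * (D x + (M `^ p)%:E)))%E).
  apply: ge0_le_integral_lower => x zx; rewrite lee_fin powR_ge0/=.
  rewrite -EFinD -EFinM lee_fin (le_trans _ (powRD_le _ _ _)) ?(ltW p0)//.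
  rewrite ge0_ler_powR ?nnegrE ?addr_ge0 ?(ltW p0)//.
  have E : limit_trace U x = level_trace U 0 x - (level_trace U 0 x - limit_trace U x) by ring.
  rewrite {1}E.
  rewrite (le_trans (ler_normB _ _))// addrC lerD2l HM//.
  by move: zx; rewrite ballEmdist.
have D0 x : (0 <= D x)%E by rewrite lee_fin powR_ge0.
have mD' := measurable_funTS (D := ball z r : set (borel Z)) mD.
rewrite ge0_integralZl//; last 2 first.
- exact: emeasurable_funD.
- by move=> x _; rewrite adde_ge0// lee_fin powR_ge0.
rewrite ge0_integralD//; last by move=> x _; rewrite lee_fin powR_ge0.
rewrite integral_cst// vol_fin// lte_mul_pinfty ?lee_fin ?powR_ge0//.
rewrite lte_add_pinfty ?ltry//.
apply: (@le_lt_trans _ _ (\int[nu]_x D x)%E).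
  rewrite integral_mkcond; apply: ge0_le_integral_lower => x _.
  by rewrite patchE; case: ifPn => _; rewrite ?lexx D0.
apply: le_lt_trans (HC U 0) _.
by rewrite lte_mul_pinfty ?lee_fin ?mulr_ge0 ?powR_ge0 ?(ltW C00).
Qed.

End traces.

(** * The Besov bound for traces *)

Section besov_bound.
Context {R : realType} {Z : completeMetricType R}.
Variable nu : {measure set (borel Z) -> \bar R}.
Hypotheses (hnu : metric_measure nu) (hdoubling : doubling nu).
Variables (p theta : R).
Hypotheses (p1 : (1 <= p)%R) (theta01 : (0 < theta < 1)%R).
Variables (alpha tau : R) (S : int -> set Z).
Hypothesis alpha1 : (1 < alpha)%R.
Hypothesis tau3 : (3 < tau)%R.
Hypothesis hS : forall n : int, maximal_separated (alpha ^ (- n))%R (S n).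

Local Open Scope ring_scope.
Local Notation V := (Z * int)%type.
Local Notation e n := (alpha ^ (- (n : int))).
Implicit Types (v w : V) (z x y : Z) (m n : int) (U : V -> R).
Local Notation vertices := (vertices S).
Local Notation vtx := (near_vtx alpha1 hS).
Local Notation vvol := (vvol nu alpha).
Local Notation tail_energy := (tail_energy p theta alpha tau S).
Local Notation energy_sum := (energy_sum nu p theta alpha tau S).
Local Notation anchor := (anchor alpha1 hS).

Let alpha0 : 0 < alpha := alpha_gt0 alpha1.
Hint Resolve alpha0 : core.
Let e0 n : 0 < e n := scale_gt0 alpha1 n.
Hint Resolve e0 : core.
Let p0 : 0 < p := lt_le_trans ltr01 p1.
Hint Resolve p0 : core.
Let theta0 : 0 < theta. Proof. by case/andP: theta01. Qed.
Hint Resolve theta0 : core.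
Let tail0 U n x : (0 <= tail_energy U n x)%E := tail_energy_ge0 p theta01 tau S alpha1 U n x.
Hint Resolve tail0 : core.

Variables (delta : Z -> Z -> R) (k : R).
Hypotheses (k0 : 0 < k) (delta_ge : forall x y, mdist x y <= k * delta x y).
Hypothesis delta_le : forall x y, delta x y <= k * mdist x y.
Hypothesis delta_ball : forall x r, measurable (dball delta x r : set (borel Z)).

Definition besov_integrand (f : Z -> R) x y : \bar R :=
  (((`|f x - f y| `^ p) / (delta x y `^ (p * theta)))%R%:E / nu (dball delta x (delta x y)))%E.

Let B v : set (borel Z) := ball v.1 (2 * e v.2).
Let mB v : measurable (B v). Proof. exact: measurable_mball. Qed.

(** The size of the Besov kernel at pairs of points near [v] whose distance is about [e v.2]. *)
Definition besov_weight v : R := e v.2 `^ (- (p * theta)) / vvol v.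

Lemma besov_weight_ge0 v : 0 <= besov_weight v.
Proof. by rewrite divr_ge0 ?powR_ge0// vol_ge0. Qed.

(** The induced distance distorts radii by the factor [k] at most, and doubling absorbs the
    difference. *)
Lemma vol_dball : exists2 C : R, 0 < C & forall n x y, e (n + 1) <= mdist x y ->
  ((vvol (vtx x n))%:E <= C%:E * nu (dball delta x (delta x y)))%E.
Proof.
pose K := alpha * k ^+ 2.
have K0 : 0 < K by rewrite mulr_gt0 ?exprn_gt0.
have [|C C00 HC] := vol_compare hnu hdoubling (_ : 0 < K + K) K0; first exact: addr_gt0.
exists C => // n x y xy2.
pose r := K^-1 * e n.
have r0 : 0 < r by rewrite mulr_gt0 ?invr_gt0.
have rE : K * r = e n by rewrite /r mulrA divff ?mul1r// gt_eqF.
have h := HC (vtx x n).1 x r r0; rewrite rE in h.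
apply: (@le_trans _ _ (C%:E * (vol nu x r)%:E)%E).
  by rewrite -EFinM lee_fin h// ltW// near_pt_dist.
rewrite lee_pmul2l ?lte_fin// -vol_fin//.
apply: le_measure; rewrite ?inE//; first exact: measurable_mball.
move=> z; rewrite ballEmdist/= /dball/= => xz.
apply: le_lt_trans (delta_le _ _) _.
rewrite -(ltr_pM2l k0) (lt_le_trans _ (delta_ge _ _))//.
apply: lt_le_trans xy2; rewrite (scaleS alpha1) mulrA -expr2 ltr_pdivlMr// mulrC mulrA.
by rewrite -ltr_pdivlMl.
Qed.

(** For [x] distinct from [y], the vertex nearest to [x] at the scale of [mdist x y] has both points
    in its doubled ball, and its single term already dominates the integrand; summing over all
    vertices removes the dependence of the vertex on the pair. *)
Lemma besov_integrand_le (C1 : R) : 0 < C1 -> exists2 C : R, 0 < C & forall U f,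
  (forall n x, ((`|f x - anchor U n x| `^ p)%:E <= C1%:E * tail_energy U n x)%E) ->
  forall x y, (besov_integrand f x y <= C%:E * \esum_(v in vertices)
    (((fun y => ((fun x => (besov_weight v)%:E * (tail_energy U v.2 x + tail_energy U v.2 y))
       \_ (B v)) x) \_ (B v)) y))%E.
Proof.
move=> C10; have [C2 C20 HC2] := vol_dball.
pose K := 2 `^ p * (2 `^ p * (1 + C1) + C1).
have K0 : 0 < K.
  by apply: mulr_gt0; rewrite ?powR_gt0// addr_gt0// mulr_gt0 ?powR_gt0// addr_gt0.
pose K2 := (alpha * k) `^ (p * theta).
have K20 : 0 < K2 by rewrite powR_gt0 ?mulr_gt0.
have KK : 0 < K * K2 * C2 := mulr_gt0 (mulr_gt0 K0 K20) C20.
exists (K * K2 * C2) => // U f Hf x y; set J := (\esum_(v in _) _)%E.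
have w0 v x' y' : (0 <= (besov_weight v)%:E * (tail_energy U v.2 x' + tail_energy U v.2 y'))%E.
  by rewrite mule_ge0 ?adde_ge0// lee_fin besov_weight_ge0.
have t0 v x' y' : (0 <= ((fun y => ((fun x => (besov_weight v)%:E * (tail_energy U v.2 x +
    tail_energy U v.2 y)) \_ (B v)) x') \_ (B v)) y')%E.
  by apply: erestrict_ge0 => y'' _; apply: erestrict_ge0.
have J0 : (0 <= J)%E by apply: esum_ge0 => v _; exact: t0.
have [->|xy] := eqVneq x y.
  by rewrite /besov_integrand subrr normr0 powR0 ?gt_eqF// mul0r mul0e mule_ge0// lee_fin ltW.
have xy0 : 0 < mdist x y by rewrite mdist_gt0.
have [n /andP[n1 n2]] := exists_scale alpha1 xy0.
set v := vtx x n.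
have Vv : vertices v by exact: near_vtxV.
have n22 : e n < 2 * e n by rewrite ltr_pMl// ltr1n.
have xB : B v x by rewrite /B ballEmdist/= (lt_trans _ n22)// near_pt_dist.
have yB : B v y.
  rewrite /B ballEmdist/= (le_lt_trans (metric_triangle _ x _))//.
  by rewrite mulr_natl mulr2n ltrD// near_pt_dist.
have J1 : ((besov_weight v)%:E * (tail_energy U n x + tail_energy U n y) <= J)%E.
  apply: le_trans (esum_ge_term (i := v) _ _) => //.
  by rewrite patchE mem_set// patchE mem_set.
apply: le_trans (lee_wpmul2l _ J1); last by rewrite lee_fin ltW.
have d0 : 0 < delta x y by rewrite -(pmulr_rgt0 _ k0) (lt_le_trans xy0).
have num : ((`|f x - f y| `^ p)%:E <= K%:E * (tail_energy U n x + tail_energy U n y))%E.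
  pose a : R := `|f x - anchor U n x|; pose b : R := `|f y - anchor U n y|.
  pose c : R := `|anchor U n x - anchor U n y|.
  have a0 : 0 <= a := normr_ge0 _; have b0 : 0 <= b := normr_ge0 _.
  have c0 : 0 <= c := normr_ge0 _.
  have E1 : ((a `^ p)%:E <= C1%:E * tail_energy U n x)%E := Hf n x.
  have E2 : ((b `^ p)%:E <= C1%:E * tail_energy U n y)%E := Hf n y.
  have E3 : ((c `^ p)%:E <= tail_energy U n x)%E := le_trans (anchor_same p1 alpha1 tau3 hS U (lt_trans n2 n22))
    (level_energy_le_tail p theta01 tau S alpha1 U n x).
  apply: (@le_trans _ _ ((2 `^ p)%:E * ((2 `^ p)%:E * ((c `^ p)%:E + (a `^ p)%:E) + (b `^ p)%:E))%E).
    suff : `|f x - f y| `^ p <= 2 `^ p * (2 `^ p * (c `^ p + a `^ p) + b `^ p).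
      by rewrite -lee_fin EFinM EFinD EFinM EFinD.
    apply: (@le_trans _ _ ((c + a + b) `^ p)).
      rewrite ge0_ler_powR ?nnegrE ?addr_ge0 ?(ltW p0)//.
      have -> : f x - f y = (anchor U n x - anchor U n y) + (f x - anchor U n x) - (f y - anchor U n y) by ring.
      by rewrite (le_trans (ler_normB _ _))// lerD2r ler_normD.
    rewrite (le_trans (powRD_le _ _ _)) ?addr_ge0 ?(ltW p0)//.
    by rewrite ler_wpM2l ?powR_ge0// lerD2r powRD_le ?(ltW p0)/c/a ?normr_ge0.
  rewrite /K EFinM -muleA lee_wpmul2l ?lee_fin ?powR_ge0//.
  set tx := tail_energy U n x in E1 E3 *; set ty := tail_energy U n y in E2 *.
  have tx0 : (0 <= tx)%E := tail0 U n x.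
  have ty0 : (0 <= ty)%E := tail0 U n y.
  have A0 : (0 <= (2 `^ p * (1 + C1))%:E)%E by rewrite lee_fin mulr_ge0 ?powR_ge0// addr_ge0// ltW.
  have C1' : (0 <= C1%:E)%E by rewrite lee_fin ltW.
  rewrite EFinD ge0_muleDl//; apply: leeD.
    rewrite EFinM -muleA lee_wpmul2l ?lee_fin ?powR_ge0//.
    apply: (@le_trans _ _ ((1 + C1)%:E * tx)%E).
      by rewrite EFinD ge0_muleDl// mul1e; exact: leeD.
    by rewrite lee_wpmul2l ?leeDl// lee_fin addr_ge0// ltW.
  by apply: (le_trans E2); rewrite lee_wpmul2l// leeDr.
pose N := nu (dball delta x (delta x y)); have N0 : (0 <= N)%E by exact: measure_ge0.
have v0 : 0 < vvol v by exact: vvol_gt0.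
have NV : (N^-1 <= (C2 / vvol v)%:E)%E.
  have h := HC2 n x y n1.
  have -> : (C2 / vvol v)%:E = ((vvol v / C2)%:E)^-1%E.
    by rewrite inver gt_eqF ?divr_gt0// invf_div.
  rewrite lee_pV2 ?inE// ?lee_fin ?divr_ge0 ?(ltW v0) ?(ltW C20)//.
  by rewrite mulrC EFinM lee_pdivrMl.
have dV : (delta x y `^ (p * theta))^-1 <= K2 * e n `^ (- (p * theta)).
  rewrite powRN -invf_div lef_pV2 ?posrE ?divr_gt0 ?powR_gt0 ?(mulr_gt0 alpha0 k0)//.
  rewrite ler_pdivrMr ?powR_gt0 ?(mulr_gt0 alpha0 k0)// /K2 -powRM ?(ltW d0)//; last by rewrite mulr_ge0 ?ltW.
  rewrite ge0_ler_powR ?nnegrE ?mulr_ge0 ?(ltW d0) ?(ltW k0) ?(ltW p0) ?(ltW theta0) ?(ltW (e0 _)) ?(ltW alpha0)//.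
  have h := le_trans n1 (delta_ge x y); rewrite (scaleS alpha1) ler_pdivrMr// in h.
  by rewrite (le_trans h)// le_eqVlt; apply/orP; left; apply/eqP; ring.
have T0 : (0 <= tail_energy U n x + tail_energy U n y)%E by exact: adde_ge0.
rewrite /besov_integrand -/N EFinM.
apply: (@le_trans _ _ (K%:E * (tail_energy U n x + tail_energy U n y) *
   (K2 * e n `^ (- (p * theta)))%:E * (C2 / vvol v)%:E)%E).
  rewrite lee_pmul ?inve_ge0 ?mule_ge0 ?lee_fin ?powR_ge0 ?invr_ge0 ?powR_ge0//.
  by rewrite lee_pmul ?lee_fin ?powR_ge0 ?invr_ge0 ?powR_ge0.
rewrite le_eqVlt; apply/orP; left; apply/eqP.
rewrite (muleC K%:E) -!muleA [in RHS]muleA -!EFinM muleC; congr (_ * _)%E.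
by congr (_%:E); rewrite /besov_weight -/v; ring.
Qed.

(** One of the two integrations only produces [nu (B v)], which cancels the volume in
    [besov_weight]. Bounded overlap then collapses each level to an integral over [Z], and
    [integral_tail_energy_sum] adds up the levels. *)
Lemma besov_energy : exists2 C : R, 0 < C & forall U,
  (\int[nu]_y (\int[nu]_x (\esum_(v in vertices)
    (((fun y => ((fun x => (besov_weight v)%:E * (tail_energy U v.2 x + tail_energy U v.2 y))
       \_ (B v)) x) \_ (B v)) y))) <= C%:E * energy_sum U)%E.
Proof.
have [C1 C10 HC1] := integral_tail_energy_sum hnu hdoubling p1 theta01 tau alpha1 hS.
have [C2 C20 HC2] := level_overlap hnu hdoubling alpha1 hS (ltr0Sn R 1).
have [C3 C31 HC3] := doubling_const hnu hdoubling.
have C30 : 0 < C3 by exact: lt_le_trans C31.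
exists (2 * C3 * C2 * C1); first by rewrite !mulr_gt0.
move=> U.
have mt n : measurable_fun setT (tail_energy U n : borel Z -> \bar R).
  exact: (tail_energy_measurable hnu hdoubling p theta01 tau alpha1 hS).
have mtS n (D : set (borel Z)) : measurable_fun D (tail_energy U n : borel Z -> \bar R).
  exact: measurable_funTS.
have cV := vertices_countable hnu hdoubling alpha1 hS.
pose w v : \bar R := (besov_weight v)%:E.
have w0 v : (0 <= w v)%E by rewrite lee_fin besov_weight_ge0.
pose I v : \bar R := (\int[nu]_(x in B v) tail_energy U v.2 x)%E.
have I0 v : (0 <= I v)%E by apply: integral_ge0.
have wt0 v x y : (0 <= w v * (tail_energy U v.2 x + tail_energy U v.2 y))%E.
  by rewrite mule_ge0 ?adde_ge0.
have inner v y : (\int[nu]_(x in B v) (w v * (tail_energy U v.2 x + tail_energy U v.2 y)) =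
    w v * (I v + tail_energy U v.2 y * nu (B v)))%E.
  rewrite ge0_integralZl//; last 2 first.
  - exact: emeasurable_funD.
  - by move=> x _; rewrite adde_ge0.
  by rewrite ge0_integralD// integral_cst.
have minner v : measurable_fun setT
    ((fun y => (w v * (I v + tail_energy U v.2 y * nu (B v)))%E) : borel Z -> \bar R).
  apply: measurable_funeM; apply: emeasurable_funD => //.
  by apply: emeasurable_funM.
have step1 y : (\int[nu]_x (\esum_(v in vertices)
    (((fun y => ((fun x => w v * (tail_energy U v.2 x + tail_energy U v.2 y))
       \_ (B v)) x) \_ (B v)) y)) = \esum_(v in vertices)
     ((fun y => w v * (I v + tail_energy U v.2 y * nu (B v))) \_ (B v)) y)%E.
  rewrite integral_esum//.
  - apply: eq_esum => v _; rewrite [in RHS]patchE; case: ifPn => yB.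
      under eq_integral do rewrite patchE yB.
      by rewrite -integral_mkcond inner.
    by under eq_integral do rewrite patchE (negbTE yB); rewrite integral0.
  - move=> v _; rewrite (_ : (fun x => _) = (if y \in B v then
        (fun x => w v * (tail_energy U v.2 x + tail_energy U v.2 y))%E \_ (B v) else cst 0%E)); last first.
      by apply/funext => x; rewrite patchE; case: ifP.
    case: ifPn => _; last exact: measurable_cst.
    apply: (measurable_restrictT _ (mB v)).1.
    by apply: measurable_funeM; exact: emeasurable_funD.
  - by move=> v x _ _; apply: erestrict_ge0 => y'' _; apply: erestrict_ge0.
under eq_integral do rewrite step1.
rewrite integral_esum//; last 2 first.
- move=> v _; apply: (measurable_restrictT _ (mB v)).1; exact: measurable_funTS.
- by move=> v y _ _; apply: erestrict_ge0 => y' _; rewrite mule_ge0// adde_ge0// mule_ge0.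
apply: (@le_trans _ _ (\esum_(v in vertices) ((2 * C3)%:E * ((e v.2 `^ (- (p * theta)))%:E * I v)))%E).
  apply: le_esum => v _; rewrite -integral_mkcond.
  rewrite ge0_integralZl//; last 2 first.
  - apply: emeasurable_funD => //; apply: emeasurable_funM => //.
  - by move=> x _; rewrite adde_ge0// mule_ge0.
  have -> : (\int[nu]_(x in B v) (I v + tail_energy U v.2 x * nu (B v)) =
      I v * nu (B v) + I v * nu (B v))%E.
    rewrite ge0_integralD//; last 2 first.
    - by move=> x _; rewrite mule_ge0.
    - exact: emeasurable_funM.
    by rewrite integral_cst// ge0_integralZr.
  rewrite [nu (B v)]vol_fin ?mulr_gt0//.
  rewrite (muleC (I v)) -ge0_muleDl ?lee_fin ?vol_ge0// -EFinD !muleA /w -!EFinM.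
  rewrite lee_wpmul2r// lee_fin /besov_weight.
  have v0 : 0 < vvol v by exact: vvol_gt0.
  have h := HC3 v.1 _ (e0 v.2); rewrite -/(vvol v) in h.
  rewrite mulrAC ler_pdivrMr// mulrC -mulrA mulrCA -mulr2n.
  rewrite mulrC ler_wpM2l ?powR_ge0// -mulrA -[leLHS]mulr_natl.
  by rewrite ler_wpM2l.
rewrite esumZl ?mulr_ge0 ?(ltW C30)//; last first.
  by move=> v _; rewrite mule_ge0// lee_fin powR_ge0.
rewrite -(mulrA (2 * C3)) [in leRHS]EFinM -[leRHS]muleA.
apply: lee_wpmul2l; first by rewrite lee_fin mulr_ge0// ltW.
rewrite (esum_vertices (S := S))//; last first.
  by move=> v; rewrite mule_ge0// lee_fin powR_ge0.
apply: (@le_trans _ _ (\esum_(n in [set: int]) (C2%:E * ((e n `^ (- (p * theta)))%:E *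
    \int[nu]_x tail_energy U n x)))%E).
  apply: le_esum => n _.
  rewrite (esumZl (a := fun z => I (z, n)) (powR_ge0 (e n) (- (p * theta)))); last by [].
  rewrite muleCA lee_wpmul2l ?lee_fin ?powR_ge0//.
  exact: (HC2 n (S n) setT (tail_energy U n)).
rewrite esumZl ?(ltW C20)//; last first.
  by move=> n _; rewrite mule_ge0 ?lee_fin ?powR_ge0 ?integral_ge0.
by rewrite EFinM -muleA lee_pmul2l ?lte_fin// HC1.
Qed.

End besov_bound.

(** The substitution [s -> t s], obtained by dominating the push-forward of Lebesgue measure; the
    image of [[0, 1]] lies in [[0, 1]]. *)
Lemma integral_dilation {R : realType} (t : R) (f : measurableTypeR R -> \bar R) :
  (0 < t <= 1)%R -> measurable_fun (`[0%R, 1%R]%classic : set (measurableTypeR R)) f ->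
  (forall s, (0 <= s <= 1)%R -> 0 <= f s) ->
  t%:E * \int[lebesgue_measure]_(s in `[0%R, 1%R]) f (t * s)%R <=
  \int[lebesgue_measure]_(s in `[0%R, 1%R]) f s.
Proof.
move=> /andP[t0 t1] mf f0.
pose F := f \_ (`[0%R, 1%R] : set (measurableTypeR R)).
have F0 s : 0 <= F s.
  by apply: erestrict_ge0 => x /=; rewrite in_itv/= => /f0.
have mF : measurable_fun setT F by exact/(measurable_restrictT _ _).1.
have md : measurable_fun setT ((fun s => t * s)%R : measurableTypeR R -> measurableTypeR R).
  exact: mulrl_measurable.
have t0' : (0 <= t^-1)%R by rewrite invr_ge0 ltW.
rewrite -lee_pdivlMl//.
apply: (@le_trans _ _ (\int[lebesgue_measure]_s F (t * s)%R)).
  rewrite integral_mkcond; apply: ge0_le_integral_lower => s _; rewrite patchE.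
  case: ifPn => [/set_mem/=|_]; last by rewrite lexx F0.
  rewrite in_itv/= => /andP[s0 s1].
  have ts : (0 <= t * s <= 1)%R by rewrite mulr_ge0 ?(ltW t0)//= mulr_ile1// ltW.
  by rewrite f0//= /F patchE mem_set//= in_itv.
have -> : \int[lebesgue_measure]_s F (t * s)%R =
    \int[pushforward lebesgue_measure ((fun s => t * s)%R : measurableTypeR R -> measurableTypeR R)]_s F s.
  by rewrite ge0_integral_pushforward// => s _.
rewrite [X in _ <= _ * X]integral_mkcond -/F -[t^-1%R]/((NngNum t0')%:num).
rewrite -ge0_integral_mscale//.
apply: ge0_le_measure_integral => // A mA.
apply: le_lebesgue_measure => //; first by rewrite /= invr_gt0.
move=> a b ab.
apply: (@le_trans _ _ (lebesgue_measure (`](a / t)%R, (b / t)%R]%classic : set (measurableTypeR R)))).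
  rewrite le_eqVlt; apply/orP; left; apply/eqP; rewrite /= /pushforward.
  congr (lebesgue_measure _); apply/seteqP; split => s /=;
    rewrite !in_itv/= ltr_pdivrMr// ler_pdivlMr// mulrC//.
rewrite lebesgue_measure_itv/= lte_fin ltr_pM2r ?invr_gt0//.
case: ifPn => [_|_]; last by rewrite lee_fin mulr_ge0// subr_ge0.
by rewrite -EFinB lee_fin -mulrBl mulrC.
Qed.

(** * Vertex values of functions with an upper gradient *)

Section newtonian_traces.
Context {R : realType} {Z : completeMetricType R}.
Variable nu : {measure set (borel Z) -> \bar R}.
Hypotheses (hnu : metric_measure nu) (hdoubling : doubling nu).
Variables (p theta : R).
Hypotheses (p1 : (1 <= p)%R) (theta01 : (0 < theta < 1)%R).
Variables (alpha tau : R) (S : int -> set Z).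
Hypothesis alpha1 : (1 < alpha)%R.
Hypothesis tau3 : (3 < tau)%R.
Hypothesis hS : forall n : int, maximal_separated (alpha ^ (- n))%R (S n).
Context {Xbar : completeMetricType R} (iota : (Z * int -> R) -> Xbar).
Hypothesis hiota : is_completion alpha tau S iota.
Variables (mu mu_beta : {measure set (borel Xbar) -> \bar R}).
Hypothesis hmu : is_mu alpha tau S iota nu mu.
Hypothesis hmu_beta : is_mu_beta alpha tau S iota (p * (1 - theta))%R mu mu_beta.

Local Open Scope ring_scope.
Local Notation V := (Z * int)%type.
Local Notation e n := (alpha ^ (- (n : int))).
Implicit Types (v w : V) (z : Z) (m n : int).
Local Notation vertices := (vertices S).
Local Notation adj := (adj alpha tau S).
Local Notation X := (fillingX alpha tau S).
Local Notation Xrho := (Xrho alpha tau S iota).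
Local Notation vvol := (vvol nu alpha).
Local Notation vmass := (vmass nu alpha (p * (1 - theta))).
Local Notation edge_path := (edge_path iota).
Local Notation energy_sum := (energy_sum nu p theta alpha tau S).
Local Notation dist := (fun x y : Xbar => (mdist x y)%:E).

Let alpha0 : 0 < alpha := alpha_gt0 alpha1.
Hint Resolve alpha0 : core.
Let e0 n : 0 < e n := scale_gt0 alpha1 n.
Hint Resolve e0 : core.
Let p0 : 0 < p := lt_le_trans ltr01 p1.
Hint Resolve p0 : core.
Let theta0 : 0 < theta. Proof. by case/andP: theta01. Qed.
Hint Resolve theta0 : core.
Let beta0 : 0 < p * (1 - theta).
Proof. by rewrite mulr_gt0// subr_gt0; case/andP: theta01. Qed.

Let edge_lip v w (s t : R) : adj v w -> 0 <= s -> s <= t -> t <= 1 ->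
  mdist (edge_path v w s) (edge_path v w t) <= alpha * e v.2 * (t - s).
Proof.
move=> vw s0 st t1; have := @iota_edge _ _ _ _ _ alpha1 _ _ hiota v w s t vw.
rewrite !in_itv/= s0 (le_trans st t1) t1 (le_trans s0 st) distrC ger0_norm ?subr_ge0//.
by move=> /(_ isT isT).
Qed.

(** Initial segments of edges are the curves on which upper gradients are tested: [t = 1] compares
    two vertices, and general [t] compares a vertex with the other points of the edge. *)
Lemma subedge_rectifiable v w (t : R) : adj v w -> 0 < t <= 1 ->
  rectifiable_curve dist Xrho 0 1 (fun s => edge_path v w (t * s)) /\
  nonconstant_curve 0 1 (fun s => edge_path v w (t * s)).
Proof.
move=> vw /andP[t0 t1].
have lip (s s' : R) : 0 <= s -> s <= s' -> s' <= 1 ->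
    (dist (edge_path v w (t * s)) (edge_path v w (t * s')) <= (alpha * e v.2 * t * (s' - s))%:E)%E.
  move=> s0 ss s1; rewrite lee_fin -mulrA mulrBr; apply: edge_lip => //.
  - by rewrite mulr_ge0// ltW.
  - by rewrite ler_pM2l.
  - by rewrite mulr_ile1 ?(ltW t0) ?(le_trans s0 ss).
split; last first.
  exists 0, 1; split; rewrite ?in_itv/= ?lexx ?ler01//.
  rewrite mulr0 mulr1 /edge_path => /(iota_inj alpha1 hiota).
  have X0 : X (edge_pt v w 0) by apply: fillingX_edge => //; rewrite in_itv/= lexx ler01.
  have Xt : X (edge_pt v w t) by apply: fillingX_edge => //; rewrite in_itv/= (ltW t0).
  move=> /(_ X0 Xt) /(congr1 (fun f => f w)); rewrite !edge_ptr ?(adj_neq vw)// => /esym/eqP.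
  by rewrite gt_eqF.
split => //.
- move=> y [s /=]; rewrite in_itv/= => /andP[s0 s1] <-.
  apply: (edge_set_sub (v := v) (w := w)) => //; exists (t * s) => //=.
  by rewrite in_itv/= mulr_ge0 ?(ltW t0)//= mulr_ile1// ltW.
- move=> s s01 r r0; pose K := alpha * e v.2.
  have K0 : 0 < K by rewrite mulr_gt0.
  apply/nbhs_ballP; exists (r / K) => /=; first by rewrite divr_gt0.
  move=> s' /=; rewrite /ball/= => ss s'01; rewrite lte_fin.
  rewrite (le_lt_trans (iota_edge alpha1 hiota vw _ _))//.
  + by move: s01; rewrite !in_itv/= => /andP[? ?]; rewrite mulr_ge0 ?(ltW t0)//= mulr_ile1// ltW.
  + by move: s'01; rewrite !in_itv/= => /andP[? ?]; rewrite mulr_ge0 ?(ltW t0)//= mulr_ile1// ltW.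
  rewrite -mulrBr normrM (gtr0_norm t0) -/K mulrC -ltr_pdivlMr//.
  by apply: le_lt_trans ss; rewrite ler_piMl.
- have := @curve_length_lip R Xbar dist 0 1 (fun s => edge_path v w (t * s))
    (alpha * e v.2 * t) ler01 lip.
  by move=> /le_lt_trans; apply; rewrite ltry.
Qed.

Lemma edge_comp_measurable v w (h : borel Xbar -> \bar R) : adj v w ->
  measurable_fun (Xrho : set (borel Xbar)) h -> measurable_fun
  (`[0, 1]%classic : set (measurableTypeR R)) (fun s => h (edge_path v w s)).
Proof.
move=> vw mh.
apply: (@measurable_comp _ _ _ (measurableTypeR R) (borel Xbar) (\bar R) Xrho h _ (edge_path v w)) => //.
- exact: (Xrho_measurable hnu hdoubling alpha1 tau3 hS hiota).
- by move=> _ [s s01 <-]; apply: (edge_set_sub vw); exists s.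
- exact: (edge_path_measurable alpha1 hiota).
Qed.

Section upper_gradients.
Variables (u g : Xbar -> \bar R).
Hypothesis hug : upper_gradient Xrho u g.

Let edge_mean v w : \bar R :=
  (\int[lebesgue_measure]_(s in `[0%R, 1%R]) (g (edge_path v w s) `^ p))%E.

Let g_edge_ge0 v w s : adj v w -> 0 <= s <= 1 -> (0 <= g (edge_path v w s))%E.
Proof.
move=> vw s01; have [g0 _ _] := hug; apply: g0.
by apply: (edge_set_sub vw); exists s => //=; rewrite in_itv.
Qed.

Let g_edge_measurable v w : adj v w -> measurable_fun
  (`[0, 1]%classic : set (measurableTypeR R)) (fun s => g (edge_path v w s)).
Proof.
by move=> vw; have [_ mg _] := hug; exact: edge_comp_measurable.
Qed.

(** An upper gradient must have infinite integral on a curve at one end of which [u] is infinite, so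
    a finite mean of [g^p] over the edge forces finite values. The bound is the upper gradient
    inequality followed by [mean_poweR]. *)
Lemma subedge_diff v w (t : R) : adj v w -> 0 < t <= 1 -> (edge_mean v w < +oo)%E ->
  [/\ u (iota (vertex_pt v)) \is a fin_num, u (edge_path v w t) \is a fin_num &
  ((`|u (iota (vertex_pt v)) - u (edge_path v w t)| `^ p)%E <=
   ((2 * alpha * e v.2) `^ p)%:E * edge_mean v w)%E].
Proof.
move=> vw t01 moo; have /andP[t0 t1] := t01.
have [rc nc] := subedge_rectifiable vw t01.
have [_ _ /(_ _ _ _ rc nc)] := hug.
rewrite mulr0 mulr1 {1 2 4}/edge_path edge_pt0.
set I := line_integral _ _ _ _ _ => -[hfin hinf].
pose J := (\int[lebesgue_measure]_(s in `[0%R, 1%R]) g (edge_path v w s))%E.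
have K0 : 0 < alpha * e v.2 by rewrite mulr_gt0.
have Kt0 : 0 < alpha * e v.2 * t by rewrite mulr_gt0.
have IJ : (I <= (alpha * e v.2)%:E * J)%E.
  have := @integral_dilation R t (fun s => g (edge_path v w s)) t01 (g_edge_measurable vw)
    (fun s => g_edge_ge0 vw).
  rewrite -/J => hd.
  apply: le_trans (lee_wpmul2l _ hd); last by rewrite lee_fin ltW.
  rewrite muleA -EFinM; apply: line_integral_lip => //.
  - by move=> x y; rewrite lee_fin mdist_ge0.
  - by move=> x y z; rewrite -EFinD lee_fin metric_triangle.
  - move=> s s' s0 ss s1; rewrite lee_fin -mulrA mulrBr; apply: edge_lip => //.
    + by rewrite mulr_ge0// ltW.
    + by rewrite ler_pM2l.
    + by rewrite mulr_ile1 ?(ltW t0) ?(le_trans s0 ss).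
  - move=> s /andP[s0 s1]; apply: g_edge_ge0 => //.
    by rewrite mulr_ge0 ?(ltW t0)//= mulr_ile1// ltW.
  - apply: (@measurable_comp _ _ _ (measurableTypeR R) (measurableTypeR R) (\bar R)
      (`[0, 1]%classic) (fun s => g (edge_path v w s)) _ (fun s => t * s)) => //.
    + move=> y [s /=]; rewrite !in_itv/= => /andP[s0 s1] <-.
      by rewrite mulr_ge0 ?(ltW t0)//= mulr_ile1// ltW.
    + exact: g_edge_measurable.
    + by apply: measurable_funTS; exact: mulrl_measurable.
have J0 : (0 <= J)%E by apply: integral_ge0 => s /=; rewrite in_itv/=; exact: g_edge_ge0.
have Jp : (J `^ p <= (2 `^ p)%:E * edge_mean v w)%E.
  have L1 : lebesgue_measure (`[0, 1]%classic : set (measurableTypeR R)) = 1%E.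
    by rewrite lebesgue_measure_itv/= lte_fin ltr01 oppr0 adde0.
  have D0 : (0 < lebesgue_measure (`[0%R, 1%R]%classic : set (measurableTypeR R)) < +oo)%E.
    by rewrite L1 lte01 ltry.
  have h := @mean_poweR _ _ _ lebesgue_measure (`[0, 1]%classic : set (measurableTypeR R)) p
    (measurable_itv _) D0 p1 _ (g_edge_measurable vw).
  apply: le_trans (h _) _; first by move=> s /=; rewrite in_itv/=; exact: g_edge_ge0.
  by rewrite [X in fine X]L1 /= powR1 mulr1.
have Joo : (J < +oo)%E.
  rewrite ltey; apply/eqP => Joo; move: Jp; rewrite Joo poweRyr ?gt_eqF//.
  rewrite leye_eq => /eqP h.
  have : ((2 `^ p)%:E * edge_mean v w < +oo)%E by rewrite lte_mul_pinfty ?lee_fin ?powR_ge0.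
  by rewrite h.
have Ioo : (I < +oo)%E.
  by apply: le_lt_trans IJ _; rewrite lte_mul_pinfty ?lee_fin// ltW.
have /andP[fu fw] : (u (iota (vertex_pt v)) \is a fin_num) && (u (iota (edge_pt v w t)) \is a fin_num).
  by apply: contraLR Ioo => /hinf ->.
split => //.
have h := hfin ltac:(by rewrite fu fw).
have h2 := le_trans h IJ.
apply: (@le_trans _ _ (((alpha * e v.2)%:E * J) `^ p)%E).
  rewrite {1}/edge_path edge_pt0 in h2.
  apply: gt0_ler_poweR => //; rewrite ?in_itv/= ?abse_ge0 ?leey ?mule_ge0 ?lee_fin ?(ltW K0) ?(ltW p0)//.
rewrite poweRM//; last by rewrite lee_fin ltW.
have -> : (2 * alpha * e v.2) `^ p = (alpha * e v.2) `^ p * 2 `^ p.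
  by rewrite -powRM ?(ltW K0)//; congr (_ `^ _); ring.
rewrite poweR_EFin EFinM -muleA.
by rewrite lee_wpmul2l// lee_fin powR_ge0.
Qed.

Let U v : R := fine (u (iota (vertex_pt v))).

Lemma edge_energy v w : adj v w -> (edge_mean v w < +oo)%E ->
  ((`|U v - U w| `^ p)%:E <= ((2 * alpha * e v.2) `^ p)%:E * edge_mean v w)%E.
Proof.
move=> vw moo; have t1 : 0 < (1 : R) <= 1 by rewrite ltr01 lexx.
have [fv] := subedge_diff vw t1 moo.
rewrite /edge_path edge_pt1 => fw.
have -> : (`|u (iota (vertex_pt v)) - u (iota (vertex_pt w))| `^ p)%E =
    (`|U v - U w| `^ p)%:E.
  by rewrite -[u (iota (vertex_pt v))](fineK fv) -[u (iota (vertex_pt w))](fineK fw) -EFinB /abse poweR_EFin.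
by [].
Qed.

Hypothesis g_fin : (\int[mu_beta]_(y in Xrho) (g y `^ p) < +oo)%E.

Let mgp : measurable_fun (Xrho : set (borel Xbar)) (fun y => (g y `^ p)%E).
Proof.
have [_ mg _] := hug.
by apply: (@measurableT_comp _ _ _ _ _ _ (fun x : \bar R => (x `^ p)%E)) => //; exact: measurable_poweR.
Qed.

Let edge_mean_ge0 v w : (0 <= edge_mean v w)%E.
Proof. by apply: integral_ge0 => s _; exact: poweR_ge0. Qed.

Lemma edge_mean_fin v w : adj v w -> (edge_mean v w < +oo)%E.
Proof.
move=> vw; have [C C0 HC] := edge_integral_le hnu hdoubling alpha1 tau3 hS hiota beta0 hmu hmu_beta.
have h := HC _ mgp (fun y _ => poweR_ge0 _ _).
have m0 := vmass_gt0 hnu alpha1 (p * (1 - theta)) v.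
have t0 v' w' : (0 <= (vmass v')%:E * edge_mean v' w')%E.
  by rewrite mule_ge0// lee_fin ltW// (vmass_gt0 hnu alpha1).
have : ((vmass v)%:E * edge_mean v w < +oo)%E.
  apply: le_lt_trans (le_trans _ h) _; last first.
    by rewrite lte_mul_pinfty// ?lee_fin// ltW.
  apply: le_trans (esum_ge_term (i := v) _ _); last 2 first.
  - by case: vw.
  - by move=> v' _; apply: esum_ge0 => w' _; exact: t0.
  by apply: (esum_ge_term (i := w)) => // w' _; exact: t0.
apply: contraTT; rewrite -!leNgt !leye_eq => /eqP ->.
by rewrite gt0_muley ?lte_fin.
Qed.

Lemma vertex_fin v : vertices v -> u (iota (vertex_pt v)) \is a fin_num.
Proof.
move=> Vv; have [w vw] := exists_adj alpha1 tau3 hS Vv.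
have t1 : 0 < (1 : R) <= 1 by rewrite ltr01 lexx.
by have [] := subedge_diff vw t1 (edge_mean_fin vw).
Qed.

Lemma energy_sum_le (C : R) : (forall h : borel Xbar -> \bar R,
    measurable_fun (Xrho : set (borel Xbar)) h -> (forall y, Xrho y -> 0 <= h y)%E ->
    (\esum_(v in vertices) \esum_(w in adj v) ((vmass v)%:E *
      \int[lebesgue_measure]_(t in `[0%R, 1%R]) h (edge_path v w t))
    <= C%:E * \int[mu_beta]_(y in Xrho) h y)%E) ->
  (energy_sum U <= ((2 * alpha) `^ p * C)%:E * \int[mu_beta]_(y in Xrho) (g y `^ p))%E.
Proof.
move=> HC; have h := HC _ mgp (fun y _ => poweR_ge0 _ _).
rewrite EFinM -muleA; apply: le_trans (lee_wpmul2l _ h); last by rewrite lee_fin powR_ge0.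
have m0 v : 0 <= vmass v by exact/ltW/(vmass_gt0 hnu alpha1).
rewrite -esumZl ?powR_ge0//; last first.
  move=> v _; apply: esum_ge0 => w _; rewrite mule_ge0 ?lee_fin ?m0//.
  exact: edge_mean_ge0.
apply: le_esum => v Vv.
have c0 : 0 <= vvol v * e v.2 `^ (- (p * theta)) by rewrite mulr_ge0 ?powR_ge0// vol_ge0.
rewrite /vertex_energy [leLHS]muleC -[leLHS]esumZl//.
rewrite -esumZl ?powR_ge0//; last first.
  by move=> w _; rewrite mule_ge0 ?lee_fin ?m0//; exact: edge_mean_ge0.
apply: le_esum => w vw.
apply: le_trans (lee_wpmul2l _ (edge_energy vw (edge_mean_fin vw))) _; first by rewrite lee_fin.
rewrite !muleA -!EFinM lee_wpmul2r// lee_fin.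
rewrite [(2 * alpha * _) `^ _]powRM ?mulr_ge0 ?(ltW (e0 _)) ?(ltW alpha0)// /vmass.
(* The value of [beta] enters here: [beta - p = - p theta] turns the mass of the edge into the
   weight of the discrete energy. *)
have -> : e v.2 `^ (p * (1 - theta)) = e v.2 `^ (- (p * theta)) * e v.2 `^ p.
  by rewrite -powRD; [congr (_ `^ _); ring|rewrite (gt_eqF (e0 _)) implybT].
by rewrite le_eqVlt; apply/orP; left; apply/eqP; ring.
Qed.

Section base_level.
Variable u' : borel Xbar -> \bar R.
Hypotheses (mu' : measurable_fun (Xrho : set (borel Xbar)) u')
  (uu' : u = u' %[ae mu_beta in Xrho]).

(** For every [t] the value at [v] is at most the value at the point [t] plus the difference between
    them; integration over [t] turns the former into an average of [|u|^p] over the edge. *)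
Lemma vertex_power_le v w : adj v w -> e v.2 = 1 ->
  ((`|U v| `^ p)%:E <= (2 `^ p)%:E *
    (\int[lebesgue_measure]_(t in `[0%R, 1%R]) (`|u' (edge_path v w t)| `^ p)
     + ((2 * alpha) `^ p)%:E * edge_mean v w))%E.
Proof.
move=> vw ev; have Vv : vertices v by case: vw.
have [N [mN N0 HN]] := uu'.
have [c c0 Hc] := mu_beta_edge_ge hnu hdoubling alpha1 tau3 hS hiota beta0 hmu hmu_beta.
have cm : 0 < c * vmass v by rewrite mulr_gt0// (vmass_gt0 hnu alpha1).
pose A : set (measurableTypeR R) := [set t | t \in `[0%R, 1%R] /\ N (edge_path v w t)].
have mA : measurable A := edge_path_measurable alpha1 hiota vw (measurable_itv _) mN.
(* By [mu_beta_edge_ge], a [mu_beta]-null set meets an edge in a null set of parameters, so the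
   Borel representative [u'] can be used on almost all of the edge. *)
have A0 : lebesgue_measure A = 0%E.
  have := Hc v w N vw mN; rewrite N0 -/A => h.
  apply/eqP; rewrite eq_le measure_ge0 andbT.
  by rewrite -(lee_pmul2l _ (_ : (0 < (c * vmass v)%:E)%E)) ?lte_fin// mule0.
have moo := edge_mean_fin vw.
have fm : edge_mean v w \is a fin_num by rewrite ge0_fin_numE.
pose K : R := (2 * alpha) `^ p * fine (edge_mean v w).
have KE : (((2 * alpha) `^ p)%:E * edge_mean v w)%E = K%:E by rewrite EFinM fineK.
have K0 : 0 <= K by rewrite mulr_ge0 ?powR_ge0// fine_ge0.
pose hh (t : measurableTypeR R) := (`|u' (edge_path v w t)| `^ p)%E.
have mh : measurable_fun (`[0, 1]%classic : set (measurableTypeR R)) hh.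
  apply: (@measurableT_comp _ _ _ _ _ _ (fun x : \bar R => (x `^ p)%E)); first exact: measurable_poweR.
  apply: (@measurableT_comp _ _ _ _ _ _ (@abse R)) => //.
  exact: (edge_comp_measurable vw mu').
have L1 : lebesgue_measure (`[0, 1]%classic : set (measurableTypeR R)) = 1%E.
  by rewrite lebesgue_measure_itv/= lte_fin ltr01 oppr0 adde0.
have hh0 t : (0 <= hh t)%E by exact: poweR_ge0.
apply: (@le_trans _ _ (\int[lebesgue_measure]_(t in `[0%R, 1%R]) ((2 `^ p)%:E * (hh t + K%:E)))%E); last first.
  rewrite ge0_integralZl//; last 2 first.
  - exact: emeasurable_funD.
  - by move=> t _; rewrite adde_ge0// lee_fin.
  rewrite ge0_integralD//.
  by rewrite integral_cst// [X in (K%:E * X)%E]L1 mule1 KE.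
rewrite -[leLHS]mule1 -[X in (_ * X)%E]L1 -integral_cst//.
apply: ae_ge0_le_integral => //.
- by move=> t _; rewrite lee_fin powR_ge0.
- by move=> t _; rewrite mule_ge0 ?lee_fin ?powR_ge0 ?adde_ge0.
- by apply: measurable_funeM; exact: emeasurable_funD.
(* The parameter 0 is excluded because its initial segment is a constant curve, on which upper
   gradients are not tested. *)
exists (A `|` [set 0]); split.
- exact: measurableU.
- apply/eqP; rewrite eq_le measure_ge0 andbT.
  by apply: (le_trans (measureU2 _ _ _)) => //; rewrite [X in (X + _)%E]A0 [X in (_ + X)%E]lebesgue_measure_set1 adde0.
move=> t /= /not_implyP[]; rewrite in_itv/= => /andP[t0 t1] nle.
apply: contrapT => /not_orP[At nt0]; apply: nle.
have t0' : 0 < t by rewrite lt_neqAle t0 eq_sym andbT; apply/eqP.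
have ut : u (edge_path v w t) = u' (edge_path v w t).
  apply: contrapT => ne; apply: At; split; first by rewrite in_itv/= t0.
  apply: HN => h; apply: ne; apply: h; apply: (edge_set_sub vw).
  by exists t => //=; rewrite in_itv/= t0.
have tI : 0 < t <= 1 by rewrite t0'.
have [fv ft hd] := subedge_diff vw tI moo.
rewrite ev mulr1 KE in hd; rewrite /hh -ut -(fineK ft).
rewrite -(fineK fv) -(fineK ft) /= in hd; rewrite lee_fin in hd.
rewrite /= -EFinD -EFinM lee_fin.
rewrite (@le_trans _ _ (2 `^ p * (`|fine (u (edge_path v w t))| `^ p +
   `|U v - fine (u (edge_path v w t))| `^ p)))//; last first.
  by rewrite ler_wpM2l ?powR_ge0// lerD2l.
rewrite (le_trans _ (powRD_le _ _ _)) ?(ltW p0)//.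
rewrite ge0_ler_powR ?nnegrE ?addr_ge0 ?(ltW p0)//.
by rewrite -{1}(subrK (fine (u (edge_path v w t))) (U v)) addrC (le_trans (ler_normD _ _)).
Qed.

(** At level 0 the mass [vmass] equals [vvol], so one edge per vertex and the edge integral estimate
    bound the level by the Newtonian energy. *)
Lemma base_level_le (C : R) : 0 < C -> (forall h : borel Xbar -> \bar R,
    measurable_fun (Xrho : set (borel Xbar)) h -> (forall y, Xrho y -> 0 <= h y)%E ->
    (\esum_(v in vertices) \esum_(w in adj v) ((vmass v)%:E *
      \int[lebesgue_measure]_(t in `[0%R, 1%R]) h (edge_path v w t))
    <= C%:E * \int[mu_beta]_(y in Xrho) h y)%E) ->
  (\esum_(z in S 0) (vvol (z, 0) * `|U (z, 0)| `^ p)%:E <=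
    (2 `^ p * C)%:E * (\int[mu_beta]_(y in Xrho) (`|u y| `^ p) +
      ((2 * alpha) `^ p)%:E * \int[mu_beta]_(y in Xrho) (g y `^ p)))%E.
Proof.
move=> C0 HC.
have m0 v : 0 <= vmass v by exact/ltW/(vmass_gt0 hnu alpha1).
have -> : (\int[mu_beta]_(y in Xrho) (`|u y| `^ p) = \int[mu_beta]_(y in Xrho) (`|u' y| `^ p))%E.
  apply: ae_eq_integral_lower; have [N [mN N0 HN]] := uu'; exists N; split => // y ny.
  by apply: HN => h; apply: ny => Xy; rewrite h.
pose h y := ((`|u' y| `^ p) + ((2 * alpha) `^ p)%:E * (g y `^ p))%E.
have mh1 : measurable_fun (Xrho : set (borel Xbar)) (fun y => (`|u' y| `^ p)%E).
  apply: (@measurableT_comp _ _ _ _ _ _ (fun x : \bar R => (x `^ p)%E)); first exact: measurable_poweR.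
  exact: (@measurableT_comp _ _ _ _ _ _ (@abse R)).
have mh2 : measurable_fun (Xrho : set (borel Xbar)) (fun y => (((2 * alpha) `^ p)%:E * (g y `^ p))%E).
  exact: measurable_funeM.
have mh : measurable_fun (Xrho : set (borel Xbar)) (h : borel Xbar -> \bar R) by exact: emeasurable_funD.
have h20 y : (0 <= ((2 * alpha) `^ p)%:E * (g y `^ p))%E by rewrite mule_ge0 ?lee_fin ?powR_ge0// poweR_ge0.
have h0 y : (0 <= h y)%E by rewrite adde_ge0// poweR_ge0.
have mX := Xrho_measurable hnu hdoubling alpha1 tau3 hS hiota.
have -> : (\int[mu_beta]_(y in Xrho) (`|u' y| `^ p) +
    ((2 * alpha) `^ p)%:E * \int[mu_beta]_(y in Xrho) (g y `^ p) = \int[mu_beta]_(y in Xrho) h y)%E.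
  rewrite ge0_integralD//; last by move=> y _; exact: poweR_ge0.
  by rewrite ge0_integralZl ?lee_fin ?powR_ge0// => y _; exact: poweR_ge0.
rewrite EFinM -muleA; apply: le_trans (lee_wpmul2l _ (HC h mh (fun y _ => h0 y))); last first.
  by rewrite lee_fin powR_ge0.
have t0 v w : (0 <= (vmass v)%:E * \int[lebesgue_measure]_(t in `[0%R, 1%R]) h (edge_path v w t))%E.
  by rewrite mule_ge0// ?lee_fin ?m0// integral_ge0.
rewrite -esumZl ?powR_ge0//; last by move=> v _; apply: esum_ge0.
rewrite (esum_vertices (S := S))//; last by move=> v; rewrite mule_ge0 ?lee_fin ?powR_ge0// esum_ge0.
apply: le_trans (esum_ge_term (i := 0 : int) _ _) => //; last first.
  by move=> n _; apply: esum_ge0 => z _; rewrite mule_ge0 ?lee_fin ?powR_ge0// esum_ge0.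
apply: le_esum => z Sz; have Vz : vertices (z, 0 : int) by [].
have [w vw] := exists_adj alpha1 tau3 hS Vz.
apply: (@le_trans _ _ ((2 `^ p)%:E * ((vmass (z, 0 : int))%:E *
   \int[lebesgue_measure]_(t in `[0%R, 1%R]) h (edge_path (z, 0 : int) w t)))%E); last first.
  by rewrite lee_wpmul2l ?lee_fin ?powR_ge0//; apply: (esum_ge_term (i := w)).
have ez : e (z, 0 : int).2 = 1 by rewrite /= oppr0 expr0z.
have -> : vmass (z, 0 : int) = vvol (z, 0) by rewrite /vmass ez powR1 mul1r.
rewrite muleCA EFinM lee_wpmul2l ?lee_fin ?vol_ge0//.
apply: le_trans (vertex_power_le vw ez) _.
rewrite lee_wpmul2l ?lee_fin ?powR_ge0// /h.
rewrite ge0_integralD//; last 3 first.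
- by move=> t _; exact: poweR_ge0.
- exact: (edge_comp_measurable vw mh1).
- exact: (edge_comp_measurable vw mh2).
rewrite leeD2l// ge0_integralZl ?lee_fin ?powR_ge0//; first exact: (edge_comp_measurable vw mgp).
by move=> t _; exact: poweR_ge0.
Qed.

End base_level.

End upper_gradients.

End newtonian_traces.

Section lower_scaling.
Import HBNNSimple.

Lemma ge0_integralZl_lower d (T : measurableType d) (R : realType)
    (mu : {measure set T -> \bar R}) (D : set T) (f : T -> \bar R) (k : R) :
  (0 <= k)%R -> (forall x, D x -> 0 <= f x) ->
  \int[mu]_(x in D) (k%:E * f x) <= k%:E * \int[mu]_(x in D) f x.
Proof.
rewrite le_eqVlt => /predU1P[<- _|k0 f0].
  by rewrite mul0e; under eq_integral do rewrite mul0e; rewrite integral0.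
have kf0 x : D x -> 0 <= k%:E * f x by move=> Dx; rewrite mule_ge0 ?f0// lee_fin ltW.
rewrite (ge0_integralE _ kf0) (ge0_integralE _ f0).
have kV0 : (0 <= k^-1)%R by rewrite invr_ge0 ltW.
apply: ge_ereal_sup => _ [h hf <-]; rewrite -lee_pdivrMl//.
rewrite -sintegralrM (_ : (_ \* _)%R = scale_nnsfun h kV0)//.
apply: ereal_sup_ubound; exists (scale_nnsfun h kV0) => // x.
have := hf x; rewrite /= !patchE; case: ifPn => _ hx.
  by rewrite EFinM lee_pdivrMl.
have -> : h x = 0%R.
  apply/eqP; rewrite eq_le fun_ge0 andbT -lee_fin; exact: hx.
by rewrite mulr0.
Qed.

End lower_scaling.

Section ereal_roots.
Context {R : realType}.
Local Open Scope ring_scope.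

Lemma le_poweR (q : R) (x y : \bar R) : 0 <= q -> (0 <= x)%E -> (x <= y)%E ->
  (x `^ q <= y `^ q)%E.
Proof.
move=> q0 x0 xy; apply: gt0_ler_poweR => //; rewrite in_itv/= leey andbT//.
exact: le_trans xy.
Qed.

Lemma poweRK (q : R) (x : \bar R) : 0 < q -> (0 <= x)%E -> ((x `^ q) `^ q^-1 = x)%E.
Proof.
move=> q0; case: x => [x|_|//].
  by rewrite lee_fin => x0; rewrite !poweR_EFin -powRrM mulfV ?gt_eqF// powRr1.
by rewrite poweRyr ?gt_eqF// poweRyr// invr_eq0 gt_eqF.
Qed.

Lemma poweR_lty (q : R) (x : \bar R) : 0 < q -> (0 <= x)%E -> (x `^ q < +oo)%E = (x < +oo)%E.
Proof.
move=> q0; case: x => [x _|_|//]; first by rewrite poweR_EFin !ltry.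
by rewrite poweRyr ?gt_eqF.
Qed.

End ereal_roots.

(** * The trace operator *)

Section trace_operator.
Context {R : realType} {Z : completeMetricType R}.
Variable nu : {measure set (borel Z) -> \bar R}.
Hypotheses (hnu : metric_measure nu) (hdoubling : doubling nu).
Variables (p theta : R).
Hypotheses (p1 : (1 <= p)%R) (theta01 : (0 < theta < 1)%R).
Variables (alpha tau : R) (S : int -> set Z).
Hypothesis alpha1 : (1 < alpha)%R.
Hypothesis tau3 : (3 < tau)%R.
Hypothesis hS : forall n : int, maximal_separated (alpha ^ (- n))%R (S n).
Context {Xbar : completeMetricType R} (iota : (Z * int -> R) -> Xbar).
Hypothesis hiota : is_completion alpha tau S iota.
Variable phi : Z -> Xbar.
Hypothesis hphi : boundary_map alpha S iota phi.
Variables (mu mu_beta : {measure set (borel Xbar) -> \bar R}).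
Hypothesis hmu : is_mu alpha tau S iota nu mu.
Hypothesis hmu_beta : is_mu_beta alpha tau S iota (p * (1 - theta))%R mu mu_beta.
Variables (C0 : R) (psi : int -> Z -> Z -> R).
Hypothesis hpsi : partition_of_unity alpha S C0 psi.

Local Open Scope ring_scope.
Local Notation V := (Z * int)%type.
Local Notation e n := (alpha ^ (- (n : int))).
Implicit Types (v w : V) (m n : int) (U : V -> R).
Local Notation vertices := (vertices S).
Local Notation adj := (adj alpha tau S).
Local Notation Xrho := (Xrho alpha tau S iota).
Local Notation vvol := (vvol nu alpha).
Local Notation energy_sum := (energy_sum nu p theta alpha tau S).
Local Notation tail_energy := (tail_energy p theta alpha tau S).
Local Notation level_trace := (level_trace S psi).
Local Notation limit_trace := (limit_trace S psi).
Local Notation delta := (induced_dist phi).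

Let alpha0 : 0 < alpha := alpha_gt0 alpha1.
Hint Resolve alpha0 : core.
Let e0 n : 0 < e n := scale_gt0 alpha1 n.
Hint Resolve e0 : core.
Let p0 : 0 < p := lt_le_trans ltr01 p1.
Hint Resolve p0 : core.
Let theta0 : 0 < theta. Proof. by case/andP: theta01. Qed.
Hint Resolve theta0 : core.
Let beta0 : 0 < p * (1 - theta).
Proof. by rewrite mulr_gt0// subr_gt0; case/andP: theta01. Qed.
Let pV0 : 0 < p^-1. Proof. by rewrite invr_gt0. Qed.
Hint Resolve pV0 : core.

Definition induced_const : R := Num.max (projC alpha tau) ((2 * chainC alpha + alpha) * alpha).

Lemma induced_const_gt0 : 0 < induced_const.
Proof. by rewrite lt_max projC_gt0. Qed.

Lemma induced_dist_ge x y : mdist x y <= induced_const * delta x y.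
Proof.
rewrite (le_trans (mdist_phi_ge alpha1 tau3 hS hiota hphi x y))//.
by rewrite ler_wpM2r ?mdist_ge0// le_max lexx.
Qed.

Lemma induced_dist_le x y : delta x y <= induced_const * mdist x y.
Proof.
rewrite (le_trans (mdist_phi_le alpha1 tau3 hS hiota hphi x y))//.
by rewrite ler_wpM2r ?mdist_ge0// le_max lexx orbT.
Qed.

Lemma dball_measurable x (r : R) : measurable (dball delta x r : set (borel Z)).
Proof.
have k0 := induced_const_gt0.
apply: sub_sigma_algebra; rewrite /= openE => y /=; rewrite /dball/= => xy.
rewrite /interior; apply/nbhs_ballP; exists ((r - delta x y) / induced_const).
  by rewrite /= divr_gt0// subr_gt0.
move=> z; rewrite ballEmdist/= ltr_pdivlMr// mulrC => yz.
have := metric_triangle (phi x) (phi y) (phi z).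
have := induced_dist_le y z; rewrite /induced_dist in yz xy *; lra.
Qed.

Lemma dball_sub x (r : R) : dball delta x r `<=` ball x (induced_const * r).
Proof.
move=> y; rewrite /dball/= ballEmdist/= => xy.
by rewrite (le_lt_trans (induced_dist_ge _ _))// ltr_pM2l// induced_const_gt0.
Qed.

Lemma norm_on_le (D D' : set Z) (f h : Z -> R) : D `<=` D' ->
  (forall x, D x -> `|f x| <= `|h x|) ->
  (norm_on nu D p (EFin \o f) <= norm_on nu D' p (EFin \o h))%E.
Proof.
move=> DD fh; apply: le_poweR; first exact: ltW.
  by apply: integral_ge0 => x _; exact: poweR_ge0.
rewrite integral_mkcond [leRHS]integral_mkcond; apply: ge0_le_integral_lower => x _.
rewrite !patchE; case: ifPn => [/set_mem Dx|_].
  rewrite ifT; last by apply/mem_set; exact: DD.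
  apply/andP; split; first exact: poweR_ge0.
  by apply: le_poweR; [exact: ltW|exact: abse_ge0|rewrite lee_fin fh].
have -> : point = 0%E :> \bar R by [].
by rewrite lexx/=; case: ifP => // _; exact: poweR_ge0.
Qed.

Definition vertex_values (u : Xbar -> \bar R) : V -> R :=
  fun v => fine (u (iota (vertex_pt v))).

Definition trace_op (u : Xbar -> \bar R) : Z -> R := limit_trace (vertex_values u).

Lemma norm_on_ge0 (u : Xbar -> \bar R) : (0 <= norm_on mu_beta Xrho p u)%E.
Proof. exact: poweR_ge0. Qed.

Lemma norm_on_gradient (u g : Xbar -> \bar R) : upper_gradient Xrho u g ->
  (norm_on mu_beta Xrho p g = (\int[mu_beta]_(y in Xrho) (g y `^ p)) `^ p^-1)%E.
Proof.
move=> [g0 _ _]; congr (_ `^ _)%E; apply: eq_integral => y /set_mem Xy.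
by rewrite gee0_abs ?g0.
Qed.

Let int_gradient_lty (u g : Xbar -> \bar R) : upper_gradient Xrho u g ->
  (norm_on mu_beta Xrho p g < +oo)%E -> (\int[mu_beta]_(y in Xrho) (g y `^ p) < +oo)%E.
Proof.
move=> hug; rewrite (norm_on_gradient hug) poweR_lty//.
by apply: integral_ge0 => y _; exact: poweR_ge0.
Qed.

(** The energy does not depend on the upper gradient, so the bound valid for each of them passes to
    the infimum. *)
Lemma energy_dirichlet : exists2 K : R, 0 < K & forall u,
  dirichlet_space mu_beta Xrho p u ->
  [/\ forall v, vertices v -> u (iota (vertex_pt v)) \is a fin_num,
      (energy_sum (vertex_values u) < +oo)%E &
      (energy_sum (vertex_values u) `^ p^-1 <= K%:E * dirichlet_norm mu_beta Xrho p u)%E].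
Proof.
have [C C1 HC] := edge_integral_le hnu hdoubling alpha1 tau3 hS hiota beta0 hmu hmu_beta.
pose K := ((2 * alpha) `^ p * C) `^ p^-1.
have KC : 0 < (2 * alpha) `^ p * C by rewrite mulr_gt0// powR_gt0// mulr_gt0.
have K0 : 0 < K by rewrite powR_gt0.
exists K => // u [mu' /ereal_inf_lt [_ [g hug <-] goo]].
have E0 : (0 <= energy_sum (vertex_values u))%E by exact: energy_sum_ge0.
have bound g' : upper_gradient Xrho u g' -> (norm_on mu_beta Xrho p g' < +oo)%E ->
    (energy_sum (vertex_values u) <= ((2 * alpha) `^ p * C)%:E *
      \int[mu_beta]_(y in Xrho) (g' y `^ p))%E.
  move=> hug' g'oo.
  exact: (energy_sum_le hnu hdoubling p1 theta01 alpha1 tau3 hS hiota hmu hmu_beta hug'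
    (int_gradient_lty hug' g'oo) HC).
split.
- exact: (vertex_fin hnu hdoubling p1 theta01 alpha1 tau3 hS hiota hmu hmu_beta hug
    (int_gradient_lty hug goo)).
- apply: le_lt_trans (bound g hug goo) _.
  by rewrite lte_mul_pinfty ?lee_fin ?(ltW KC)// (int_gradient_lty hug).
- rewrite -lee_pdivrMl//; apply: le_ereal_inf_tmp => _ [g' hug' <-].
  have [->|ng'] := eqVneq (norm_on mu_beta Xrho p g') +oo%E; first by rewrite leey.
  rewrite lee_pdivrMl// (norm_on_gradient hug') /K -poweR_EFin -poweRM ?lee_fin ?(ltW KC)//; last first.
    by apply: integral_ge0 => y _; exact: poweR_ge0.
  by apply: le_poweR => //; [exact: ltW|apply: bound => //; rewrite ltey].
Qed.

Lemma limit_trace_eq U x (l : R) : level_trace U k%:Z x @[k --> \oo] --> l ->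
  limit_trace U x = l.
Proof.
move=> cv; have cvE : (level_trace U k%:Z x)%:E @[k --> \oo] --> l%:E.
  by apply: cvg_EFin => //; exact: nearW.
by rewrite /limit_trace (cvg_limn_einf_sup cvE).2.
Qed.

Lemma tail_energy_ae U : (energy_sum U < +oo)%E ->
  \forall x \ae nu, (tail_energy U 0 x < +oo)%E.
Proof.
move=> Eoo; have [C C1 HC] := integral_tail_energy hnu hdoubling p1 theta01 tau alpha1 hS.
have mt := tail_energy_measurable hnu hdoubling p theta01 tau alpha1 hS U 0.
have it : nu.-integrable setT (tail_energy U 0 : borel Z -> \bar R).
  apply/integrableP; split => //.
  under eq_integral do rewrite gee0_abs ?(tail_energy_ge0 p theta01 tau S alpha1)//.
  apply: le_lt_trans (HC U 0) _; rewrite lte_mul_pinfty//.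
  by rewrite lee_fin mulr_ge0 ?powR_ge0// ltW.
have [N [mN N0 HN]] := integrable_ae measurableT it; exists N; split => // x nx.
apply: HN => h; apply: nx; have := h I.
by rewrite ge0_fin_numE// (tail_energy_ge0 p theta01 tau S alpha1).
Qed.

Lemma trace_op_cvg_ae u : dirichlet_space mu_beta Xrho p u ->
  \forall x \ae nu, level_trace (vertex_values u) k%:Z x @[k --> \oo] --> trace_op u x.
Proof.
move=> Du; have [K _ HK] := energy_dirichlet; have [_ Eoo _] := HK u Du.
have [N [mN N0 HN]] := tail_energy_ae Eoo; exists N; split => // x nx.
apply: HN => h; apply: nx.
by have [] := limit_trace_cvg hnu hdoubling p1 theta01 alpha1 tau3 hS hpsi h.
Qed.

Lemma level_trace_linear U1 U2 U (a b : R) n x :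
  (forall z, S n z -> U (z, n) = a * U1 (z, n) + b * U2 (z, n)) ->
  level_trace U n x = a * level_trace U1 n x + b * level_trace U2 n x.
Proof.
move=> HU; rewrite !(level_trace_ball hpsi).
have fF := packing_finite hnu hdoubling alpha1 hS 2 n x.
rewrite !fsbig_finite//= !mulr_sumr -big_split/=.
rewrite big_seq [RHS]big_seq; apply: eq_bigr => z.
by rewrite in_fset_set// => /set_mem [Sz _]; rewrite HU//; ring.
Qed.

(** Outside a null set both discrete traces converge, and there the upper limit is a limit.
    Finiteness of the vertex values makes [fine] additive on them. *)
Lemma trace_op_linear : linear_ae nu (dirichlet_space mu_beta Xrho p) trace_op.
Proof.
move=> a b u v Du Dv.
have [K _ HK] := energy_dirichlet.
have [fu _ _] := HK u Du; have [fv _ _] := HK v Dv.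
have [N1 [mN1 N10 HN1]] := trace_op_cvg_ae Du.
have [N2 [mN2 N20 HN2]] := trace_op_cvg_ae Dv.
exists (N1 `|` N2); split; first exact: measurableU.
  apply/eqP; rewrite eq_le measure_ge0 andbT.
  by apply: (le_trans (measureU2 _ _ _)) => //; rewrite [X in (X + _)%E]N10 [X in (_ + X)%E]N20 adde0.
move=> x; apply: contra_notP => /not_orP[nx1 nx2] _.
have c1 : level_trace (vertex_values u) k%:Z x @[k --> \oo] --> trace_op u x.
  by apply: contrapT => h; apply: nx1; exact: HN1.
have c2 : level_trace (vertex_values v) k%:Z x @[k --> \oo] --> trace_op v x.
  by apply: contrapT => h; apply: nx2; exact: HN2.
apply: limit_trace_eq.
have -> : (fun k : nat => level_trace (vertex_values (lincomb a b u v)) k%:Z x) =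
    (fun k : nat => a * level_trace (vertex_values u) k%:Z x +
       b * level_trace (vertex_values v) k%:Z x).
  apply/funext => k; apply: level_trace_linear => z Sz.
  have Vz : vertices (z, k%:Z) by [].
  rewrite /vertex_values /lincomb -(fineK (fu _ Vz)) -(fineK (fv _ Vz)).
  by rewrite -!EFinM -EFinD.
by apply: cvgD; apply: cvgMr.
Qed.

(** [integral_trace_diff] gives a rate: the [L^p] distance at level [n] is of order
    [alpha^(- theta n)], uniformly over the balls. *)
Lemma trace_op_is_trace u : dirichlet_space mu_beta Xrho p u ->
  is_trace S iota nu delta p psi u (trace_op u).
Proof.
move=> Du z r.
have [K _ HK] := energy_dirichlet; have [_ Eoo _] := HK u Du.
have [C C1 HC] := integral_trace_diff hnu hdoubling p1 theta01 alpha1 tau3 hS hpsi.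
set U := vertex_values u in Eoo.
have E0 : (0 <= energy_sum U)%E by exact: energy_sum_ge0.
have fE : energy_sum U \is a fin_num by rewrite ge0_fin_numE.
pose M := (C * fine (energy_sum U)) `^ p^-1.
have bound (n : nat) : (norm_on nu (dball delta z r) p
    (fun x => (trace_approx S iota psi u n x - trace_op u x)%R%:E) <=
    (M * (alpha `^ (- theta)) ^+ n)%:E)%E.
  apply: (@le_trans _ _ (((C * e n%:Z `^ (p * theta))%:E * energy_sum U) `^ p^-1)%E).
    apply: le_poweR; first exact: ltW.
      by apply: integral_ge0 => x _; exact: poweR_ge0.
    apply: le_trans (HC U n%:Z); rewrite integral_mkcond.
    apply: ge0_le_integral_lower => x _; rewrite patchE; case: ifP => _.
      by rewrite poweR_ge0/= -poweR_EFin.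
    by rewrite lexx lee_fin powR_ge0.
  rewrite -(fineK fE) -EFinM poweR_EFin lee_fin mulrAC powRM ?powR_ge0//; last first.
    by rewrite mulr_ge0 ?fine_ge0// ltW.
  rewrite -/M ler_wpM2l ?powR_ge0//.
  rewrite -(powR_mulrn n (powR_ge0 alpha (- theta))) (scale_powR alpha1) -!powRrM.
  rewrite le_eqVlt; apply/orP; left; apply/eqP; congr (_ `^ _).
  by field; rewrite gt_eqF.
have : \forall n \near \oo, ((cst 0 : nat -> \bar R) n <= norm_on nu (dball delta z r) p
    (fun x => (trace_approx S iota psi u n x - trace_op u x)%R%:E) <=
    (M * (alpha `^ (- theta)) ^+ n)%:E)%E.
  by apply: nearW => n; rewrite bound andbT; exact: poweR_ge0.
move/squeeze_cvge; apply.
- exact: cvg_cst.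
- apply: cvg_EFin; first exact: nearW.
  rewrite -(mulr0 M); apply: cvgMr; apply: cvg_expr.
  by rewrite ger0_norm ?powR_ge0// powRN_lt1.
Qed.

Lemma trace_op_besov : bounded_operator (dirichlet_space mu_beta Xrho p)
  (dirichlet_norm mu_beta Xrho p) (besov_space nu delta p theta)
  (besov_norm nu delta p theta) trace_op.
Proof.
have [K K0 HK] := energy_dirichlet.
have [C1 C10 HC1] := limit_trace_anchor hnu hdoubling p1 theta01 alpha1 tau3 hS hpsi.
have [C2 C20 HC2] := besov_integrand_le hnu hdoubling p1 theta01 alpha1 tau3 hS
  induced_const_gt0 induced_dist_ge induced_dist_le dball_measurable C10.
have [C3 C30 HC3] := besov_energy hnu hdoubling p1 theta01 tau alpha1 hS.
exists ((C2 * C3) `^ p^-1 * K) => u Du; have [_ Eoo Ele] := HK u Du.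
set U := vertex_values u in Eoo Ele.
have C23 : 0 < C2 * C3 by rewrite mulr_gt0.
have E0 : (0 <= energy_sum U)%E by exact: energy_sum_ge0.
have normle : (besov_norm nu delta p theta (trace_op u) <=
    ((C2 * C3) `^ p^-1)%:E * energy_sum U `^ p^-1)%E.
  rewrite -poweR_EFin -poweRM ?lee_fin ?(ltW C23)//.
  have I0 x y : (0 <= besov_integrand nu p theta delta (trace_op u) x y)%E.
    by rewrite mule_ge0 ?inve_ge0// lee_fin divr_ge0 ?powR_ge0.
  have J0 x y : (0 <= \esum_(v in vertices) (((fun y => ((fun x =>
      (besov_weight nu p theta alpha v)%:E * (tail_energy U v.2 x + tail_energy U v.2 y))
      \_ (ball v.1 (2 * e v.2))) x) \_ (ball v.1 (2 * e v.2))) y))%E.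
    apply: esum_ge0 => v _; apply: erestrict_ge0 => ? _; apply: erestrict_ge0 => ? _.
    rewrite mule_ge0 ?lee_fin ?(besov_weight_ge0 nu p theta)//.
    by rewrite adde_ge0// (tail_energy_ge0 p theta01 tau S alpha1).
  apply: le_poweR; first exact: ltW.
    by apply: integral_ge0 => y _; apply: integral_ge0 => x _; exact: I0.
  rewrite EFinM -muleA; apply: le_trans (lee_wpmul2l _ (HC3 U)); last by rewrite lee_fin ltW.
  apply: le_trans (ge0_integralZl_lower _ (ltW C20) _); last first.
    by move=> y _; apply: integral_ge0 => x _; exact: J0.
  apply: ge0_le_integral_lower => y _; rewrite integral_ge0/=; last by move=> x _; exact: I0.
  apply: le_trans (ge0_integralZl_lower _ (ltW C20) _); last by move=> x _; exact: J0.
  apply: ge0_le_integral_lower => x _; rewrite I0/=; apply: HC2 => n z.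
  exact: HC1.
have foo : (besov_norm nu delta p theta (trace_op u) < +oo)%E.
  apply: le_lt_trans normle _; rewrite lte_mul_pinfty ?lee_fin ?powR_ge0//.
  by rewrite poweR_lty.
have mT : measurable_fun setT (trace_op u : borel Z -> R).
  exact: (limit_trace_measurable hnu hdoubling alpha1 hS hpsi).
split; last first.
  apply: (le_trans normle); rewrite EFinM -muleA lee_wpmul2l// lee_fin powR_ge0//.
split => //; split.
  exists (trace_op u) => //; exact: nearW.
move=> x r; have [r0|r0] := leP r 0.
  rewrite (_ : dball delta x r = set0); last first.
    apply/seteqP; split => // y; rewrite /dball/= ltNge (le_trans r0)//; exact: mdist_ge0.
  by rewrite /norm_on integral_set0 poweR0r ?ltry// gt_eqF.
have k0 := induced_const_gt0.
apply: le_lt_trans (norm_on_le (@dball_sub x r) (fun y _ => lexx _)) _.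
rewrite /norm_on poweR_lty//; last by apply: integral_ge0 => y _; exact: poweR_ge0.
rewrite (eq_integral (fun x : borel Z => (`|trace_op u x| `^ p)%:E)); last first.
  by move=> y _; exact: poweR_EFin.
by apply: (limit_trace_Lp_loc hnu hdoubling p1 theta01 alpha1 tau3 hS hpsi) => //; exact: mulr_gt0.
Qed.

Lemma trace_op_newton : bounded_operator (newton_space mu_beta Xrho p)
  (newton_norm mu_beta Xrho p) (besov_check_space nu delta p theta)
  (besov_check_norm nu delta p theta) trace_op.
Proof.
have [K1 HK1] := trace_op_besov.
have [C C1 HC] := edge_integral_le hnu hdoubling alpha1 tau3 hS hiota beta0 hmu hmu_beta.
have [C2 C20 HC2] := integral_limit_trace hnu hdoubling p1 theta01 alpha1 tau3 hS hpsi.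
pose a2 := (2 * alpha) `^ p; have a20 : 0 < a2 by rewrite powR_gt0// mulr_gt0.
have t20 : 0 < 2 `^ p by rewrite powR_gt0.
pose A := C2 * (a2 * C + 2 `^ p * C * (1 + a2)).
have A0 : 0 < A.
  by apply: mulr_gt0 => //; apply: addr_gt0; rewrite !mulr_gt0// addr_gt0.
pose K2 := (2 * A) `^ p^-1; have K20 : 0 < K2 by rewrite powR_gt0// mulr_gt0.
(* The constant [K1] supplied by [trace_op_besov] may be negative, hence the maximum. *)
exists (K2 + Num.max K1 0) => u [[u' mu' uu'] Noo].
have n0 : (0 <= norm_on mu_beta Xrho p u)%E by exact: norm_on_ge0.
have d0 : (0 <= dirichlet_norm mu_beta Xrho p u)%E.
  by apply: le_ereal_inf_tmp => _ [g _ <-]; exact: norm_on_ge0.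
have noo : (norm_on mu_beta Xrho p u < +oo)%E by apply: le_lt_trans Noo; rewrite leeDl.
have doo : (dirichlet_norm mu_beta Xrho p u < +oo)%E by apply: le_lt_trans Noo; rewrite leeDr.
have fn : norm_on mu_beta Xrho p u \is a fin_num by rewrite ge0_fin_numE.
have Du : dirichlet_space mu_beta Xrho p u by split => //; exists u'.
have [Bu Bn] := HK1 u Du; set U := vertex_values u.
have Tn : (norm_on nu setT p (EFin \o trace_op u) <=
    K2%:E * (norm_on mu_beta Xrho p u + dirichlet_norm mu_beta Xrho p u))%E.
  (* The finite norm of [u] is moved to the other side so that the infimum over upper gradients
     stands alone. *)
  rewrite -lee_pdivrMl// -leeBlDl//; apply: le_ereal_inf_tmp => _ [g hug <-].
  have [->|ng] := eqVneq (norm_on mu_beta Xrho p g) +oo%E; first by rewrite leey.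
  have goo : (norm_on mu_beta Xrho p g < +oo)%E by rewrite ltey.
  have igoo := int_gradient_lty hug goo.
  rewrite leeBlDl// lee_pdivrMl// (norm_on_gradient hug).
  set Iu : \bar R := (\int[mu_beta]_(y in Xrho) (`|u y| `^ p))%E.
  have -> : norm_on mu_beta Xrho p u = (Iu `^ p^-1)%E by [].
  set Ig : \bar R := (\int[mu_beta]_(y in Xrho) (g y `^ p))%E.
  have Iu0 : (0 <= Iu)%E by apply: integral_ge0 => y _; exact: poweR_ge0.
  have Ig0 : (0 <= Ig)%E by apply: integral_ge0 => y _; exact: poweR_ge0.
  have E1 := energy_sum_le hnu hdoubling p1 theta01 alpha1 tau3 hS hiota hmu hmu_beta hug igoo HC.
  have E2 := base_level_le hnu hdoubling p1 theta01 alpha1 tau3 hS hiota hmu hmu_beta hug igoo mu' uu' C1 HC.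
  have IT : (\int[nu]_x (`|trace_op u x| `^ p)%:E <= A%:E * (Iu + Ig))%E.
    apply: (le_trans (HC2 U)); rewrite /A EFinM -muleA lee_pmul2l ?lte_fin//.
    apply: le_trans (leeD E1 E2) _; rewrite -/a2 -/Ig -/Iu.
    rewrite EFinD ge0_muleDl ?lee_fin ?mulr_ge0 ?addr_ge0 ?(ltW a20) ?(ltW t20) ?(ltW C1)//.
    apply: leeD.
      by rewrite lee_wpmul2l ?leeDr// lee_fin mulr_ge0// ltW.
    rewrite (EFinM (2 `^ p * C) (1 + a2)) -muleA lee_wpmul2l ?lee_fin ?mulr_ge0 ?(ltW t20) ?(ltW C1)//.
    rewrite [leRHS]ge0_muleDr//; apply: leeD.
      by rewrite -[leLHS]mul1e lee_wpmul2r// lee_fin lerDl ltW.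
    by rewrite lee_wpmul2r// lee_fin lerDr.
  rewrite /K2 /norm_on -poweR_EFin.
  apply: (@le_trans _ _ ((A%:E * (Iu + Ig)) `^ p^-1)%E).
    apply: le_poweR; first exact: ltW.
      by apply: integral_ge0 => x _; exact: poweR_ge0.
    rewrite (eq_integral (fun x : borel Z => (`|trace_op u x| `^ p)%:E)); last first.
      by move=> y _; exact: poweR_EFin.
    exact: IT.
  have root0 x : (0 <= x `^ p^-1)%E by move=> *; exact: poweR_ge0.
  have s0 : (0 <= Iu `^ p^-1 + Ig `^ p^-1)%E by rewrite adde_ge0.
  have pVV : (p^-1)^-1 = p by rewrite invrK.
  have pw x : (0 <= x)%E -> ((x `^ p^-1) `^ p = x)%E.
    by move=> x0; rewrite -{2}pVV poweRK.
  rewrite -[X in (_ <= _ * X)%E](poweRK p0 s0) -[leRHS]poweRM ?poweR_ge0//; last first.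
    by rewrite lee_fin mulr_ge0// ltW.
  apply: le_poweR; first exact: ltW.
    by apply: mule_ge0; [rewrite lee_fin ltW|exact: adde_ge0].
  have -> : ((2 * A)%:E = A%:E * 2%:E)%E by rewrite -EFinM mulrC.
  rewrite -[leRHS]muleA; apply: lee_wpmul2l; first by rewrite lee_fin ltW.
  have m2 a b : (0 <= a)%E -> (0 <= b)%E -> (a + b <= 2%:E * (a `^ p^-1 + b `^ p^-1) `^ p)%E.
    move=> a0 b0; rewrite (_ : 2%:E = 1 + 1)%E// ge0_muleDl// mul1e; apply: leeD.
      by rewrite -[leLHS]pw//; apply: le_poweR; rewrite ?(ltW p0)// leeDl.
    by rewrite -[leLHS]pw//; apply: le_poweR; rewrite ?(ltW p0)// leeDr.
  exact: m2.
have E0 := K1.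
split; first by split => //; apply: le_lt_trans Tn _; rewrite lte_mul_pinfty ?lee_fin ?(ltW K20).
rewrite /besov_check_norm EFinD ge0_muleDl ?lee_fin ?(ltW K20) ?le_max ?lexx ?orbT//.
  apply: leeD => //; apply: (le_trans Bn).
  apply: (@le_trans _ _ ((Num.max K1 0)%:E * dirichlet_norm mu_beta Xrho p u)%E).
    by rewrite lee_wpmul2r// lee_fin le_max lexx.
  by rewrite lee_wpmul2l ?leeDr// lee_fin le_max lexx orbT.
Qed.

End trace_operator.

(** * Upper gradients on the filling *)

Section radial_bounds.
Context {R : realType} {T : pmetricType R}.
Local Open Scope ring_scope.
Variable (g : T -> \bar R).

(* Lower bounds for the integral of g along a curve from the centre x to the
   distance d, in terms of lower bounds for g on concentric balls. *)
Definition radial_bound (x : T) (d I : R) :=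
  forall n (c r : nat -> R), r 0%N <= d -> (forall j, 0 <= r j) ->
  (forall j, r j.+1 <= r j) -> (forall j, 0 <= c j) ->
  (forall j y, (j < n)%N -> mdist y x <= r j -> ((c j)%:E <= g y)%E) ->
  \sum_(0 <= j < n) c j * (r j - r j.+1) <= I.

Let dist (x y : T) : \bar R := (mdist x y)%:E.

(** [chain_integral] is applied to the distance from either end, which is continuous along the curve
    and changes by at most the distance of the points. *)
Lemma curve_radial_bound a b (gam : R -> T) (I : R) :
  (forall y, 0 <= g y)%E -> rectifiable_curve dist setT a b gam ->
  (line_integral dist a b gam g <= I%:E)%E ->
  forall s0, a <= s0 <= b ->
  radial_bound (gam a) (mdist (gam s0) (gam a)) I /\
  radial_bound (gam b) (mdist (gam s0) (gam b)) I.
Proof.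
move=> g0 [ab _ gamc gamoo] HI s0 s0ab.
have dist0 (x y : T) : (0 <= dist x y)%E by rewrite lee_fin mdist_ge0.
have dtri (x y z : T) : (dist x z <= dist x y + dist y z)%E.
  by rewrite -EFinD lee_fin metric_triangle.
have cont x t : a <= t <= b -> forall e : R, 0 < e ->
    exists2 d : R, 0 < d & forall s, a <= s <= b -> `|s - t| < d ->
    `|mdist (gam s) x - mdist (gam t) x| < e.
  move=> tab e e0; have tI : t \in `[a, b] by rewrite in_itv/=.
  have /nbhs_ballP[d /= d0 Hd] := gamc t tI e e0.
  exists d => // s sab st; have := Hd s; rewrite /ball/= distrC => /(_ st).
  rewrite in_itv/= => /(_ sab); rewrite lte_fin => lt.
  have := metric_triangle (gam s) (gam t) x; have := metric_triangle (gam t) (gam s) x.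
  rewrite (metric_sym (gam s) (gam t)) ltr_norml; lra.
pose J := sub_integral dist a b gam g.
have J0 s t : a <= s -> s <= t -> t <= b -> (0 <= J s t)%E.
  by move=> *; apply: sub_integral_ge0.
have JD s t u : a <= s -> s <= t -> t <= u -> u <= b -> (J s t + J t u <= J s u)%E.
  by move=> *; apply: sub_integralD.
have J_ge x s t (c : R) : a <= s -> s <= t -> t <= b -> 0 <= c ->
    (forall r, s <= r <= t -> (c%:E <= g (gam r))%E) ->
    ((c * `|mdist (gam s) x - mdist (gam t) x|)%:E <= J s t)%E.
  move=> as_ st tb c0 H.
  apply: (@le_trans _ _ (c%:E * dist (gam s) (gam t))%E).
    rewrite -EFinM lee_fin ler_wpM2l//.
    have := metric_triangle (gam s) (gam t) x; have := metric_triangle (gam t) (gam s) x.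
    rewrite (metric_sym (gam t) (gam s)) ler_norml; lra.
  apply: sub_integral_ge => //; first by rewrite /dist mdistxx.
have JI s t : a <= s -> s <= t -> t <= b -> (J s t <= I%:E)%E.
  by move=> *; apply: le_trans HI; exact: sub_integral_le.
have /andP[as0 s0b] := s0ab.
split => n c r rd r0 rdec c0 H; rewrite -lee_fin.
- apply: le_trans (JI a s0 _ _ _) => //.
  apply: (@chain_integral _ a b (fun s => mdist (gam s) (gam a)) (cont (gam a))
    (fun s => g (gam s)) J J0 JD (J_ge (gam a))) => //.
    by rewrite mdistxx.
  by move=> j s jn _ sr; exact: H.
- apply: le_trans (JI s0 b _ _ _) => //.
  apply: (@chain_integral_rev _ a b (fun s => mdist (gam s) (gam b))
    (fun s => g (gam s)) J (cont (gam b)) J0 JD (J_ge (gam b))) => //.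
    by rewrite mdistxx.
  by move=> j s jn _ sr; exact: H.
Qed.

End radial_bounds.

(** * Differences of two values bounded by integrals around the end points *)

Section edge_gradient.
Context {R : realType} {Z : completeMetricType R}.
Variables (alpha tau : R) (S : int -> set Z).
Hypothesis alpha1 : (1 < alpha)%R.
Hypothesis tau3 : (3 < tau)%R.
Hypothesis hS : forall n : int, maximal_separated (alpha ^ (- n))%R (S n).
Context {Xbar : completeMetricType R} (iota : (Z * int -> R) -> Xbar).
Hypothesis hiota : is_completion alpha tau S iota.
Variable phi : Z -> Xbar.
Hypothesis hphi : boundary_map alpha S iota phi.

Local Open Scope ring_scope.
Local Notation V := (Z * int)%type.
Local Notation e n := (alpha ^ (- (n : int))).
Implicit Types (v w : V) (z : Z) (m n : int).
Local Notation vertices := (vertices S).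
Local Notation adj := (adj alpha tau S).
Local Notation X := (fillingX alpha tau S).
Local Notation Xrho := (Xrho alpha tau S iota).
Local Notation vtx := (near_vtx alpha1 hS).
Local Notation chainC := (chainC alpha).
Local Notation projC := (projC alpha tau).

Let alpha0 : 0 < alpha := alpha_gt0 alpha1.
Hint Resolve alpha0 : core.
Let e0 n : 0 < e n := scale_gt0 alpha1 n.
Hint Resolve e0 : core.
Let chainC0 : 0 < chainC := chainC_gt0 alpha1.
Hint Resolve chainC0 : core.
Let projC0 : 0 < projC := projC_gt0 alpha1 tau3.
Hint Resolve projC0 : core.

(** Chosen so that [end_scale d < e n], for points at distance [d], has two effects: by the first
    summand the vertices near both points lie at levels from [n] on, and by the second the boundary
    points below them are within [2 e n] of each other. *)
Definition end_scale : R :=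
  2 * alpha ^+ 4 + projC * (4 * alpha ^+ 4 * (chainC + alpha) + 1).

Let D0 : 0 < end_scale.
Proof.
have a4 : 0 < alpha ^+ 4 by rewrite exprn_gt0.
rewrite /end_scale; apply: addr_gt0; first exact: mulr_gt0.
by apply: mulr_gt0 => //; apply: addr_gt0 => //; do 2?apply: mulr_gt0 => //; exact: addr_gt0.
Qed.

Definition radius_ratio : R := (alpha * end_scale)^-1.

Lemma radius_ratio_gt0 : 0 < radius_ratio.
Proof. by rewrite invr_gt0 mulr_gt0. Qed.
Let kap0 := radius_ratio_gt0.
Hint Resolve kap0 : core.
Let kap1 : radius_ratio <= 1.
Proof.
have a4 : 1 <= alpha ^+ 4 by rewrite exprn_ege1// ltW.
have D1 : 1 <= end_scale.
  have : 0 <= projC * (4 * alpha ^+ 4 * (chainC + alpha) + 1).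
    by apply: mulr_ge0; [exact: ltW|apply: addr_ge0 => //; do 2?apply: mulr_ge0 => //; [lra|exact/ltW/addr_gt0]].
  rewrite /end_scale; lra.
by rewrite invf_le1 ?mulr_gt0// (le_trans D1)// ler_peMl ?(ltW alpha1)// ltW.
Qed.

(** Large enough for both kinds of end points: a point within [e v.2] of the end of a chain through
    [v], and a point as far from one end as the other when both ends lie on edges at [v]. *)
Definition star_radius : R := 4 * alpha + 1 + chainC.

(** The first term pays for a chain: annuli have width [radius_ratio (1 - alpha^-1) e n], and the
    factor 3 leaves one third of the integral for each of the two chains and for the step between
    them. The second is the constant of [star_diff], for two points on edges with a common
    vertex. *)
Definition gradient_factor : R :=
  3 / (radius_ratio * (1 - alpha^-1)) + 2 * alpha ^+ 5.

Let aV : 0 < 1 - alpha^-1. Proof. by rewrite subr_gt0 invf_lt1. Qed.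

Lemma gradient_factor_gt0 : 0 < gradient_factor.
Proof. by apply: addr_gt0; rewrite ?divr_gt0 ?mulr_gt0 ?exprn_gt0. Qed.

(** The common setting for the Poisson extension, its truncation, and functions vanishing on the
    graph: [U] is the function on the graph, [a v] bounds its slope on the edges at [v], and [u_bd]
    describes the boundary value only where the slopes are summable along a chain. *)
Variables (u g : Xbar -> \bar R) (U : (V -> R) -> R) (a : V -> R).
Hypothesis a0 : forall v, 0 <= a v.
Hypothesis uU : forall x, X x -> u (iota x) = (U x)%:E.
Hypothesis U_lip : forall v w s t, adj v w -> s \in `[0, 1] -> t \in `[0, 1] ->
  `|U (edge_pt v w s) - U (edge_pt v w t)| <= a v * e v.2 * `|s - t|.
Hypothesis u_bd : forall z n (I : R),
  (forall k : nat, \sum_(0 <= j < k) a (vtx z (n + j%:Z)) * e (n + j%:Z) <= I) ->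
  exists2 l : R, U (vertex_pt (vtx z (n + k%:Z))) @[k --> \oo] --> l &
    u (phi z) = l%:E.
Hypothesis g_ge : forall v y, vertices v ->
  mdist y (iota (vertex_pt v)) < star_radius * e v.2 ->
  ((gradient_factor * a v)%:E <= g y)%E.

Lemma star_edge x v : X x -> 0 < x v -> exists w t,
  [/\ adj v w, t \in `[0, 1] & x = edge_pt v w t].
Proof.
move=> Xx xv; have [v1 [w1 [t [vw /[!in_itv]/= /andP[t0 t2] xE]]]] := fillingXE2 alpha1 tau3 hS Xx.
have t1 : t <= 1 by lra.
have [->|n1] := eqVneq v v1; first by exists w1, t; rewrite in_itv/= t0 t1.
have [->|n2] := eqVneq v w1.
  exists v1, (1 - t); split; [exact: adj_sym|by rewrite in_itv/=; lra|].
  by rewrite edge_ptC xE; congr edge_pt; ring.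
by move: xv; rewrite xE edge_ptn// ltxx.
Qed.

(** On distinct edges at [v], each point has a coordinate that vanishes at the other, so
    [iota_coord] bounds the distance of both from [v] by their mutual distance; passing through [v]
    then costs a factor 2. *)
Lemma star_diff v w w' s t : adj v w -> adj v w' -> s \in `[0, 1] -> t \in `[0, 1] ->
  `|U (edge_pt v w s) - U (edge_pt v w' t)| <=
  2 * alpha ^+ 5 * a v * mdist (iota (edge_pt v w s)) (iota (edge_pt v w' t)).
Proof.
move=> vw vw' s01 t01.
have Xs := fillingX_edge vw s01; have Xt := fillingX_edge vw' t01.
set d := mdist _ _; have d0 : 0 <= d by exact: mdist_ge0.
have coord w1 : adj v w1 -> e v.2 * `|edge_pt v w s w1 - edge_pt v w' t w1| <= alpha ^+ 5 * d.
  move=> vw1; have := iota_coord alpha1 hiota w1 Xs Xt; rewrite -/d => H.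
  apply: (@le_trans _ _ (alpha * e w1.2 * (alpha ^+ 4 / e w1.2 * d))).
    apply: ler_pM => //; first exact: ltW.
    exact: adj_scale (adj_sym vw1).
  rewrite le_eqVlt; apply/orP; left; apply/eqP; field.
  exact: lt0r_neq0.
have [ww|nww] := eqVneq w w'.
  subst w'; have := coord w vw; rewrite !edge_ptr ?(adj_neq vw)// => H.
  apply: (le_trans (U_lip vw s01 t01)).
  rewrite -mulrA (mulrC _ (a v)) -mulrA ler_wpM2l//.
  apply: (le_trans H); have : 0 <= alpha ^+ 5 * d by rewrite mulr_ge0 ?exprn_ge0// ltW.
  lra.
have Hs := coord w vw; have Ht := coord w' vw'.
have nvw := adj_neq vw; have nvw' := adj_neq vw'.
have nwv : w != v by rewrite eq_sym.
rewrite edge_ptr// (edge_ptn _ nwv nww) subr0 in Hs.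
have nw'v : w' != v by rewrite eq_sym.
have nw'w : w' != w by rewrite eq_sym.
rewrite edge_ptr// (edge_ptn _ nw'v nw'w) sub0r normrN in Ht.
have z01 : (0 : R) \in `[0, 1] by rewrite in_itv/= lexx ler01.
have := U_lip vw s01 z01; have := U_lip vw' z01 t01.
rewrite !edge_pt0 subr0 sub0r normrN => H1 H2.
apply: (le_trans (ler_distD (U (vertex_pt v)) _ _)); apply: (le_trans (lerD H2 H1)).
rewrite -!mulrA -mulrDr (_ : 2 * _ = a v * (alpha ^+ 5 * d + alpha ^+ 5 * d)); last by ring.
by rewrite ler_wpM2l// lerD.
Qed.

(** The vertical chain over [z], started at level [n], leads to [x]: either it is infinite and [x]
    is its limit on the boundary, or [x] lies on an edge at a vertex of this chain. *)
Definition chain_end (x : Xbar) z n : Prop :=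
  x = phi z \/ exists k w t, [/\ n <= k, adj (z, k) w, t \in `[0, 1] &
    x = iota (edge_pt (z, k) w t)].

Lemma chain_tele z n (k : nat) :
  `|U (vertex_pt (vtx z n)) - U (vertex_pt (vtx z (n + k%:Z)))| <=
  \sum_(0 <= j < k) a (vtx z (n + j%:Z)) * e (n + j%:Z).
Proof.
elim: k => [|k IH]; first by rewrite addr0 subrr normr0 big_geq.
rewrite big_nat_recr//=; apply: le_trans (ler_distD (U (vertex_pt (vtx z (n + k%:Z)))) _ _) _.
apply: lerD => //; have vw := near_vtx_succ alpha1 tau3 hS z (n + k%:Z).
have z01 : (0 : R) \in `[0, 1] by rewrite in_itv/= lexx ler01.
have o01 : (1 : R) \in `[0, 1] by rewrite in_itv/= lexx ler01.
have := U_lip vw z01 o01; rewrite edge_pt0 edge_pt1 sub0r normrN normr1 mulr1.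
by rewrite -addrA -[(k%:Z + 1)]/(k%:Z + 1%:Z) -PoszD addn1.
Qed.

(** The radial bound is used with radii proportional to the scales of the chain: the ball of radius
    [radius_ratio e (n + j)] around [x] lies in the star of the [j]-th vertex, where [g] is at least
    [gradient_factor] times its slope. *)
Lemma chain_levels x z n (d I : R) (k : nat) : chain_end x z n ->
  radius_ratio * e n <= d -> radial_bound g x d I ->
  (forall j : nat, (j < k)%N -> mdist x (iota (vertex_pt (vtx z (n + j%:Z)))) <=
     (alpha + chainC) * e (n + j%:Z)) ->
  3 * \sum_(0 <= j < k) a (vtx z (n + j%:Z)) * e (n + j%:Z) <= I.
Proof.
move=> hx dn HI near.
pose c j : R := gradient_factor * a (vtx z (n + Posz j)).
pose r j : R := radius_ratio * e (n + Posz j).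
have M0 := ltW gradient_factor_gt0.
apply: le_trans (HI k c r _ _ _ _ _).
- rewrite mulr_sumr; apply: ler_sum => j _; rewrite /c /r.
  have -> : e (n + Posz j.+1) = alpha^-1 * e (n + j%:Z).
    have -> : n + Posz j.+1 = (n + j%:Z) + 1 by rewrite -addrA -PoszD addn1.
    by rewrite scaleS// mulrC.
  set en := e _; set A := a _.
  have -> : gradient_factor * A * (radius_ratio * en - radius_ratio * (alpha^-1 * en)) =
    gradient_factor * (radius_ratio * (1 - alpha^-1)) * (A * en) by ring.
  apply: ler_wpM2r; first exact: mulr_ge0 (a0 _) (ltW (e0 _)).
  rewrite /gradient_factor mulrDl divfK; last by rewrite lt0r_neq0// mulr_gt0.
  by rewrite lerDl !mulr_ge0// ?exprn_ge0 ?ltW.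
- by rewrite /r addr0.
- by move=> j; rewrite mulr_ge0 ?ltW.
- by move=> j; rewrite /r ler_wpM2l ?(ltW kap0)// scale_le// lerD2l lez_nat.
- by move=> j; rewrite mulr_ge0.
move=> j y jk yx; apply: g_ge; first exact: near_vtxV.
have := near j jk; have := metric_triangle y x (iota (vertex_pt (vtx z (n + j%:Z)))).
rewrite /r in yx; have := ler_wpM2r (ltW (e0 (n + j%:Z))) kap1.
have ep := e0 (n + j%:Z); rewrite /= /star_radius.
have : 0 < alpha * e (n + j%:Z) by exact: mulr_gt0.
lra.
Qed.

(** The difference between [x] and the top of the chain telescopes into slopes times scales, which
    [chain_levels] bounds. For a boundary point this holds for chains of every length, so the slopes
    are summable and [u_bd] gives a finite value. *)
Lemma chain_end_bound x z n (d I : R) : chain_end x z n ->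
  radius_ratio * e n <= d -> radial_bound g x d I ->
  exists l : R, [/\ u x = l%:E, 3 * `|l - U (vertex_pt (vtx z n))| <= I &
    3 * (a (vtx z n) * e n) <= I].
Proof.
move=> hx dn HI; have lev := chain_levels hx dn HI.
case: hx => [xE|[k [w [t [nk vw t01 xE]]]]].
  have lev' (k : nat) : 3 * \sum_(0 <= j < k) a (vtx z (n + j%:Z)) * e (n + j%:Z) <= I.
    apply: lev => j _; rewrite xE metric_sym.
    apply: le_trans (vtx_phi alpha1 tau3 hS hiota hphi _ _) _.
    by apply: (ler_wpM2r (ltW (e0 _))); rewrite lerDr ltW.
  have [k|l Ul ul] := @u_bd z n (I / 3).
    by rewrite ler_pdivlMr// mulrC.
  exists l; split; first by rewrite xE.
    rewrite mulrC -ler_pdivlMr//; apply/ler_addgt0Pl => eps eps0.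
    have /cvgrPdist_le/(_ _ eps0)[N _ HN] := Ul.
    have := HN N (leqnn N) => /= HN'.
    apply: le_trans (ler_distD (U (vertex_pt (vtx z (n + N%:Z)))) _ _) _.
    rewrite distrC [X in _ + X]distrC; apply: lerD; first by rewrite distrC.
    apply: le_trans (chain_tele z n N) _.
    by rewrite ler_pdivlMr// mulrC.
  by have := lev' 1%N; rewrite big_nat1 addr0.
have [N kE] : exists N : nat, k = n + N%:Z.
  exists `|k - n|%N; rewrite gez0_abs ?subr_ge0//; ring.
subst k.
have Vz : S (n + N%:Z) z by have [] := vw.
have vE : vtx z (n + N%:Z) = (z, n + N%:Z) by rewrite /near_vtx near_pt_id.
(* One term more than there are full steps: it pays for the piece of edge between the last vertex of
   the chain and [x]. *)
have lev' : 3 * \sum_(0 <= j < N.+1) a (vtx z (n + j%:Z)) * e (n + j%:Z) <= I.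
  apply: lev => j jN; rewrite xE.
  have ep := e0 (n + j%:Z).
  have jN' : e (n + N%:Z) <= e (n + j%:Z) by rewrite scale_le// lerD2l lez_nat.
  apply: le_trans (metric_triangle _ (iota (vertex_pt (z, n + N%:Z))) _) _.
  rewrite mulrDl; apply: lerD.
    apply: le_trans (iota_edge_vertex alpha1 hiota vw t01) _.
    by rewrite /= ler_wpM2l// ltW.
  rewrite metric_sym -vE; apply: (iota_chain_le alpha1 tau3 hS hiota).
  by rewrite lerD2l lez_nat.
exists (U (edge_pt (z, n + N%:Z) w t)); split.
- by rewrite xE uU//; exact: fillingX_edge.
- rewrite big_nat_recr//= in lev'.
  have z01 : (0 : R) \in `[0, 1] by rewrite in_itv/= lexx ler01.
  have := U_lip vw t01 z01; rewrite edge_pt0 subr0 => H1.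
  have := chain_tele z n N; rewrite vE in lev' *; rewrite distrC => H2.
  have := ler_distD (U (vertex_pt (z, n + N%:Z))) (U (edge_pt (z, n + N%:Z) w t)) (U (vertex_pt (vtx z n))).
  have : a (z, n + N%:Z) * e (n + N%:Z) * `|t| <= a (z, n + N%:Z) * e (n + N%:Z).
    rewrite ler_piMr//; first by rewrite mulr_ge0// ltW.
    by move: t01; rewrite in_itv/= => /andP[t0 t1]; rewrite ger0_norm.
  move: H1 => /=; lra.
- rewrite big_nat_recl//= addr0 mulrDr in lev'.
  have : 0 <= 3 * \sum_(0 <= i < N) a (vtx z (n + Posz i.+1)) * e (n + Posz i.+1).
    by rewrite mulr_ge0// sumr_ge0// => i _; rewrite mulr_ge0// ltW.
  lra.
Qed.

(** If the coordinate of [y] vanishes at the vertex [v] nearest to [x], or if [y] is on the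
    boundary, then [e v.2] is at most a multiple of [mdist x y], so [x] ends a chain started at that
    scale. Otherwise both points lie on edges at [v]. *)
Lemma end_dichotomy x y :
  (exists v w w' s t, [/\ adj v w, adj v w', s \in `[0, 1], t \in `[0, 1] &
     x = iota (edge_pt v w s) /\ y = iota (edge_pt v w' t)]) \/
  exists z, mdist x (phi z) <= (chainC + alpha) * (2 * alpha ^+ 4) * mdist x y /\
    forall n, 2 * alpha ^+ 4 * mdist x y < e (n - 1) -> chain_end x z n.
Proof.
have a4 : 0 < alpha ^+ 4 by rewrite exprn_gt0.
have [Xx|nXx] := pselect (Xrho x); last first.
  have [z xE] := boundary_phi alpha1 tau3 hS hiota hphi nXx.
  right; exists z; split; last by move=> *; left.
  rewrite xE mdistxx !mulr_ge0 ?mdist_ge0// ?addr_ge0 ?ltW//.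
move: Xx => [x0 Xx0 xE].
have [v [w [t [vw t2 x0E]]]] := fillingXE2 alpha1 tau3 hS Xx0.
have t01 : t \in `[0, 1] by move: t2; rewrite !in_itv/=; lra.
have far : e v.2 <= 2 * alpha ^+ 4 * mdist x y ->
  exists z, mdist x (phi z) <= (chainC + alpha) * (2 * alpha ^+ 4) * mdist x y /\
    forall n, 2 * alpha ^+ 4 * mdist x y < e (n - 1) -> chain_end x z n.
  move=> H; exists v.1; split.
    apply: (@le_trans _ _ ((chainC + alpha) * e v.2)); last first.
      by rewrite -mulrA ler_wpM2l// addr_ge0// ltW.
    have Vv : S v.2 v.1 by have [] := vw.
    have := vtx_phi alpha1 tau3 hS hiota hphi v.1 v.2.
    rewrite /near_vtx near_pt_id// -surjective_pairing => H1.
    have := iota_edge_vertex alpha1 hiota vw t01; rewrite -x0E xE.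
    have := metric_triangle x (iota (vertex_pt v)) (phi v.1); rewrite mulrDl; lra.
  move=> n nx; right; exists v.2, w, t; split => //; last by rewrite -surjective_pairing -x0E.
    by have := le_lt_trans H nx; rewrite scale_lt// ltrBlDr ltzD1.
have [Xy|nXy] := pselect (Xrho y); last first.
  by right; apply: far; rewrite -xE x0E; apply: (edge_depth_boundary alpha1 tau3 hS hiota).
move: Xy => [y0 Xy0 yE].
have [y0v|y0v] := ltP 0 (y0 v).
  have [w' [s [vw' s01 y0E]]] := star_edge Xy0 y0v.
  by left; exists v, w, w', t, s; rewrite -xE -yE x0E y0E.
right; apply: far; have := iota_coord alpha1 hiota v Xx0 Xy0.
rewrite x0E edge_ptl ?(adj_neq vw)// -x0E xE yE => H.
have : 2^-1 <= alpha ^+ 4 / e v.2 * mdist x y.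
  apply: le_trans H; rewrite ler_normr; apply/orP; left.
  by move: t2; rewrite in_itv/= => /andP[_]; lra.
rewrite -(ler_pM2l (e0 v.2)) (_ : e v.2 * (_ / _ * _) = alpha ^+ 4 * mdist x y); last first.
  by field; exact: lt0r_neq0.
lra.
Qed.

(** Points on a common star are compared through its centre. Otherwise both are ends of chains
    started at the scale of their distance, where the top vertices coincide or are adjacent; the two
    chains and the top edge cost a third of [I] each. *)
Lemma two_point_gradient x y (I : R) : x <> y ->
  radial_bound g x (mdist x y) I -> radial_bound g y (mdist x y) I ->
  exists l l' : R, [/\ u x = l%:E, u y = l'%:E & `|l - l'| <= I].
Proof.
move=> xy Hx Hy; set d := mdist x y in Hx Hy *.
have d0 : 0 < d by rewrite mdist_gt0; exact/eqP.
have a4 : 0 < alpha ^+ 4 by rewrite exprn_gt0.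
have star : (exists v w w' s t, [/\ adj v w, adj v w', s \in `[0, 1], t \in `[0, 1] &
     x = iota (edge_pt v w s) /\ y = iota (edge_pt v w' t)]) ->
  exists l l' : R, [/\ u x = l%:E, u y = l'%:E & `|l - l'| <= I].
  move=> [v [w [w' [s [t [vw vw' s01 t01 [xE yE]]]]]]].
  exists (U (edge_pt v w s)), (U (edge_pt v w' t)).
  rewrite xE yE !uU; [split => //|exact: fillingX_edge|exact: fillingX_edge].
  apply: (le_trans (star_diff vw vw' s01 t01)); rewrite -xE -yE -/d.
  have dv : d <= 2 * alpha * e v.2.
    have := iota_edge_vertex alpha1 hiota vw s01; have := iota_edge_vertex alpha1 hiota vw' t01.
    rewrite -xE -yE; have := metric_triangle x (iota (vertex_pt v)) y.
    rewrite (metric_sym (iota _) y) /d; lra.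
  have ep : 0 < alpha * e v.2 by exact: mulr_gt0.
  have near y1 : mdist y1 x <= d -> mdist y1 (iota (vertex_pt v)) < star_radius * e v.2.
    have := iota_edge_vertex alpha1 hiota vw s01; rewrite -xE.
    have := metric_triangle y1 x (iota (vertex_pt v)); rewrite /star_radius.
    have : 0 < chainC * e v.2 by exact: mulr_gt0.
    have := e0 v.2; lra.
  have := Hx 1%N (fun=> gradient_factor * a v) (fun j => if j is 0%N then d else 0).
  rewrite big_nat1 subr0 => H; apply: le_trans (H _ _ _ _ _) => //.
  - rewrite ler_wpM2r ?(ltW d0)// ler_wpM2r// /gradient_factor lerDr ltW// divr_gt0// mulr_gt0//.
  - by case=> //; exact: ltW.
  - by case => //; exact: ltW.
  - by move=> j; rewrite mulr_ge0 ?(ltW gradient_factor_gt0).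
  - case=> // y1 _ y1x; apply: g_ge; first by have [] := vw.
    exact: near.
have [/star//|[z [xz Hz]]] := end_dichotomy x y.
have [[v [w [w' [s [t [vw vw' s01 t01 [yE xE]]]]]]]|[z' [yz' Hz']]] := end_dichotomy y x.
  by apply: star; exists v, w', w, t, s.
rewrite (metric_sym y x) -/d in yz' Hz' xz Hz.
(* The level is the first whose radius [radius_ratio e n] does not exceed [d], so that the radial
   bounds reach it; minimality yields [end_scale * d < e n]. *)
have [n [n1 n2]] : exists n, radius_ratio * e n <= d /\ d < radius_ratio * e (n - 1).
  have [m /andP[m1 m2]] := exists_scale alpha1 (divr_gt0 d0 kap0).
  exists (m + 1); rewrite addrK mulrC -ler_pdivlMr// m1; split => //.
  by rewrite mulrC -ltr_pdivrMr.
have Dd : end_scale * d < e n.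
  have := n2; rewrite (scale_pred alpha1) /radius_ratio => H.
  rewrite mulrC -ltr_pdivlMr//; apply: lt_le_trans H _.
  rewrite le_eqVlt; apply/orP; left; apply/eqP; field.
  by rewrite !lt0r_neq0.
have P0 : 0 <= projC * (4 * alpha ^+ 4 * (chainC + alpha) + 1) * d.
  apply: mulr_ge0 (ltW d0); apply: mulr_ge0; first exact: ltW.
  apply: addr_ge0 => //; apply: mulr_ge0; last exact/ltW/addr_gt0.
  by apply: mulr_ge0 => //; exact: ltW.
have Q0 : 0 <= 2 * alpha ^+ 4 * d by rewrite !mulr_ge0// ltW.
have nn1 : 2 * alpha ^+ 4 * d < e (n - 1).
  have : e n <= e (n - 1) by rewrite scale_le// lerBlDr lerDl.
  move: Dd; rewrite /end_scale mulrDl; lra.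
have [l [ul Hl Ha]] := chain_end_bound (Hz n nn1) n1 Hx.
have [l' [ul' Hl' _]] := chain_end_bound (Hz' n nn1) n1 Hy.
exists l, l'; split => //.
have zz : mdist z z' < 2 * e n.
  apply: le_lt_trans (mdist_phi_ge alpha1 tau3 hS hiota hphi z z') _.
  have : mdist (phi z) (phi z') <= (4 * alpha ^+ 4 * (chainC + alpha) + 1) * d.
    have := metric_triangle (phi z) x (phi z'); have := metric_triangle x y (phi z').
    rewrite -/d (metric_sym _ x); move: xz yz'.
    set A := (chainC + alpha) * _ * d; have -> : (4 * alpha ^+ 4 * (chainC + alpha) + 1) * d = 2 * A + d.
      by rewrite /A; ring.
    lra.
  move=> /(ler_wpM2l (ltW projC0)) H; apply: le_lt_trans H _.
  have := e0 n; move: Dd; rewrite /end_scale mulrDl -!mulrA in P0 Q0 *; lra.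
have top : `|U (vertex_pt (vtx z n)) - U (vertex_pt (vtx z' n))| <= a (vtx z n) * e n.
  have [->|vw] := near_vtx_same alpha1 tau3 hS zz.
    by rewrite subrr normr0 mulr_ge0// ltW.
  have z01 : (0 : R) \in `[0, 1] by rewrite in_itv/= lexx ler01.
  have o01 : (1 : R) \in `[0, 1] by rewrite in_itv/= lexx ler01.
  by have := U_lip vw z01 o01; rewrite edge_pt0 edge_pt1 sub0r normrN normr1 mulr1.
have := ler_distD (U (vertex_pt (vtx z n))) l l'.
have := ler_distD (U (vertex_pt (vtx z' n))) (U (vertex_pt (vtx z n))) l'.
rewrite distrC in Hl'; lra.
Qed.

End edge_gradient.

(** * The discrete upper gradient and its norm *)

Section star_gradients.
Context {R : realType} {Z : completeMetricType R}.
Variable nu : {measure set (borel Z) -> \bar R}.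
Hypotheses (hnu : metric_measure nu) (hdoubling : doubling nu).
Variable p : R.
Hypothesis p1 : (1 <= p)%R.
Variables (alpha tau : R) (S : int -> set Z).
Hypothesis alpha1 : (1 < alpha)%R.
Hypothesis tau3 : (3 < tau)%R.
Hypothesis hS : forall n : int, maximal_separated (alpha ^ (- n))%R (S n).
Context {Xbar : completeMetricType R} (iota : (Z * int -> R) -> Xbar).
Hypothesis hiota : is_completion alpha tau S iota.
Variable phi : Z -> Xbar.
Hypothesis hphi : boundary_map alpha S iota phi.
Variables (mu mu_beta : {measure set (borel Xbar) -> \bar R}) (beta : R).
Hypothesis beta0 : (0 < beta)%R.
Hypothesis hmu : is_mu alpha tau S iota nu mu.
Hypothesis hmu_beta : is_mu_beta alpha tau S iota beta mu mu_beta.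

Local Open Scope ring_scope.
Local Notation V := (Z * int)%type.
Local Notation e n := (alpha ^ (- (n : int))).
Implicit Types (v w : V) (z : Z) (n : int) (a : V -> R).
Local Notation vertices := (vertices S).
Local Notation adj := (adj alpha tau S).
Local Notation X := (fillingX alpha tau S).
Local Notation Xrho := (Xrho alpha tau S iota).
Local Notation vtx := (near_vtx alpha1 hS).
Local Notation vmass := (vmass nu alpha beta).
Local Notation star_radius := (star_radius alpha).
Local Notation gradient_factor := (gradient_factor alpha tau).

Let alpha0 : 0 < alpha := alpha_gt0 alpha1.
Hint Resolve alpha0 : core.
Let e0 n : 0 < e n := scale_gt0 alpha1 n.
Hint Resolve e0 : core.
Let p0 : 0 < p := lt_le_trans ltr01 p1.
Hint Resolve p0 : core.

Definition star_ball v : set (borel Xbar) :=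
  ball (iota (vertex_pt v)) (star_radius * e v.2).

(* Infinite on the boundary, which is a null set. *)
Definition star_gradient a (y : Xbar) : \bar R :=
  if `[< Xrho y >] then ((\esum_(v in vertices)
    ((gradient_factor * a v) `^ p * \1_(star_ball v) y)%:E) `^ p^-1)%E
  else +oo%E.

Lemma star_gradient_ge0 a y : (0 <= star_gradient a y)%E.
Proof. by rewrite /star_gradient; case: ifP => // _; exact: poweR_ge0. Qed.

Let term0 a v y : (0 <= ((gradient_factor * a v) `^ p * \1_(star_ball v) y)%:E)%E.
Proof. by rewrite lee_fin mulr_ge0 ?powR_ge0. Qed.

Let term_measurable a v : measurable_fun (setT : set (borel Xbar))
  (fun y : borel Xbar => ((gradient_factor * a v) `^ p * \1_(star_ball v) y)%:E).
Proof.
apply/measurable_EFinP; apply: measurable_funM => //.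
by apply: measurable_indic; exact: measurable_mball.
Qed.

Lemma star_gradient_measurable a :
  measurable_fun (setT : set (borel Xbar)) (star_gradient a : borel Xbar -> \bar R).
Proof.
have mX : measurable (Xrho : set (borel Xbar)).
  exact: (Xrho_measurable hnu hdoubling alpha1 tau3 hS hiota).
rewrite -(setUv (Xrho : set (borel Xbar))); apply/measurable_funU => //.
  exact: measurableC.
split.
  apply: (eq_measurable_fun (fun y : borel Xbar => ((\esum_(v in vertices)
    ((gradient_factor * a v) `^ p * \1_(star_ball v) y)%:E) `^ p^-1)%E)).
    by move=> y /set_mem Xy; rewrite /star_gradient asboolT.
  apply: measurable_funTS.
  apply: (@measurableT_comp _ _ _ _ _ _ (fun x : \bar R => (x `^ p^-1)%E)).
    exact: measurable_poweR.
  apply: measurable_fun_esum => //.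
  exact: (vertices_countable hnu hdoubling alpha1 hS).
apply: (eq_measurable_fun (cst +oo%E)) => //.
by move=> y /set_mem nXy; rewrite /star_gradient asboolF.
Qed.

Lemma star_gradient_ge a v y : (forall v, 0 <= a v) -> vertices v ->
  mdist y (iota (vertex_pt v)) < star_radius * e v.2 ->
  ((gradient_factor * a v)%:E <= star_gradient a y)%E.
Proof.
move=> a0 Vv yv; rewrite /star_gradient; case: ifP => _; last by rewrite leey.
have Ma : 0 <= gradient_factor * a v.
  by rewrite mulr_ge0// ltW// (gradient_factor_gt0 alpha1 tau3).
have -> : (gradient_factor * a v)%:E = (((gradient_factor * a v) `^ p)%:E `^ p^-1)%E.
  by rewrite poweR_EFin -powRrM mulfV ?gt_eqF// powRr1.
apply: le_poweR; [by rewrite invr_ge0 ltW|by rewrite lee_fin powR_ge0|].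
apply: (le_trans _ (esum_ge_term Vv _)) => //=.
rewrite indicE mem_set ?mulr1//.
by rewrite /star_ball ballEmdist/= metric_sym.
Qed.

(** The [p]-th power of the gradient is the sum itself, which is integrated term by term; each star
    ball has mass [O(vmass v)] and the boundary is a null set. *)
Lemma star_gradient_norm : exists2 K : R, 0 < K & forall a, (forall v, 0 <= a v) ->
  (norm_on mu_beta setT p (star_gradient a) <=
   (K%:E * \esum_(v in vertices) (a v `^ p * vmass v)%:E) `^ p^-1)%E.
Proof.
have M0 := gradient_factor_gt0 alpha1 tau3.
have k0 : 0 < star_radius.
  apply: addr_gt0; last exact: chainC_gt0.
  by apply: addr_gt0 => //; exact: mulr_gt0.
have [C C0 HC] := mu_beta_ball hnu hdoubling alpha1 tau3 hS hiota beta0 hmu hmu_beta k0.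
have mX : measurable (Xrho : set (borel Xbar)).
  exact: (Xrho_measurable hnu hdoubling alpha1 tau3 hS hiota).
exists (gradient_factor `^ p * C) => [|a a0]; first by rewrite mulr_gt0 ?powR_gt0.
apply: le_poweR; first by rewrite invr_ge0 ltW.
  by apply: integral_ge0 => y _; exact: poweR_ge0.
rewrite (@ge0_negligible_integral_lower _ _ _ mu_beta _ (~` Xrho)); first last.
- by move=> y _; exact: poweR_ge0.
- exact: (mu_beta_boundary hnu hdoubling alpha1 tau3 hS hiota hmu_beta).
- exact: measurableC.
rewrite setTD setCK.
rewrite (_ : (\int[mu_beta]_(y in Xrho) _)%E = (\int[mu_beta]_(y in Xrho)
    \esum_(v in vertices) ((gradient_factor * a v) `^ p * \1_(star_ball v) y)%:E)%E); last first.
  apply: eq_integral => y /set_mem Xy; rewrite gee0_abs ?star_gradient_ge0//.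
  rewrite /star_gradient asboolT//.
  by rewrite -[X in (_ `^ X = _)%E](invrK p) poweRK ?invr_gt0// esum_ge0.
rewrite integral_esum//; first last.
- by move=> v _; apply: measurable_funTS; exact: term_measurable.
- exact: (vertices_countable hnu hdoubling alpha1 hS).
rewrite -esumZl ?mulr_ge0 ?powR_ge0 ?(ltW C0)//; last first.
  by move=> v _; rewrite lee_fin mulr_ge0 ?powR_ge0// ltW// vmass_gt0.
apply: le_esum => v Vv.
under eq_integral do rewrite EFinM.
rewrite ge0_integralZl//; last first.
- by rewrite lee_fin powR_ge0.
- apply: measurable_funTS; apply/measurable_EFinP; apply: measurable_indic; exact: measurable_mball.
rewrite integral_indic//; last exact: measurable_mball.
apply: (@le_trans _ _ (((gradient_factor * a v) `^ p)%:E * (C * vmass v)%:E)%E).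
  rewrite lee_wpmul2l ?lee_fin ?powR_ge0//; apply: le_trans (HC v Vv).
  apply: le_measure; rewrite ?inE; [|exact: measurable_mball|exact: subIsetl].
  by apply: measurableI => //; exact: measurable_mball.
rewrite -!EFinM lee_fin powRM ?(ltW M0)//.
by rewrite le_eqVlt; apply/orP; left; apply/eqP; ring.
Qed.

(** Only curves with finite integral need attention. On them the radial bounds at both ends hold
    with the value of the integral, and [two_point_gradient] gives finiteness and the inequality
    together. *)
Lemma star_upper_gradient (u : Xbar -> \bar R) (U : (V -> R) -> R) a :
  (forall v, 0 <= a v) ->
  (forall x, X x -> u (iota x) = (U x)%:E) ->
  (forall v w s t, adj v w -> s \in `[0, 1] -> t \in `[0, 1] ->
    `|U (edge_pt v w s) - U (edge_pt v w t)| <= a v * e v.2 * `|s - t|) ->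
  (forall z n (I : R),
    (forall k : nat, \sum_(0 <= j < k) a (vtx z (n + j%:Z)) * e (n + j%:Z) <= I) ->
    exists2 l : R, U (vertex_pt (vtx z (n + k%:Z))) @[k --> \oo] --> l &
      u (phi z) = l%:E) ->
  upper_gradient setT u (star_gradient a).
Proof.
move=> a0 uU U_lip u_bd.
have g_ge v y := @star_gradient_ge a v y a0.
split; [by move=> *; exact: star_gradient_ge0|exact: star_gradient_measurable|].
move=> s t gam hgam nonc.
set L := line_integral _ s t gam _.
have L0 : (0 <= L)%E by apply: integral_ge0 => l _; exact: star_gradient_ge0.
have st : s <= t by case: hgam.
suff main : (L < +oo)%E -> exists l l' : R,
    [/\ u (gam s) = l%:E, u (gam t) = l'%:E & (`|l - l'|%:E <= L)%E].
  split => [/andP[fs ft]|].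
    have [/main[l [l' [-> -> H]]]|] := ltP L +oo%E; first by rewrite -EFinB.
    by rewrite leye_eq => /eqP ->; rewrite leey.
  apply: contraNeq => Loo; have [|l [l' [-> -> _]]//] := main.
  by rewrite ltey.
move=> Loo; have fL : L \is a fin_num by rewrite ge0_fin_numE.
have LE : (L <= (fine L)%:E)%E by rewrite fineK.
have rad := curve_radial_bound (star_gradient_ge0 a) hgam LE.
have ends (x : Xbar) (d : R) : 0 < d -> radial_bound (star_gradient a) x d (fine L) ->
    exists l : R, u x = l%:E.
  move=> d0 Hx; have [[x0 Xx0 <-]|nX] := pselect (Xrho x); first by exists (U x0); rewrite uU.
  have [z xE] := boundary_phi alpha1 tau3 hS hiota hphi nX.
  have k0 : 0 < radius_ratio alpha tau by exact: (radius_ratio_gt0 alpha1 tau3).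
  have [n /andP[n1 _]] := exists_scale alpha1 (divr_gt0 d0 k0).
  have [||l [ul _ _]] := @chain_end_bound _ _ _ _ _ alpha1 tau3 hS _ _ hiota _ hphi u
    (star_gradient a) U a a0 uU U_lip u_bd g_ge x z (n + 1) d (fine L) _ _ Hx.
  - by left.
  - by rewrite mulrC -ler_pdivlMr.
  by exists l.
have [xy|xy] := pselect (gam s = gam t); last first.
  have [Hs _] := rad t (introT andP (conj st (lexx t))).
  have [_ Ht] := rad s (introT andP (conj (lexx s) st)).
  rewrite metric_sym in Hs.
  have [l [l' [ul ul' H]]] := two_point_gradient tau3 hiota hphi a0 uU U_lip u_bd g_ge xy Hs Ht.
  by exists l, l'; rewrite -[L]fineK// lee_fin.
(* For a closed curve the inequality is trivial, but the value at the end must still be shown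
   finite. A nonconstant curve moves away from its end, which provides a radial bound of positive
   extent. *)
have [r [rst nr]] : exists r, s <= r <= t /\ gam r <> gam s.
  have [r1 [r2 [r1I r2I r12]]] := nonc; rewrite !in_itv/= in r1I r2I.
  have [h|h] := pselect (gam r1 = gam s); last by exists r1.
  by exists r2; split => // h2; apply: r12; rewrite h h2.
have [Hs _] := rad r rst.
have [|l ul] := ends (gam s) _ _ Hs; first by rewrite mdist_gt0; exact/eqP.
by exists l, l; rewrite -xy ul subrr normr0.
Qed.

End star_gradients.

(** * The Poisson extension *)

(** The set [E] is not assumed open, so each superlevel set is exhibited as the trace on [E] of a
    union of balls. *)
Lemma lipschitz_on_measurable {R : realType} {M : pmetricType R} (E : set (borel M))
    (f : M -> R) (K : R) :
  (forall x y, E x -> E y -> `|f x - f y| <= K * mdist x y)%R ->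
  measurable_fun E (f : borel M -> R).
Proof.
move=> fK mE; suff : measurable_fun E (f : borel M -> R) by apply.
apply: (measurability _ (RGenOInfty.measurableE R)) => _ [_ [c ->] <-].
pose O : set M := \bigcup_(x in [set x | E x /\ (c < f x)%R])
  ball x ((f x - c) / (`|K| + 1))%R.
have K1 : (0 < `|K| + 1)%R by rewrite ltr_pwDr.
have -> : E `&` f @^-1` `]c, +oo[ = E `&` (O : set (borel M)).
  apply/seteqP; split => [x [Ex]|y [Ey [x [Ex cx] xy]]].
    rewrite /= in_itv/= andbT => cx; split => //; exists x; first by split.
    by apply: ballxx; rewrite divr_gt0// subr_gt0.
  split => //.
  have K0 : (K <= `|K| + 1)%R by have := ler_norm K; lra.
  have h := le_trans (fK _ _ Ex Ey) (ler_wpM2r (mdist_ge0 _ _) K0).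
  rewrite ballEmdist/= ltr_pdivlMr// mulrC in xy.
  by have := ler_norm (f x - f y)%R; rewrite /= in_itv/= andbT; lra.
apply: measurableI => //; apply: sub_sigma_algebra; apply: bigcup_open => x _.
exact: open_mball.
Qed.

(** * Interpolation along arc length on the edges *)

Section arc_interpolation.
Context {R : realType} {Z : completeMetricType R}.
Variables (alpha tau : R) (S : int -> set Z).
Hypothesis alpha1 : (1 < alpha)%R.
Hypothesis tau3 : (3 < tau)%R.
Hypothesis hS : forall n : int, maximal_separated (alpha ^ (- n))%R (S n).
Context {Xbar : completeMetricType R} (iota : (Z * int -> R) -> Xbar).
Hypothesis hiota : is_completion alpha tau S iota.

Local Open Scope ring_scope.
Local Notation V := (Z * int)%type.
Local Notation e n := (alpha ^ (- (n : int))).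
Implicit Types (v w : V) (n : int) (W : V -> R) (x : V -> R).
Local Notation adj := (adj alpha tau S).
Local Notation X := (fillingX alpha tau S).
Local Notation Xrho := (Xrho alpha tau S iota).
Local Notation dist_rho := (dist_rho alpha tau S).
Local Notation arc_fraction := (arc_fraction alpha tau S).

Let alpha0 : 0 < alpha := alpha_gt0 alpha1.
Hint Resolve alpha0 : core.
Let e0 n : 0 < e n := scale_gt0 alpha1 n.
Hint Resolve e0 : core.

(** No curve joins points outside the graph, so the infimum is over the empty set. With this
    convention the triangle inequality and symmetry hold for all pairs, as the theory of curve
    length requires. *)
Lemma dist_rho_off (x y : V -> R) : ~ (X x /\ X y) -> dist_rho x y = +oo%E.
Proof.
move=> nX; apply/eqP; rewrite -leye_eq; apply: le_ereal_inf_tmp => L.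
move=> [a [b [gam [[ab gX _ _] gx gy _]]]]; exfalso; apply: nX.
split; [rewrite -gx|rewrite -gy]; apply: gX; [exists a|exists b] => //.
  by rewrite /= in_itv/= lexx ab.
by rewrite /= in_itv/= lexx ab.
Qed.

Lemma dist_rho_iota (x y : V -> R) : X x -> X y ->
  dist_rho x y = (mdist (iota x) (iota y))%:E.
Proof. by move=> Xx Xy; rewrite hiota.1. Qed.

Lemma dist_rho_ge0 x y : (0 <= dist_rho x y)%E.
Proof.
have [[Xx Xy]|nX] := pselect (X x /\ X y); last by rewrite dist_rho_off.
by rewrite dist_rho_iota// lee_fin mdist_ge0.
Qed.

Lemma dist_rho_tri x y (z : V -> R) : (dist_rho x z <= dist_rho x y + dist_rho y z)%E.
Proof.
have [[Xx Xy]|nX] := pselect (X x /\ X y); last first.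
  by rewrite (dist_rho_off nX) addye ?leey// gt_eqF// (lt_le_trans _ (dist_rho_ge0 _ _)).
have [[_ Xz]|nX] := pselect (X y /\ X z); last first.
  by rewrite (dist_rho_off nX) addey ?leey// gt_eqF// (lt_le_trans _ (dist_rho_ge0 _ _)).
by rewrite !dist_rho_iota// -EFinD lee_fin metric_triangle.
Qed.

Lemma dist_rho_sym x y : dist_rho x y = dist_rho y x.
Proof.
have [[Xx Xy]|nX] := pselect (X x /\ X y); last first.
  by rewrite !dist_rho_off// => -[Xy Xx]; apply: nX.
by rewrite !dist_rho_iota// metric_sym.
Qed.

Let len v w (s t : R) := curve_length dist_rho s t (edge_pt v w).

Let len_le v w (s t : R) : adj v w -> 0 <= s -> s <= t -> t <= 1 ->
  (0 <= len v w s t <= (alpha * e v.2 * (t - s))%:E)%E.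
Proof.
move=> vw s0 st t1; rewrite (curve_length_ge0 dist_rho_ge0)//=.
apply: curve_length_lip => // r r' sr rr r't.
by apply: dist_rho_edge => //; [exact: le_trans sr|exact: le_trans t1].
Qed.

Let len_fin v w (s t : R) : adj v w -> 0 <= s -> s <= t -> t <= 1 ->
  len v w s t \is a fin_num.
Proof.
move=> vw s0 st t1; have /andP[l0 ll] := len_le vw s0 st t1.
by rewrite ge0_fin_numE// (le_lt_trans ll)// ltry.
Qed.

Let len_add v w (s t : R) : adj v w -> 0 <= s -> s <= t -> t <= 1 ->
  fine (len v w 0 t) = fine (len v w 0 s) + fine (len v w s t).
Proof.
move=> vw s0 st t1; have s1 := le_trans st t1; have t0 := le_trans s0 st.
rewrite /len (curve_lengthD dist_rho_ge0 dist_rho_tri _ s0 st) fineD//.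
  exact: len_fin.
exact: len_fin.
Qed.

Let len1_ge v w : adj v w -> e v.2 / alpha ^+ 4 <= fine (len v w 0 1).
Proof.
move=> vw; have := dist_le_curve_length dist_rho (edge_pt v w) ltr01.
rewrite edge_pt0 edge_pt1 -/(len v w 0 1) -(fineK (len_fin vw (lexx 0) ler01 (lexx 1))).
have Vv : S v.2 v.1 by case: vw. have Vw : S w.2 w.1 by case: vw.
have Xv := fillingX_vertex alpha tau (v := v) Vv.
have Xw := fillingX_vertex alpha tau (v := w) Vw.
rewrite dist_rho_iota// lee_fin => H; apply: le_trans H.
have := iota_coord alpha1 hiota v Xv Xw.
rewrite -(edge_pt0 v w) -(edge_pt1 v w) !edge_ptl ?(adj_neq vw)// subr0 subrr subr0 normr1.
rewrite edge_pt0 edge_pt1 => H.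
have a4 : 0 < alpha ^+ 4 by rewrite exprn_gt0.
rewrite ler_pdivrMr// -[leLHS]mulr1; apply: le_trans (ler_wpM2l (ltW (e0 v.2)) H) _.
rewrite le_eqVlt; apply/orP; left; apply/eqP; field.
exact: lt0r_neq0.
Qed.

Lemma arc_fraction0 v w : arc_fraction v w 0 = 0.
Proof. by rewrite /Defs.arc_fraction curve_lengthxx/= mul0r. Qed.

Let len1_gt0 v w : adj v w -> 0 < fine (len v w 0 1).
Proof. by move=> vw; apply: lt_le_trans (len1_ge vw); rewrite divr_gt0// exprn_gt0. Qed.

Lemma arc_fraction1 v w : adj v w -> arc_fraction v w 1 = 1.
Proof. by move=> vw; rewrite /Defs.arc_fraction mulfV// gt_eqF// len1_gt0. Qed.

(** The length of a piece is at most [alpha e v.2 (t - s)] and the whole edge has length at least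
    [e v.2 / alpha^4], whence [alpha^5]. *)
Lemma arc_fraction_diff v w (s t : R) : adj v w -> 0 <= s -> s <= t -> t <= 1 ->
  0 <= arc_fraction v w t - arc_fraction v w s <= alpha ^+ 5 * (t - s).
Proof.
move=> vw s0 st t1; rewrite /Defs.arc_fraction -mulrBl -!/(len v w _ _).
rewrite (len_add vw s0 st t1) addrC addKr.
have /andP[l0 ll] := len_le vw s0 st t1.
have l1 := len1_gt0 vw; have lf := len_fin vw s0 st t1.
have -> : 0 <= fine (len v w s t) / fine (len v w 0 1).
  by apply: divr_ge0; [exact: fine_ge0|exact: ltW].
rewrite /= ler_pdivrMr//.
rewrite -(fineK lf) lee_fin in ll; apply: (le_trans ll).
apply: le_trans (ler_wpM2l _ (len1_ge vw)); last first.
  by rewrite mulr_ge0 ?exprn_ge0 ?subr_ge0 ?(ltW alpha0).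
rewrite le_eqVlt; apply/orP; left; apply/eqP; field.
by rewrite lt0r_neq0.
Qed.

Lemma arc_fraction_lip v w (s t : R) : adj v w -> s \in `[0, 1] -> t \in `[0, 1] ->
  `|arc_fraction v w s - arc_fraction v w t| <= alpha ^+ 5 * `|s - t|.
Proof.
move=> vw; wlog st : s t / s <= t => [H s01 t01|].
  by have [/H|/ltW/H] := leP s t; [exact|rewrite distrC (distrC s); exact].
rewrite !in_itv/= => /andP[s0 s1] /andP[t0 t1].
have /andP[h1 h2] := arc_fraction_diff vw s0 st t1.
by rewrite distrC ger0_norm// distrC ger0_norm ?subr_ge0.
Qed.

Lemma arc_fraction_itv v w (t : R) : adj v w -> t \in `[0, 1] ->
  0 <= arc_fraction v w t <= 1.
Proof.
rewrite in_itv/= => vw /andP[t0 t1].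
have /andP[h1 _] := arc_fraction_diff vw (lexx 0) t0 t1.
have /andP[h2 _] := arc_fraction_diff vw t0 t1 (lexx 1).
by rewrite arc_fraction0 subr0 in h1; rewrite arc_fraction1// subr_ge0 in h2; rewrite h1.
Qed.

Lemma arc_fraction_rev v w (t : R) : adj v w -> t \in `[0, 1] ->
  arc_fraction w v (1 - t) = 1 - arc_fraction v w t.
Proof.
rewrite in_itv/= => vw /andP[t0 t1].
have revE (s : R) : edge_pt w v s = edge_pt v w (1 - s) by exact: edge_ptC.
have lenE a b : curve_length dist_rho (1 - b) (1 - a) (edge_pt w v) = len v w a b.
  rewrite /len -(curve_length_rev dist_rho_sym a b 1).
  by congr Defs.curve_length; apply/funext => s; exact: revE.
rewrite /Defs.arc_fraction -!/(len v w _ _).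
have -> : curve_length dist_rho 0 (1 - t) (edge_pt w v) = len v w t 1.
  by rewrite -lenE subrr.
have -> : curve_length dist_rho 0 1 (edge_pt w v) = len v w 0 1.
  by rewrite -lenE subrr subr0.
have l1 := len1_gt0 vw.
rewrite [X in 1 - fine _ / X](len_add vw t0 t1 (lexx 1)).
rewrite {1}(len_add vw t0 t1 (lexx 1)).
rewrite (len_add vw t0 t1 (lexx 1)) in l1.
by field; rewrite gt_eqF.
Qed.

Definition arc_value W v w (t : R) : R :=
  (1 - arc_fraction v w t) * W v + arc_fraction v w t * W w.

Definition edge_triple x (c : V * V * R) : Prop :=
  [/\ adj c.1.1 c.1.2, c.2 \in `[0, 1] & x = edge_pt c.1.1 c.1.2 c.2].

(* Interpolation of vertex values, linear with respect to dist_rho-arclength on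
   each edge; the value does not depend on the chosen edge through x. *)
Definition arc_interp W x : R :=
  if pselect (exists c, edge_triple x c) is left h
  then let c := projT1 (cid h) in arc_value W c.1.1 c.1.2 c.2 else 0.

(** An interior point determines its edge up to orientation, and [arc_fraction_rev] handles the
    reversal. A vertex lies on many edges, but the value there is [W] at the vertex on each of
    them. *)
Lemma edge_triple_value W x c c' : edge_triple x c -> edge_triple x c' ->
  arc_value W c.1.1 c.1.2 c.2 = arc_value W c'.1.1 c'.1.2 c'.2.
Proof.
case: c => [[v w] t] [/= vw t01 xE].
have nvw := adj_neq vw; have nwv : w != v by rewrite eq_sym.
have at0 u v' w' t' : edge_triple x (v', w', t') -> x u = 1 ->
    arc_value W v' w' t' = W u.
  case=> /= vw' t01' xE' xv.
  have [vv|nv] := eqVneq u v'.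
    subst v'; move: xv; rewrite xE' edge_ptl ?(adj_neq vw')// => h.
    have -> : t' = 0 by lra.
    by rewrite /arc_value arc_fraction0; ring.
  have [vv|nv'] := eqVneq u w'.
    subst w'; move: xv; rewrite xE' edge_ptr ?(adj_neq vw')// => ->.
    by rewrite /arc_value arc_fraction1//; ring.
  by move: xv; rewrite xE' edge_ptn// => /eqP; rewrite eq_sym oner_eq0.
move=> c'x; case: c' c'x => [[v' w'] t'] c'x; have [/= vw' t01' xE'] := c'x.
have xv : x v = 1 - t by rewrite xE edge_ptl.
have xw : x w = t by rewrite xE edge_ptr.
have [t0|t0] := eqVneq t 0.
  by rewrite (at0 v _ _ _ c'x) ?xv ?t0 ?subr0// /arc_value arc_fraction0; ring.
have [t1|t1] := eqVneq t 1.
  by rewrite (at0 w _ _ _ c'x) ?xw ?t1// /arc_value arc_fraction1//; ring.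
have inv u : x u != 0 -> u = v' \/ u = w'.
  move=> xu; have [->|n1] := eqVneq u v'; first by left.
  have [->|n2] := eqVneq u w'; first by right.
  by move: xu; rewrite xE' edge_ptn// eqxx.
have v0 : x v != 0 by rewrite xv subr_eq0 eq_sym.
have w0 : x w != 0 by rewrite xw.
have [vE|vE] := inv v v0; have [wE|wE] := inv w w0.
- by rewrite vE wE eqxx in nvw.
- subst v' w'; suff -> : t = t' by [].
  by rewrite -xw xE' edge_ptr.
- subst v' w'; have tt : t' = 1 - t by rewrite -xv xE' edge_ptr// eq_sym.
  by rewrite /arc_value tt arc_fraction_rev//; ring.
- by rewrite vE wE eqxx in nvw.
Qed.

Lemma arc_interp_edge W v w (t : R) : adj v w -> t \in `[0, 1] ->
  arc_interp W (edge_pt v w t) = arc_value W v w t.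
Proof.
move=> vw t01; rewrite /arc_interp.
have hc : edge_triple (edge_pt v w t) (v, w, t) by [].
case: pselect => [h|[]]; last by exists (v, w, t).
exact: edge_triple_value (projT2 (cid h)) hc.
Qed.

Lemma arc_interp_vertex W v : vertices S v -> arc_interp W (vertex_pt v) = W v.
Proof.
move=> Vv; have [w vw] := exists_adj alpha1 tau3 hS Vv.
rewrite -(edge_pt0 v w) arc_interp_edge//; last by rewrite in_itv/= lexx ler01.
by rewrite /arc_value arc_fraction0; ring.
Qed.

Lemma arc_interp_lip W v w s t : adj v w -> s \in `[0, 1] -> t \in `[0, 1] ->
  `|arc_interp W (edge_pt v w s) - arc_interp W (edge_pt v w t)| <=
  alpha ^+ 5 * `|W v - W w| * `|s - t|.
Proof.
move=> vw s01 t01; rewrite !arc_interp_edge// /arc_value.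
have -> : forall a b x y : R, (1 - a) * x + a * y - ((1 - b) * x + b * y) = (b - a) * (x - y).
  by move=> a b x y; ring.
rewrite normrM distrC mulrAC ler_wpM2r//.
exact: arc_fraction_lip.
Qed.

Lemma arc_interp_convex W v w (t c M : R) : adj v w -> t \in `[0, 1] ->
  `|W v - c| <= M -> `|W w - c| <= M -> `|arc_interp W (edge_pt v w t) - c| <= M.
Proof.
move=> vw t01 Mv Mw; rewrite arc_interp_edge// /arc_value.
have /andP[a0 a1] := arc_fraction_itv vw t01; set b := arc_fraction v w t in a0 a1 *.
have -> : (1 - b) * W v + b * W w - c = (1 - b) * (W v - c) + b * (W w - c) by ring.
apply: (le_trans (ler_normD _ _)); rewrite (normrM b) (normrM (1 - b)) (ger0_norm a0) ger0_norm ?subr_ge0//.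
have -> : M = (1 - b) * M + b * M by ring.
by apply: lerD; rewrite ler_wpM2l// subr_ge0.
Qed.

Lemma arc_interp_linear (a b : R) W1 W2 x :
  arc_interp (fun v => a * W1 v + b * W2 v) x = a * arc_interp W1 x + b * arc_interp W2 x.
Proof.
rewrite /arc_interp; case: pselect => [h|_]; last by rewrite !mulr0 addr0.
by rewrite /arc_value; ring.
Qed.

Lemma eq_arc_interp W1 W2 x : (forall v, vertices S v -> W1 v = W2 v) ->
  arc_interp W1 x = arc_interp W2 x.
Proof.
move=> WW; rewrite /arc_interp; case: pselect => // h.
have [[Vv Vw _ _ _] _ _] := projT2 (cid h).
by rewrite /arc_value !WW.
Qed.

Definition graph_inv (y : Xbar) : V -> R := 'pinv_(fun=> cst 0%R) X iota y.

Lemma graph_invK x : X x -> graph_inv (iota x) = x.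
Proof.
move=> Xx; rewrite /graph_inv pinvKV//; last exact/mem_set.
by move=> y z /set_mem Xy /set_mem Xz; exact: (iota_inj alpha1 hiota).
Qed.

Variable nu : {measure set (borel Z) -> \bar R}.
Hypotheses (hnu : metric_measure nu) (hdoubling : doubling nu).

(** The function is Lipschitz on each edge and the edges are countably many Borel sets; no Lipschitz
    bound on all of [Xrho] is available for general [W]. *)
Lemma arc_interp_measurable W : measurable_fun (Xrho : set (borel Xbar))
  ((arc_interp W \o graph_inv) : borel Xbar -> R).
Proof.
move=> _ Y mY.
have -> : Xrho `&` (arc_interp W \o graph_inv) @^-1` Y = \bigcup_(vw in edges alpha tau S)
    (edge_set iota vw.1 vw.2 `&` (arc_interp W \o graph_inv) @^-1` Y).
  by rewrite -setI_bigcupl -(Xrho_edges alpha1 tau3 hS).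
apply: (bigcup_edges_measurable hnu hdoubling alpha1 hS) => -[v w] /edgesE vw/=.
have mE := edge_set_measurable alpha1 hiota vw.
suff : measurable_fun (edge_set iota v w) ((arc_interp W \o graph_inv) : borel Xbar -> R).
  by apply.
pose L := alpha ^+ 5 * `|W v - W w| * (alpha ^+ 4 / e w.2).
apply: (@lipschitz_on_measurable _ _ _ _ L) => //.
move=> _ _ [s s01 <-] [t t01 <-] /=; rewrite /edge_path.
have Xs := fillingX_edge vw s01; have Xt := fillingX_edge vw t01.
rewrite !graph_invK//; apply: (le_trans (arc_interp_lip W vw s01 t01)).
rewrite -(mulrA _ (alpha ^+ 4 / _)) ler_wpM2l ?mulr_ge0 ?exprn_ge0 ?(ltW alpha0)//.
have := iota_coord alpha1 hiota w Xs Xt.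
by rewrite !edge_ptr// (adj_neq vw).
Qed.

End arc_interpolation.

Section lower_integral_sums.
Context d (T : measurableType d) (R : realType) (mu : {measure set T -> \bar R}).

Lemma ge0_integralZ_lower (D : set T) (f : T -> \bar R) (k : R) :
  (0 <= k)%R -> (forall x, D x -> 0 <= f x) ->
  \int[mu]_(x in D) (k%:E * f x) = k%:E * \int[mu]_(x in D) f x.
Proof.
move=> k0 f0; apply/eqP; rewrite eq_le ge0_integralZl_lower//=.
have [->|kn0] := eqVneq k 0%R.
  by rewrite mul0e; apply: integral_ge0 => x _; rewrite mul0e.
have kp : (0 < k)%R by rewrite lt_neqAle eq_sym kn0.
have kf0 x : D x -> 0 <= k%:E * f x by move=> Dx; rewrite mule_ge0 ?f0// lee_fin.
have kV : (0 <= k^-1)%R by rewrite invr_ge0.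
have := ge0_integralZl_lower mu kV kf0.
rewrite lee_pdivlMl// (_ : \int[mu]_(x in D) _ = \int[mu]_(x in D) f x)//.
by apply: eq_integral => x _; rewrite muleA -EFinM mulVf// mul1e.
Qed.

(** From superadditivity on finite subsums; it replaces Tonelli's theorem where the integrands are
    not known to be measurable. *)
Lemma esum_integral_lower {I : choiceType} (A : set I) (D : set T) (f : I -> T -> \bar R) :
  (forall i x, A i -> D x -> 0 <= f i x) ->
  \esum_(i in A) \int[mu]_(x in D) f i x <= \int[mu]_(x in D) \esum_(i in A) f i x.
Proof.
move=> f0; apply: ge_ereal_sup => _ [F [finF FA] <-].
have sum_le (s : seq I) : {in s, forall i, A i} ->
    \sum_(i <- s) \int[mu]_(x in D) f i x <= \int[mu]_(x in D) \sum_(i <- s) f i x.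
  elim: s => [_|i s IH sA].
    by rewrite big_nil; apply: integral_ge0 => x _; rewrite big_nil.
  have sA' : {in s, forall i, A i} by move=> j js; apply: sA; rewrite inE js orbT.
  have Ai : A i by apply: sA; rewrite inE eqxx.
  rewrite big_cons; apply: le_trans (leeD2l _ (IH sA')) _.
  apply: le_trans (ge0_integralD_lower _ _ _) _.
  - by move=> x Dx; exact: f0.
  - move=> x Dx; rewrite big_seq; apply: sume_ge0 => j js; apply: f0 => //; exact: sA'.
  rewrite le_eqVlt; apply/orP; left; apply/eqP; apply: eq_integral => x _.
  by rewrite big_cons.
rewrite fsbig_finite//=; apply: le_trans (sum_le _ _) _.
  by move=> i; rewrite in_fset_set// => /set_mem/FA.
apply: ge0_le_integral_lower => x Dx; apply/andP; split.
  by rewrite big_seq; apply: sume_ge0 => i; rewrite in_fset_set// => /set_mem/FA Ai; exact: f0.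
by rewrite -fsbig_finite//; apply: ereal_sup_ubound; exists F.
Qed.

End lower_integral_sums.

(** * Oscillations and the Besov energy *)

Section oscillation.
Context {R : realType} {Z : completeMetricType R}.
Variable nu : {measure set (borel Z) -> \bar R}.
Hypotheses (hnu : metric_measure nu) (hdoubling : doubling nu).
Variables (p theta : R).
Hypotheses (p1 : (1 <= p)%R) (theta01 : (0 < theta < 1)%R).
Variables (alpha tau : R) (S : int -> set Z).
Hypothesis alpha1 : (1 < alpha)%R.
Hypothesis tau3 : (3 < tau)%R.
Hypothesis hS : forall n : int, maximal_separated (alpha ^ (- n))%R (S n).

Local Open Scope ring_scope.
Local Notation V := (Z * int)%type.
Local Notation e n := (alpha ^ (- (n : int))).
Implicit Types (v w : V) (z x y : Z) (m n : int).
Local Notation vertices := (vertices S).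
Local Notation vvol := (vvol nu alpha).
Local Notation besov_weight := (besov_weight nu p theta alpha).

Let alpha0 : 0 < alpha := alpha_gt0 alpha1.
Hint Resolve alpha0 : core.
Let e0 n : 0 < e n := scale_gt0 alpha1 n.
Hint Resolve e0 : core.
Let p0 : 0 < p := lt_le_trans ltr01 p1.
Hint Resolve p0 : core.
Let theta0 : 0 < theta. Proof. by case/andP: theta01. Qed.
Let pt0 : 0 < p * theta. Proof. exact: mulr_gt0. Qed.

Variable lam : R.
Hypothesis lam0 : 0 < lam.
Let B v : set Z := ball v.1 (lam * e v.2).

Definition osc_energy (f : Z -> R) v : \bar R :=
  (\int[nu]_(y in B v) \int[nu]_(x in B v) (`|f x - f y| `^ p)%:E)%E.

Lemma osc_energy_ge0 f v : (0 <= osc_energy f v)%E.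
Proof. by apply: integral_ge0 => y _; apply: integral_ge0 => x _; rewrite lee_fin powR_ge0. Qed.

Section besov.
Variables (delta : Z -> Z -> R) (k : R).
Hypotheses (k0 : 0 < k) (delta_ge : forall x y, mdist x y <= k * delta x y).
Hypothesis delta_le : forall x y, delta x y <= k * mdist x y.
Hypothesis delta_ball : forall x r, measurable (dball delta x r : set (borel Z)).
Local Notation besov_integrand := (besov_integrand nu p theta delta).

(** A ball [B v] containing both points has scale at least [mdist x y / (2 lam)], each level has
    boundedly many such balls, and the volume of each is bounded below by that of the Besov ball.
    The powers [e n^(- p theta)] then sum, over the coarser levels, to the value at the finest
    one. *)
Lemma besov_kernel_sum : exists2 C : R, 0 < C & forall x y, x <> y ->
  (\esum_(v in [set v | vertices v /\ B v x /\ B v y]) (besov_weight v)%:E <=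
   (C / delta x y `^ (p * theta))%:E / nu (dball delta x (delta x y)))%E.
Proof.
pose b := 2 * lam * k ^+ 2.
have b0 : 0 < b by rewrite !mulr_gt0// exprn_gt0.
have [|C1 C10 HC1] := @vol_compare _ _ nu hnu hdoubling lam b _ b0.
  exact: addr_gt0.
have [C2 C20 HC2] := packing hnu hdoubling alpha1 hS lam0.
have [C3 C30 HC3] := geometric_scale_le alpha1 pt0.
pose K := (2 * lam * k) `^ (p * theta).
have K0 : 0 < K by rewrite powR_gt0// !mulr_gt0.
exists (C1 * C2 * C3 * K) => [|x y xy]; first by rewrite !mulr_gt0.
set r := mdist x y; have r0 : 0 < r by rewrite mdist_gt0; exact/eqP.
set dl := delta x y; have d0 : 0 < dl by rewrite -(pmulr_rgt0 _ k0) (lt_le_trans r0 (delta_ge x y)).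
set D := [set v | _].
have DV : D `<=` vertices by move=> v [].
pose N := nu (dball delta x dl).
have Nsub : dball delta x dl `<=` ball x (k * dl).
  move=> z; rewrite /dball/= ballEmdist/= => xz.
  by rewrite (le_lt_trans (delta_ge _ _))// ltr_pM2l.
have Nsup : ball x (dl / k) `<=` dball delta x dl.
  move=> z; rewrite ballEmdist/= /dball/= ltr_pdivlMr// mulrC => xz.
  by rewrite (le_lt_trans (delta_le _ _)).
have kd0 : 0 < k * dl by exact: mulr_gt0.
have N0 : (0 < N)%E.
  apply: (@lt_le_trans _ _ (nu (ball x (dl / k)))).
    by have /andP[] := hnu x (divr_gt0 d0 k0).
  by apply: le_measure; rewrite ?inE//; exact: measurable_mball.
have Noo : (N <= nu (ball x (k * dl)))%E.
  by apply: le_measure; rewrite ?inE//; exact: measurable_mball.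
have fN : N \is a fin_num.
  rewrite ge0_fin_numE ?(ltW N0)// (le_lt_trans Noo)//.
  by have /andP[] := hnu x kd0.
have FN0 : 0 < fine N by rewrite fine_gt0// N0/= -ge0_fin_numE// ltW.
have wt v : D v -> ((besov_weight v)%:E <= (C1 / fine N * e v.2 `^ (- (p * theta)))%:E)%E.
  move=> [Vv [xB yB]]; rewrite /B !ballEmdist/= in xB yB.
  have v0 : 0 < vvol v by exact: vvol_gt0.
  rewrite lee_fin /besov_weight mulrC ler_wpM2r ?powR_ge0//.
  rewrite ler_pdivlMr// mulrC ler_pdivrMr//.
  have h : vol nu x (b * e v.2) <= C1 * vol nu v.1 (e v.2).
    by apply: HC1 => //; rewrite metric_sym ltW.
  rewrite (le_trans _ h)// -lee_fin fineK// -vol_fin//; last exact: mulr_gt0.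
  apply: le_measure; rewrite ?inE//; first exact: measurable_mball.
  move=> z /Nsub; rewrite !ballEmdist/= => /lt_le_trans; apply.
  have h1 := delta_le x y; rewrite -/dl -/r in h1.
  have h2 := metric_triangle x v.1 y; rewrite -/r (metric_sym x) in h2.
  have h3 : r <= 2 * lam * e v.2 by lra.
  have h4 := le_trans h1 (ler_wpM2l (ltW k0) h3).
  apply: le_trans (ler_wpM2l (ltW k0) h4) _.
  by rewrite le_eqVlt; apply/orP; left; apply/eqP; rewrite /b; ring.
have [n1 /andP[n1l n1u]] := exists_scale alpha1 (divr_gt0 r0 (mulr_gt0 (ltr0Sn R 1) lam0)).
have lev n z : D (z, n) -> n <= n1.
  move=> [_ [xB yB]]; rewrite /B !ballEmdist/= in xB yB.
  rewrite -ltzD1 -(scale_lt alpha1); apply: le_lt_trans n1l _.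
  rewrite ltr_pdivrMr ?mulr_gt0//.
  have := metric_triangle x z y; rewrite -/r (metric_sym x); lra.
apply: (@le_trans _ _ (\esum_(v in D) (C1 / fine N * e v.2 `^ (- (p * theta)))%:E)%E).
  by apply: le_esum => v Dv; exact: wt.
have c0 : 0 <= C1 / fine N by rewrite divr_ge0 ?ltW.
rewrite (esum_vertices (S := S))//; last by move=> v; rewrite lee_fin mulr_ge0 ?powR_ge0.
apply: (@le_trans _ _ (\esum_(n in [set n : int | (n <= n1)%R])
   ((C1 / fine N * C2)%:E * (e n `^ (- (p * theta)))%:E)))%E.
  rewrite [leRHS]esum_mkcond; apply: le_esum => n _ /=.
  case: ifPn => [_|/negP nj]; last first.
    rewrite esum1// => z Dz; exfalso; apply: nj; apply/mem_set; exact: lev Dz.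
  rewrite [X in (X <= _)%E](_ : _ =
     \esum_(z in [set z | D (z, n)]) ((C1 / fine N * e n `^ (- (p * theta)))%:E * 1))%E; last first.
    by apply: eq_esum => z _; rewrite mule1.
  rewrite esumZl//; last exact: mulr_ge0 c0 (powR_ge0 _ _).
  apply: (@le_trans _ _ ((C1 / fine N * e n `^ (- (p * theta)))%:E * C2%:E)%E).
    apply: lee_wpmul2l; first by rewrite lee_fin; exact: mulr_ge0 c0 (powR_ge0 _ _).
    apply: le_trans (HC2 n x).
    apply: le_esum_sub => // z [/= Sz [xB _]]; split => //.
    by move: xB; rewrite /B !ballEmdist/= metric_sym.
  by rewrite -!EFinM lee_fin le_eqVlt; apply/orP; left; apply/eqP; ring.
have CC := mulr_ge0 c0 (ltW C20).
rewrite esumZl//; last by move=> n _; rewrite lee_fin powR_ge0.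
apply: le_trans (lee_wpmul2l _ (HC3 n1)) _; first by rewrite lee_fin mulr_ge0// ltW.
have -> : (N^-1 = ((fine N)^-1)%:E)%E by rewrite -{1}(fineK fN) inver gt_eqF.
rewrite -/N -!EFinM lee_fin.
have lk0 : 0 < 2 * lam * k by rewrite !mulr_gt0.
have hs : e n1 `^ (- (p * theta)) <= K / dl `^ (p * theta).
  rewrite powRN -invf_div lef_pV2 ?posrE ?divr_gt0 ?powR_gt0//.
  rewrite ler_pdivrMr// /K -powRM ?(ltW (e0 _)) ?(ltW lk0)//.
  rewrite ge0_ler_powR ?nnegrE ?(ltW pt0) ?(ltW d0) ?(ltW (mulr_gt0 (e0 _) lk0))//.
  have h1 := delta_le x y; rewrite -/dl -/r in h1; apply: (le_trans h1).
  move: n1u; rewrite ltr_pdivrMr ?mulr_gt0// => h.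
  apply: le_trans (ler_wpM2l (ltW k0) (ltW h)) _.
  by rewrite le_eqVlt; apply/orP; left; apply/eqP; ring.
have := ler_wpM2l (mulr_ge0 (mulr_ge0 c0 (ltW C20)) (ltW C30)) hs.
move=> /le_trans H; apply: le_trans (H _ _); last first.
  by rewrite le_eqVlt; apply/orP; left; apply/eqP; ring.
by rewrite le_eqVlt; apply/orP; left; apply/eqP; ring.
Qed.

(** The sum is moved inside both integrals, in the direction that holds without measurability of
    [f], and is then dominated by the kernel point by point; the diagonal contributes nothing. *)
Lemma osc_energy_sum : exists2 C : R, 0 < C & forall f,
  (\esum_(v in vertices) ((besov_weight v)%:E * osc_energy f v) <=
   C%:E * \int[nu]_y \int[nu]_x besov_integrand f x y)%E.
Proof.
have [C C0 HC] := besov_kernel_sum; exists C => // f.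
pose ind v x y : R := (besov_weight v * (\1_(B v) x * \1_(B v) y))%R.
pose t v x y : \bar R := (ind v x y * `|f x - f y| `^ p)%:E.
have w0 v : 0 <= besov_weight v by apply: besov_weight_ge0.
have ind0 v x y : 0 <= ind v x y.
  by apply: mulr_ge0 => //; rewrite !indicE mulr_ge0.
have t0 v x y : (0 <= t v x y)%E by rewrite lee_fin mulr_ge0 ?powR_ge0.
have I0 x y : (0 <= besov_integrand f x y)%E.
  by rewrite mule_ge0 ?inve_ge0// lee_fin divr_ge0 ?powR_ge0.
apply: (@le_trans _ _ (\esum_(v in vertices) \int[nu]_y \int[nu]_x t v x y)%E).
  apply: le_esum => v _; rewrite -ge0_integralZ_lower//; last first.
    by move=> y _; apply: integral_ge0 => x _; rewrite lee_fin powR_ge0.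
  rewrite integral_mkcond; apply: ge0_le_integral_lower => y _; rewrite patchE.
  case: ifPn => [yB|_]; last by rewrite lexx/=; apply: integral_ge0 => x _; exact: t0.
  apply/andP; split.
    by apply: mule_ge0; [rewrite lee_fin|apply: integral_ge0 => x _; rewrite lee_fin powR_ge0].
  rewrite -ge0_integralZ_lower//.
  rewrite integral_mkcond; apply: ge0_le_integral_lower => x _; rewrite patchE.
  case: ifPn => [xB|_]; last by rewrite lexx t0.
  by rewrite /t /ind !indicE xB yB !mulr1 -EFinM lexx lee_fin mulr_ge0 ?powR_ge0.
apply: le_trans (esum_integral_lower _ _) _.
  by move=> v y _ _; apply: integral_ge0 => x _; exact: t0.
rewrite -ge0_integralZ_lower ?(ltW C0)//; last first.
  by move=> y _; apply: integral_ge0 => x _; exact: I0.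
apply: ge0_le_integral_lower => y _; apply/andP; split.
  by apply: esum_ge0 => v _; apply: integral_ge0 => x _; exact: t0.
apply: le_trans (esum_integral_lower _ _) _; first by move=> *; exact: t0.
rewrite -ge0_integralZ_lower ?(ltW C0)//.
apply: ge0_le_integral_lower => x _; rewrite esum_ge0//=.
have [->|/eqP xy] := eqVneq x y.
  rewrite esum1; first by rewrite mule_ge0// lee_fin ltW.
  by move=> v _; rewrite /t subrr normr0 powR0 ?gt_eqF// mulr0.
have -> : (\esum_(v in vertices) t v x y = (`|f x - f y| `^ p)%:E *
    \esum_(v in [set v | vertices v /\ B v x /\ B v y]) (besov_weight v)%:E)%E.
  rewrite -esumZl ?powR_ge0//; last by move=> v _; rewrite lee_fin.
  rewrite (esum_mkcond vertices) [RHS]esum_mkcond; apply: eq_esum => v _.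
  rewrite /t /ind !indicE; case: ifPn => [|/negP] Vv; last first.
    by rewrite ifF//; apply/negbTE/negP => /set_mem[Vv' _]; apply: Vv; exact/mem_set.
  have [xB|xB] := boolP (x \in B v); have [yB|yB] := boolP (y \in B v).
  - rewrite ifT; first by rewrite !mulr1 -EFinM mulrC.
    by apply/mem_set; split; [exact/set_mem|split; exact/set_mem].
  - rewrite ifF; first by rewrite !(mulr0, mul0r).
    by apply/negbTE; apply: contra yB => /set_mem[_ [_ ?]]; exact/mem_set.
  - rewrite ifF; first by rewrite !(mulr0, mul0r).
    by apply/negbTE; apply: contra xB => /set_mem[_ [? _]]; exact/mem_set.
  - rewrite ifF; first by rewrite !(mulr0, mul0r).
    by apply/negbTE; apply: contra xB => /set_mem[_ [? _]]; exact/mem_set.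
apply: le_trans (lee_wpmul2l _ (HC x y xy)) _; first by rewrite lee_fin powR_ge0.
rewrite /besov_integrand !muleA -!EFinM le_eqVlt; apply/orP; left; apply/eqP.
by congr (_%:E * _)%E; ring.
Qed.

End besov.

End oscillation.

(** * Averages over vertex balls *)

Section averages.
Context {R : realType} {Z : completeMetricType R}.
Variable nu : {measure set (borel Z) -> \bar R}.
Hypotheses (hnu : metric_measure nu) (hdoubling : doubling nu).
Variable p : R.
Hypothesis p1 : (1 <= p)%R.
Variables (alpha tau : R) (S : int -> set Z).
Hypothesis alpha1 : (1 < alpha)%R.
Hypothesis tau3 : (3 < tau)%R.
Hypothesis hS : forall n : int, maximal_separated (alpha ^ (- n))%R (S n).

Local Open Scope ring_scope.
Local Notation V := (Z * int)%type.
Local Notation e n := (alpha ^ (- (n : int))).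
Implicit Types (v w : V) (z x y : Z) (m n : int).
Local Notation vertices := (vertices S).
Local Notation adj := (adj alpha tau S).
Local Notation vball := (vball alpha tau).
Local Notation vvol := (vvol nu alpha).
Local Notation vaverage := (vaverage alpha tau nu).

Let alpha0 : 0 < alpha := alpha_gt0 alpha1.
Hint Resolve alpha0 : core.
Let e0 n : 0 < e n := scale_gt0 alpha1 n.
Hint Resolve e0 : core.
Let p0 : 0 < p := lt_le_trans ltr01 p1.
Hint Resolve p0 : core.
Let tau0 : 0 < tau := tau_gt0 tau3.
Hint Resolve tau0 : core.

(** Meant for the Borel representative of a Besov function, with balls of the original metric. *)
Definition locally_Lp (f : Z -> R) : Prop :=
  measurable_fun setT (f : borel Z -> R) /\
  forall x (r : R), 0 < r -> (\int[nu]_(y in ball x r) (`|f y| `^ p)%:E < +oo)%E.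

Variable f : Z -> R.
Hypothesis hf : locally_Lp f.

Let mf (D : set (borel Z)) : measurable_fun D (f : borel Z -> R).
Proof. by apply: measurable_funTS; exact: hf.1. Qed.

Let nu_fin x (r : R) : 0 < r -> (nu (ball x r) < +oo)%E.
Proof. by move=> r0; have /andP[] := hnu x r0. Qed.

Lemma locally_Lp_integrable x (r : R) : 0 < r ->
  nu.-integrable (ball x r : set (borel Z)) (EFin \o (f : borel Z -> R)).
Proof.
move=> r0; have mB : measurable (ball x r : set (borel Z)) by exact: measurable_mball.
apply/integrableP; split; first by apply/measurable_EFinP; exact: mf.
apply: (@le_lt_trans _ _ (\int[nu]_(y in ball x r) (1 + (`|f y| `^ p)%:E))%E).
  apply: ge0_le_integral_lower => y _; rewrite abse_ge0/= lee_fin.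
  have := young_powR p1 ltr01 (normr_ge0 (f y)); rewrite powR1 mul1r.
  by rewrite -lee_fin EFinD.
rewrite ge0_integralD//; last first.
  apply/measurable_EFinP; apply: (measurableT_comp (measurable_powR p)).
  exact: measurableT_comp.
by rewrite integral_cst// mul1e lte_add_pinfty ?nu_fin// hf.2.
Qed.

Let vb v : measurable (vball v : set (borel Z)). Proof. exact: measurable_mball. Qed.
Let te v : 0 < tau * e v.2. Proof. exact: mulr_gt0. Qed.
Hint Resolve te : core.

Lemma vvol_le_vball v : ((vvol v)%:E <= nu (vball v : set (borel Z)))%E.
Proof.
rewrite /vvol -vol_fin//; apply: le_measure; rewrite ?inE//; first exact: measurable_mball.
apply: ball_sub; rewrite mdistxx add0r; have := e0 v.2.
by move=> ev; rewrite ler_peMl ?(ltW ev)//; have := tau3; lra.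
Qed.

Let nvb_fin v : nu (vball v) \is a fin_num.
Proof. by rewrite ge0_fin_numE// nu_fin. Qed.

Let nvb_ge v : vvol v <= fine (nu (vball v)).
Proof. by have := vvol_le_vball v; rewrite -{1}(fineK (nvb_fin v)) lee_fin. Qed.

Let vvol0 v : 0 < vvol v. Proof. exact: vvol_gt0. Qed.
Hint Resolve vvol0 : core.

Lemma vaverage_dev v (c : R) : ((`|vaverage f v - c| * fine (nu (vball v)))%:E <=
  \int[nu]_(x in vball v) (`|f x - c|)%:E)%E.
Proof.
have iF := locally_Lp_integrable v.1 (te v).
have iC : nu.-integrable (vball v : set (borel Z)) (EFin \o (cst c : borel Z -> R)).
  apply/integrableP; split; first by apply/measurable_EFinP.
  by rewrite /= integral_cst// lte_mul_pinfty ?nu_fin ?abse_ge0.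
have m0 : 0 < fine (nu (vball v)) by exact: lt_le_trans (nvb_ge v).
have -> : `|vaverage f v - c| * fine (nu (vball v)) =
    `|\int[nu]_(x in vball v) ((f : borel Z -> R) x - c)|.
  rewrite (RintegralB (vb v) iF iC) Rintegral_cst//.
  rewrite -[X in _ * X = _](gtr0_norm m0) -normrM mulrBl; congr (`|_ - _|).
  by rewrite /Defs.vaverage divfK// gt_eqF.
have iB : nu.-integrable (vball v : set (borel Z)) (EFin \o (fun x : borel Z => f x - c)).
  have := integrableB (vb v) iF iC; apply: eq_integrable => //.
have iB' := integrable_abse iB.
apply: (@le_trans _ _ (\int[nu]_(x in vball v) `|(f : borel Z -> R) x - c|)%:E).
  by rewrite lee_fin le_normr_Rintegral.
rewrite /Rintegral fineK//.
by have := integrable_fin_num (vb v) iB'; under eq_integral do rewrite /=.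
Qed.

(** [mean_poweR] on the vertex ball; the normalization is then weakened from the volume of that ball
    to the smaller [vvol v]. *)
Lemma vaverage_dev_pow v (c : R) : ((`|vaverage f v - c| `^ p)%:E <=
  (2 `^ p / vvol v)%:E * \int[nu]_(x in vball v) (`|f x - c| `^ p)%:E)%E.
Proof.
have m0 : 0 < fine (nu (vball v)) by exact: lt_le_trans (nvb_ge v).
have nu0 : (0 < nu (vball v) < +oo)%E by rewrite nu_fin// andbT -(fineK (nvb_fin v)) lte_fin.
have mh : measurable_fun (vball v : set (borel Z)) (fun x : borel Z => (`|f x - c|)%:E).
  apply/measurable_EFinP; apply: measurableT_comp => //.
  by apply: measurable_funB => //; exact: mf.
have := mean_poweR (vb v) nu0 p1 mh (fun x _ => normr_ge0 (f x - c)).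
set m := fine (nu (vball v)) in m0 *.
under [in X in (_ <= _ * X)%E]eq_integral do rewrite poweR_EFin.
set J := (X in (_ <= _ * X -> _)%E); set I := (X in (X `^ _ <= _ -> _)%E) => H.
have J0 : (0 <= J)%E by apply: integral_ge0 => x _; rewrite lee_fin powR_ge0.
have H2 : (((`|vaverage f v - c| * m) `^ p)%:E <= (2 `^ p * m `^ (p - 1))%:E * J)%E.
  apply: le_trans H; rewrite -poweR_EFin; apply: le_poweR; first exact: ltW.
    by rewrite lee_fin mulr_ge0// ltW.
  exact: vaverage_dev.
apply: (@le_trans _ _ ((2 `^ p / m)%:E * J)%E); last first.
  apply: lee_wpmul2r => //; rewrite lee_fin ler_wpM2l ?powR_ge0// lef_pV2 ?posrE//.
rewrite powRM ?(ltW m0)// mulrC EFinM -lee_pdivlMl ?powR_gt0// in H2.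
apply: (le_trans H2); rewrite muleA -EFinM le_eqVlt; apply/orP; left; apply/eqP.
congr (_%:E * _)%E; rewrite powRB ?(gt_eqF m0)// ?implybT// powRr1 ?(ltW m0)//.
by field; rewrite !lt0r_neq0// powR_gt0.
Qed.

Variable lam : R.
Hypothesis lam_tau : tau * (1 + 2 * alpha) <= lam.
Local Notation osc_energy := (osc_energy nu p alpha lam).

Let tlam : tau <= lam.
Proof.
apply: le_trans lam_tau; rewrite -{1}(mulr1 tau) ler_pM2l//.
by have := alpha0; lra.
Qed.

(** The origin of the bound on [lam]: centres of neighbours are within [tau (1 + alpha) e v.2], and
    the ball of the neighbour adds [tau alpha e v.2]. *)
Lemma vball_sub v w : adj v w -> vball w `<=` ball v.1 (lam * e v.2).
Proof.
move=> vw; apply: ball_sub; have := adj_dist alpha1 tau3 vw.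
have := ler_wpM2l (ltW tau0) (adj_scale alpha1 vw).
have := ler_wpM2r (ltW (e0 v.2)) lam_tau; rewrite metric_sym; lra.
Qed.

Lemma mean_osc v : (\int[nu]_(y in ball v.1 (lam * e v.2)) (`|f y - vaverage f v| `^ p)%:E <=
  (2 `^ p / vvol v)%:E * osc_energy f v)%E.
Proof.
have k0 : 0 <= 2 `^ p / vvol v by rewrite divr_ge0 ?powR_ge0 ?(ltW (vvol0 v)).
rewrite /osc_energy -ge0_integralZ_lower//; last first.
  by move=> y _; apply: integral_ge0 => x _; rewrite lee_fin powR_ge0.
apply: ge0_le_integral_lower => y _; rewrite lee_fin powR_ge0/=.
rewrite distrC; apply: (le_trans (vaverage_dev_pow v (f y))).
rewrite lee_wpmul2l ?lee_fin// integral_mkcond [leRHS]integral_mkcond.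
apply: ge0_le_integral_lower => x _; rewrite !patchE; case: ifPn => [/set_mem xv|_].
  rewrite ifT ?lexx ?lee_fin ?powR_ge0//; apply/mem_set.
  by apply: (ball_sub _ xv); rewrite mdistxx add0r ler_pM2r.
have -> : point = 0%E :> \bar R by [].
by rewrite lexx/=; case: ifP => // _; rewrite lee_fin powR_ge0.
Qed.

(** Both balls lie in the dilate of [vball v], so the difference is a deviation from the average
    over [vball v], which [mean_osc] bounds. *)
Lemma vaverage_adj (C : R) v w : (forall v w, adj v w -> vvol w <= C * vvol v) ->
  adj v w -> ((`|vaverage f v - vaverage f w| `^ p)%:E <=
    (2 `^ p * 2 `^ p * C / vvol v ^+ 2)%:E * osc_energy f v)%E.
Proof.
move=> HC vw.
have Vw : 2 `^ p / vvol w <= 2 `^ p * C / vvol v.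
  rewrite -mulrA ler_wpM2l ?powR_ge0// ler_pdivlMr// mulrC ler_pdivrMr//.
  exact: HC (adj_sym vw).
rewrite distrC; apply: (le_trans (vaverage_dev_pow w (vaverage f v))).
apply: (@le_trans _ _ ((2 `^ p * C / vvol v)%:E * ((2 `^ p / vvol v)%:E * osc_energy f v))%E).
  apply: lee_pmul; rewrite ?lee_fin ?divr_ge0 ?powR_ge0 ?(ltW (vvol0 w))//.
    by apply: integral_ge0 => x _; rewrite lee_fin powR_ge0.
  apply: le_trans (mean_osc v).
  rewrite integral_mkcond [leRHS]integral_mkcond; apply: ge0_le_integral_lower => x _.
  rewrite !patchE; case: ifPn => [/set_mem xw|_].
    by rewrite ifT ?lexx ?lee_fin ?powR_ge0//; apply/mem_set; exact: vball_sub vw _ xw.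
  have -> : point = 0%E :> \bar R by [].
  by rewrite lexx/=; case: ifP => // _; rewrite lee_fin powR_ge0.
rewrite muleA -EFinM le_eqVlt; apply/orP; left; apply/eqP; congr (_%:E * _)%E.
by field; rewrite lt0r_neq0.
Qed.

End averages.

Lemma limf_esup_right {R : realType} (f : R -> \bar R) (l : R) :
  (forall eps : R, 0 < eps -> exists2 d : R, 0 < d & forall r, 0 < r < d ->
    exists2 x : R, f r = x%:E & `|x - l| <= eps)%R ->
  limf_esup f (0%R : R)^'+ = l%:E.
Proof.
move=> H; apply/eqP; rewrite eq_le limf_esupE; apply/andP; split.
  apply/lee_addgt0Pr => eps eps0; have [d d0 Hd] := H _ eps0.
  pose V := `]0%R, d[%classic : set R.
  apply: ge_ereal_inf; exists (ereal_sup [set f x | x in V]).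
    exists V => //; near=> r; rewrite /V/= in_itv/=; apply/andP; split; near: r.
      exact: nbhs_right_gt.
    exact: nbhs_right_lt.
  apply: ge_ereal_sup => _ [r /= rV <-]; rewrite /V/= in_itv/= in rV.
  have [x -> xl] := Hd r rV; rewrite -EFinD lee_fin.
  by have := le_trans (ler_norm _) xl; lra.
apply: le_ereal_inf_tmp => _ [V FV <-]; apply/lee_subgt0Pr => eps eps0.
have [d d0 Hd] := H _ eps0.
have [r [rV r0 rd]] : exists r, [/\ V r, (0 < r)%R & (r < d)%R].
  apply: (@filter_ex _ (0%R : R)^'+); near=> r; split; near: r => //.
    exact: nbhs_right_gt.
  exact: nbhs_right_lt.
have [|x fx xl] := Hd r; first by rewrite r0.
apply: le_trans (ereal_sup_ubound (ex_intro2 _ _ r rV erefl)).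
rewrite fx -EFinB lee_fin.
by move: xl; rewrite ler_norml => /andP[]; lra.
Unshelve. all: by end_near. Qed.

(** * Averages of the interpolant near the boundary *)

Section poisson_boundary.
Context {R : realType} {Z : completeMetricType R}.
Variable nu : {measure set (borel Z) -> \bar R}.
Hypotheses (hnu : metric_measure nu) (hdoubling : doubling nu).
Variable p : R.
Hypothesis p1 : (1 <= p)%R.
Variables (alpha tau : R) (S : int -> set Z).
Hypothesis alpha1 : (1 < alpha)%R.
Hypothesis tau3 : (3 < tau)%R.
Hypothesis hS : forall n : int, maximal_separated (alpha ^ (- n))%R (S n).
Context {Xbar : completeMetricType R} (iota : (Z * int -> R) -> Xbar).
Hypothesis hiota : is_completion alpha tau S iota.
Variable phi : Z -> Xbar.
Hypothesis hphi : boundary_map alpha S iota phi.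
Variables (mu mu_beta : {measure set (borel Xbar) -> \bar R}) (beta : R).
Hypothesis beta0 : (0 < beta)%R.
Hypothesis hmu : is_mu alpha tau S iota nu mu.
Hypothesis hmu_beta : is_mu_beta alpha tau S iota beta mu mu_beta.

Local Open Scope ring_scope.
Local Notation V := (Z * int)%type.
Local Notation e n := (alpha ^ (- (n : int))).
Implicit Types (v w : V) (z : Z) (n : int) (f : Z -> R).
Local Notation vertices := (vertices S).
Local Notation adj := (adj alpha tau S).
Local Notation X := (fillingX alpha tau S).
Local Notation Xrho := (Xrho alpha tau S iota).
Local Notation vtx := (near_vtx alpha1 hS).
Local Notation vvol := (vvol nu alpha).
Local Notation vmass := (vmass nu alpha beta).
Local Notation vaverage := (vaverage alpha tau nu).
Local Notation vball := (vball alpha tau).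
Local Notation chainC := (chainC alpha).
Local Notation arc_interp := (arc_interp alpha tau S).
Local Notation graph_inv := (graph_inv alpha tau S iota).

Let alpha0 : 0 < alpha := alpha_gt0 alpha1.
Hint Resolve alpha0 : core.
Let e0 n : 0 < e n := scale_gt0 alpha1 n.
Hint Resolve e0 : core.
Let p0 : 0 < p := lt_le_trans ltr01 p1.
Hint Resolve p0 : core.
Let chainC0 : 0 < chainC := chainC_gt0 alpha1.
Hint Resolve chainC0 : core.
Let vvol0 v : 0 < vvol v. Proof. exact: vvol_gt0. Qed.
Hint Resolve vvol0 : core.

Definition vosc (lam : R) f v : R :=
  (fine (osc_energy nu p alpha lam f v) / vvol v ^+ 2) `^ p^-1.

Lemma vosc_ge0 lam f v : 0 <= vosc lam f v.
Proof. exact: powR_ge0. Qed.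

Lemma vosc_powR lam f v : osc_energy nu p alpha lam f v \is a fin_num ->
  (osc_energy nu p alpha lam f v = (vosc lam f v `^ p * vvol v ^+ 2)%:E).
Proof.
move=> fo; rewrite /vosc -powRrM mulVf ?gt_eqF// powRr1; last first.
  by rewrite divr_ge0 ?exprn_ge0 ?fine_ge0 ?osc_energy_ge0 ?(ltW (vvol0 v)).
by rewrite divfK ?fineK// lt0r_neq0// exprn_gt0.
Qed.

Let root_le (a b : R) : 0 <= a -> 0 <= b -> a `^ p <= b `^ p -> a <= b.
Proof.
move=> a0 b0 ab; rewrite leNgt; apply/negP => ba.
have : b `^ p < a `^ p by rewrite gt0_ltr_powR.
by rewrite ltNge ab.
Qed.

Lemma vosc_adj (lam : R) : tau * (1 + 2 * alpha) <= lam -> exists2 K : R, 0 < K &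
  forall f, locally_Lp nu p f ->
  (forall v, vertices v -> osc_energy nu p alpha lam f v \is a fin_num) ->
  forall v w, adj v w -> `|vaverage f v - vaverage f w| <= K * vosc lam f v.
Proof.
move=> lamt; have [C C0 HC] := vvol_adj hnu hdoubling S alpha1 tau3.
have K0 : 0 < 2 `^ p * 2 `^ p * C by rewrite !mulr_gt0 ?powR_gt0.
exists ((2 `^ p * 2 `^ p * C) `^ p^-1) => [|f hf fin v w vw]; first exact: powR_gt0.
apply: root_le; [by []|by rewrite mulr_ge0 ?powR_ge0|].
rewrite powRM ?powR_ge0// -powRrM mulVf ?gt_eqF// powRr1 ?(ltW K0)//.
have := vaverage_adj hnu p1 alpha1 tau3 hf lamt HC vw.
rewrite vosc_powR; last by apply: fin; case: vw.
rewrite -EFinM lee_fin => /le_trans; apply.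
by rewrite le_eqVlt; apply/orP; left; apply/eqP; field; rewrite lt0r_neq0.
Qed.

Lemma vosc_ball (lam : R) : tau * (1 + 2 * alpha) <= lam -> exists2 K : R, 0 < K &
  forall f, locally_Lp nu p f ->
  (forall v, vertices v -> osc_energy nu p alpha lam f v \is a fin_num) ->
  forall v, vertices v ->
  (\int[nu]_(x in ball v.1 (lam * e v.2)) (`|f x - vaverage f v|)%:E <=
   (K * vvol v * vosc lam f v)%:E)%E.
Proof.
move=> lamt; have lam0 : 0 < lam.
  apply: lt_le_trans lamt; rewrite mulr_gt0 ?(tau_gt0 tau3)//.
  by rewrite addr_gt0// mulr_gt0.
have [C C0 HC] := doubling_factor hnu hdoubling lam.
have K0 : 0 < 2 `^ p * C `^ (p - 1) * 2 `^ p by rewrite !mulr_gt0 ?powR_gt0.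
exists ((2 `^ p * C `^ (p - 1) * 2 `^ p) `^ p^-1) => [|f hf fin v Vv]; first exact: powR_gt0.
have r0 : 0 < lam * e v.2 by exact: mulr_gt0.
have mB : measurable (ball v.1 (lam * e v.2) : set (borel Z)) by exact: measurable_mball.
set I := integral nu _ _.
have I0 : (0 <= I)%E by apply: integral_ge0 => x _; rewrite lee_fin.
have mh : measurable_fun (ball v.1 (lam * e v.2) : set (borel Z))
    (fun x : borel Z => (`|f x - vaverage f v|)%:E).
  apply/measurable_EFinP; apply: measurableT_comp => //.
  by apply: measurable_funB => //; apply: measurable_funTS; exact: hf.1.
have := mean_poweR mB (hnu v.1 r0) p1 mh (fun x _ => normr_ge0 (f x - _)).
under [in X in (_ <= _ * X)%E]eq_integral do rewrite poweR_EFin.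
rewrite -/I => H.
set m := fine (nu (ball v.1 (lam * e v.2))) in H.
have m0 : 0 <= m by exact: fine_ge0.
have mC : m <= C * vvol v by apply: HC.
have c0 : (0 <= (2 `^ p * m `^ (p - 1))%:E)%E by rewrite lee_fin mulr_ge0 ?powR_ge0.
have {H} := le_trans H (lee_wpmul2l c0 (mean_osc hnu p1 alpha1 tau3 hf lamt v)).
rewrite vosc_powR ?fin// -!EFinM => H.
rewrite -(poweRK p0 I0); apply: le_trans (le_poweR _ (poweR_ge0 _ _) H) _.
  by rewrite invr_ge0 ltW.
have o0 := vosc_ge0 lam f v.
set Q := 2 `^ p * C `^ (p - 1) * 2 `^ p in K0 *.
have v0 := ltW (vvol0 v); have q0 : 0 <= Q `^ p^-1 := powR_ge0 _ _.
have Xp : (Q `^ p^-1 * vvol v * vosc lam f v) `^ p = Q * vvol v `^ p * vosc lam f v `^ p.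
  rewrite (powRM _ (mulr_ge0 q0 v0) o0) (powRM _ q0 v0) -powRrM mulVf ?lt0r_neq0//.
  by rewrite powRr1// ltW.
set x := Q `^ p^-1 * vvol v * vosc lam f v in Xp *.
have x0 : 0 <= x by rewrite /x; exact: mulr_ge0 (mulr_ge0 q0 v0) o0.
have -> : x = (x `^ p) `^ p^-1 by rewrite -powRrM mulfV ?lt0r_neq0// powRr1.
have pV : 0 <= p^-1 by rewrite invr_ge0 ltW.
have vV0 : 0 <= (vvol v)^-1 by rewrite invr_ge0.
have t0 : 0 <= (2 : R) `^ p := powR_ge0 _ _.
have y0 : 0 <= 2 `^ p / vvol v * (vosc lam f v `^ p * vvol v ^+ 2).
  by apply: mulr_ge0; [exact: mulr_ge0|apply: mulr_ge0; [exact: powR_ge0|exact: exprn_ge0]].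
rewrite poweR_EFin lee_fin; apply: (ge0_ler_powR pV); rewrite ?nnegrE.
- by apply: mulr_ge0 y0; apply: mulr_ge0 => //; exact: powR_ge0.
- exact: powR_ge0.
rewrite Xp /Q.
have mp : m `^ (p - 1) <= (C * vvol v) `^ (p - 1).
  by rewrite ge0_ler_powR ?nnegrE ?subr_ge0// mulr_ge0// ltW.
rewrite powRM ?(ltW C0) ?(ltW (vvol0 v))// in mp.
have vp : vvol v `^ p = vvol v `^ (p - 1) * vvol v.
  rewrite -[X in _ * X](powRr1 v0) -powRD; first by congr (_ `^ _); ring.
  by rewrite (gt_eqF (vvol0 v)) implybT.
apply: (@le_trans _ _ (2 `^ p * (C `^ (p - 1) * vvol v `^ (p - 1)) *
   (2 `^ p / vvol v * (vosc lam f v `^ p * vvol v ^+ 2)))).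
  by apply: ler_wpM2r => //; exact: ler_wpM2l.
by rewrite vp le_eqVlt; apply/orP; left; apply/eqP; field; rewrite lt0r_neq0.
Qed.

(** The graph inside the ball around [phi z] is covered by the edges of descendants of [vtx z n],
    and their averages deviate from the average at [vtx z n] by integrals of [|f - c|] over small
    balls. [star_descendants] sums these to an integral over one ball, hence to [vosc]; a single
    edge inside the ball bounds its mass from below. The bound [lam0] makes the dilate large enough,
    and no constant depends on [f]. *)
Lemma boundary_average : exists lam0 : R, forall lam, lam0 <= lam ->
  tau * (1 + 2 * alpha) <= lam -> exists2 K : R, 0 < K &
  forall z (r : R), 0 < r -> exists n : int,
  [/\ e n <= r / (2 * (chainC + alpha)) < alpha * e n,
   (0 < mu_beta (Xrho `&` ball (phi z) r) < +oo)%E &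
   forall f, locally_Lp nu p f ->
   (forall v, vertices v -> osc_energy nu p alpha lam f v \is a fin_num) ->
   (\int[mu_beta]_(y in Xrho `&` ball (phi z) r)
      (`|arc_interp (vaverage f) (graph_inv y) - vaverage f (vtx z n)|)%:E <=
    (K * vosc lam f (vtx z n))%:E * mu_beta (Xrho `&` ball (phi z) r))%E].
Proof.
(* With [D e n <= r], the vertical edge leaving [vtx z n] towards [z] lies within [r] of [phi z];
   this gives the ball its mass. *)
pose D := 2 * (chainC + alpha); have D0 : 0 < D by rewrite mulr_gt0// addr_gt0.
pose P := tau * (1 + alpha) * alpha ^+ 3.
have P0 : 0 < P by rewrite !mulr_gt0 ?exprn_gt0 ?(tau_gt0 tau3)// addr_gt0.
pose cg := alpha ^+ 4 + D^-1 + P * (1 + chainC / D).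
have cg0 : 0 < cg.
  apply: addr_gt0; last by apply: mulr_gt0 => //; apply: addr_gt0 => //; exact: divr_gt0.
  by apply: addr_gt0; [exact: exprn_gt0|rewrite invr_gt0].
have [M [C2 [M0 C20 HC2]]] := star_descendants hnu hdoubling alpha1 tau3 hS hiota
   cg0 (tau_gt0 tau3) beta0.
have [C1 C10 HC1] := star_integral hnu hdoubling alpha1 tau3 hS hiota beta0 hmu hmu_beta.
have [c0 c00 Hc0] := mu_beta_edge_ge hnu hdoubling alpha1 tau3 hS hiota beta0 hmu hmu_beta.
exists (1 + M * (alpha * D)) => lam lamM lamt.
have [K1 K10 HK1] := vosc_ball lamt.
have aD0 : 0 < alpha * D by exact: mulr_gt0.
pose K := C1 * C2 * (alpha * D) `^ beta * K1 / c0.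
have kr0 : 0 < alpha * D + chainC by exact: addr_gt0.
have [C3 C30 HC3] := mu_beta_ball hnu hdoubling alpha1 tau3 hS hiota beta0 hmu hmu_beta kr0.
exists K => [|z r r0]; first by rewrite !mulr_gt0 ?invr_gt0 ?powR_gt0.
have [m /andP[m1 m2]] := exists_scale alpha1 (divr_gt0 r0 D0).
exists (m + 1); set v := vtx z (m + 1).
have em : e m = alpha * e (m + 1) by rewrite scaleS// mulrCA divff ?mulr1// lt0r_neq0.
rewrite em in m2.
have Vv : vertices v by exact: near_vtxV.
set B := Xrho `&` ball (phi z) r.
have mX : measurable (Xrho : set (borel Xbar)).
  exact: (Xrho_measurable hnu hdoubling alpha1 tau3 hS hiota).
have mB : measurable (B : set (borel Xbar)) by apply: measurableI => //; exact: measurable_mball.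
have rD : e (m + 1) * D <= r by rewrite -ler_pdivlMr.
have rDu : r < alpha * D * e (m + 1).
  by move: m2; rewrite ltr_pdivrMr// => h; rewrite mulrAC.
have vphi : mdist (iota (vertex_pt v)) (phi z) <= chainC * e (m + 1).
  exact: (vtx_phi alpha1 tau3 hS hiota hphi).
have mge : ((c0 * vmass v)%:E <= mu_beta B)%E.
  have vw := near_vtx_succ alpha1 tau3 hS z (m + 1).
  apply: le_trans (Hc0 _ _ _ vw mB).
  rewrite (_ : [set t : R | _ /\ _] = `[0, 1]%classic).
    by rewrite lebesgue_measure_itv/= lte_fin ltr01 -EFinB subr0 mule1.
  apply/seteqP; split => [t []//|t t01]; split => //; split.
    by exists (edge_pt v (vtx z (m + 1 + 1)) t) => //; exact: fillingX_edge.
  rewrite ballEmdist/= metric_sym.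
  have h := iota_edge_vertex alpha1 hiota vw t01; rewrite -/v /= in h.
  apply: le_lt_trans (metric_triangle _ (iota (vertex_pt v)) _) _.
  apply: le_lt_trans (lerD h vphi) _; rewrite -mulrDl.
  apply: lt_le_trans rD; rewrite mulrC ltr_pM2l// /D.
  by have := chainC0; have := alpha0; lra.
have mle : (mu_beta B < +oo)%E.
  apply: (@le_lt_trans _ _ (C3 * vmass v)%:E); last exact: ltry.
  apply: le_trans (HC3 v Vv); apply: le_measure; rewrite ?inE//; first exact: measurable_mball.
  move=> y [_]; rewrite !ballEmdist/= => yz.
  apply: le_lt_trans (metric_triangle _ (phi z) _) _; rewrite mulrDl addrC.
  by apply: ltr_leD => //; exact: lt_trans rDu.
have vm0 : 0 < vmass v by exact: vmass_gt0.
have mgt : (0 < mu_beta B)%E by apply: lt_le_trans mge; rewrite lte_fin mulr_gt0.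
split; [by rewrite m1 m2|by rewrite mgt|move=> f hf fin; set c := vaverage f v].
pose a w : R := `|vaverage f w - c|.
have a0 w : 0 <= a w by exact: normr_ge0.
apply: (@le_trans _ _ (C1%:E * \esum_(w in star_set alpha tau S iota B) (a w * vmass w)%:E)%E).
  apply: HC1 => // [y []//|w w' t ww t01 _].
  rewrite lee_fin normr_ge0/= lee_fin /edge_path graph_invK//; last exact: fillingX_edge.
  by apply: (arc_interp_convex alpha1 hiota) => //; rewrite ?lerDl ?lerDr.
pose h : borel Z -> \bar R := fun x => (`|f x - c|)%:E.
have mh : measurable_fun setT h.
  apply/measurable_EFinP; apply: measurableT_comp => //.
  by apply: measurable_funB => //; exact: hf.1.
have h0 x : (0 <= h x)%E by rewrite lee_fin.
have geo x : X x -> B (iota x) -> depth alpha x <= cg * r /\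
     interpol (fun v => mdist v.1 z) x <= cg * r.
  move=> Xx [_]; rewrite ballEmdist/= metric_sym => xz.
  have a4 : 0 <= alpha ^+ 4 by rewrite exprn_ge0// ltW.
  have Dr : 0 <= D^-1 * r by rewrite mulr_ge0 ?invr_ge0 ?(ltW D0) ?(ltW r0).
  have Cr : 0 <= chainC / D * r by exact: mulr_ge0 (divr_ge0 (ltW chainC0) (ltW D0)) (ltW r0).
  have Pr : 0 <= P * (r + chainC / D * r) := mulr_ge0 (ltW P0) (addr_ge0 (ltW r0) Cr).
  have Ar : 0 <= alpha ^+ 4 * r by rewrite mulr_ge0// ltW.
  have cgE : cg * r = alpha ^+ 4 * r + D^-1 * r + P * (r + chainC / D * r) by rewrite /cg; ring.
  split.
    have := depth_phi alpha1 hS hiota hphi z Xx.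
    have := ler_wpM2l a4 (ltW xz); rewrite cgE; lra.
  have Xv := fillingX_vertex alpha tau Vv.
  have h2 := iota_proj alpha1 tau3 hiota z Xx Xv; rewrite -/P interpol_vertex in h2.
  have h3 : mdist v.1 z <= D^-1 * r.
    by rewrite mulrC (le_trans _ m1)// ltW// near_pt_dist.
  have h4 : mdist (iota x) (iota (vertex_pt v)) <= r + chainC / D * r.
    apply: le_trans (metric_triangle _ (phi z) _) _; apply: lerD; first exact: ltW.
    rewrite metric_sym; apply: (le_trans vphi); rewrite -mulrA ler_wpM2l ?(ltW chainC0)//.
    by rewrite mulrC.
  have := ler_wpM2l (ltW P0) h4.
  have := le_trans (ler_norm _) h2; rewrite cgE; lra.
have [_ H2] := HC2 B z r h r0 mh h0 geo.
have sB : ball z (M * r) `<=` ball v.1 (lam * e v.2).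
  apply: ball_sub; rewrite /= metric_sym.
  have h1 : mdist v.1 z < e (m + 1) by exact: near_pt_dist.
  have h2 := ler_wpM2r (ltW (e0 (m + 1))) lamM.
  have h3 := ler_wpM2l (ltW M0) (ltW rDu).
  have h4 : M * (alpha * D * e (m + 1)) = M * (alpha * D) * e (m + 1) by rewrite mulrA.
  rewrite /=; lra.
apply: (@le_trans _ _ (C1%:E * ((C2 * r `^ beta)%:E * (K1 * vvol v * vosc lam f v)%:E))%E).
  apply: lee_wpmul2l; first by rewrite lee_fin ltW.
  apply: (@le_trans _ _ (\esum_(w in star_set alpha tau S iota B)
    ((e w.2 `^ beta)%:E * \int[nu]_(x in ball w.1 (tau * e w.2)) h x))%E).
    apply: le_esum => w _; rewrite /vmass.
    rewrite (_ : a w * _ = e w.2 `^ beta * (a w * vvol w)); last by ring.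
    rewrite EFinM lee_wpmul2l ?lee_fin ?powR_ge0//.
    apply: le_trans (vaverage_dev hnu p1 alpha1 tau3 hf w c).
    rewrite lee_fin ler_wpM2l//.
    have := vvol_le_vball hnu alpha1 tau3 w.
    rewrite nu_vball// ?lee_fin//.
  apply: (le_trans H2); apply: lee_wpmul2l.
    by rewrite lee_fin mulr_ge0 ?powR_ge0// ltW.
  apply: le_trans (HK1 f hf fin v Vv).
  rewrite integral_mkcond [leRHS]integral_mkcond; apply: ge0_le_integral_lower => x _.
  rewrite !patchE; case: ifPn => [/set_mem xw|_].
    by rewrite ifT ?lexx ?h0//; apply/mem_set; exact: sB.
  have -> : point = 0%E :> \bar R by [].
  by rewrite lexx/=; case: ifP.
have o0 := vosc_ge0 lam f v.
have Ko : 0 <= K * vosc lam f v.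
  by rewrite !mulr_ge0 ?powR_ge0 ?invr_ge0 ?(ltW C10) ?(ltW C20) ?(ltW K10) ?(ltW c00).
apply: le_trans (lee_wpmul2l _ mge); last by rewrite lee_fin.
rewrite -!EFinM lee_fin /K /vmass.
have rb : r `^ beta <= (alpha * D) `^ beta * e v.2 `^ beta.
  rewrite -powRM ?(ltW aD0) ?(ltW (e0 _))//.
  by rewrite ge0_ler_powR ?nnegrE ?(ltW beta0) ?(ltW r0) ?(ltW rDu)// mulr_ge0 ?ltW.
apply: (@le_trans _ _ (C1 * (C2 * ((alpha * D) `^ beta * e v.2 `^ beta) * (K1 * vvol v * vosc lam f v)))).
  rewrite ler_wpM2l ?(ltW C10)// ler_wpM2r ?ler_wpM2l ?(ltW C20)//.
  by rewrite !mulr_ge0 ?(ltW K10) ?(ltW (vvol0 v)).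
by rewrite le_eqVlt; apply/orP; left; apply/eqP; field; rewrite lt0r_neq0.
Qed.

End poisson_boundary.

(** The mean of [g - c] is at most the mean of [|g - c|]; the hypothesis also supplies the
    integrability of [g]. *)
Lemma mean_near d (T : measurableType d) (R : realType) (mu : {measure set T -> \bar R})
    (B : set T) (g : T -> R) (c K : R) : measurable B -> measurable_fun B g ->
  0 < mu B < +oo -> \int[mu]_(x in B) (`|g x - c|%R)%:E <= K%:E * mu B ->
  exists2 m : R, (mu B)^-1 * \int[mu]_(x in B) (g x)%:E = m%:E & (`|m - c| <= K)%R.
Proof.
move=> mB mg /andP[B0 Boo] H.
have fB : mu B \is a fin_num by rewrite ge0_fin_numE// ltW.
have b0 : (0 < fine (mu B))%R by rewrite fine_gt0// B0.
have mgc : measurable_fun B (fun x => g x - c)%R by apply: measurable_funB.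
have iC : mu.-integrable B (EFin \o cst c).
  apply/integrableP; split; first by apply/measurable_EFinP.
  by rewrite /= integral_cst// lte_mul_pinfty ?abse_ge0.
have iD : mu.-integrable B (EFin \o (fun x => g x - c)%R).
  apply/integrableP; split; first exact/measurable_EFinP.
  by apply: le_lt_trans H _; rewrite -(fineK fB) -EFinM ltry.
have iG : mu.-integrable B (EFin \o g).
  have := integrableD mB iD iC; apply: eq_integrable => // x _ /=.
  by rewrite -EFinD subrK.
pose I := (\int[mu]_(x in B) g x)%R.
have IE : \int[mu]_(x in B) (g x)%:E = I%:E.
  by rewrite /I /Rintegral fineK//; exact: integrable_fin_num.
have dE : (I - c * fine (mu B))%R = (\int[mu]_(x in B) (g x - c))%R.
  by rewrite (RintegralB mB iG iC) Rintegral_cst.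
exists (I / fine (mu B))%R.
  by rewrite IE -{1}(fineK fB) inver gt_eqF// -EFinM mulrC.
rewrite -(ler_pM2r b0) -[X in (_ * X <= _)%R](gtr0_norm b0) -normrM mulrBl divfK ?gt_eqF// dE.
apply: (le_trans (le_normr_Rintegral mB iD)).
rewrite -lee_fin EFinM (fineK fB) /Rintegral fineK//.
exact: integrable_fin_num (integrable_abse iD).
Qed.

(** The telescoping series of [c] is dominated by the convergent series of [b]. *)
Lemma summable_steps {R : realType} (c b : nat -> R) (I : R) :
  (forall k, `|c k.+1 - c k| <= b k)%R ->
  (forall k : nat, \sum_(0 <= j < k) b j <= I)%R ->
  b k @[k --> \oo] --> 0%R /\ exists l : R, c k @[k --> \oo] --> l.
Proof.
move=> cb bI; have b0 k : (0 <= b k)%R by apply: le_trans (cb k).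
have cvb : cvgn (series b).
  apply: nondecreasing_is_cvgn; first exact: nondecreasing_series.
  by exists I => _ [k _ <-]; rewrite seriesEnat; exact: bI.
split; first exact: cvg_series_cvg_0.
have : cvgn (series (telescope c)).
  by apply: normed_cvg; apply: (series_le_cvg _ b0 cb cvb).
move=> /cvg_ex[l cl]; exists (c 0%N + l)%R.
apply: cvg_trans (cvgD (cvg_cst (c 0%N)) cl).
by apply: near_eq_cvg; apply: nearW => k /=; rewrite [RHS]eq_sum_telescope.
Qed.

Section integer_levels.
Local Open Scope ring_scope.
Implicit Types a b n : int.

Lemma consecutive_levels a b : 1 <= a -> b < 1 -> a - 1 <= b -> a = 1 /\ b = 0.
Proof. lia. Qed.

Lemma outer_levels a b : a < 0 \/ 1 < a -> a - 1 <= b -> b <= a + 1 -> (1 <= a) = (1 <= b).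
Proof. lia. Qed.

Lemma level_ge1 n (k : nat) : (`|1 - n|%N <= k)%N -> 1 <= n + k%:Z.
Proof. lia. Qed.

End integer_levels.

Lemma negative_levels (a b : int) : (a < 0 \/ b < 0 -> a - 1 <= b -> b <= a + 1 ->
  (1 <= a) = false /\ (1 <= b) = false)%R.
Proof. lia. Qed.

Lemma poweRD_root {R : realType} (p : R) (x y : \bar R) : (0 < p)%R -> 0 <= x -> 0 <= y ->
  (x + y) `^ p^-1 <= (2 `^ p^-1)%:E * (x `^ p^-1 + y `^ p^-1).
Proof.
move=> p0 x0 y0; have pV : (0 < p^-1)%R by rewrite invr_gt0.
have s0 : 0 <= x `^ p^-1 + y `^ p^-1 by rewrite adde_ge0 ?poweR_ge0.
have pw (z : \bar R) : 0 <= z -> (z `^ p^-1) `^ p = z.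
  by move=> z0; rewrite -{2}(invrK p) poweRK.
rewrite -[X in _ <= _ * X](poweRK p0 s0) -poweR_EFin -poweRM ?poweR_ge0 ?lee_fin//.
apply: le_poweR; [exact: ltW|exact: adde_ge0|].
have -> : 2%:E = 1 + 1 :> \bar R by [].
rewrite ge0_muleDl// mul1e; apply: leeD.
  by rewrite -[leLHS](pw x)//; apply: le_poweR; rewrite ?poweR_ge0 ?(ltW p0)// leeDl ?poweR_ge0.
by rewrite -[leLHS](pw y)//; apply: le_poweR; rewrite ?poweR_ge0 ?(ltW p0)// leeDr ?poweR_ge0.
Qed.

(** * The Poisson extension and its truncation *)

Section poisson_operator.
Context {R : realType} {Z : completeMetricType R}.
Variable nu : {measure set (borel Z) -> \bar R}.
Hypotheses (hnu : metric_measure nu) (hdoubling : doubling nu).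
Variables (p theta : R).
Hypotheses (p1 : (1 <= p)%R) (theta01 : (0 < theta < 1)%R).
Variables (alpha tau : R) (S : int -> set Z).
Hypothesis alpha1 : (1 < alpha)%R.
Hypothesis tau3 : (3 < tau)%R.
Hypothesis hS : forall n : int, maximal_separated (alpha ^ (- n))%R (S n).
Context {Xbar : completeMetricType R} (iota : (Z * int -> R) -> Xbar).
Hypothesis hiota : is_completion alpha tau S iota.
Variable phi : Z -> Xbar.
Hypothesis hphi : boundary_map alpha S iota phi.
Variables (mu mu_beta : {measure set (borel Xbar) -> \bar R}).
Hypothesis hmu : is_mu alpha tau S iota nu mu.
Hypothesis hmu_beta : is_mu_beta alpha tau S iota (p * (1 - theta))%R mu mu_beta.

Local Open Scope ring_scope.
Local Notation V := (Z * int)%type.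
Local Notation e n := (alpha ^ (- (n : int))).
Implicit Types (v w : V) (z : Z) (n : int) (f : Z -> R).
Local Notation vertices := (vertices S).
Local Notation adj := (adj alpha tau S).
Local Notation X := (fillingX alpha tau S).
Local Notation Xrho := (Xrho alpha tau S iota).
Local Notation vtx := (near_vtx alpha1 hS).
Local Notation vvol := (vvol nu alpha).
Local Notation beta := (p * (1 - theta)).
Local Notation vmass := (vmass nu alpha beta).
Local Notation vaverage := (vaverage alpha tau nu).
Local Notation vball := (vball alpha tau).
Local Notation arc_interp := (arc_interp alpha tau S).
Local Notation graph_inv := (graph_inv alpha tau S iota).
Local Notation delta := (induced_dist phi).
Local Notation besov := (besov_space nu delta p theta).
Local Notation vosc := (vosc nu p alpha).
Local Notation osc_energy := (osc_energy nu p alpha).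

Let alpha0 : 0 < alpha := alpha_gt0 alpha1.
Hint Resolve alpha0 : core.
Let e0 n : 0 < e n := scale_gt0 alpha1 n.
Hint Resolve e0 : core.
Let p0 : 0 < p := lt_le_trans ltr01 p1.
Hint Resolve p0 : core.
Let theta0 : 0 < theta. Proof. by case/andP: theta01. Qed.
Let pV0 : 0 < p^-1. Proof. by rewrite invr_gt0. Qed.
Hint Resolve pV0 : core.
Let beta0 : 0 < beta.
Proof. by rewrite mulr_gt0// subr_gt0; case/andP: theta01. Qed.
Let vvol0 v : 0 < vvol v. Proof. exact: vvol_gt0. Qed.
Hint Resolve vvol0 : core.
Let mX : measurable (Xrho : set (borel Xbar)).
Proof. exact: (Xrho_measurable hnu hdoubling alpha1 tau3 hS hiota). Qed.

(** The upper limit is written with the interpolant, not with [poisson] itself, to avoid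
    circularity; the integration is over [Xrho], where the two agree. *)
Definition poisson f (y : Xbar) : \bar R :=
  if `[< Xrho y >] then (arc_interp (vaverage f) (graph_inv y))%:E
  else limf_esup (fun r : R => ((mu_beta (Xrho `&` ball y r))^-1 *
    \int[mu_beta]_(x in Xrho `&` ball y r)
       (arc_interp (vaverage f) (graph_inv x))%:E)%E) (0%R : R)^'+.

Lemma poisson_graph f x : X x -> poisson f (iota x) = (arc_interp (vaverage f) x)%:E.
Proof.
move=> Xx; rewrite /poisson asboolT; last by exists x.
by rewrite graph_invK.
Qed.

Lemma poisson_vertex f v : vertices v -> poisson f (iota (vertex_pt v)) = (vaverage f v)%:E.
Proof.
move=> Vv; rewrite poisson_graph; last exact: fillingX_vertex.
by rewrite (arc_interp_vertex alpha1 tau3 hS hiota).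
Qed.

Lemma poisson_is_extension f : poisson_extension alpha tau S iota nu mu_beta f (poisson f).
Proof.
split; [exact: poisson_vertex| |].
  move=> v w t vw t01; rewrite poisson_graph; last exact: fillingX_edge.
  by rewrite (arc_interp_edge alpha1 hiota).
move=> y nXy; rewrite [LHS]/poisson; case: asboolP => [/nXy[]|_].
apply: (congr1 (fun g => limf_esup g (0%R : R)^'+)); apply/funext => r.
congr (_ * _)%E; apply: eq_integral => x /set_mem[Xx _].
by rewrite /poisson; case: asboolP => [_|/(_ Xx)[]].
Qed.

Definition besov_energy_of f : \bar R :=
  (\int[nu]_y \int[nu]_x besov_integrand nu p theta delta f x y)%E.

(** Averages and oscillations see [f] only up to null sets. Replacing [f] by the Borel function [g]
    once makes measurability available in everything derived from them. *)
Lemma besov_representative f : besov f -> exists g : Z -> R, [/\ locally_Lp nu p g,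
  f = g %[ae nu],
  forall v, vaverage f v = vaverage g v &
  forall lam v, osc_energy lam f v = osc_energy lam g v].
Proof.
move=> [[[g mg fg] loc] _]; exists g.
have fg' (D : set (borel Z)) (F : R -> R -> \bar R) (c : R) :
    {ae nu, forall x : borel Z, D x -> F (f x) c = F (g x) c}.
  have [N [mN N0 HN]] := fg; exists N; split => // x nx; apply: HN => h; apply: nx => _.
  by rewrite (h I).
have k0 := induced_const_gt0 alpha1 tau3.
split.
- split => // x r r0.
  have := loc x (induced_const alpha tau * r).
  rewrite /norm_on (poweR_lty pV0); last by apply: integral_ge0 => y _; exact: poweR_ge0.
  apply: le_lt_trans.
  rewrite (ae_eq_integral_lower (g := fun y : borel Z => (`|f y| `^ p)%:E)); last first.
    have [N [mN N0 HN]] := fg' (ball x r) (fun a _ => (`|a| `^ p)%:E) 0.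
    by exists N; split => // y ny; apply: HN => h; apply: ny => /h.
  rewrite integral_mkcond [leRHS]integral_mkcond; apply: ge0_le_integral_lower => y _.
  rewrite !patchE; case: ifPn => [/set_mem xy|_].
    rewrite ifT; first by rewrite lee_fin powR_ge0/= -poweR_EFin.
    apply/mem_set; rewrite /dball/=.
    apply: le_lt_trans (induced_dist_le alpha1 tau3 hS hiota hphi x y) _.
    by rewrite ltr_pM2l//; rewrite ballEmdist in xy.
  have -> : point = 0%E :> \bar R by [].
  by rewrite lexx/=; case: ifP => // _; exact: poweR_ge0.
- exact: fg.
- move=> v; rewrite /Defs.vaverage /Rintegral; congr (fine _ / _).
  by apply: ae_eq_integral_lower; exact: (fg' _ (fun a _ => a%:E) 0).
- move=> lam v; rewrite /osc_energy.
  transitivity (\int[nu]_(y in ball v.1 (lam * e v.2))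
    \int[nu]_(x in ball v.1 (lam * e v.2)) (`|f x - g y| `^ p)%:E)%E.
    apply: ae_eq_integral_lower; have [N [mN N0 HN]] := fg; exists N; split => // y ny.
    by apply: HN => h; apply: ny => _; rewrite (h I).
  apply: eq_integral => y _; apply: ae_eq_integral_lower.
  exact: (fg' _ (fun a c => (`|a - c| `^ p)%:E) (g y)).
Qed.

(** The estimates for Besov functions with constants independent of the function, and with the level
    [n] depending only on [z] and [r]: linearity compares several functions at the same vertex. *)
Definition poisson_bounds (lam K : R) : Prop :=
  [/\ tau * (1 + 2 * alpha) <= lam,
   forall f, besov f -> forall v, vertices v -> osc_energy lam f v \is a fin_num,
   forall f, besov f -> forall v w, adj v w -> `|vaverage f v - vaverage f w| <= K * vosc lam f v,
   forall z (r : R), 0 < r -> exists n : int,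
     [/\ e n <= r / (2 * (chainC alpha + alpha)) < alpha * e n,
     (0 < mu_beta (Xrho `&` ball (phi z) r) < +oo)%E &
     forall f, besov f -> (\int[mu_beta]_(y in Xrho `&` ball (phi z) r)
      (`|arc_interp (vaverage f) (graph_inv y) - vaverage f (vtx z n)|)%:E <=
      (K * vosc lam f (vtx z n))%:E * mu_beta (Xrho `&` ball (phi z) r))%E] &
   forall f, besov f ->
    (\esum_(v in vertices) (besov_weight nu p theta alpha v)%:E * osc_energy lam f v <=
      K%:E * besov_energy_of f)%E].

Lemma poisson_constants : exists lam : R, exists2 K : R, 0 < K & poisson_bounds lam K.
Proof.
have k0 := induced_const_gt0 alpha1 tau3.
have [lam0 H0] := boundary_average hnu hdoubling p1 alpha1 tau3 hS hiota hphi beta0 hmu hmu_beta.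
pose lam := Num.max lam0 (tau * (1 + 2 * alpha)); exists lam.
have lam1 : lam0 <= lam by rewrite le_max lexx.
have lamt : tau * (1 + 2 * alpha) <= lam by rewrite le_max lexx orbT.
have lam00 : 0 < lam.
  apply: lt_le_trans lamt; rewrite mulr_gt0 ?(tau_gt0 tau3)//.
  by rewrite addr_gt0// mulr_gt0.
have [K1 K10 H1] := H0 lam lam1 lamt.
have [K2 K20 H2] := vosc_adj hnu hdoubling p1 S alpha1 tau3 lamt.
have [K3 K30 H3] := osc_energy_sum hnu hdoubling p1 theta01 alpha1 hS lam00 k0
  (induced_dist_ge alpha1 tau3 hS hiota hphi) (induced_dist_le alpha1 tau3 hS hiota hphi)
  (dball_measurable alpha1 tau3 hS hiota hphi).
have fin f : besov f -> forall v, vertices v -> osc_energy lam f v \is a fin_num.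
  move=> [_ foo] v Vv; rewrite ge0_fin_numE ?osc_energy_ge0//.
  have E0 : (besov_energy_of f < +oo)%E.
    move: foo; rewrite /besov_norm poweR_lty ?invr_gt0//.
    apply: integral_ge0 => y _; apply: integral_ge0 => x _.
    by rewrite mule_ge0 ?inve_ge0// lee_fin divr_ge0 ?powR_ge0.
  have w0 u : (0 <= (besov_weight nu p theta alpha u)%:E * osc_energy lam f u)%E.
    by rewrite mule_ge0 ?osc_energy_ge0// lee_fin besov_weight_ge0.
  have h1 := le_trans (esum_ge_term Vv (fun u _ => w0 u)) (H3 f).
  rewrite ltey; apply/negP => /eqP oE; move: h1; rewrite oE gt0_muley; last first.
    by rewrite lte_fin divr_gt0// powR_gt0.
  apply/negP; rewrite -ltNge; rewrite lte_mul_pinfty// ?lee_fin ?ltW//.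
exists (K1 + K2 + K3); first by rewrite !addr_gt0.
have rep f : besov f -> exists g : Z -> R, [/\ locally_Lp nu p g,
    forall v, vertices v -> osc_energy lam g v \is a fin_num,
    vaverage f = vaverage g & vosc lam f = vosc lam g].
  move=> Bf; have [g [Lg _ vE oE]] := besov_representative Bf; exists g; split.
  - exact: Lg.
  - by move=> v Vv; rewrite -oE; exact: fin.
  - exact/funext.
  - by apply/funext => v; rewrite /vosc oE.
split; [exact: lamt|exact: fin| | |].
- move=> f Bf v w vw; have [g [Lg fg -> ->]] := rep f Bf.
  apply: le_trans (H2 g Lg fg v w vw) _.
  by apply: ler_wpM2r; [exact: vosc_ge0|lra].
- move=> z r r0; have [n [h1 h2 h3]] := H1 z r r0; exists n; split; [exact: h1|exact: h2|].
  move=> f Bf; have [g [Lg fg -> ->]] := rep f Bf.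
  apply: (le_trans (h3 g Lg fg)); rewrite lee_wpmul2r// lee_fin.
  by apply: ler_wpM2r; [exact: vosc_ge0|lra].
- move=> f Bf; apply: le_trans (H3 f) _; rewrite lee_wpmul2r//.
    apply: integral_ge0 => y _; apply: integral_ge0 => x _.
    by rewrite mule_ge0 ?inve_ge0// lee_fin divr_ge0 ?powR_ge0.
  by rewrite lee_fin; lra.
Qed.

Local Notation energy := besov_energy_of.

Variables (C0 : R) (psi : int -> Z -> Z -> R).
Hypothesis hpsi : partition_of_unity alpha S C0 psi.
Variables (lam K : R).
Hypothesis K0 : 0 < K.
Hypothesis hb : poisson_bounds lam K.

(** Slope bound of the interpolant per unit of [e v.2]: neighbouring averages differ by at most
    [K vosc], and arc length distorts the edge parameter by at most [alpha^5]. *)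
Definition poisson_slope f v : R := alpha ^+ 5 * K * vosc lam f v / e v.2.

Lemma poisson_slope_ge0 f v : 0 <= poisson_slope f v.
Proof.
rewrite /poisson_slope divr_ge0 ?(ltW (e0 _))// mulr_ge0 ?vosc_ge0//.
by rewrite mulr_ge0 ?exprn_ge0 ?ltW.
Qed.

Lemma poisson_slope_scale f v : poisson_slope f v * e v.2 = alpha ^+ 5 * (K * vosc lam f v).
Proof. by rewrite /poisson_slope divfK ?lt0r_neq0// mulrA. Qed.

Lemma poisson_lip f v w s t : besov f -> adj v w -> s \in `[0, 1] -> t \in `[0, 1] ->
  `|arc_interp (vaverage f) (edge_pt v w s) - arc_interp (vaverage f) (edge_pt v w t)| <=
  poisson_slope f v * e v.2 * `|s - t|.
Proof.
move=> Bf vw s01 t01; have [_ _ H _ _] := hb.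
apply: le_trans (arc_interp_lip alpha1 hiota _ vw s01 t01) _.
rewrite poisson_slope_scale ler_wpM2r// ler_wpM2l ?exprn_ge0 ?(ltW alpha0)//.
exact: H.
Qed.

(** Since [beta - p = - p theta], the term at [v] is a constant times [besov_weight v] times the
    oscillation energy. *)
Lemma poisson_slope_energy f : besov f ->
  (\esum_(v in vertices) (poisson_slope f v `^ p * vmass v)%:E <=
   ((alpha ^+ 5 * K) `^ p * K)%:E * energy f)%E.
Proof.
move=> Bf; have [_ fin _ _ H] := hb.
have A0 : 0 <= alpha ^+ 5 * K by rewrite mulr_ge0 ?exprn_ge0 ?ltW.
rewrite EFinM -muleA; apply: le_trans (lee_wpmul2l _ (H f Bf)); last by rewrite lee_fin powR_ge0.
rewrite -esumZl ?powR_ge0//; last first.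
  by move=> v _; rewrite mule_ge0 ?osc_energy_ge0// lee_fin besov_weight_ge0.
apply: le_esum => v Vv; rewrite vosc_powR ?fin// -!EFinM lee_fin.
have o0 := vosc_ge0 nu p alpha lam f v.
have i0 : 0 <= (e v.2)^-1 by rewrite invr_ge0 ltW.
rewrite /poisson_slope (powRM _ (mulr_ge0 A0 o0) i0) (powRM _ A0 o0).
rewrite /vmass /besov_weight.
have -> : e v.2 `^ (p * (1 - theta)) = e v.2 `^ p * e v.2 `^ (- (p * theta)).
  rewrite -powRD; first by congr (_ `^ _); ring.
  by rewrite (gt_eqF (e0 _)) implybT.
have E0 : 0 < e v.2 `^ p by rewrite powR_gt0.
have -> : (e v.2)^-1 `^ p = (e v.2 `^ p)^-1.
  apply: (mulfI (lt0r_neq0 E0)).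
  by rewrite -(powRM _ (ltW (e0 _)) i0) !mulfV ?powR1// lt0r_neq0.
by rewrite le_eqVlt; apply/orP; left; apply/eqP; field; rewrite !lt0r_neq0.
Qed.

(** Summability of [s] along the chain makes the averages converge and [s] tend to 0; the mean over
    the ball of radius [r] differs from an average on the chain by at most [s] there. The bound [s]
    is arbitrary so that combinations of two functions are covered too. *)
Lemma poisson_boundary_value f (s : V -> R) z n (I : R) :
  (forall v w, adj v w -> `|vaverage f v - vaverage f w| <= s v) ->
  (forall (r : R), 0 < r -> exists m : int,
     [/\ e m <= r / (2 * (chainC alpha + alpha)) < alpha * e m,
     (0 < mu_beta (Xrho `&` ball (phi z) r) < +oo)%E &
     (\int[mu_beta]_(y in Xrho `&` ball (phi z) r)
      (`|arc_interp (vaverage f) (graph_inv y) - vaverage f (vtx z m)|)%:E <=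
      (s (vtx z m))%:E * mu_beta (Xrho `&` ball (phi z) r))%E]) ->
  (forall k : nat, \sum_(0 <= j < k) s (vtx z (n + j%:Z)) <= I) ->
  exists2 l : R, vaverage f (vtx z (n + k%:Z)) @[k --> \oo] --> l &
    poisson f (phi z) = l%:E.
Proof.
move=> Hadj Hav HI; pose b (k : nat) := s (vtx z (n + k%:Z)).
have [|b_cvg [l cl]] := @summable_steps _ (fun k : nat => vaverage f (vtx z (n + k%:Z))) b I _ HI.
  move=> k; rewrite distrC.
  have := near_vtx_succ alpha1 tau3 hS z (n + k%:Z).
  by rewrite -addrA -[k%:Z + 1]/(k%:Z + 1%:Z) -PoszD addn1; exact: Hadj.
exists l => //; rewrite /poisson; case: asboolP => [/(phi_notin alpha1 tau3 hS hiota hphi)[]|_].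
apply: limf_esup_right => eps eps0.
have eps2 : 0 < eps / 2 by exact: divr_gt0.
have /cvgrPdist_le/(_ _ eps2)[N1 _ HN1] := b_cvg.
have /cvgrPdist_le/(_ _ eps2)[N2 _ HN2] := cl.
pose D := 2 * (chainC alpha + alpha).
have D0 : 0 < D by rewrite mulr_gt0// addr_gt0// chainC_gt0.
exists (D * e (n + (maxn N1 N2)%:Z)) => [|r /andP[r0 rD]]; first exact: mulr_gt0.
have [m [/andP[m1 m2] mB avg]] := Hav r r0.
have nm : n + (maxn N1 N2)%:Z <= m.
  rewrite ltW// -(scale_lt alpha1); apply: le_lt_trans m1 _.
  by rewrite ltr_pdivrMr// mulrC.
have [k mE] : exists k : nat, m = n + k%:Z.
  exists `|m - n|%N; rewrite gez0_abs; first by ring.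
  by rewrite subr_ge0 (le_trans _ nm)// lerDl.
have kN : (maxn N1 N2 <= k)%N by rewrite mE lerD2l lez_nat in nm.
rewrite mE in avg.
have mBm : measurable (Xrho `&` ball (phi z) r : set (borel Xbar)).
  by apply: measurableI => //; exact: measurable_mball.
have mg : measurable_fun (Xrho `&` ball (phi z) r : set (borel Xbar))
    ((arc_interp (vaverage f) \o graph_inv) : borel Xbar -> R).
  apply: measurable_funS (@subIsetl _ _ _) _; first exact: mX.
  exact: (arc_interp_measurable alpha1 tau3 hS hiota hnu hdoubling).
have [x xE xl] := mean_near mBm mg mB avg.
exists x; first exact: xE.
have h1 : s (vtx z (n + k%:Z)) <= eps / 2.
  have := HN1 k (leq_trans (leq_maxl _ _) kN).
  by rewrite /= sub0r normrN; apply: le_trans; exact: ler_norm.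
have h2 := HN2 k (leq_trans (leq_maxr _ _) kN).
rewrite /= distrC in h2.
have := ler_distD (vaverage f (vtx z (n + k%:Z))) x l; lra.
Qed.

Lemma poisson_slope_sum f z n (k : nat) (I : R) :
  \sum_(0 <= j < k) poisson_slope f (vtx z (n + j%:Z)) * e (n + j%:Z) <= I ->
  \sum_(0 <= j < k) K * vosc lam f (vtx z (n + j%:Z)) <= I.
Proof.
apply: le_trans; apply: ler_sum => j _; rewrite (poisson_slope_scale _ (vtx z (n + j%:Z))).
by rewrite ler_peMl ?mulr_ge0 ?vosc_ge0 ?(ltW K0)// exprn_ege1// ltW.
Qed.

Lemma poisson_boundary f z n (I : R) : besov f ->
  (forall k : nat, \sum_(0 <= j < k) poisson_slope f (vtx z (n + j%:Z)) * e (n + j%:Z) <= I) ->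
  exists2 l : R, vaverage f (vtx z (n + k%:Z)) @[k --> \oo] --> l &
    poisson f (phi z) = l%:E.
Proof.
move=> Bf HI; have [_ _ Hadj Hav _] := hb.
apply: (@poisson_boundary_value f (fun v => K * vosc lam f v) z n I).
- by move=> v w; exact: Hadj.
- move=> r r0; have [m [h1 h2 h3]] := Hav z r r0; exists m; split=> //; exact: h3.
- by move=> k; apply: poisson_slope_sum.
Qed.

Lemma vaverage_linear f g (a b : R) v : besov f -> besov g ->
  vaverage (fun x => a * f x + b * g x) v = a * vaverage f v + b * vaverage g v.
Proof.
move=> Bf Bg; have tv : 0 < tau * e v.2 by rewrite mulr_gt0// (tau_gt0 tau3).
have mB : measurable (vball v : set (borel Z)) by exact: measurable_mball.
have [f' [Lf ff -> _]] := besov_representative Bf.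
have [g' [Lg gg -> _]] := besov_representative Bg.
have i1 := locally_Lp_integrable hnu p1 Lf v.1 tv.
have i2 := locally_Lp_integrable hnu p1 Lg v.1 tv.
rewrite /Defs.vaverage.
have -> : (\int[nu]_(x in vball v) (a * f x + b * g x))%R =
    (\int[nu]_(x in vball v) ((fun x : borel Z => a * f' x) x + (fun x : borel Z => b * g' x) x))%R.
  congr fine; apply: ae_eq_integral_lower.
  have [N1 [mN1 N10 HN1]] := ff; have [N2 [mN2 N20 HN2]] := gg.
  exists (N1 `|` N2); split; first exact: measurableU.
    apply/eqP; rewrite eq_le measure_ge0 andbT.
    by apply: (le_trans (measureU2 _ _ _)) => //; rewrite [X in (X + _)%E]N10 [X in (_ + X)%E]N20 adde0.
  move=> x; apply: contra_notP => /not_orP[nx1 nx2] _.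
  have -> : f x = f' x by apply: contrapT => h; apply: nx1; apply: HN1 => /(_ I).
  by have -> : g x = g' x by apply: contrapT => h; apply: nx2; apply: HN2 => /(_ I).
rewrite RintegralD//; first last.
- by have := integrableZl mB b i2; apply: eq_integrable.
- by have := integrableZl mB a i1; apply: eq_integrable.
rewrite !RintegralZl//; first by ring.
Qed.

Lemma poisson_boundary_linear f g (a b : R) z n (I : R) : besov f -> besov g ->
  (forall k : nat, \sum_(0 <= j < k) (poisson_slope f (vtx z (n + j%:Z)) +
     poisson_slope g (vtx z (n + j%:Z))) * e (n + j%:Z) <= I) ->
  exists l1 l2 : R, [/\ poisson f (phi z) = l1%:E, poisson g (phi z) = l2%:E &
    poisson (fun x => a * f x + b * g x) (phi z) = (a * l1 + b * l2)%:E].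
Proof.
move=> Bf Bg HI; have [_ _ Hadj Hav _] := hb.
have HI1 k : \sum_(0 <= j < k) poisson_slope f (vtx z (n + j%:Z)) * e (n + j%:Z) <= I.
  apply: le_trans (HI k); apply: ler_sum => j _.
  by rewrite ler_wpM2r ?(ltW (e0 _))// lerDl poisson_slope_ge0.
have HI2 k : \sum_(0 <= j < k) poisson_slope g (vtx z (n + j%:Z)) * e (n + j%:Z) <= I.
  apply: le_trans (HI k); apply: ler_sum => j _.
  by rewrite ler_wpM2r ?(ltW (e0 _))// lerDr poisson_slope_ge0.
have [l1 c1 p1'] := poisson_boundary Bf HI1.
have [l2 c2 p2'] := poisson_boundary Bg HI2.
exists l1, l2; split => //; set h := (fun x => _).
have hE v : vaverage h v = a * vaverage f v + b * vaverage g v by exact: vaverage_linear.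
have hE' : vaverage h = (fun v => a * vaverage f v + b * vaverage g v) by apply/funext.
pose s v := `|a| * (K * vosc lam f v) + `|b| * (K * vosc lam g v).
have [|||l cl ->] := @poisson_boundary_value h s z n (`|a| * I + `|b| * I).
- move=> v w vw; rewrite !hE.
  have -> : forall x y x' y' : R, a * x + b * y - (a * x' + b * y') = a * (x - x') + b * (y - y').
    by move=> *; ring.
  rewrite (le_trans (ler_normD _ _))// !normrM lerD// ler_wpM2l// Hadj//.
- move=> r r0; have [m [h1 h2 h3]] := Hav z r r0; exists m; split=> //.
  have mBm : measurable (Xrho `&` ball (phi z) r : set (borel Xbar)).
    by apply: measurableI => //; exact: measurable_mball.
  pose A W := ((fun y : borel Xbar => (`|arc_interp W (graph_inv y) - W (vtx z m)|)%:E) : borel Xbar -> \bar R).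
  have mg W : measurable_fun (Xrho `&` ball (phi z) r : set (borel Xbar)) (A W).
    apply/measurable_EFinP; apply: measurableT_comp => //; apply: measurable_funB => //.
    apply: measurable_funS (@subIsetl _ _ _) _; first exact: mX.
    exact: (arc_interp_measurable alpha1 tau3 hS hiota hnu hdoubling).
  have A0 W y : (0 <= A W y)%E by rewrite lee_fin.
  apply: (@le_trans _ _ (\int[mu_beta]_(y in Xrho `&` ball (phi z) r)
     (`|a|%:E * A (vaverage f) y + `|b|%:E * A (vaverage g) y))%E).
    apply: ge0_le_integral_lower => y _; rewrite lee_fin normr_ge0/= hE' arc_interp_linear.
    rewrite -!EFinM -EFinD lee_fin -!normrM.
    apply: le_trans (ler_normD _ _); rewrite le_eqVlt; apply/orP; left; apply/eqP.
    by congr (`|_|); ring.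
  rewrite ge0_integralD//; first last.
  + by apply: measurable_funeM; exact: mg.
  + by move=> y _; rewrite mule_ge0// lee_fin.
  + by apply: measurable_funeM; exact: mg.
  + by move=> y _; rewrite mule_ge0// lee_fin.
  rewrite !ge0_integralZl ?lee_fin//.
  rewrite /s EFinD ge0_muleDl ?lee_fin ?mulr_ge0 ?vosc_ge0 ?(ltW K0)//.
  apply: leeD; rewrite (EFinM `|_| (K * _)) -[leRHS]muleA; apply: lee_wpmul2l.
  + by rewrite lee_fin.
  + exact: (h3 f Bf).
  + by rewrite lee_fin.
  + exact: (h3 g Bg).
- move=> k.
  have -> : \sum_(0 <= j < k) s (vtx z (n + j%:Z)) =
      `|a| * \sum_(0 <= j < k) K * vosc lam f (vtx z (n + j%:Z)) +
      `|b| * \sum_(0 <= j < k) K * vosc lam g (vtx z (n + j%:Z)).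
    by rewrite (mulr_sumr _ _ _ `|a|) (mulr_sumr _ _ _ `|b|) -big_split.
  have F1 := poisson_slope_sum (HI1 k); have F2 := poisson_slope_sum (HI2 k).
  exact: lerD (ler_wpM2l (normr_ge0 a) F1) (ler_wpM2l (normr_ge0 b) F2).
congr (_%:E); apply: cvg_unique cl _ => //.
rewrite (_ : (fun k : nat => _) = (fun k : nat => a * vaverage f (vtx z (n + k%:Z)) + b * vaverage g (vtx z (n + k%:Z)))).
  by apply: cvgD; apply: cvgMr.
by apply/funext => k.
Qed.

Lemma poisson_upper_gradient f : besov f ->
  upper_gradient setT (poisson f) (star_gradient p alpha tau S iota (poisson_slope f)).
Proof.
move=> Bf; apply: (star_upper_gradient hnu hdoubling p1 tau3 hiota hphi
  (alpha1 := alpha1) (hS := hS) (U := arc_interp (vaverage f)) (poisson_slope_ge0 f)).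
- move=> x Xx; exact: poisson_graph.
- by move=> *; exact: poisson_lip.
- move=> z n I HI; have [l cl pl] := poisson_boundary Bf HI; exists l => //.
  rewrite (_ : (fun k : nat => _) = (fun k : nat => vaverage f (vtx z (n + k%:Z))))//.
  by apply/funext => k; rewrite (arc_interp_vertex alpha1 tau3 hS hiota)//; exact: near_vtxV.
Qed.

Lemma poisson_measurable f : mu_measurable mu_beta setT (poisson f).
Proof.
exists (fun y : borel Xbar => if `[< Xrho y >] then (arc_interp (vaverage f) (graph_inv y))%:E else 0%E).
  rewrite -(setUv (Xrho : set (borel Xbar))); apply/measurable_funU => //.
    exact: measurableC.
  split.
    apply: (eq_measurable_fun (EFin \o ((arc_interp (vaverage f) \o graph_inv) : borel Xbar -> R))).
      by move=> y /set_mem Xy; rewrite /=; case: asboolP => [_|/(_ Xy)[]].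
    apply/measurable_EFinP.
    exact: (arc_interp_measurable alpha1 tau3 hS hiota hnu hdoubling).
  apply: (eq_measurable_fun (cst 0%E)) => //.
  by move=> y /set_mem nXy; rewrite /=; case: asboolP => [/nXy[]|_].
exists (~` Xrho); split; first exact: measurableC.
  exact: (mu_beta_boundary hnu hdoubling alpha1 tau3 hS hiota hmu_beta).
move=> y ny; apply: contra_not ny => Xy _; rewrite /poisson.
by case: asboolP => [_|/(_ Xy)[]].
Qed.

(** On the graph [w] has slope 0, so [t a] is an admissible slope for every [t > 0], and the norms
    of the resulting gradients tend to 0 with [t]. Boundary points where [a] is not summable along
    chains are unrestricted. *)
Lemma newton_norm_eq0 (w : Xbar -> \bar R) (a : V -> R) : (forall v, 0 <= a v) ->
  (\esum_(v in vertices) (a v `^ p * vmass v)%:E < +oo)%E ->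
  (forall x, X x -> w (iota x) = 0%E) ->
  (forall z n (I : R),
    (forall k : nat, \sum_(0 <= j < k) a (vtx z (n + j%:Z)) * e (n + j%:Z) <= I) ->
    w (phi z) = 0%E) ->
  newton_norm mu_beta setT p w = 0%E.
Proof.
move=> a0 Aoo w0 wb.
have wn : norm_on mu_beta setT p w = 0%E.
  rewrite /norm_on (@ge0_negligible_integral_lower _ _ _ mu_beta _ (~` Xrho)); first last.
  - by move=> y _; exact: poweR_ge0.
  - exact: (mu_beta_boundary hnu hdoubling alpha1 tau3 hS hiota hmu_beta).
  - exact: measurableC.
  rewrite setTD setCK integral0_eq ?poweR0r ?lt0r_neq0//.
  by move=> y [x Xx <-]; rewrite w0// abse0 poweR0r// lt0r_neq0.
have [K1 K10 HK1] := star_gradient_norm hnu hdoubling p1 alpha1 tau3 hS hiota beta0 hmu hmu_beta.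
set A := (\esum_(v in vertices) _)%E in Aoo.
have A0 : (0 <= A)%E by apply: esum_ge0 => v _; rewrite lee_fin mulr_ge0 ?powR_ge0 ?ltW ?vmass_gt0.
have fA : A \is a fin_num by rewrite ge0_fin_numE.
rewrite /newton_norm wn add0e; apply/eqP; rewrite eq_le; apply/andP; split; last first.
  by apply: le_ereal_inf_tmp => _ [g _ <-]; exact: poweR_ge0.
pose c := (K1 * fine A) `^ p^-1.
have c0 : 0 <= c by exact: powR_ge0.
apply/lee_addgt0Pr => eps eps0; rewrite add0e.
pose t := eps / (c + 1); have t0 : 0 < t by rewrite divr_gt0// ltr_wpDl.
have ta0 v : 0 <= t * a v by rewrite mulr_ge0// ltW.
have ug : upper_gradient setT w (star_gradient p alpha tau S iota (fun v => t * a v)).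
  apply: (star_upper_gradient hnu hdoubling p1 tau3 hiota hphi (alpha1 := alpha1) (hS := hS)
    (U := fun=> 0) ta0).
  - by move=> x Xx; rewrite w0.
  - move=> v v' s s' _ _ _; rewrite subrr normr0.
    exact: mulr_ge0 (mulr_ge0 (ta0 v) (ltW (e0 _))) (normr_ge0 _).
  - move=> z n I HI; exists 0; first exact: cvg_cst.
    apply: (wb z n (I / t)) => k; rewrite ler_pdivlMr// mulr_suml.
    apply: le_trans (HI k); rewrite le_eqVlt; apply/orP; left; apply/eqP.
    by apply: eq_bigr => j _; ring.
apply: (@le_trans _ _ (norm_on mu_beta setT p (star_gradient p alpha tau S iota (fun v => t * a v)))).
  by apply: ereal_inf_lbound; exists (star_gradient p alpha tau S iota (fun v => t * a v)).
apply: (le_trans (HK1 _ ta0)).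
have -> : (\esum_(v in vertices) ((t * a v) `^ p * vmass v)%:E = (t `^ p * fine A)%:E)%E.
  rewrite EFinM fineK// /A -esumZl ?powR_ge0//; last first.
    by move=> v _; rewrite lee_fin mulr_ge0 ?powR_ge0 ?ltW ?vmass_gt0.
  apply: eq_esum => v _; rewrite -EFinM (powRM _ (ltW t0) (a0 v)).
  by congr (_%:E); symmetry; exact: mulrA.
rewrite -EFinM poweR_EFin lee_fin mulrCA.
have KA0 : 0 <= K1 * fine A by rewrite mulr_ge0 ?fine_ge0// ltW.
rewrite (powRM _ (powR_ge0 t p) KA0) -powRrM mulfV ?lt0r_neq0// powRr1 ?(ltW t0)// -/c.
rewrite /t mulrAC ler_pdivrMr ?ltr_wpDl//.
by rewrite ler_pM2l// lerDl.
Qed.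

Let energy_lty f : besov f -> (energy f < +oo)%E.
Proof.
move=> [_]; rewrite /besov_norm poweR_lty//.
by apply: integral_ge0 => y _; apply: integral_ge0 => x _; rewrite mule_ge0 ?inve_ge0// lee_fin divr_ge0 ?powR_ge0.
Qed.

Let energy_ge0 f : (0 <= energy f)%E.
Proof.
by apply: integral_ge0 => y _; apply: integral_ge0 => x _; rewrite mule_ge0 ?inve_ge0// lee_fin divr_ge0 ?powR_ge0.
Qed.

Let CK : R := (alpha ^+ 5 * K) `^ p * K.
Let CK0 : 0 < CK.
Proof. by rewrite mulr_gt0// powR_gt0// mulr_gt0// exprn_gt0. Qed.

Let slope_lty f : besov f -> (\esum_(v in vertices) (poisson_slope f v `^ p * vmass v)%:E < +oo)%E.
Proof.
move=> Bf; apply: le_lt_trans (poisson_slope_energy Bf) _.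
by rewrite lte_mul_pinfty ?lee_fin ?(ltW CK0)// energy_lty.
Qed.

Lemma poisson_bounded : bounded_operator besov (besov_norm nu delta p theta)
  (dirichlet_space mu_beta setT p) (dirichlet_norm mu_beta setT p) poisson.
Proof.
have [K1 K10 HK1] := star_gradient_norm hnu hdoubling p1 alpha1 tau3 hS hiota beta0 hmu hmu_beta.
exists ((K1 * CK) `^ p^-1) => f Bf.
have bound : (dirichlet_norm mu_beta setT p (poisson f) <=
    ((K1 * CK) `^ p^-1)%:E * besov_norm nu delta p theta f)%E.
  apply: (@le_trans _ _ (norm_on mu_beta setT p (star_gradient p alpha tau S iota (poisson_slope f)))).
    apply: ereal_inf_lbound; exists (star_gradient p alpha tau S iota (poisson_slope f)) => //.
    exact: (poisson_upper_gradient Bf).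
  apply: le_trans (HK1 _ _) _; first by move=> v; exact: poisson_slope_ge0.
  have KC0 : 0 <= K1 * CK by rewrite mulr_ge0// ltW.
  have -> : besov_norm nu delta p theta f = (energy f `^ p^-1)%E by [].
  rewrite -poweR_EFin -poweRM ?lee_fin//; apply: le_poweR; first exact: ltW.
    apply: mule_ge0; first by rewrite lee_fin ltW.
    by apply: esum_ge0 => v _; rewrite lee_fin mulr_ge0 ?powR_ge0 ?ltW ?vmass_gt0.
  rewrite EFinM -muleA; apply: lee_wpmul2l; first by rewrite lee_fin ltW.
  exact: (poisson_slope_energy Bf).
split => //; split.
  exact: (poisson_measurable).
apply: le_lt_trans bound _; rewrite lte_mul_pinfty ?lee_fin ?powR_ge0//.
by case: Bf.
Qed.

Lemma poisson_diff_norm f g (a b : R) (w : Xbar -> \bar R) : besov f -> besov g ->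
  (forall x, X x -> w (iota x) = 0%E) ->
  (forall z, w (phi z) = poisson (fun x => a * f x + b * g x)%R (phi z) -
     lincomb a b (poisson f) (poisson g) (phi z))%E ->
  newton_norm mu_beta setT p w = 0%E.
Proof.
move=> Bf Bg w0 wb.
apply: (@newton_norm_eq0 _ (fun v => poisson_slope f v + poisson_slope g v)) => //.
- by move=> v; rewrite addr_ge0 ?poisson_slope_ge0.
- apply: (@le_lt_trans _ _ ((2 `^ p)%:E * (\esum_(v in vertices) (poisson_slope f v `^ p * vmass v)%:E
    + \esum_(v in vertices) (poisson_slope g v `^ p * vmass v)%:E))%E).
    have t0 h v : (0 <= (poisson_slope h v `^ p * vmass v)%:E)%E.
      by rewrite lee_fin mulr_ge0 ?powR_ge0 ?ltW ?vmass_gt0.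
    rewrite -esumD// -esumZl ?powR_ge0//; last by move=> v _; rewrite adde_ge0.
    apply: le_esum => v _; rewrite -EFinD -EFinM lee_fin.
    set A := poisson_slope f v; set B := poisson_slope g v; set m := vmass v.
    rewrite -(mulrDl _ _ m) (mulrA _ _ m).
    apply: ler_wpM2r; first by rewrite ltW// vmass_gt0.
    by apply: powRD_le; rewrite ?poisson_slope_ge0// ltW.
  by rewrite lte_mul_pinfty ?lee_fin ?powR_ge0// lte_add_pinfty// slope_lty.
move=> z n I HI.
have [l1 [l2 [e1 e2 e3]]] := poisson_boundary_linear a b Bf Bg HI.
by rewrite wb /lincomb e1 e2 e3 EFinD !EFinM subee.
Qed.

Lemma poisson_linear : linear_newton mu_beta p besov poisson.
Proof.
move=> a b f g Bf Bg; apply: (poisson_diff_norm Bf Bg (a := a) (b := b)) => // x Xx.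
rewrite /lincomb !poisson_graph//.
have -> : arc_interp (vaverage (fun z => a * f z + b * g z)) x =
    a * arc_interp (vaverage f) x + b * arc_interp (vaverage g) x.
  rewrite -arc_interp_linear; apply: eq_arc_interp => v _.
  exact: (vaverage_linear a b v Bf Bg).
by rewrite EFinD !EFinM subee.
Qed.

Let pt0 : 0 < p * theta. Proof. exact: mulr_gt0. Qed.

Lemma trace_reproduces f U : besov f ->
  (forall n z, 1 <= n -> S n z -> U (z, n) = vaverage f (z, n)) ->
  limit_trace S psi U = f %[ae nu].
Proof.
move=> Bf HU; have [lamt fin _ _ Hsum] := hb.
have [g [Lg fg vE oE]] := besov_representative Bf.
have mg : measurable_fun setT (g : borel Z -> R) := Lg.1.
pose h n z : Z -> \bar R := fun x => (`|vaverage f (z, n) - g x| `^ p * \1_(ball z (2 * e n)) x)%:E.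
have h0 n z x : (0 <= h n z x)%E by rewrite lee_fin mulr_ge0 ?powR_ge0.
have mh n z : measurable_fun setT (h n z : borel Z -> \bar R).
  apply/measurable_EFinP; apply: measurable_funM.
    apply: (measurableT_comp (measurable_powR p)); apply: measurableT_comp => //.
    exact: measurable_funB.
  by apply: measurable_indic; exact: measurable_mball.
pose H n : Z -> \bar R := fun x => (\esum_(z in S n) h n z x)%E.
have H0 n x : (0 <= H n x)%E by apply: esum_ge0.
have cS n : countable (S n) := net_countable hnu hdoubling alpha1 hS n.
have mH n : measurable_fun setT (H n : borel Z -> \bar R).
  by apply: measurable_fun_esum.
have lam2 : 2 <= lam.
  apply: le_trans lamt; have := alpha1; have := tau3.
  move=> t3 a1; apply: (@le_trans _ _ (tau * 1)); first by rewrite mulr1; lra.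
  by rewrite ler_pM2l ?(tau_gt0 tau3)//; lra.
have ih n z : S n z -> (\int[nu]_x h n z x <= (2 `^ p / vvol (z, n))%:E * osc_energy lam f (z, n))%E.
  move=> Sz; rewrite oE.
  apply: le_trans (mean_osc hnu p1 alpha1 tau3 Lg lamt (z, n)).
  rewrite [leRHS]integral_mkcond; apply: ge0_le_integral_lower => x _; rewrite h0/= patchE.
  case: ifPn => [_|/negP xB].
    rewrite /h vE distrC lee_fin ler_piMr ?powR_ge0// indicE; case: (_ \in _) => //.
  rewrite /h indicE memNset ?mulr0// => xb; apply: xB; apply/mem_set.
  by apply: (ball_sub _ xb); rewrite mdistxx add0r ler_pM2r.
have w0 v : 0 <= besov_weight nu p theta alpha v by exact: besov_weight_ge0.
have wo v : (0 <= (besov_weight nu p theta alpha v)%:E * osc_energy lam f v)%E.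
  by rewrite mule_ge0 ?osc_energy_ge0// lee_fin.
pose E := (K%:E * energy f)%E.
have E0 : (0 <= E)%E by rewrite mule_ge0 ?energy_ge0// lee_fin ltW.
have iH n : (\int[nu]_x H n x <= (2 `^ p * e n `^ (p * theta))%:E * E)%E.
  rewrite integral_esum//.
  have c0 : 0 <= 2 `^ p * e n `^ (p * theta) by rewrite mulr_ge0 ?powR_ge0.
  apply: le_trans (lee_wpmul2l _ (Hsum f Bf)); last by rewrite lee_fin.
  apply: (@le_trans _ _ ((2 `^ p * e n `^ (p * theta))%:E * \esum_(z in S n)
    ((besov_weight nu p theta alpha (z, n))%:E * osc_energy lam f (z, n)))%E).
    rewrite -esumZl//.
    apply: le_esum => z Sz; apply: (le_trans (ih n z Sz)).
    rewrite muleA -EFinM le_eqVlt; apply/orP; left; apply/eqP; congr (_%:E * _)%E.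
    rewrite /besov_weight/= powRN; field.
    by rewrite !lt0r_neq0// powR_gt0.
  apply: lee_wpmul2l; first by rewrite lee_fin.
  rewrite [leRHS](esum_vertices (S := S))//.
  by apply: (esum_ge_term (i := n)) => // m _; apply: esum_ge0 => z _; exact: wo.
pose F x : \bar R := (\esum_(k in [set: nat]) H (1 + k%:Z)%R x)%E.
have F0 x : (0 <= F x)%E by apply: esum_ge0.
have cN : countable [set: nat] by exact: countableP.
have mF : measurable_fun setT (F : borel Z -> \bar R) by apply: measurable_fun_esum.
have Eoo : (E < +oo)%E by rewrite lte_mul_pinfty ?lee_fin ?(ltW K0)// energy_lty.
have [Cg Cg0 HCg] := geometric_scale_ge alpha1 pt0.
have iF : (\int[nu]_x F x < +oo)%E.
  rewrite integral_esum//.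
  apply: (@le_lt_trans _ _ (\esum_(k in [set: nat]) (2 `^ p * fine E)%:E * (e (1 + k%:Z)%R `^ (p * theta))%:E)%E).
    apply: le_esum => k _; apply: (le_trans (iH _)).
    have fE : E \is a fin_num by rewrite ge0_fin_numE.
    by rewrite -{1}(fineK fE) -!EFinM lee_fin le_eqVlt; apply/orP; left; apply/eqP; ring.
  have c0 : 0 <= 2 `^ p * fine E by rewrite mulr_ge0 ?powR_ge0 ?fine_ge0.
  rewrite esumZl//; last by move=> k _; rewrite lee_fin powR_ge0.
  have := HCg 1; rewrite esum_int_ge; last by move=> n; rewrite lee_fin powR_ge0.
  rewrite nneseries_esumT; last by move=> k; rewrite lee_fin powR_ge0.
  move=> h1; apply: (@le_lt_trans _ _ ((2 `^ p * fine E)%:E * (Cg * e 1 `^ (p * theta))%:E)%E).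
    by apply: lee_wpmul2l; rewrite ?lee_fin.
  by rewrite -EFinM ltry.
have aeF : \forall x \ae nu, (F x < +oo)%E.
  have it : nu.-integrable setT (F : borel Z -> \bar R).
    apply/integrableP; split => //.
    by under eq_integral do rewrite gee0_abs//.
  have [N [mN N0 HN]] := integrable_ae measurableT it; exists N; split => // x nx.
  by apply: HN => h'; apply: nx; have := h' I; rewrite ge0_fin_numE.
have [N1 [mN1 N10 HN1]] := aeF; have [N2 [mN2 N20 HN2]] := fg.
exists (N1 `|` N2); split; first exact: measurableU.
  apply/eqP; rewrite eq_le measure_ge0 andbT.
  by apply: (le_trans (measureU2 _ _ _)) => //; rewrite [X in (X + _)%E]N10 [X in (_ + X)%E]N20 adde0.
move=> x; apply: contra_notP => /not_orP[nx1 nx2] _.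
have -> : f x = g x by apply: contrapT => h'; apply: nx2; apply: HN2 => /(_ I).
have Fx : (F x < +oo)%E by apply: contrapT => h'; apply: nx1; exact: HN1.
apply: limit_trace_eq.
have Hoo k : (H (1 + k%:Z)%R x < +oo)%E.
  by apply: le_lt_trans Fx; apply: (esum_ge_term (i := k)).
have fH k : H (1 + k%:Z)%R x \is a fin_num by rewrite ge0_fin_numE.
pose b k := fine (H (1 + k%:Z)%R x).
have [|k|b0 _] := @summable_steps _ (fun=> 0 : R) b (fine (F x)).
- by move=> k; rewrite subrr normr0 fine_ge0.
- rewrite -lee_fin fineK ?ge0_fin_numE//.
  rewrite -sumEFin.
  have -> : (\sum_(0 <= j < k) (b j)%:E = \sum_(0 <= j < k) H (1 + j%:Z)%R x)%E.
    by apply: eq_bigr => j _; rewrite /b fineK.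
  rewrite /F -nneseries_esumT; last by move=> j; exact: H0.
  by apply: nneseries_lim_ge => j _ _; exact: H0.
apply/cvgrPdist_le => eps eps0.
have ep : 0 < eps `^ p by rewrite powR_gt0.
have /cvgrPdist_le/(_ _ ep)[N _ HN] := b0.
exists N.+1 => // -[//|k] /= Nk; rewrite distrC.
have kE : (k.+1)%:Z = 1 + k%:Z by rewrite -add1n PoszD.
apply: (level_trace_convex hnu hdoubling alpha1 hS hpsi) => z Sz zx.
rewrite kE in Sz zx *.
rewrite HU ?lerDl//.
have h1 : `|vaverage f (z, 1 + k%:Z) - g x| `^ p <= b k.
  rewrite -lee_fin /b fineK//; apply: (@le_trans _ _ (h (1 + k%:Z) z x)).
    rewrite /h indicE mem_set ?mulr1//.
    by rewrite ballEmdist.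
  exact: (esum_ge_term (i := z)).
have h2 : `|vaverage f (z, 1 + k%:Z) - g x| `^ p <= eps `^ p.
  apply: (le_trans h1); have := HN k Nk; rewrite /= sub0r normrN.
  by apply: le_trans; exact: ler_norm.
rewrite leNgt; apply/negP => h3.
have : eps `^ p < `|vaverage f (z, 1 + k%:Z) - g x| `^ p.
  by rewrite gt0_ltr_powR ?nnegrE// ltW.
by rewrite ltNge h2.
Qed.

(** Interpolating this indicator gives the cutoff on all edges by one formula; it is constant except
    on edges between the levels 0 and 1. *)
Definition level_cut (v : V) : R := (1 <= v.2)%R%:R.

Definition cutoff (y : Xbar) : R :=
  if `[< Xrho y >] then arc_interp level_cut (graph_inv y) else 1.

Lemma cutoff_graph x : X x -> cutoff (iota x) = arc_interp level_cut x.
Proof.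
move=> Xx; rewrite /cutoff; case: asboolP => [_|[]]; last by exists x.
by rewrite graph_invK.
Qed.

Lemma cutoff_boundary y : ~ Xrho y -> cutoff y = 1.
Proof. by move=> nX; rewrite /cutoff; case: asboolP. Qed.

Lemma cutoff_is_cutoff : is_cutoff alpha tau S iota cutoff.
Proof.
split; first exact: cutoff_boundary.
- move=> x Xx; rewrite cutoff_graph//.
  have [v [w [t [vw t01 ->]]]] := fillingXE alpha1 tau3 hS Xx.
  rewrite (height_edge _ (adj_neq vw)) (arc_interp_edge alpha1 hiota)// /arc_value /level_cut.
  have [h1 h2] := adj_level vw; move: (t01); rewrite in_itv/= => /andP[t0 t1].
  have [v1|v1] := leP 1 v.2; have [w1|w1] := leP 1 w.2 => ht.
  + by rewrite /= ?mulr1n ?mulr0n; ring.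
  + have [vE wE] := consecutive_levels v1 w1 h1.
    rewrite vE wE in ht; have -> : t = 0 by move: ht; rewrite mulr1 mulr0; lra.
    by rewrite arc_fraction0 /= ?mulr1n ?mulr0n; ring.
  + rewrite -lerBlDr in h2; have [wE vE] := consecutive_levels w1 v1 h2.
    rewrite vE wE in ht; have -> : t = 1 by move: ht; rewrite mulr1 mulr0; lra.
    by rewrite (arc_fraction1 alpha1 hiota)//= ?mulr1n ?mulr0n; ring.
  + exfalso; have v0 : v.2%:~R <= (0 : R) by rewrite lerz0 -ltzD1.
    have w0 : w.2%:~R <= (0 : R) by rewrite lerz0 -ltzD1.
    have := mulr_ge0_le0 t0 w0; have : 0 <= 1 - t by lra.
    by move=> /mulr_ge0_le0/(_ v0); lra.
- move=> x Xx; rewrite cutoff_graph//.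
  have [v [w [t [vw t01 ->]]]] := fillingXE alpha1 tau3 hS Xx.
  rewrite (height_edge _ (adj_neq vw)) (arc_interp_edge alpha1 hiota)// /arc_value /level_cut.
  have [h1 h2] := adj_level vw; move: (t01); rewrite in_itv/= => /andP[t0 t1].
  have [v1|v1] := leP 1 v.2; have [w1|w1] := leP 1 w.2 => ht.
  + exfalso; have v0 : (1 : R) <= v.2%:~R by rewrite ler1z.
    have w0 : (1 : R) <= w.2%:~R by rewrite ler1z.
    have := ler_wpM2l t0 w0; have t2 : 0 <= 1 - t by lra.
    by have := ler_wpM2l t2 v0; lra.
  + have [vE wE] := consecutive_levels v1 w1 h1.
    rewrite vE wE in ht; have -> : t = 1 by move: ht; rewrite mulr1 mulr0; lra.
    by rewrite (arc_fraction1 alpha1 hiota)//= ?mulr1n ?mulr0n; ring.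
  + rewrite -lerBlDr in h2; have [wE vE] := consecutive_levels w1 v1 h2.
    rewrite vE wE in ht; have -> : t = 0 by move: ht; rewrite mulr1 mulr0; lra.
    by rewrite arc_fraction0 /= ?mulr1n ?mulr0n; ring.
  + by rewrite /= ?mulr1n ?mulr0n; ring.
- move=> v w t vw v0 w0 t01; rewrite cutoff_graph; last exact: fillingX_edge.
  rewrite (arc_interp_edge alpha1 hiota)// /arc_value /level_cut v0 w0.
  by rewrite /= ?mulr1n ?mulr0n; ring.
Qed.

Let cut_itv v w t : adj v w -> t \in `[0, 1] -> `|arc_interp level_cut (edge_pt v w t)| <= 1.
Proof.
move=> vw t01; rewrite -[X in `|X|]subr0; apply: (arc_interp_convex alpha1 hiota) => //.
  by rewrite subr0 /level_cut normr_nat lern1 leq_b1.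
by rewrite subr0 /level_cut normr_nat lern1 leq_b1.
Qed.

(** The product rule: the cutoff varies only on edges between the levels 0 and 1, where it
    multiplies a value of size at most [|vaverage f v| + K vosc]; the second part of this value
    accounts for the factor 2. *)
Definition truncated_slope f v : R := 2 * poisson_slope f v +
  (if (0 <= v.2 <= 1) then alpha ^+ 5 * `|vaverage f v| / e v.2 else 0).

Let sl0 f v : 0 <= poisson_slope f v.
Proof. exact: (poisson_slope_ge0). Qed.

Let tr0 f v : 0 <= alpha ^+ 5 * `|vaverage f v| / e v.2.
Proof. by rewrite divr_ge0 ?(ltW (e0 _))// mulr_ge0// exprn_ge0// ltW. Qed.

Lemma truncated_slope_ge f v : poisson_slope f v <= truncated_slope f v.
Proof.
have := sl0 f v; have := tr0 f v; rewrite /truncated_slope; case: ifP => _; lra.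
Qed.

Lemma truncated_slope_ge0 f v : 0 <= truncated_slope f v.
Proof. exact: le_trans (sl0 f v) (truncated_slope_ge f v). Qed.

Lemma truncated_poisson_lip f v w s t : besov f -> adj v w -> s \in `[0, 1] -> t \in `[0, 1] ->
  `|arc_interp level_cut (edge_pt v w s) * arc_interp (vaverage f) (edge_pt v w s) -
    arc_interp level_cut (edge_pt v w t) * arc_interp (vaverage f) (edge_pt v w t)| <=
  truncated_slope f v * e v.2 * `|s - t|.
Proof.
move=> Bf vw s01 t01; have [_ _ Hadj _ _] := hb.
set xs := arc_interp level_cut _; set us := arc_interp (vaverage f) _.
set xt := arc_interp level_cut _; set ut := arc_interp (vaverage f) _.
(* In this form the variation of the interpolant is multiplied by a cutoff value, at most 1, and the
   variation of the cutoff by an interpolant value. *)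
have -> : xs * us - xt * ut = xs * (us - ut) + (xs - xt) * ut by ring.
apply: (le_trans (ler_normD _ _)); rewrite !normrM.
have U1 : `|us - ut| <= poisson_slope f v * e v.2 * `|s - t|.
  exact: (poisson_lip Bf vw s01 t01).
have X1 : `|xs| <= 1 by exact: cut_itv.
have X2 : `|xs - xt| <= alpha ^+ 5 * `|level_cut v - level_cut w| * `|s - t|.
  exact: (arc_interp_lip alpha1 hiota).
have U2 : `|ut| <= `|vaverage f v| + K * vosc lam f v.
  have Ko : 0 <= K * vosc lam f v by rewrite mulr_ge0 ?vosc_ge0// ltW.
  rewrite -[X in `|X|]subr0; apply: (arc_interp_convex alpha1 hiota) => //.
    by rewrite subr0 lerDl.
  rewrite subr0; have := Hadj f Bf v w vw; have := ler_distD (vaverage f v) (vaverage f w) 0.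
  by rewrite !subr0 (distrC (vaverage f w)); lra.
have st0 : 0 <= `|s - t| by [].
have sl := poisson_slope_scale f v.
have A1 : `|xs| * `|us - ut| <= poisson_slope f v * e v.2 * `|s - t|.
  by apply: le_trans U1; rewrite ler_piMl.
have A2 : `|xs - xt| * `|ut| <= alpha ^+ 5 * `|level_cut v - level_cut w| * `|s - t| *
    (`|vaverage f v| + K * vosc lam f v).
  exact: ler_pM.
apply: (le_trans (lerD A1 A2)).
have a50 : 0 <= alpha ^+ 5 by rewrite exprn_ge0// ltW.
have o0 : 0 <= K * vosc lam f v by rewrite mulr_ge0 ?vosc_ge0// ltW.
set c : R := if 0 <= v.2 <= 1 then 1 else 0.
have cut : `|level_cut v - level_cut w| <= c.
  have [h1 h2] := adj_level vw; rewrite /level_cut /c.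
  case: ifP => [_|/negbT]; last first.
    rewrite negb_and -!ltNge => /orP h.
    by rewrite (outer_levels h h1 h2) subrr normr0.
  by case: (1 <= v.2); case: (1 <= w.2); rewrite ?subrr ?subr0 ?sub0r ?normrN ?normr1 ?normr0.
have c1 : c <= 1 by rewrite /c; case: ifP.
have trE : truncated_slope f v * e v.2 =
    2 * (alpha ^+ 5 * (K * vosc lam f v)) + c * (alpha ^+ 5 * `|vaverage f v|).
  rewrite /truncated_slope mulrDl -mulrA sl /c; congr (_ + _).
  by case: ifP => _; rewrite ?mul0r// divfK ?mul1r// lt0r_neq0.
rewrite trE sl.
apply: (@le_trans _ _ (alpha ^+ 5 * (K * vosc lam f v) * `|s - t| +
   alpha ^+ 5 * c * `|s - t| * (`|vaverage f v| + K * vosc lam f v))).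
  apply: lerD => //; apply: ler_wpM2r; first exact: addr_ge0.
  by apply: ler_wpM2r => //; exact: ler_wpM2l.
have := ler_wpM2r (mulr_ge0 (mulr_ge0 a50 o0) st0) c1; lra.
Qed.

Lemma truncated_vertex f v : vertices v ->
  ((cutoff (iota (vertex_pt v)))%:E * poisson f (iota (vertex_pt v)) =
   (level_cut v * vaverage f v)%:E)%E.
Proof.
move=> Vv; rewrite poisson_vertex// cutoff_graph; last exact: fillingX_vertex.
by rewrite (arc_interp_vertex alpha1 tau3 hS hiota).
Qed.

Lemma truncated_poisson_upper_gradient f : besov f ->
  upper_gradient setT (fun y => (cutoff y)%:E * poisson f y)%E
    (star_gradient p alpha tau S iota (truncated_slope f)).
Proof.
move=> Bf; apply: (star_upper_gradient hnu hdoubling p1 tau3 hiota hphi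
  (alpha1 := alpha1) (hS := hS)
  (U := fun x => arc_interp level_cut x * arc_interp (vaverage f) x) (truncated_slope_ge0 f)).
- by move=> x Xx; rewrite poisson_graph// cutoff_graph.
- by move=> *; exact: truncated_poisson_lip.
- move=> z n I HI.
  have HI' k : \sum_(0 <= j < k) poisson_slope f (vtx z (n + j%:Z)) * e (n + j%:Z) <= I.
    apply: le_trans (HI k); apply: ler_sum => j _.
    by apply: ler_wpM2r; [exact: ltW|exact: truncated_slope_ge].
  have [l cl pl] := poisson_boundary Bf HI'.
  exists l; last first.
    by rewrite pl cutoff_boundary ?mul1e//; exact: (phi_notin alpha1 tau3 hS hiota hphi).
  apply: cvg_trans cl; apply: near_eq_cvg; exists `|1 - n|%N => // k /= nk.
  have Vv : vertices (vtx z (n + k%:Z)) by exact: near_vtxV.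
  rewrite !(arc_interp_vertex alpha1 tau3 hS hiota)// /level_cut/=.
  by rewrite (level_ge1 nk) mul1r.
Qed.

Definition level_mass f : \bar R :=
  (\esum_(v in [set v | vertices v /\ (0 <= v.2)%R]) (`|vaverage f v| `^ p * vmass v)%:E)%E.

(** All levels from 0 on are summed over the whole space; [beta > 0] makes this series converge.
    Over the coarse levels the geometric series would diverge, which is why the extension is
    truncated to reach [L^p]. *)
Lemma level_mass_le : exists2 C : R, 0 < C & forall f, besov f ->
  (level_mass f <= C%:E * \int[nu]_x (`|f x| `^ p)%:E)%E.
Proof.
have [C C1 HC] := descendant_sum hnu hdoubling alpha1 hS (tau_gt0 tau3) beta0.
exists (2 `^ p * (C * e 0 `^ beta)); first by rewrite !mulr_gt0 ?powR_gt0.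
move=> f Bf; have [g [Lg fg vE _]] := besov_representative Bf.
have -> : (\int[nu]_x (`|f x| `^ p)%:E = \int[nu]_x (`|g x| `^ p)%:E)%E.
  apply: ae_eq_integral_lower; have [N [mN N0 HN]] := fg; exists N; split => // y ny.
  by apply: HN => h; apply: ny => _; rewrite (h I).
pose h : borel Z -> \bar R := fun x => (`|g x| `^ p)%:E.
have mh : measurable_fun setT h.
  apply/measurable_EFinP; apply: (measurableT_comp (measurable_powR p)).
  by apply: measurableT_comp => //; exact: Lg.1.
have h0 x : (0 <= h x)%E by rewrite lee_fin powR_ge0.
rewrite /level_mass; set D := [set v | _].
have DV : D `<=` vertices by move=> v [].
have HD v : D v -> 0 <= v.2 /\ ball v.1 (tau * e v.2) `<=` setT by case.
have := HC 0 D setT h DV measurableT mh h0 HD => {}HC.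
rewrite EFinM -muleA; apply: le_trans (lee_wpmul2l _ HC); last by rewrite lee_fin powR_ge0.
rewrite -esumZl ?powR_ge0//; last first.
  move=> v _; rewrite mule_ge0 ?lee_fin ?powR_ge0//.
  by apply: integral_ge0 => x _; exact: h0.
apply: le_esum => v Dv; rewrite vE /vmass.
rewrite (_ : _ * _ = e v.2 `^ beta * (vvol v * `|vaverage g v| `^ p)); last by ring.
rewrite EFinM muleCA; apply: lee_wpmul2l; first by rewrite lee_fin powR_ge0.
have := vaverage_dev_pow hnu p1 alpha1 tau3 Lg v 0; rewrite subr0.
under eq_integral do rewrite subr0.
move=> H; apply: (@le_trans _ _ ((vvol v)%:E * ((2 `^ p / vvol v)%:E * \int[nu]_(x in vball v) h x))%E).
  by rewrite EFinM; apply: lee_wpmul2l => //; rewrite lee_fin ltW.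
rewrite muleA -EFinM le_eqVlt; apply/orP; left; apply/eqP; congr (_%:E * _)%E.
by field; rewrite lt0r_neq0.
Qed.

Lemma truncated_slope_energy : exists2 C : R, 0 < C & forall f, besov f ->
  (\esum_(v in vertices) (truncated_slope f v `^ p * vmass v)%:E <=
   C%:E * (energy f + \int[nu]_x (`|f x| `^ p)%:E))%E.
Proof.
have [C1 C10 H1] := level_mass_le.
pose A := 2 `^ p * 2 `^ p * ((alpha ^+ 5 * K) `^ p * K).
pose B := 2 `^ p * (alpha ^+ 6) `^ p * C1.
have a50 : 0 < alpha ^+ 5 by rewrite exprn_gt0.
have a60 : 0 < alpha ^+ 6 by rewrite exprn_gt0.
have A0 : 0 < A by rewrite !mulr_gt0 ?powR_gt0 ?mulr_gt0.
have B0 : 0 < B by rewrite !mulr_gt0 ?powR_gt0.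
exists (A + B) => [|f Bf]; first exact: addr_gt0.
have E0 : (0 <= energy f)%E.
  apply: integral_ge0 => y _; apply: integral_ge0 => x _.
  by rewrite mule_ge0 ?inve_ge0// lee_fin divr_ge0 ?powR_ge0.
have I0 : (0 <= \int[nu]_x (`|f x| `^ p)%:E)%E.
  by apply: integral_ge0 => x _; rewrite lee_fin powR_ge0.
have vm0 v : 0 <= vmass v by rewrite ltW// vmass_gt0.
pose c v : R := if 0 <= v.2 <= 1 then (alpha ^+ 5 * `|vaverage f v| / e v.2) `^ p * vmass v else 0.
have c0 v : 0 <= c v by rewrite /c; case: ifP => // _; rewrite mulr_ge0 ?powR_ge0.
apply: (@le_trans _ _ (\esum_(v in vertices) ((2 `^ p * 2 `^ p)%:E *
   (poisson_slope f v `^ p * vmass v)%:E + (2 `^ p)%:E * (c v)%:E))%E).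
  apply: le_esum => v _; rewrite -!EFinM -EFinD lee_fin.
  set m := vmass v; set s := poisson_slope f v.
  have s0 : 0 <= s by exact: sl0.
  have t0 : 0 <= 2 * s by rewrite mulr_ge0.
  have -> : 2 `^ p * 2 `^ p * (s `^ p * m) + 2 `^ p * c v =
      2 `^ p * ((2 * s) `^ p * m + c v).
    by rewrite (powRM _ (ler0n _ 2) s0); ring.
  rewrite /truncated_slope -/s /c; case: ifP => _.
    apply: le_trans (ler_wpM2r (vm0 v) (powRD_le _ _ _)) _ => //; first exact: ltW.
    by rewrite -/m -mulrDl mulrA.
  rewrite addr0 addr0; apply: ler_peMl; first exact: mulr_ge0 (powR_ge0 _ _) (vm0 v).
  apply: (@le_trans _ _ (1 `^ p)); first by rewrite powR1.
  by rewrite ge0_ler_powR ?nnegrE ?(ltW p0)// ler1n.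
have sl v : (0 <= (poisson_slope f v `^ p * vmass v)%:E)%E.
  by rewrite lee_fin mulr_ge0 ?powR_ge0.
rewrite esumD; first last.
- by move=> v _; rewrite mule_ge0 ?lee_fin ?powR_ge0.
- by move=> v _; apply: mule_ge0 => //; rewrite lee_fin mulr_ge0 ?powR_ge0.
rewrite !esumZl ?mulr_ge0 ?powR_ge0//; last by move=> v _; rewrite lee_fin.
have cle : (\esum_(v in vertices) (c v)%:E <= ((alpha ^+ 6) `^ p)%:E * level_mass f)%E.
  rewrite /level_mass -esumZl ?powR_ge0//; last first.
    by move=> v _; rewrite lee_fin mulr_ge0 ?powR_ge0.
  have tt0 v : (0 <= ((alpha ^+ 6) `^ p)%:E * (`|vaverage f v| `^ p * vmass v)%:E)%E.
    by rewrite -EFinM lee_fin mulr_ge0 ?powR_ge0// mulr_ge0 ?powR_ge0.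
  rewrite (esum_mkcond vertices) [leRHS]esum_mkcond; apply: le_esum => v _.
  case: ifPn => [/set_mem Vv|_]; last first.
    by case: ifP => // _; exact: tt0.
  rewrite /c; case: ifPn => [/andP[v0 v1]|_]; last first.
    by case: ifP => // _; exact: tt0.
  rewrite ifT; last by apply/mem_set.
  rewrite -EFinM lee_fin; move: (vm0 v); set m := vmass v => m0.
  rewrite (mulrA _ _ m); apply: ler_wpM2r => //.
  rewrite -powRM//; last exact: ltW.
  apply: ge0_ler_powR; rewrite ?nnegrE ?(ltW p0)//.
    by rewrite mulr_ge0// ltW.
  have ev : alpha^-1 <= e v.2 by rewrite -exprN1 ler_weXz2l ?(ltW alpha1)// lerN2.
  rewrite ler_pdivrMr// [leRHS]mulrAC; apply: ler_wpM2r => //.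
  have -> : alpha ^+ 5 = alpha ^+ 6 * alpha^-1.
    by rewrite exprS mulrAC mulfV ?mul1r// lt0r_neq0.
  by rewrite ler_pM2l.
apply: (@le_trans _ _ (A%:E * energy f + B%:E * \int[nu]_x (`|f x| `^ p)%:E)%E).
  apply: leeD.
    rewrite /A (EFinM (2 `^ p * 2 `^ p)) -[leRHS]muleA; apply: lee_wpmul2l; first by rewrite lee_fin mulr_ge0 ?powR_ge0.
    exact: (poisson_slope_energy Bf).
  rewrite /B -(mulrA (2 `^ p)) (EFinM (2 `^ p)) -[leRHS]muleA; apply: lee_wpmul2l; first by rewrite lee_fin powR_ge0.
  apply: (le_trans cle); rewrite (EFinM ((alpha ^+ 6) `^ p)) -[leRHS]muleA.
  apply: lee_wpmul2l; first by rewrite lee_fin powR_ge0.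
  exact: H1.
rewrite [leRHS]ge0_muleDr//; apply: leeD; apply: lee_wpmul2r => //; rewrite lee_fin; lra.
Qed.

Local Notation P0 := (fun f y => ((cutoff y)%:E * poisson f y)%E).
Local Notation check := (besov_check_space nu delta p theta).

Let cutE v w t : adj v w -> t \in `[0, 1] ->
  cutoff (iota (edge_pt v w t)) = arc_interp level_cut (edge_pt v w t).
Proof. by move=> vw t01; apply: cutoff_graph => //; exact: fillingX_edge. Qed.

(** On an edge with an end at a negative level the cutoff vanishes, since the other end has level at
    most 0. On the remaining edges the value is at most the larger of the two averages, so only
    [level_mass] enters. *)
Lemma truncated_integral : exists2 C : R, 0 < C & forall f, besov f ->
  (\int[mu_beta]_y (`|P0 f y| `^ p) <= C%:E * \int[nu]_x (`|f x| `^ p)%:E)%E.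
Proof.
have [C1 C10 H1] := star_integral hnu hdoubling alpha1 tau3 hS hiota beta0 hmu hmu_beta.
have [C2 C20 H2] := level_mass_le.
exists (C1 * C2) => [|f Bf]; first exact: mulr_gt0.
rewrite (@ge0_negligible_integral_lower _ _ _ mu_beta _ (~` Xrho)); first last.
- by move=> y _; exact: poweR_ge0.
- exact: (mu_beta_boundary hnu hdoubling alpha1 tau3 hS hiota hmu_beta).
- exact: measurableC.
rewrite setTD setCK EFinM -muleA.
apply: le_trans (lee_wpmul2l _ (H2 f Bf)); last by rewrite lee_fin ltW.
pose a v : R := if 0 <= v.2 then `|vaverage f v| `^ p else 0.
have a0 v : 0 <= a v by rewrite /a; case: ifP => // _; exact: powR_ge0.
apply: le_trans (H1 Xrho _ a mX _ a0 _) _ => //.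
  move=> v w t vw t01 _; rewrite poweR_ge0/=.
  rewrite /edge_path cutE// poisson_graph//; last exact: fillingX_edge.
  rewrite -EFinM [(`|_|)%E]/= poweR_EFin lee_fin normrM.
  set x := arc_interp level_cut _; set y := arc_interp _ _.
  have cut_le u : `|level_cut u - 0| <= 1.
    by rewrite subr0 /level_cut normr_nat lern1 leq_b1.
  have [h1 h2] := adj_level vw.
  have neg : v.2 < 0 \/ w.2 < 0 -> (`|x| * `|y|) `^ p <= a v + a w.
    move=> h; have [cv cw] := negative_levels h h1 h2.
    have : `|x - 0| <= 0.
      by apply: (arc_interp_convex alpha1 hiota) => //; rewrite /level_cut ?cv ?cw subr0 normr0.
    rewrite subr0 normr_le0 => /eqP ->; rewrite normr0 mul0r powR0 ?lt0r_neq0//.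
    exact: addr_ge0.
  case: (ltP v.2 0) => [v0|v0]; last case: (ltP w.2 0) => [w0|w0].
  - by apply: neg; left.
  - by apply: neg; right.
  - pose M := Num.max `|vaverage f v| `|vaverage f w|.
    have x1 : `|x| <= 1.
      by rewrite -[x]subr0; apply: (arc_interp_convex alpha1 hiota).
    have y1 : `|y| <= M.
      rewrite -[y]subr0; apply: (arc_interp_convex alpha1 hiota) => //.
        by rewrite subr0 /M le_max lexx.
      by rewrite subr0 /M le_max lexx orbT.
    have M0 : 0 <= M by apply: le_trans y1.
    apply: (@le_trans _ _ (M `^ p)).
      apply: ge0_ler_powR; rewrite ?nnegrE ?(ltW p0)//.
      by rewrite -[M]mul1r; apply: ler_pM.
    rewrite /a v0 w0 /M; case: (leP `|vaverage f v| `|vaverage f w|) => _.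
      by rewrite lerDr powR_ge0.
    by rewrite lerDl powR_ge0.
apply: lee_wpmul2l; first by rewrite lee_fin ltW.
rewrite /level_mass esum_mkcond [leRHS]esum_mkcond; apply: le_esum => v _.
have vm0 : 0 <= vmass v by rewrite ltW// vmass_gt0.
have t0 : 0 <= `|vaverage f v| `^ p * vmass v by exact: mulr_ge0 (powR_ge0 _ _) vm0.
case: ifPn => [/set_mem[w vw _]|_]; last by case: ifP => // _; rewrite lee_fin.
rewrite /a; case: (leP 0 v.2) => v0.
  by rewrite ifT//; apply/mem_set; split => //; case: vw.
by rewrite mul0r; case: ifP.
Qed.

Lemma truncated_measurable f : mu_measurable mu_beta setT (P0 f).
Proof.
exists (fun y : borel Xbar => if `[< Xrho y >] then
   (arc_interp level_cut (graph_inv y) * arc_interp (vaverage f) (graph_inv y))%:E else 0%E).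
  rewrite -(setUv (Xrho : set (borel Xbar))); apply/measurable_funU => //.
    exact: measurableC.
  split.
    apply: (eq_measurable_fun (EFin \o (((arc_interp level_cut \o graph_inv) : borel Xbar -> R) \*
      ((arc_interp (vaverage f) \o graph_inv) : borel Xbar -> R)))).
      by move=> y /set_mem Xy; rewrite /=; case: asboolP => [_|/(_ Xy)[]].
    apply/measurable_EFinP; apply: measurable_funM.
      exact: (arc_interp_measurable alpha1 tau3 hS hiota hnu hdoubling).
    exact: (arc_interp_measurable alpha1 tau3 hS hiota hnu hdoubling).
  apply: (eq_measurable_fun (cst 0%E)) => //.
  by move=> y /set_mem nXy; rewrite /=; case: asboolP => [/nXy[]|_].
exists (~` Xrho); split; first exact: measurableC.
  exact: (mu_beta_boundary hnu hdoubling alpha1 tau3 hS hiota hmu_beta).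
move=> y ny; apply: contra_not ny => Xy _; rewrite /poisson /cutoff.
by case: asboolP => [_|/(_ Xy)[]].
Qed.

Lemma truncated_bounded : bounded_operator check (besov_check_norm nu delta p theta)
  (newton_space mu_beta setT p) (newton_norm mu_beta setT p) P0.
Proof.
have [C1 C10 H1] := truncated_integral.
have [C2 C20 H2] := truncated_slope_energy.
have [K1 K10 HK1] := star_gradient_norm hnu hdoubling p1 alpha1 tau3 hS hiota beta0 hmu hmu_beta.
pose A := C1 `^ p^-1; pose B := (K1 * C2) `^ p^-1 * 2 `^ p^-1.
have A0 : 0 <= A by exact: powR_ge0.
have B0 : 0 <= B by rewrite mulr_ge0 ?powR_ge0.
(* [A] bounds the [L^p] norm of the truncation by that of [f]. [B] bounds the Dirichlet seminorm by
   both terms of the norm, with a factor [2^(1/p)] for the root of a sum. *)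
exists (A + B) => f [Bf fp].
pose I := (\int[nu]_x (`|f x| `^ p)%:E)%E.
have I0 : (0 <= I)%E by apply: integral_ge0 => x _; rewrite lee_fin powR_ge0.
have E0 : (0 <= energy f)%E.
  apply: integral_ge0 => y _; apply: integral_ge0 => x _.
  by rewrite mule_ge0 ?inve_ge0// lee_fin divr_ge0 ?powR_ge0.
have nE : norm_on nu setT p (EFin \o f) = (I `^ p^-1)%E by [].
have bE : besov_norm nu delta p theta f = (energy f `^ p^-1)%E by [].
have n1 : (norm_on mu_beta setT p (P0 f) <= A%:E * I `^ p^-1)%E.
  rewrite -poweR_EFin -poweRM ?lee_fin ?(ltW C10)//; apply: le_poweR; first exact: ltW.
    by apply: integral_ge0 => y _; exact: poweR_ge0.
  exact: H1.
have n2 : (dirichlet_norm mu_beta setT p (P0 f) <= B%:E * (energy f `^ p^-1 + I `^ p^-1))%E.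
  apply: (@le_trans _ _ (norm_on mu_beta setT p (star_gradient p alpha tau S iota
    (truncated_slope f)))).
    apply: ereal_inf_lbound; exists (star_gradient p alpha tau S iota
      (truncated_slope f)) => //.
    exact: (truncated_poisson_upper_gradient Bf).
  apply: le_trans (HK1 _ _) _; first by move=> v; apply: truncated_slope_ge0.
  apply: (@le_trans _ _ (((K1 * C2)%:E * (energy f + I)) `^ p^-1)%E).
    apply: le_poweR; first exact: ltW.
      apply: mule_ge0; first by rewrite lee_fin ltW.
      apply: esum_ge0 => v _; rewrite lee_fin; apply: mulr_ge0; first exact: powR_ge0.
      by rewrite ltW// vmass_gt0.
    rewrite EFinM -muleA; apply: lee_wpmul2l; first by rewrite lee_fin ltW.
    exact: H2.
  have KC : (0 <= (K1 * C2)%:E)%E by rewrite lee_fin; exact: mulr_ge0 (ltW K10) (ltW C20).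
  have EI : (0 <= energy f + I)%E by exact: adde_ge0.
  rewrite (poweRM _ KC EI) poweR_EFin.
  rewrite /B EFinM -muleA; apply: lee_wpmul2l; first by rewrite lee_fin powR_ge0.
  exact: poweRD_root.
have bound : (newton_norm mu_beta setT p (P0 f) <= (A + B)%:E * besov_check_norm nu delta p theta f)%E.
  rewrite /newton_norm /besov_check_norm nE bE.
  apply: le_trans (leeD n1 n2) _.
  rewrite EFinD [leRHS]ge0_muleDl ?lee_fin//; apply: leeD.
    by apply: lee_wpmul2l; rewrite ?lee_fin// leeDl// poweR_ge0.
  by rewrite addeC.
split => //; split; first exact: truncated_measurable.
apply: le_lt_trans bound _; rewrite lte_mul_pinfty ?lee_fin ?addr_ge0//.
rewrite /besov_check_norm lte_add_pinfty//.
by case: Bf.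
Qed.

Lemma truncated_linear : linear_newton mu_beta p check P0.
Proof.
move=> a b f g [Bf _] [Bg _].
apply: (poisson_diff_norm
  (a := a) (b := b) Bf Bg) => [x Xx|z].
  rewrite /lincomb cutoff_graph// !poisson_graph//.
  have -> : arc_interp (vaverage (fun z => a * f z + b * g z)) x =
      a * arc_interp (vaverage f) x + b * arc_interp (vaverage g) x.
    rewrite -arc_interp_linear; apply: eq_arc_interp => v _.
    exact: (vaverage_linear a b v Bf Bg).
  set c := arc_interp level_cut x; set r := arc_interp _ x; set s := arc_interp _ x.
  have -> : (a%:E * (c%:E * r%:E) + b%:E * (c%:E * s%:E) = c%:E * (a * r + b * s)%:E)%E.
    by rewrite -!EFinM -EFinD; congr (_%:E); ring.
  by rewrite -EFinM subee.
(* On the boundary the truncation agrees with the extension, so the difference there is the one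
   already treated. *)
have c1 : cutoff (phi z) = 1.
  by apply: cutoff_boundary; exact: (phi_notin alpha1 tau3 hS hiota hphi).
rewrite /lincomb c1; move: (poisson _ _) (poisson f _) (poisson g _) => x y w.
by rewrite !mul1e.
Qed.

Lemma trace_poisson f : besov f -> trace_op S iota psi (poisson f) = f %[ae nu].
Proof.
move=> Bf; apply: (trace_reproduces Bf).
by move=> n z _ Sz; rewrite /vertex_values poisson_vertex.
Qed.

Lemma trace_truncated f : besov f -> trace_op S iota psi (P0 f) = f %[ae nu].
Proof.
move=> Bf; apply: (trace_reproduces Bf).
move=> n z n1 Sz; rewrite /vertex_values truncated_vertex//.
by rewrite /level_cut /= n1 mul1r.
Qed.

End poisson_operator.

Theorem theorem1p1 (R : realType) (Z : completeMetricType R)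
    (nu : {measure set (borel Z) -> \bar R})
    (hnu : metric_measure nu) (hdoubling : doubling nu)
    (p theta : R) (hp : (1 <= p)%R) (htheta : (0 < theta < 1)%R)
    (alpha tau : R) (halpha : (1 < alpha)%R)
    (htau : (Num.max 3 (alpha / (alpha - 1)) < tau)%R)
    (S : int -> set Z)
    (hS : forall n : int, maximal_separated (alpha ^ (- n)) (S n))
    (Xbar : completeMetricType R) (iota : (Z * int -> R) -> Xbar)
    (hiota : is_completion alpha tau S iota)
    (phi : Z -> Xbar) (hphi : boundary_map alpha S iota phi)
    (mu mu_beta : {measure set (borel Xbar) -> \bar R})
    (hmu : is_mu alpha tau S iota nu mu)
    (hmu_beta : is_mu_beta alpha tau S iota (p * (1 - theta)) mu mu_beta)
    (C : R) (psi : int -> Z -> Z -> R)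
    (hpsi : partition_of_unity alpha S C psi) :
  let delta := induced_dist phi in
  let X_rho := Xrho alpha tau S iota in
  let B := besov_space nu delta p theta in
  let normB := besov_norm nu delta p theta in
  let Bcheck := besov_check_space nu delta p theta in
  let normBcheck := besov_check_norm nu delta p theta in
  let D Y := dirichlet_space mu_beta Y p in
  let normD Y := dirichlet_norm mu_beta Y p in
  let N Y := newton_space mu_beta Y p in
  let normN Y := newton_norm mu_beta Y p in
  exists (T : (Xbar -> \bar R) -> (Z -> R))
         (P : (Z -> R) -> (Xbar -> \bar R))
         (xi0 : Xbar -> R),
    let P0 f := fun y => (xi0 y)%:E * P f y in
    [/\ forall u, D X_rho u -> is_trace S iota nu delta p psi u (T u),
        forall f, B f -> poisson_extension alpha tau S iota nu mu_beta f (P f) &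
        is_cutoff alpha tau S iota xi0] /\
    [/\ linear_ae nu (D X_rho) T,
        bounded_operator (D X_rho) (normD X_rho) B normB T,
        linear_newton mu_beta p B P,
        bounded_operator B normB (D setT) (normD setT) P &
        forall f, B f -> T (P f) = f %[ae nu]] /\
    [/\ bounded_operator (N X_rho) (normN X_rho) Bcheck normBcheck T,
        linear_newton mu_beta p Bcheck P0,
        bounded_operator Bcheck normBcheck (N setT) (normN setT) P0 &
        forall f, Bcheck f -> T (P0 f) = f %[ae nu]].
Proof.
move=> delta X_rho B normB Bcheck normBcheck D normD N normN.
have tau3 : (3 < tau)%R by apply: le_lt_trans htau; rewrite le_max lexx.
have [lam [K K0 hb]] := poisson_constants hnu hdoubling hp htheta halpha tau3 hS hiota hphi
  hmu hmu_beta.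
exists (trace_op S iota psi), (poisson nu alpha tau S iota mu_beta), (cutoff alpha tau S iota).
move=> P0; split; [split|split; [split|split]].
- move=> u Du.
  exact: (trace_op_is_trace hnu hdoubling hp htheta halpha tau3 hS hiota phi hmu hmu_beta hpsi Du).
- by move=> f _; exact: (poisson_is_extension nu halpha tau3 hS hiota mu_beta).
- exact: (cutoff_is_cutoff halpha tau3 hS hiota).
- exact: (trace_op_linear hnu hdoubling hp htheta halpha tau3 hS hiota hmu hmu_beta hpsi).
- exact: (trace_op_besov hnu hdoubling hp htheta halpha tau3 hS hiota hphi hmu hmu_beta hpsi).
- exact: (poisson_linear hnu hdoubling hp htheta tau3 hiota hphi hmu hmu_beta K0 hb).
- exact: (poisson_bounded hnu hdoubling hp htheta tau3 hiota hphi hmu hmu_beta K0 hb).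
- move=> f Bf; exact: (trace_poisson hnu hdoubling hp htheta tau3 hiota hphi hpsi K0 hb Bf).
- exact: (trace_op_newton hnu hdoubling hp htheta halpha tau3 hS hiota hphi hmu hmu_beta hpsi).
- exact: (truncated_linear hnu hdoubling hp htheta tau3 hiota hphi hmu hmu_beta K0 hb).
- exact: (truncated_bounded hnu hdoubling hp htheta tau3 hiota hphi hmu hmu_beta K0 hb).
- move=> f [Bf _]; exact: (trace_truncated hnu hdoubling hp htheta tau3 hiota hphi hpsi K0 hb Bf).
Qed.
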